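(* Let $n\in\mathbb N$, $p\in(1,\infty)$, and let $s\in(0,n)$ satisfy $$\left|\frac1p-\frac12\right|<\frac sn .$$ Let $\Psi$ be a Schwartz function on $\mathbb R^n$ whose Fourier transform $\widehat\Psi$ is supported in the annulus $\{\xi: 1/2<|\xi|<2\}$ and satisfies $\sum_{j\in\mathbb Z}\widehat\Psi(2^{-j}\xi)=1$ for all $\xi\neq0$. Then there is a constant $C$, independent of $\sigma$ and $f$, such that for every bounded measurable function $\sigma$ on $\mathbb R^n$ for which the supremum below is finite and every Schwartz function $f$ on $\mathbb R^n$, $$\|T_\sigma f\|_{L^p(\mathbb R^n)}\le C\,\sup_{j\in\mathbb Z}\big\|(I-\Delta)^{\frac s2}\big[\widehat\Psi\,\sigma(2^j\cdot)\big]\big\|_{L^{\frac ns,1}(\mathbb R^n)}\,\|f\|_{L^p(\mathbb R^n)} .$$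
   Context: The Fourier transform is $\widehat f(\xi)=\int_{\mathbb R^n}f(x)e^{-2\pi i x\cdot\xi}\,dx$. For a bounded function $\sigma$ on $\mathbb R^n$ and a Schwartz function $f$, $T_\sigma f(x)=\int_{\mathbb R^n}\widehat f(\xi)\sigma(\xi)e^{2\pi i x\cdot\xi}\,d\xi$. The operator $(I-\Delta)^{s/2}$ is given on the Fourier transform side by multiplication by $(1+4\pi^2|\xi|^2)^{s/2}$ (acting on tempered distributions). The symbol $\widehat\Psi\,\sigma(2^j\cdot)$ denotes the function $\xi\mapsto\widehat\Psi(\xi)\sigma(2^j\xi)$. The nonincreasing rearrangement of a measurable function $f$ on $\mathbb R^n$ is $f^*(t)=\inf\{r\ge0: |\{y\in\mathbb R^n:|f(y)|>r\}|<t\}$, $t>0$. For $1<q<\infty$, $\|f\|_{L^{q,1}(\mathbb R^n)}=\int_0^\infty f^*(t)\,t^{\frac1q-1}\,dt$ (so $\|f\|_{L^{n/s,1}(\mathbb R^n)}=\int_0^\infty f^*(t)t^{\frac sn-1}dt$); the norm of a tempered distribution that is not given by a function is taken to be $+\infty$. *)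

(* Defs.v *)
From HB Require Import structures.
From mathcomp Require Import all_boot all_order all_algebra.
From mathcomp Require Import complex.
From mathcomp Require Import all_classical all_reals all_analysis.

Set Implicit Arguments.
Unset Strict Implicit.
Unset Printing Implicit Defensive.

Import Order.TTheory GRing.Theory Num.Theory.
Import numFieldNormedType.Exports.

Local Open Scope classical_set_scope.
Local Open Scope ring_scope.

(* [R^n] is ['rV[R]_n], with the sigma-algebra generated by the coordinates,
   i.e. the Borel one. *)
Definition measure_rV_display : measure_display. Proof. exact. Qed.

Section measurable_rV.
Context {R : realType}.
Variable n : nat.

Let coor (i : 'I_n) (x : 'rV[R]_n) : measurableTypeR R := x ord0 i.

Let rV_set0 : g_sigma_preimage coor set0.
Proof. exact: sigma_algebra0. Qed.

Let rV_setC A : g_sigma_preimage coor A -> g_sigma_preimage coor (~` A).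
Proof. exact: sigma_algebraC. Qed.

Let rV_bigcup (F : (set 'rV[R]_n)^nat) :
  (forall i, g_sigma_preimage coor (F i)) ->
  g_sigma_preimage coor (\bigcup_i (F i)).
Proof. exact: sigma_algebra_bigcup. Qed.

HB.instance Definition _ := @isMeasurable.Build measure_rV_display
  'rV[R]_n (g_sigma_preimage coor) rV_set0 rV_setC rV_bigcup.

Lemma measurable_coor (i : 'I_n) :
  measurable_fun setT (fun x : 'rV[R]_n => x ord0 i : measurableTypeR R).
Proof.
move=> _ Y mY; rewrite setTI; apply: sub_sigma_algebra => /=.
rewrite -bigcup_seq/=; exists i => /=; first by rewrite mem_index_enum.
by exists Y => //; rewrite setTI.
Qed.

Lemma measurable_fun_rV d (T : measurableType d) (f : T -> 'rV[R]_n) :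
  (forall i, measurable_fun setT (fun t => f t ord0 i : measurableTypeR R)) ->
  measurable_fun setT f.
Proof.
move=> mf _ A mA; rewrite setTI.
suff : g_sigma_preimage coor `<=` [set B | measurable (f @^-1` B)] by exact.
apply: smallest_sub.
  split=> [|B mB|F mF] /=; first by rewrite preimage_set0.
    by rewrite setTD preimage_setC; exact: measurableC.
  by rewrite preimage_bigcup; apply: bigcup_measurable => k _; exact: mF.
rewrite -bigcup_seq => B [i _ [C mC <-]] /=.
by rewrite setTI -comp_preimage; have := mf i measurableT C mC; rewrite setTI.
Qed.

End measurable_rV.

Section lebesgue_rV.
Context {R : realType}.

Definition rV_cons n (p : measurableTypeR R * 'rV[R]_n) : 'rV[R]_n.+1 :=
  \row_i oapp (p.2 ord0) p.1 (unlift ord0 i).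

Definition rV_uncons n (x : 'rV[R]_n.+1) : measurableTypeR R * 'rV[R]_n :=
  (x ord0 ord0, \row_(i < n) x ord0 (lift ord0 i)).

Lemma rV_consE0 n p : @rV_cons n p ord0 ord0 = p.1.
Proof. by rewrite mxE unlift_none. Qed.

Lemma rV_consES n p (i : 'I_n) : rV_cons p ord0 (lift ord0 i) = p.2 ord0 i.
Proof. by rewrite mxE liftK. Qed.

Lemma rV_consK n : cancel (@rV_cons n) (@rV_uncons n).
Proof.
move=> [a v]; rewrite /rV_uncons rV_consE0; congr pair.
by apply/rowP => i; rewrite mxE rV_consES.
Qed.

Lemma measurable_rV_cons n : measurable_fun setT (@rV_cons n).
Proof.
apply: measurable_fun_rV => i.
case: (unliftP ord0 i) => [j|] ->; last first.
- by under eq_fun do rewrite rV_consE0; exact: measurable_fst.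
- under eq_fun do rewrite rV_consES.
  exact: (measurableT_comp (@measurable_coor R n j) measurable_snd).
Qed.

HB.instance Definition _ n :=
  isMeasurableFun.Build _ _ _ _ (@rV_cons n) (@measurable_rV_cons n).

Lemma measurable_rV_uncons n : measurable_fun setT (@rV_uncons n).
Proof.
apply: measurable_fun_pair => /=; first exact: measurable_coor.
apply: measurable_fun_rV => i; under eq_fun do rewrite mxE.
exact: measurable_coor.
Qed.

(* The [n]-fold product of the Lebesgue measure of [R]. *)
Fixpoint lebesgue_rV n : set 'rV[R]_n -> \bar R :=
  match n with
  | 0 => \d_(0 : 'rV[R]_0)
  | n.+1 => pushforward (lebesgue_measure \x @lebesgue_rV n)%E (@rV_cons n)
  end.

Arguments lebesgue_rV n : clear implicits.

Section lebesgue_rV_step.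
Local Open Scope ereal_scope.
Variables (n : nat) (m : {sigma_finite_measure set 'rV[R]_n -> \bar R}).

Let mS := pushforward (lebesgue_measure \x m) (@rV_cons n).

Let mS0 : mS set0 = 0. Proof. exact: measure0. Qed.

Let mS_ge0 A : 0 <= mS A. Proof. exact: measure_ge0. Qed.

Let mS_sigma_additive : semi_sigma_additive mS.
Proof. exact: measure_semi_sigma_additive. Qed.

HB.instance Definition _ := isMeasure.Build _ _ _ mS
  mS0 mS_ge0 mS_sigma_additive.

Let mS_sigma_finite : sigma_finite setT mS.
Proof.
have /sigma_finiteP[F [TF ndF Foo]] :=
  sigma_finiteT (@lebesgue_measure R : {sigma_finite_measure set _ -> \bar R}).
have /sigma_finiteP[G [TG ndG Goo]] := sigma_finiteT m.
exists (fun k => @rV_uncons n @^-1` (F k `*` G k)).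
  rewrite -preimage_bigcup; apply/esym; rewrite -subTset => x _ /=.
  have [k1 _ Fk1] : (\bigcup_k F k) (rV_uncons x).1 by rewrite -TF.
  have [k2 _ Gk2] : (\bigcup_k G k) (rV_uncons x).2 by rewrite -TG.
  exists (maxn k1 k2) => //; split.
  - by move: Fk1; exact/subsetPset/ndF/leq_maxl.
  - by move: Gk2; exact/subsetPset/ndG/leq_maxr.
move=> k; have [mF Fk] := Foo k; have [mG Gk] := Goo k.
have mFG : measurable (F k `*` G k) by exact: measurableX.
split.
  by rewrite -[X in measurable X]setTI; exact: measurable_rV_uncons.
rewrite /mS /pushforward -comp_preimage (_ : _ \o _ = id); last first.
  by apply/funext => p /=; rewrite rV_consK.
by rewrite preimage_id product_measure1E// lte_mul_pinfty// ge0_fin_numE.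
Qed.

HB.instance Definition _ := Measure_isSigmaFinite.Build _ _ _ mS
  mS_sigma_finite.

Lemma lebesgue_rV_step :
  exists m' : {sigma_finite_measure set 'rV[R]_n.+1 -> \bar R},
    pushforward (lebesgue_measure \x m) (@rV_cons n) = m'.
Proof. by exists mS. Qed.

End lebesgue_rV_step.

Let lebesgue_rV_measure n :
  exists m : {sigma_finite_measure set 'rV[R]_n -> \bar R},
    lebesgue_rV n = m :> (set 'rV[R]_n -> \bar R).
Proof.
elim: n => [|n [m IH]]; first by
  exists (dirac (0 : 'rV[R]_0) : {sigma_finite_measure set 'rV[R]_0 -> \bar R}).
by rewrite /= IH; exact: lebesgue_rV_step.
Qed.

Section lebesgue_rV_instances.
Variable n : nat.

Let leb0 : lebesgue_rV n set0 = 0%E.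
Proof. by have [m ->] := lebesgue_rV_measure n. Qed.

Let leb_ge0 A : (0 <= lebesgue_rV n A)%E.
Proof. by have [m ->] := lebesgue_rV_measure n. Qed.

Let leb_sigma_additive : semi_sigma_additive (lebesgue_rV n).
Proof.
have [m ->] := lebesgue_rV_measure n; exact: measure_semi_sigma_additive.
Qed.

HB.instance Definition _ := isMeasure.Build _ _ _ (lebesgue_rV n)
  leb0 leb_ge0 leb_sigma_additive.

Let leb_sigma_finite : sigma_finite setT (lebesgue_rV n).
Proof. by have [m ->] := lebesgue_rV_measure n; exact: sigma_finiteT. Qed.

HB.instance Definition _ := Measure_isSigmaFinite.Build _ _ _ (lebesgue_rV n)
  leb_sigma_finite.

End lebesgue_rV_instances.

Lemma measurable_rV_box n (A : 'I_n -> set (measurableTypeR R)) :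
  (forall i, measurable (A i)) ->
  measurable [set x : 'rV[R]_n | forall i, A i (x ord0 i)].
Proof.
move=> mA; rewrite (_ : mkset _ = \bigcap_(i in [set: 'I_n])
    ((fun x : 'rV[R]_n => x ord0 i : measurableTypeR R) @^-1` A i)).
  apply: fin_bigcap_measurable => // i _.
  by rewrite -[X in measurable X]setTI; exact: measurable_coor.
by apply/seteqP; split=> x /= h i => [_|]; exact: h.
Qed.

Lemma lebesgue_rV_box n (A : 'I_n -> set (measurableTypeR R)) :
  (forall i, measurable (A i)) ->
  lebesgue_rV n [set x | forall i, A i (x ord0 i)] =
  (\prod_(i < n) lebesgue_measure (A i))%E.
Proof.
elim: n A => [|n IH] A mA.
  by rewrite big_ord0 /= diracE mem_set// => -[].
rewrite big_ord_recl -IH//= /pushforward -product_measure1E//; last first.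
  exact: (@measurable_rV_box n (fun i => A (lift ord0 i))).
congr product_measure1; apply/seteqP; split=> p /=.
  move=> h; split=> [|i]; first by have := h ord0; rewrite rV_consE0.
  by have := h (lift ord0 i); rewrite rV_consES.
move=> [h0 hS] i; case: (unliftP ord0 i) => [j|] ->.
  by rewrite rV_consES; exact: hS.
by rewrite rV_consE0.
Qed.

End lebesgue_rV.
Arguments lebesgue_rV {R} n.

Section euclidean.
Context {R : realType} {n : nat}.
Implicit Types x y : 'rV[R]_n.

Definition dotmx x y : R := \sum_(i < n) x ord0 i * y ord0 i.

(* The library norm [`|x|] on ['rV[R]_n] is the sup norm. *)
Definition enorm x : R := Num.sqrt (dotmx x x).

End euclidean.

Section complex_functions.
Context {R : realType} {n : nat}.
Local Notation mu := (lebesgue_rV n : set 'rV[R]_n -> \bar R).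
Implicit Types f g : 'rV[R]_n -> R[i].

Definition cexpi (t : R) : R[i] := Complex (cos t) (sin t).

Definition cmeasurable f : Prop :=
  measurable_fun setT (fun x => complex.Re (f x)) /\
  measurable_fun setT (fun x => complex.Im (f x)).

(* Measurability for the completion of [mu]: the library integrals of such an
   [f], being suprema over simple functions, coincide with those of [g]. *)
Definition lebesgue_measurable f : Prop :=
  exists2 g, cmeasurable g & {ae mu, forall x, f x = g x}.

Definition cintegrable f : Prop :=
  mu.-integrable setT (fun x => (complex.Re (f x))%:E) /\
  mu.-integrable setT (fun x => (complex.Im (f x))%:E).

Definition cintegral f : R[i] :=
  Complex (\int[mu]_x complex.Re (f x)) (\int[mu]_x complex.Im (f x)).

Definition cLnorm (p : R) f : \bar R :=
  Lnorm mu p%:E (fun x => (ComplexField.Normc.normc (f x))%:E).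

Definition fourier f (xi : 'rV[R]_n) : R[i] :=
  cintegral (fun x => f x * cexpi (- (2 * pi * dotmx x xi))).

Definition invfourier f (x : 'rV[R]_n) : R[i] :=
  cintegral (fun xi => f xi * cexpi (2 * pi * dotmx x xi)).

Definition multiplier_op (sigma f : 'rV[R]_n -> R[i]) : 'rV[R]_n -> R[i] :=
  invfourier (fun xi => fourier f xi * sigma xi).

Definition partial (i : 'I_n) (g : 'rV[R]_n -> R) : 'rV[R]_n -> R :=
  fun x => 'D_(delta_mx ord0 i) g x.

Definition partials (s : seq 'I_n) (g : 'rV[R]_n -> R) : 'rV[R]_n -> R :=
  foldr partial g s.

Definition rschwartz (g : 'rV[R]_n -> R) : Prop :=
  (forall s x, differentiable (partials s g) x) /\
  (forall (k : nat) s, exists M : R,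
     forall x, enorm x ^+ k * `|partials s g x| <= M).

Definition schwartz f : Prop :=
  rschwartz (fun x => complex.Re (f x)) /\ rschwartz (fun x => complex.Im (f x)).

End complex_functions.

(* Tempered distributions are represented by their action on test functions;
   only the values at Schwartz functions are meaningful. *)
Section distributions.
Context {R : realType} {n : nat}.
Local Notation mu := (lebesgue_rV n : set 'rV[R]_n -> \bar R).
Local Notation distribution := (('rV[R]_n -> R[i]) -> R[i]).
Implicit Types (u : distribution) (g h phi : 'rV[R]_n -> R[i]).

Definition dist_of_fun g : distribution :=
  fun phi => cintegral (fun x => g x * phi x).

Definition dist_fourier u : distribution := fun phi => u (fourier phi).

Definition dist_invfourier u : distribution := fun phi => u (invfourier phi).

Definition dist_mul (w : 'rV[R]_n -> R[i]) u : distribution :=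
  fun phi => u (fun x => w x * phi x).

Definition bessel_weight (s : R) (xi : 'rV[R]_n) : R[i] :=
  Complex ((1 + 4 * pi ^+ 2 * enorm xi ^+ 2) `^ (s / 2)) 0.

(* (I - Delta)^(s/2) *)
Definition bessel (s : R) u : distribution :=
  dist_invfourier (dist_mul (bessel_weight s) (dist_fourier u)).

Definition represents h u : Prop :=
  cmeasurable h /\
  forall phi, schwartz phi ->
    cintegrable (fun x => h x * phi x) /\ u phi = dist_of_fun h phi.

Definition rearrangement h (t : R) : \bar R :=
  ereal_inf [set r%:E | r in
    [set r : R | 0 <= r /\ (mu [set y | (r < ComplexField.Normc.normc (h y))%R] < t%:E)%E]].

Definition lorentz1 (q : R) h : \bar R :=
  (\int[lebesgue_measure]_(t in `]0%R, +oo[)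
     (rearrangement h t * (t `^ (q^-1 - 1))%:E))%E.

(* The function representing [u] is unique up to a null set, on which [lorentz1]
   does not depend; when there is none the infimum is [+oo]. *)
Definition dist_lorentz1 (q : R) u : \bar R :=
  ereal_inf [set lorentz1 q h | h in [set h | represents h u]].

End distributions.

(* Main.v *)
(** Put [m_j = Psihat(2^-j .) sigma]. The function [h] representing the Bessel potential of a
    rescaled [m_j] is cut into dyadic levels, and [Psi] into dyadic bands; each piece is bounded
    in weighted [L^2] by writing [(1+|x|^2)^(-s/2)] as an average of Gaussians, and the gains
    sum when [n/(2r) < s < n], giving [int |m_j(D) f|^2 w <= C L^2 int |f|^2 (M w^r)^(1/r)],
    with [L] the Lorentz norm of [h]. Together with a vector-valued sharp function inequality
    for smooth Littlewood-Paley windows, duality against [w] bounds the sums of the [m_j(D)] on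
    [L^p] for [2 < p] and [1 - 2/p < 1/r]; an absorption argument on the adjoint gives [p < 2]. *)

Require Import Defs.
From HB Require Import structures.
From mathcomp Require Import all_boot all_order all_algebra.
From mathcomp Require Import complex ring lra zify.
From mathcomp Require Import all_classical all_reals all_analysis measurable_realfun.

Set Implicit Arguments.
Unset Strict Implicit.
Unset Printing Implicit Defensive.

Import Order.TTheory GRing.Theory Num.Theory.
Import numFieldNormedType.Exports.
Import ComplexField.Normc.

Local Open Scope classical_set_scope.
Local Open Scope ring_scope.

Local Notation mfunT f := (measurable_fun setT f).
Local Notation le_via y := (@le_trans _ _ y).
Local Notation lt_le_via y := (@lt_le_trans _ _ y).
Local Notation le_lt_via y := (@le_lt_trans _ _ y).
Local Notation Re := complex.Re.
Local Notation Im := complex.Im.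

(** Let g be one rescaled multiplier, the product of Psihat and sigma(2^j .), and K its kernel, the
    inverse transform of g. In position space (1+4pi^2|y|^2)^(s/2) K is the inverse transform of h.
    The one function Psi plays two parts: in frequency its dilates split sigma, and in position the
    functions Psihat(2^-l y) split K into annuli. A level of h of measure e, restricted to |y| ~
    2^l, is estimated in two ways according to whether t = 2^(ln) e is small or large. The resulting
    gain decays geometrically in l on both sides of t = 1, so the sum over l costs a constant
    whatever e is, and the sum over the levels is controlled by the L^(n/s,1) norm: this is where
    the second Lorentz index 1 enters. The exponent r must satisfy 1/r > |1-2/p| for the duality
    with the maximal function and 1/r < 2s/n for the sum over l; the hypothesis |1/p-1/2| < s/n
    makes room for it. Qualitative questions are kept cheap by working with bounded integrable
    functions and finite sums of pieces, with constants independent of the number of pieces; the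
    infinite sums come back through Fatou's lemma. *)

Lemma le_of_eq d (T : porderType d) (x y : T) : x = y -> (x <= y)%O.
Proof. by move=> ->. Qed.

Lemma measurable_eq d (T : semiRingOfSetsType d) (A B : set T) : A = B -> measurable B -> measurable A.
Proof. by move=> ->. Qed.

(** Comparison without measurability: the integral of a nonnegative function is a supremum over the
    simple functions below it. *)
Lemma nn_le d (T : measurableType d) (R : realType)
    (m : {measure set T -> \bar R}) (f g : T -> \bar R) :
  (forall x, 0 <= f x)%E -> (forall x, f x <= g x)%E -> (\int[m]_x f x <= \int[m]_x g x)%E.
Proof.
move=> f0 fg; have g0 x : (0 <= g x)%E by exact: le_trans (fg x).
rewrite !ge0_integralTE//; apply: le_ereal_sup => _ [h hf <-].
by exists h => // x; exact: le_trans (fg x).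
Qed.

Lemma int_ge0 d (T : measurableType d) (R : realType) (m : {measure set T -> \bar R}) (f : T -> R) :
  (forall x, 0 <= f x) -> (0 <= \int[m]_x (f x)%:E)%E.
Proof. by move=> f0; apply: integral_ge0 => x _; rewrite lee_fin. Qed.

(** * Measurability of the elementary operations *)

Section measurability.
Context d (T : measurableType d) (R : realType) (n : nat).
Implicit Types f g : T -> 'rV[R]_n.

Lemma measurable_coorT f i : mfunT f -> mfunT (fun x => f x ord0 i : R).
Proof. by move=> mf; exact: (measurableT_comp (@measurable_coor R n i) mf). Qed.

Lemma measurable_addV f g : mfunT f -> mfunT g -> mfunT (fun x => f x + g x).
Proof.
move=> mf mg; apply: measurable_fun_rV => i.
under eq_fun do rewrite mxE.
by apply: measurable_funD; exact: measurable_coorT.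
Qed.

Lemma measurable_scaleV (c : T -> R) f : mfunT c -> mfunT f -> mfunT (fun x => c x *: f x).
Proof.
move=> mc mf; apply: measurable_fun_rV => i.
under eq_fun do rewrite mxE.
by apply: measurable_funM => //; exact: measurable_coorT.
Qed.

Lemma measurable_oppV f : mfunT f -> mfunT (fun x => - f x).
Proof.
move=> mf; under eq_fun do rewrite -scaleN1r.
by apply: measurable_scaleV => //; exact: measurable_cst.
Qed.

Lemma norm_ltP (x : 'rV[R]_n) r : 0 < r -> reflect (forall i, `|x ord0 i| < r) (`|x| < r).
Proof.
move=> r0; rewrite [`|x|]mx_normrE.
apply: (iffP (bigmax_ltP _ _ _ _)) => [[_ h] i|h].
  by have := h (ord0, i) isT.
by split=> // -[i j] _ /=; rewrite (ord1 i).
Qed.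

Lemma norm_leP (x : 'rV[R]_n) r : 0 <= r -> reflect (forall i, `|x ord0 i| <= r) (`|x| <= r).
Proof.
move=> r0; rewrite [`|x|]mx_normrE.
apply: (iffP (bigmax_leP _ _ _ _)) => [[_ h] i|h].
  by have := h (ord0, i) isT.
by split=> // -[i j] _ /=; rewrite (ord1 i).
Qed.

Lemma coor_le_norm (x : 'rV[R]_n) i : `|x ord0 i| <= `|x|.
Proof. by have /norm_leP := lexx `|x|; apply. Qed.

Lemma measurable_bigmax (I : Type) (s : seq I) (h : I -> T -> R) : (forall i, mfunT (h i)) ->
  mfunT (fun x => \big[Num.max/0]_(i <- s) h i x).
Proof.
move=> mh; elim: s => [|i s IH].
  by under eq_fun do rewrite big_nil; exact: measurable_cst.
by under eq_fun do rewrite big_cons; apply: measurable_maxr.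
Qed.

Lemma measurable_normV f : mfunT f -> mfunT (fun x => `|f x| : R).
Proof.
move=> mf; under eq_fun do rewrite [`|_|]mx_normrE.
apply: measurable_bigmax => -[i j] /=; rewrite (ord1 i).
by apply: (measurableT_comp (@normr_measurable R setT)); exact: measurable_coorT.
Qed.

End measurability.

Section measurability_real.
Context (R : realType).

Lemma measurable_boolr d (T : measurableType d) (b : T -> bool) : mfunT b ->
  mfunT (fun x => (b x)%:R : R).
Proof.
move=> mb; rewrite (_ : (fun x => _) = \1_[set x | b x]).
  apply: measurable_indic; have := mb measurableT [set true] I.
  by rewrite setTI (_ : _ @^-1` _ = [set x | b x])//; apply/seteqP; split => x.
by apply/funext => x; rewrite indicE; case E: (b x); [rewrite mem_set|rewrite memNset// /= E].
Qed.

Lemma measurable_opprl d (T : measurableType d) (f : T -> R) : mfunT f -> mfunT (fun x => - f x).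
Proof. by move=> mf; exact: (measurableT_comp (@oppr_measurable R setT) mf). Qed.

Lemma measurable_powRl d (T : measurableType d) (c : R) (f : T -> R) : mfunT f ->
  mfunT (fun x => f x `^ c).
Proof. by move=> mf; exact: (measurableT_comp (@measurable_powR R c) mf). Qed.

Lemma measurable_expRl d (T : measurableType d) (f : T -> R) : mfunT f -> mfunT (fun x => expR (f x)).
Proof. by move=> mf; exact: (measurableT_comp (@measurable_expR R) mf). Qed.

Lemma measurable_cosl d (T : measurableType d) (f : T -> R) : mfunT f -> mfunT (fun x => cos (f x)).
Proof.
move=> mf; apply: (measurableT_comp _ mf).
by apply: continuous_measurable_fun; exact: continuous_cos.
Qed.

Lemma measurable_sinl d (T : measurableType d) (f : T -> R) : mfunT f -> mfunT (fun x => sin (f x)).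
Proof.
move=> mf; apply: (measurableT_comp _ mf).
by apply: continuous_measurable_fun; exact: continuous_sin.
Qed.

Lemma measurable_normrl d (T : measurableType d) (f : T -> R) : mfunT f -> mfunT (fun x => `|f x|).
Proof. by move=> mf; exact: (measurableT_comp (@normr_measurable R setT) mf). Qed.

Lemma measurable_invl d (T : measurableType d) (f : T -> R) : mfunT f -> mfunT (fun x => (f x)^-1).
Proof.
move=> mf; apply: (measurableT_comp _ mf).
rewrite (_ : @GRing.inv R = fun x : R => Num.sg x * `|x| `^ (-1)).
  apply: measurable_funM.
    rewrite (_ : @Num.sg R = fun x : R => (0 < x)%R%:R - (x < 0)%R%:R).
      by apply: measurable_funB; apply: measurable_boolr;
        apply: measurable_fun_ltr => //; exact: measurable_cst.
    apply/funext => x; case: (ltgtP x 0) => [x0|x0|->].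
    - by rewrite ltr0_sg// sub0r.
    - by rewrite gtr0_sg// subr0.
    - by rewrite sgr0 subrr.
  by apply: measurable_powRl; exact: normr_measurable.
apply/funext => x; rewrite powR_inv1//; case: (sgrP x) => [->|x0|x0].
- by rewrite invr0 mul0r.
- by rewrite mul1r.
- by rewrite mulN1r invrN opprK.
Qed.

Lemma measurable_sqrtl d (T : measurableType d) (f : T -> R) : mfunT f ->
  mfunT (fun x => Num.sqrt (f x)).
Proof.
move=> mf; apply: (measurableT_comp _ mf).
by apply: continuous_measurable_fun => x; exact: sqrt_continuous.
Qed.

End measurability_real.

Lemma measurable_fun_tonelli d1 d2 (T1 : measurableType d1) (T2 : measurableType d2) (R : realType)
    (m : {sigma_finite_measure set T2 -> \bar R}) (F : T1 -> T2 -> \bar R) :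
  mfunT (fun z => F z.1 z.2) -> (forall x y, 0 <= F x y)%E -> mfunT (fun x => \int[m]_y F x y)%E.
Proof.
move=> mF F0; exact: (@measurable_fun_fubini_tonelli_F _ _ _ _ _ m (fun z => F z.1 z.2)).
Qed.

Lemma tonelli d1 d2 (T1 : measurableType d1) (T2 : measurableType d2)
    (R : realType) (m1 : {sigma_finite_measure set T1 -> \bar R})
    (m2 : {sigma_finite_measure set T2 -> \bar R}) (F : T1 -> T2 -> \bar R) :
  mfunT (fun z => F z.1 z.2) -> (forall x y, 0 <= F x y)%E ->
  (\int[m1]_x \int[m2]_y F x y = \int[m2]_y \int[m1]_x F x y)%E.
Proof.
by move=> mF F0; apply: (@fubini_tonelli _ _ _ _ _ m1 m2 (fun z => F z.1 z.2)).
Qed.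

(** Lets [mstep] eta-expand a goal, so that its patterns, all written for [fun x => _], can
    match. *)
Lemma measurable_eta d1 d2 (T1 : measurableType d1) (T2 : measurableType d2)
    (D : set T1) (f : T1 -> T2) : measurable_fun D (fun x => f x) -> measurable_fun D f.
Proof. by []. Qed.

Ltac mstep :=
  match goal with
  | |- measurable_fun _ (fun _ => ?c) => exact: measurable_cst
  | H : measurable_fun _ ?f |- measurable_fun _ ?f => exact H
  | H : forall _, measurable_fun _ _ |- _ => apply: H
  | |- measurable_fun _ (fun x => x) => exact: measurable_id
  | |- measurable_fun _ (fun x => fst x) => exact: measurable_fst
  | |- measurable_fun _ (fun x => snd x) => exact: measurable_snd
  | |- measurable_fun _ (fun x => (@?f x)%:E) => apply/measurable_EFinP
  | |- measurable_fun _ (fun x => (@?f x)%:R) => apply: measurable_boolr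
  | |- measurable_fun _ (fun x => fun_of_matrix (@?f x) _ _) => apply: measurable_coorT
  | |- measurable_fun _ (fun x => (@?f x + @?g x)%R) => first
       [apply: measurable_funD | apply: measurable_addV]
  | |- measurable_fun _ (fun x => (- @?f x)%R) => first
       [apply: measurable_opprl | apply: measurable_oppV]
  | |- measurable_fun _ (fun x => (@?f x * @?g x)%R) => apply: measurable_funM
  | |- measurable_fun _ (fun x => (@?f x *: @?g x)%R) => apply: measurable_scaleV
  | |- measurable_fun _ (fun x => (@?f x ^+ _)%R) => apply: measurable_funX
  | |- measurable_fun _ (fun x => ((@?f x)^-1)%R) => apply: measurable_invl
  | |- measurable_fun _ (fun x => (@?f x `^ _)%R) => apply: measurable_powRl
  | |- measurable_fun _ (fun x => Num.sqrt (@?f x)) => apply: measurable_sqrtl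
  | |- measurable_fun _ (fun x => expR (@?f x)) => apply: measurable_expRl
  | |- measurable_fun _ (fun x => cos (@?f x)) => apply: measurable_cosl
  | |- measurable_fun _ (fun x => sin (@?f x)) => apply: measurable_sinl
  | |- measurable_fun _ (fun x => `|@?f x|%R) => first
       [apply: measurable_normrl | apply: measurable_normV]
  | |- measurable_fun _ (fun x => (@?f x < @?g x)%R) => apply: measurable_fun_ltr
  | |- measurable_fun _ (fun x => (@?f x <= @?g x)%R) => apply: measurable_fun_ler
  | |- measurable_fun _ (fun x => (@?f x && @?g x)) => apply: measurable_and
  | |- measurable_fun _ (fun x => (@?f x == @?g x)) => apply: measurable_fun_eqr
  | |- measurable_fun _ (fun x => Num.max (@?f x) (@?g x)) => apply: measurable_maxr
  | |- measurable_fun _ (fun x => \sum_(i <- _) _)%R => first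
      [apply: measurable_sum => ? | apply: emeasurable_sum => ?]
  | |- measurable_fun _ (fun x => \prod_(i <- _) _)%R => apply: measurable_prod => ? _
  | |- measurable_fun _ (fun x => (@?f x + @?g x)%E) => apply: emeasurable_funD
  | |- measurable_fun _ (fun x => (@?f x * @?g x)%E) => apply: emeasurable_funM
  | |- measurable_fun _ (fun x => (\int[_]_y _)%E) =>
      apply: measurable_fun_tonelli => //=
  | H : measurable_fun _ ?f |- measurable_fun _ (fun x => ?f (@?e x)) =>
      apply: (measurableT_comp H)
  | |- measurable_fun ?D ?f => lazymatch f with
      | fun _ => _ => fail
      | _ => refine (@measurable_eta _ _ _ _ D f _)
      end
  end.
Ltac mfun := repeat (mstep => //=).

(** * Integrals of nonnegative functions and their limits *)

Section generic_integral.
Context d (T : measurableType d) (R : realType) (m : {measure set T -> \bar R}).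

Lemma nnZ (c : R) (f : T -> \bar R) : 0 <= c -> mfunT f ->
  (forall x, 0 <= f x)%E -> (\int[m]_x (c%:E * f x) = c%:E * \int[m]_x f x)%E.
Proof. by move=> c0 mf f0; rewrite ge0_integralZl_EFin. Qed.

Lemma nnZr (c : R) (f : T -> R) : 0 <= c -> mfunT f -> (forall x, 0 <= f x) ->
  (\int[m]_x (c * f x)%:E = c%:E * \int[m]_x (f x)%:E)%E.
Proof.
by move=> c0 mf f0; rewrite -nnZ//; mfun.
Qed.

Lemma nnD (f g : T -> R) : mfunT f -> mfunT g -> (forall x, 0 <= f x) -> (forall x, 0 <= g x) ->
  (\int[m]_x (f x + g x)%:E = \int[m]_x (f x)%:E + \int[m]_x (g x)%:E)%E.
Proof.
move=> mf mg f0 g0; under eq_integral do rewrite EFinD.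
by rewrite ge0_integralD//; try (by mfun); move=> x _; rewrite lee_fin.
Qed.

Lemma nnD_lty (f g : T -> R) : mfunT f -> mfunT g -> (forall x, 0 <= f x) -> (forall x, 0 <= g x) ->
  (\int[m]_x (f x)%:E < +oo)%E -> (\int[m]_x (g x)%:E < +oo)%E -> (\int[m]_x (f x + g x)%:E < +oo)%E.
Proof. by move=> mf mg f0 g0 fi gi; rewrite nnD// lte_add_pinfty. Qed.

Lemma nnZr_lty (c : R) (f : T -> R) : 0 <= c -> mfunT f ->
  (forall x, 0 <= f x) -> (\int[m]_x (f x)%:E < +oo)%E -> (\int[m]_x (c * f x)%:E < +oo)%E.
Proof. by move=> c0 mf f0 fi; rewrite nnZr// lte_mul_pinfty// lee_fin. Qed.

Lemma nn_sum I (s : seq I) (f : I -> T -> R) : (forall i, mfunT (f i)) -> (forall i x, 0 <= f i x) ->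
  (\int[m]_x (\sum_(i <- s) f i x)%:E = \sum_(i <- s) \int[m]_x (f i x)%:E)%E.
Proof.
move=> mf f0; under eq_integral do rewrite -sumEFin.
rewrite ge0_integral_sum// => [i|i x _]; first by mfun.
by rewrite lee_fin.
Qed.

(** The device by which norm inequalities pass to limits below: integral bounds uniform in [k] are
    enough, so no dominating function has to be found. *)
Lemma fatou_le (f : nat -> T -> R) (g : T -> R) (B : \bar R) :
  (forall k, mfunT (f k)) -> (forall k x, 0 <= f k x) -> (forall x, f k x @[k --> \oo] --> g x) ->
  (forall k, \int[m]_x (f k x)%:E <= B)%E -> (\int[m]_x (g x)%:E <= B)%E.
Proof.
move=> mf f0 fg fB.
have := @fatou _ _ _ m setT measurableT (fun k x => (f k x)%:E).
have -> : (fun x => limn_einf (fun k => (f k x)%:E)) = fun x => (g x)%:E.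
  apply/funext => x; have fgx : (f k x)%:E @[k --> \oo] --> (g x)%:E.
    by apply: cvg_EFin; [exact: nearW|exact: fg].
  by rewrite is_cvg_limn_einfE; [exact/cvg_lim|apply/cvg_ex; exists (g x)%:E].
move=> h; apply: le_trans (h _ _) _ => //; first by move=> k; mfun.
  by move=> k x _; rewrite lee_fin.
rewrite limn_einf_lim; apply: lime_le; first exact: is_cvg_einfs.
near=> k; apply: le_trans (fB k); apply: ereal_inf_lbound; exists k => //=.
Unshelve. all: by end_near. Qed.

End generic_integral.

(** * Continuity along sequences *)

Section sequential_continuity.
Context {R : realType} {n : nat}.

Definition vcvg (u : nat -> 'rV[R]_n) (x : 'rV[R]_n) := forall i, u k ord0 i @[k --> \oo] --> x ord0 i.

(** Continuity along sequences is the form that dominated convergence yields directly for integrals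
    depending on a parameter. *)
Definition scont (f : 'rV[R]_n -> R) := forall u x, vcvg u x -> f (u k) @[k --> \oo] --> f x.

Lemma cvg_floor (x : R) : ((Num.floor (2 ^+ k * x))%:~R / 2 ^+ k : R) @[k --> \oo] --> x.
Proof.
have h k : x - 2 ^- k <= (Num.floor (2 ^+ k * x))%:~R / 2 ^+ k <= x.
  have k0 : (0 : R) < 2 ^+ k by rewrite exprn_gt0.
  have /andP[h1 h2] := floor_itv (2 ^+ k * x).
  rewrite ler_pdivrMr// (mulrC x) h1 andbT ler_pdivlMr// mulrBl mulVf ?gt_eqF//.
  by rewrite lerBlDr mulrC; move: h2; rewrite intrD => /ltW.
apply: (squeeze_cvgr (f := fun k => x - 2 ^- k) (h := fun => x)).
- by near=> k; exact: h.
- rewrite -[X in _ --> X]subr0; apply: cvgB; first exact: cvg_cst.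
  under eq_fun do rewrite -exprVn.
  by apply: cvg_expr; rewrite ger0_norm// invf_lt1// ltr1n.
- exact: cvg_cst.
Unshelve. all: by end_near. Qed.

(** Rounding every coordinate down to a multiple of [2 ^- k] gives functions that are constant on
    the boxes of a countable grid and converge pointwise to [f]. *)
Lemma scont_measurable f : scont f -> mfunT f.
Proof.
move=> cf.
pose rd k (x : 'rV[R]_n) : 'rV[R]_n := \row_i ((Num.floor (2 ^+ k * x ord0 i))%:~R / 2 ^+ k).
apply: (@measurable_fun_cvg _ _ _ _ (fun k x => f (rd k x))) => [k|x _].
  move=> _ A mA; rewrite setTI.
  pose pt (a : {ffun 'I_n -> int}) : 'rV[R]_n := \row_i ((a i)%:~R / 2 ^+ k).
  have k0 : (0 : R) < 2 ^+ k by rewrite exprn_gt0.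
  have E (z : R) (a : int) : `[a%:~R / 2 ^+ k, (a + 1)%:~R / 2 ^+ k[%classic z <->
      Num.floor (2 ^+ k * z) = a.
    rewrite /= in_itv/= ler_pdivrMr// ltr_pdivlMr// mulrC.
    by split => [/floor_def//|<-]; exact: floor_itv.
  have EA : (fun x : 'rV[R]_n => f (rd k x)) @^-1` A = \bigcup_(a in [set: {ffun 'I_n -> int}])
    [set x : 'rV[R]_n | A (f (pt a)) /\ forall i,
      `[(a i)%:~R / 2 ^+ k, (a i + 1)%:~R / 2 ^+ k[%classic (x ord0 i)].
    apply/seteqP; split => x /= => [h|[a _ [h1 h2]]].
      exists [ffun i => Num.floor (2 ^+ k * x ord0 i)] => //; split.
        by rewrite (_ : pt _ = rd k x)//; apply/rowP => i; rewrite !mxE ffunE.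
      by move=> i; apply/E; rewrite ffunE.
    rewrite (_ : rd k x = pt a)//; apply/rowP => i; rewrite !mxE.
    by have /E -> := h2 i.
  apply: (measurable_eq EA).

  apply: countable_bigcupT_measurable; first exact: countableP.
  move=> a; have [h|h] := pselect (A (f (pt a))); last first.
    by rewrite (_ : [set x | _] = set0)//; apply/seteqP; split => x // [].
  rewrite (_ : [set x | _] = [set x : 'rV[R]_n | forall i,
    `[(a i)%:~R / 2 ^+ k, (a i + 1)%:~R / 2 ^+ k[%classic (x ord0 i)]); last first.
    by apply/seteqP; split => x //= [].
  by apply: (@measurable_rV_box R n (fun i => _)) => i; exact: measurable_itv.
by apply: cf => i; under eq_fun do rewrite mxE; exact: cvg_floor.
Qed.

End sequential_continuity.

(** * Affine changes of variables and integrals of products *)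

Definition affine_map (R : realType) (c h : R) (x : measurableTypeR R) : measurableTypeR R := c * x + h.

Lemma measurable_affine_map (R : realType) (c h : R) : mfunT (affine_map c h).
Proof. by rewrite /affine_map; mfun. Qed.

Section affine_line.
Context {R : realType}.
Local Notation leb := (@lebesgue_measure R).
Variables (c h : R).
Hypothesis c0 : c != 0.

Local Notation aff := (affine_map c h).

Let affm : {measure set (measurableTypeR R) -> \bar R} := mscale `|c|%:nng
    (measure_function_pushforward__canonical__measure_function_Measure leb (measurable_affine_map c h)).

Let affmE A : measurable A -> leb A = affm A.
Proof.
apply: lebesgue_measure_unique => _ [[a b] _ <-] /=.
rewrite lebesgue_measure_itv /= /affm /mscale /= /pushforward.
have [cp|cn] := ltP 0 c.
  rewrite (_ : _ @^-1` _ = `](a - h) / c, (b - h) / c]%classic); last first.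
    apply/seteqP; split => x; rewrite /= /affine_map !in_itv/= ltr_pdivrMr// ler_pdivlMr//;
    by rewrite (mulrC x) ltrBlDr lerBrDr.
  rewrite lebesgue_measure_itv/= !lte_fin ltr_pM2r ?invr_gt0// ltrD2r.
  case: ifPn => _; last by rewrite mule0.
  by rewrite -!EFinD -EFinM gtr0_norm//; congr EFin; field.
(* A negative slope exchanges the two ends, so the preimage of []a, b]] is closed on the left. *)
have cn' : c < 0 by rewrite lt_neqAle c0.
rewrite (_ : _ @^-1` _ = `[(b - h) / c, (a - h) / c[%classic); last first.
  apply/seteqP; split => x; rewrite /= /affine_map !in_itv/= ltr_ndivlMr// ler_ndivrMr//;
  by rewrite (mulrC x) ltrBlDr lerBrDr => /andP[-> ->].
rewrite lebesgue_measure_itv/= !lte_fin ltr_nM2r ?invr_lt0// ltrD2r.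
case: ifPn => _; last by rewrite mule0.
by rewrite -!EFinD -EFinM ltr0_norm//; congr EFin; field.
Qed.

(** By uniqueness of Lebesgue measure on half-open intervals, [|c|] times its image under the affine
    map is Lebesgue measure again. *)
Lemma int1_affine (f : R -> \bar R) : mfunT f -> (forall x, 0 <= f x)%E ->
  (\int[leb]_x f (c * x + h)%R = `|c|^-1%:E * \int[leb]_x f x)%E.
Proof.
move=> mf f0.
have -> : (\int[leb]_x f x = \int[affm]_x f x)%E.
  by apply: eq_measure_integral => A mA _; exact: affmE.
rewrite ge0_integral_mscale// (ge0_integral_pushforward (measurable_affine_map c h))//= muleA -EFinM mulVf ?normr_eq0//.
by rewrite mul1e preimage_setT.
Qed.

End affine_line.

Section integral_rV.
Context {R : realType}.
Local Notation leb := (@lebesgue_measure R).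
Local Notation mu n := (@lebesgue_rV R n : set 'rV[R]_n -> \bar R).

Lemma int_rV0 (f : 'rV[R]_0 -> \bar R) : mfunT f -> (\int[mu 0]_x f x = f 0%R)%E.
Proof. by move=> mf; rewrite integral_dirac// diracT mul1e. Qed.

Lemma int_rV_cons n (f : 'rV[R]_n.+1 -> \bar R) : mfunT f -> (forall x, 0 <= f x)%E ->
  (\int[mu n.+1]_x f x = \int[leb]_a \int[mu n]_v f (rV_cons (a, v)))%E.
Proof.
move=> mf f0.
rewrite (_ : mu n.+1 = pushforward (leb \x mu n)%E (@rV_cons R n))//.
rewrite ge0_integral_pushforward//= preimage_setT.
rewrite (@fubini_tonelli1 _ _ _ _ R leb (@lebesgue_rV R n))//=.
by apply: (measurableT_comp mf); exact: measurable_rV_cons.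
Qed.

(** Induction on the dimension: [rV_cons] splits the map into an affine map of the first coordinate
    and one of the others, each coordinate costing a factor [|c|^-1]. *)
Lemma int_affine n c (h : 'rV[R]_n) (f : 'rV[R]_n -> \bar R) : c != 0 ->
  mfunT f -> (forall x, 0 <= f x)%E ->
  (\int[mu n]_x f (c *: x + h)%R = (`|c|^-1 ^+ n)%:E * \int[mu n]_x f x)%E.
Proof.
move=> c0; elim: n h f => [|n IH] h f mf f0.
  rewrite !int_rV0//; last by mfun.
  by rewrite expr0 mul1e; congr f; apply/rowP => -[].
have mfa : mfunT (fun x : 'rV[R]_n.+1 => f (c *: x + h)) by mfun.
rewrite !int_rV_cons//; pose h' : 'rV[R]_n := \row_i h ord0 (lift ord0 i).
have E a v : c *: rV_cons (a, v) + h = rV_cons (c * a + h ord0 ord0, c *: v + h').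
  apply/rowP => i; rewrite !mxE; case: (unliftP ord0 i) => [j|] ->.
    by rewrite /= !mxE.
  by [].
have mc (a : R) : mfunT (fun v : 'rV[R]_n => f (rV_cons (a, v))).
  apply: (measurableT_comp mf); apply: (measurableT_comp (@measurable_rV_cons R n)).
  exact: measurable_fun_pair.
have mF : mfunT (fun z : R * 'rV[R]_n => f (rV_cons (z.1, z.2))).
  apply: (measurableT_comp mf); apply: (measurableT_comp (@measurable_rV_cons R n)).
  exact: measurable_fun_pair.
under eq_integral => a _.
  under eq_integral do rewrite E.
  rewrite (IH h' (fun v => f (rV_cons (c * a + h ord0 ord0, v))))//.
  over.
rewrite nnZ; first last.
- by move=> a; apply: integral_ge0 => v _; exact: f0.
- apply: (measurableT_comp (f := fun a => \int[mu n]_v f (rV_cons (a, v)))%E).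
    by apply: (@measurable_fun_tonelli _ _ _ _ R (@lebesgue_rV R n) (fun a v => f (rV_cons (a, v)))).
  by mfun.
- by rewrite exprn_ge0// invr_ge0.
rewrite (int1_affine (h ord0 ord0) c0 (f := fun a => \int[mu n]_v f (rV_cons (a, v)))%E).
- by rewrite muleA -EFinM exprSr.
- by apply: (@measurable_fun_tonelli _ _ _ _ R (@lebesgue_rV R n) (fun a v => f (rV_cons (a, v)))).
- by move=> a; exact: integral_ge0.
Qed.

Lemma int_shift n (h : 'rV[R]_n) (f : 'rV[R]_n -> \bar R) : mfunT f -> (forall x, 0 <= f x)%E ->
  (\int[mu n]_x f (x + h)%R = \int[mu n]_x f x)%E.
Proof.
move=> mf f0; have := int_affine h (oner_neq0 R) mf f0.
rewrite normr1 invr1 expr1n mul1e => <-.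
by apply: eq_integral => x _; rewrite scale1r.
Qed.

Lemma int_subl n (z : 'rV[R]_n) (f : 'rV[R]_n -> \bar R) : mfunT f -> (forall x, 0 <= f x)%E ->
  (\int[mu n]_x f (z - x)%R = \int[mu n]_x f x)%E.
Proof.
move=> mf f0; have N1 : (-1 : R) != 0 by rewrite oppr_eq0 oner_neq0.
have := int_affine z N1 mf f0.
rewrite normrN1 invr1 expr1n mul1e => <-.
by apply: eq_integral => x _; rewrite scaleN1r addrC.
Qed.

Lemma int_scale n (c : R) (f : 'rV[R]_n -> \bar R) : c != 0 -> mfunT f -> (forall x, 0 <= f x)%E ->
  (\int[mu n]_x f (c *: x)%R = (`|c|^-1 ^+ n)%:E * \int[mu n]_x f x)%E.
Proof.
move=> c0 mf f0; rewrite -(int_affine 0)//.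
by apply: eq_integral => x _; rewrite addr0.
Qed.

Lemma int_prod n (g : R -> R) : mfunT g -> (forall x, 0 <= g x) -> (\int[leb]_a (g a)%:E < +oo)%E ->
  (\int[mu n]_x (\prod_(i < n) g (x ord0 i))%:E = (fine (\int[leb]_a (g a)%:E) ^+ n)%:E)%E.
Proof.
move=> mg g0 gf.
have mp m : mfunT (fun x : 'rV[R]_m => \prod_(i < m) g (x ord0 i)).
  by mfun.
have p0 m (x : 'rV[R]_m) : 0 <= \prod_(i < m) g (x ord0 i).
  by apply: prodr_ge0.
elim: n => [|n IH].
  rewrite int_rV0; first by rewrite big_ord0.
  by apply/measurable_EFinP; exact: (mp 0%N).
rewrite int_rV_cons//; last 2 first.
- by apply/measurable_EFinP; exact: mp.
- by move=> x; rewrite lee_fin.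
under eq_integral => a _.
  under eq_integral => v _.
    rewrite big_ord_recl rV_consE0; under eq_bigr do rewrite rV_consES.
    over.
  rewrite /= (nnZr _ (f := fun v : 'rV[R]_n => \prod_(i < n) g (v ord0 i)))//; last exact: mp.
  rewrite IH muleC.
  over.
rewrite nnZ//; last 2 first.
- by rewrite exprn_ge0// fine_ge0// integral_ge0// => a _; rewrite lee_fin.
- exact/measurable_EFinP.
rewrite exprSr EFinM fineK// ge0_fin_numE//.
by apply: int_ge0 => a.
Qed.

(** A ball of the sup norm is a cube, which makes all volumes exact. *)
Lemma int_ball n (z : 'rV[R]_n) r : 0 < r ->
  (\int[mu n]_x (`|x - z| < r)%R%:R%:E = ((2 * r) ^+ n)%:E)%E.
Proof.
move=> r0; rewrite (int_shift (- z) (f := fun x => (`|x| < r)%R%:R%:E)); last 2 first.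
- by mfun.
- by move=> x; rewrite lee_fin.
have I1 : (\int[leb]_a (`|a| < r)%R%:R%:E = (2 * r)%:E)%E.
  rewrite (_ : (fun a => _) = fun a => (\1_(`]-r, r[%classic) a)%:E); last first.
    by apply/funext => a; rewrite indicE mem_setE in_itv/= ltr_norml.

  rewrite integral_indic//= setIT lebesgue_measure_itv/= lte_fin.
  by rewrite ifT ?gt0_cp// -EFinD opprK mulr2n mulrDl mul1r.
transitivity (\int[mu n]_x (\prod_(i < n) (`|x ord0 i| < r)%R%:R)%:E)%E.
  apply: eq_integral => x _; congr EFin.
  case: norm_ltP => // [h|h].
    by rewrite big1// => i _; rewrite h.
  have [i ni] : exists i, ~~ (`|x ord0 i| < r).
    by apply/existsP; rewrite -negb_forall; apply/negP => /forallP.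
  by rewrite (bigD1 i)//= (negbTE ni) mul0r.
rewrite (@int_prod n (fun a => (`|a| < r)%R%:R)) ?I1//; first by mfun.
by rewrite ltry.
Qed.

End integral_rV.

(** * Complex-valued functions and their integrals *)

Local Notation normc := ComplexField.Normc.normc.

Section normc_facts.
Context {R : realType}.
Implicit Types z w : R[i].

Lemma ReD z w : Re (z + w) = Re z + Re w.
Proof. by case: z w => ? ? []. Qed.
Lemma ImD z w : Im (z + w) = Im z + Im w.
Proof. by case: z w => ? ? []. Qed.
Lemma ReM z w : Re (z * w) = Re z * Re w - Im z * Im w.
Proof. by case: z w => ? ? []. Qed.
Lemma ImM z w : Im (z * w) = Re z * Im w + Im z * Re w.
Proof. by case: z w => ? ? []. Qed.
Lemma ReN z : Re (- z) = - Re z. Proof. by case: z. Qed.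
Lemma ImN z : Im (- z) = - Im z. Proof. by case: z. Qed.
Lemma Csplit z : z = Complex (Re z) (Im z). Proof. by case: z. Qed.

Lemma normc_ge0 z : 0 <= normc z. Proof. by case: z => a b; exact: sqrtr_ge0. Qed.
Hint Resolve normc_ge0 : core.

Lemma normcM z w : normc (z * w) = normc z * normc w.
Proof. exact: ComplexField.Normc.normcM. Qed.

Lemma normcD z w : normc (z + w) <= normc z + normc w.
Proof. exact: le_normcD. Qed.

Lemma normcNE z : normc (- z) = normc z.
Proof. by case: z => a b; rewrite /= !sqrrN. Qed.

Lemma sqr_normc z : normc z ^+ 2 = Re z ^+ 2 + Im z ^+ 2.
Proof. by case: z => a b; rewrite /= sqr_sqrtr// addr_ge0// sqr_ge0. Qed.

Lemma Re_le_normc z : `|Re z| <= normc z.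
Proof.
rewrite -ler_sqr ?nnegrE// sqr_normc real_normK ?num_real//.
by rewrite lerDl sqr_ge0.
Qed.

Lemma Im_le_normc z : `|Im z| <= normc z.
Proof.
rewrite -ler_sqr ?nnegrE// sqr_normc real_normK ?num_real//.
by rewrite lerDr sqr_ge0.
Qed.

Lemma normc_le_ReIm z : normc z <= `|Re z| + `|Im z|.
Proof.
rewrite -ler_sqr ?nnegrE ?addr_ge0// sqr_normc sqrrD !real_normK ?num_real//.
by rewrite lerD2r lerDl mulrn_wge0// mulr_ge0.
Qed.

Lemma normc_rc (x : R) : normc x%:C%C = `|x|.
Proof. by rewrite /= expr0n/= addr0 sqrtr_sqr. Qed.

Lemma normc_conj z : normc (conjc z) = normc z.
Proof. by case: z => a b; rewrite /= sqrrN. Qed.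

Lemma mulc_conj z : z * conjc z = (normc z ^+ 2)%:C%C.
Proof.
rewrite sqr_normc; case: z => a b; apply/eqP; rewrite eq_complex /=.
by apply/andP; split; apply/eqP; ring.
Qed.

Lemma normc_cexpi (t : R) : normc (cexpi t) = 1.
Proof. by rewrite /= cos2Dsin2 sqrtr1. Qed.

Lemma cexpiD (s t : R) : cexpi (s + t) = cexpi s * cexpi t.
Proof.
apply/eqP; rewrite eq_complex /= sinD cosD.
by apply/andP; split; apply/eqP; ring.
Qed.

Lemma cexpi0 : cexpi (0 : R) = 1.
Proof. by rewrite /cexpi cos0 sin0. Qed.

Lemma normc_sum I (s : seq I) (F : I -> R[i]) : normc (\sum_(i <- s) F i) <= \sum_(i <- s) normc (F i).
Proof.
elim: s => [|i s IH]; first by rewrite !big_nil normc0.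
by rewrite !big_cons; apply: le_trans (normcD _ _) _; rewrite lerD2l.
Qed.

Definition ccvg (u : nat -> R[i]) (l : R[i]) := Re (u k) @[k --> \oo] --> Re l /\
  Im (u k) @[k --> \oo] --> Im l.

Lemma ccvgM u v a b : ccvg u a -> ccvg v b -> ccvg (fun k => u k * v k) (a * b).
Proof.
move=> [u1 u2] [v1 v2]; split.
  under eq_fun do rewrite ReM.
  by rewrite ReM; apply: cvgB; exact: cvgM.
under eq_fun do rewrite ImM.
by rewrite ImM; apply: cvgD; exact: cvgM.
Qed.

Lemma ccvg_cst a : ccvg (fun=> a) a.
Proof. by split; exact: cvg_cst. Qed.

Lemma ccvg_sum I (s : seq I) (u : I -> nat -> R[i]) a : (forall i, ccvg (u i) (a i)) ->
  ccvg (fun k => \sum_(i <- s) u i k) (\sum_(i <- s) a i).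
Proof.
move=> h; elim: s => [|i s [IH1 IH2]].
  by rewrite big_nil; under eq_fun do rewrite big_nil; exact: ccvg_cst.
have [h1 h2] := h i; rewrite big_cons; under eq_fun do rewrite big_cons.
split; [under eq_fun do rewrite ReD | under eq_fun do rewrite ImD].
  by rewrite ReD; exact: cvgD.
by rewrite ImD; exact: cvgD.
Qed.

Lemma ccvg_normc u a : ccvg u a -> normc (u k) @[k --> \oo] --> normc a.
Proof.
move=> [h1 h2].
rewrite (_ : normc a = Num.sqrt (Re a ^+ 2 + Im a ^+ 2)); last by case: (a).
rewrite (_ : (fun k => _) = fun k => Num.sqrt (Re (u k) ^+ 2 + Im (u k) ^+ 2)).
  by apply: continuous_cvg; [exact: sqrt_continuous|apply: cvgD; exact: cvgM].
by apply/funext => k; case: (u k).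
Qed.

Lemma ccvg_unique u a b : ccvg u a -> ccvg u b -> a = b.
Proof.
move=> [h1 h2] [h3 h4]; rewrite (Csplit a) (Csplit b).
by congr Complex; [exact: cvg_unique h1 h3|exact: cvg_unique h2 h4].
Qed.

End normc_facts.
#[global] Hint Extern 0 (is_true (@Order.le _ _ _ (ComplexField.Normc.normc _))) =>
  exact: normc_ge0 : core.
#[global] Hint Extern 0 (is_true (@Order.le _ _ _ (@EFin _ _))) =>
  (rewrite lee_fin; done) : core.

Arguments ComplexField.Normc.normc : simpl never.
Arguments fourier : simpl never.
Arguments invfourier : simpl never.
Arguments cexpi : simpl never.

(** [cmeasurable] on an arbitrary measurable space, so that it also covers functions on products. *)
Definition cmeas d (T : measurableType d) (R : realType) (f : T -> R[i]) := mfunT (fun x => Re (f x)) /\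
  mfunT (fun x => Im (f x)).

Section cmeas_facts.
Context d (T : measurableType d) (R : realType).
Implicit Types f g : T -> R[i].

Lemma cmeasD f g : cmeas f -> cmeas g -> cmeas (fun x => f x + g x).
Proof.
move=> [f1 f2] [g1 g2]; split.
  have -> : (fun x => Re (f x + g x)) = fun x => Re (f x) + Re (g x).
    by apply/funext => x; exact: ReD.
  by mfun.
have -> : (fun x => Im (f x + g x)) = fun x => Im (f x) + Im (g x).
  by apply/funext => x; exact: ImD.
by mfun.
Qed.

Lemma cmeasN f : cmeas f -> cmeas (fun x => - f x).
Proof.
move=> [f1 f2]; split; [under eq_fun do rewrite ReN|under eq_fun do rewrite ImN].
  by apply: (measurableT_comp _ f1); exact: oppr_measurable.
by apply: (measurableT_comp _ f2); exact: oppr_measurable.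
Qed.

Lemma cmeasM f g : cmeas f -> cmeas g -> cmeas (fun x => f x * g x).
Proof.
move=> [f1 f2] [g1 g2]; split.
  under eq_fun do rewrite ReM.
  by apply: measurable_funB; apply: measurable_funM.
under eq_fun do rewrite ImM.
by apply: measurable_funD; apply: measurable_funM.
Qed.

Lemma cmeas_conj f : cmeas f -> cmeas (fun x => conjc (f x)).
Proof.
move=> [f1 f2]; split.
  by rewrite (_ : (fun x => _) = fun x => Re (f x))//; apply/funext => x; case: (f x).
rewrite (_ : (fun x => _) = fun x => - Im (f x)).
  by apply: (measurableT_comp _ f2); exact: oppr_measurable.
by apply/funext => x; case: (f x).
Qed.

Lemma cmeas_cst (c : R[i]) : cmeas (fun _ : T => c).
Proof. by split; exact: measurable_cst. Qed.

Lemma cmeas_rc (f : T -> R) : mfunT f -> cmeas (fun x => (f x)%:C%C).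
Proof. by move=> mf; split => //=; exact: measurable_cst. Qed.

Lemma cmeas_cexpi (f : T -> R) : mfunT f -> cmeas (fun x => cexpi (f x)).
Proof. by move=> mf; split; rewrite /=; mfun. Qed.

Lemma cmeas_sum I (s : seq I) (f : I -> T -> R[i]) : (forall i, cmeas (f i)) ->
  cmeas (fun x => \sum_(i <- s) f i x).
Proof.
move=> mf; elim: s => [|i s IH].
  by under eq_fun do rewrite big_nil; exact: cmeas_cst.
by under eq_fun do rewrite big_cons; exact: cmeasD.
Qed.

Lemma measurable_normc f : cmeas f -> mfunT (fun x => normc (f x)).
Proof.
move=> [f1 f2]; rewrite (_ : (fun x => _) = fun x =>
  Num.sqrt (Re (f x) ^+ 2 + Im (f x) ^+ 2)); first by mfun.
by apply/funext => x; case: (f x).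
Qed.

Lemma cmeas_comp d' (T' : measurableType d') (h : T' -> T) f :
  cmeas f -> mfunT h -> cmeas (fun x => f (h x)).
Proof. by move=> [f1 f2] mh; split; [exact: (measurableT_comp f1)|exact: (measurableT_comp f2)]. Qed.

End cmeas_facts.

Ltac cstep :=
  match goal with
  | H : cmeas ?f |- cmeas ?f => exact H
  | H : cmeas _ |- cmeas _ => exact: H
  | |- cmeas (fun _ => ?c) => exact: cmeas_cst
  | |- cmeas (fun x => @?f x + @?g x) => apply: cmeasD
  | |- cmeas (fun x => @?f x * @?g x) => apply: cmeasM
  | |- cmeas (fun x => - @?f x) => apply: cmeasN
  | |- cmeas (fun x => conjc (@?f x)) => apply: cmeas_conj
  | |- cmeas (fun x => (@?f x)%:C%C) => apply: cmeas_rc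
  | |- cmeas (fun x => cexpi (@?f x)) => apply: cmeas_cexpi
  | |- cmeas (fun x => \sum_(i <- _) _) => apply: cmeas_sum => ?
  | |- measurable_fun _ (fun x => normc (@?f x)) => apply: measurable_normc
  | H : forall _, cmeas _ |- cmeas _ => apply: H
  | H : cmeas ?f |- cmeas (fun x => ?f (@?e x)) => apply: (cmeas_comp H)
  | H : forall _, cmeas _ |- cmeas (fun x => ?f (@?e x)) => apply: (cmeas_comp (H _))
  | |- measurable_fun _ _ => mstep
  end.
Ltac cm := repeat (cstep => //=).

Section cint.
Context d (T : measurableType d) (R : realType) (m : {measure set T -> \bar R}).
Implicit Types f g : T -> R[i].

(** Integrability through the modulus; [cintg_ReIm] and [cintgP] translate from and to the real and
    imaginary parts that [cintegrable] speaks of. *)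
Definition cintg f := cmeas f /\ (\int[m]_x (normc (f x))%:E < +oo)%E.

(** Unfolds to [cintegral] when the measure is that of ['rV[R]_n]. *)
Definition cint f : R[i] := Complex (\int[m]_x Re (f x)) (\int[m]_x Im (f x)).

Lemma cintg_ReIm f : cintg f -> m.-integrable setT (fun x => (Re (f x))%:E) /\
  m.-integrable setT (fun x => (Im (f x))%:E).
Proof.
move=> [[f1 f2] fi]; split; apply/integrableP; split; try (by mfun);
  apply: le_lt_trans fi; apply: nn_le => x //=; rewrite lee_fin.
- exact: Re_le_normc.
- exact: Im_le_normc.
Qed.

Lemma cintgP f : m.-integrable setT (fun x => (Re (f x))%:E) ->
  m.-integrable setT (fun x => (Im (f x))%:E) -> cintg f.
Proof.
move=> /integrableP[/measurable_EFinP f1 i1] /integrableP[/measurable_EFinP f2 i2].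
split=> //; apply: (@le_lt_trans _ _ (\int[m]_x (`|Re (f x)| + `|Im (f x)|)%:E)%E).
  by apply: nn_le => x; rewrite lee_fin//; exact: normc_le_ReIm.
by apply: nnD_lty => //; mfun.
Qed.

Lemma cintg_le f (g : T -> R) : cmeas f -> (forall x, normc (f x) <= g x) ->
  (\int[m]_x (g x)%:E < +oo)%E -> cintg f.
Proof.
move=> mf fg gi; split => //; apply: le_lt_trans gi.
by apply: nn_le => x; rewrite lee_fin.
Qed.

Lemma cintgD f g : cintg f -> cintg g -> cintg (fun x => f x + g x).
Proof.
move=> [mf fi] [mg gi]; apply: (@cintg_le _ (fun x => normc (f x) + normc (g x))).
- by cm.
- by move=> x; exact: normcD.
- by apply: nnD_lty => //; cm.
Qed.

Lemma cintgMb f g (B : R) : cintg f -> cmeas g -> (forall x, normc (g x) <= B) ->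
  cintg (fun x => g x * f x).
Proof.
move=> [mf fi] mg gB; have B0 (x : T) : 0 <= B by exact: le_trans (normc_ge0 _) (gB x).
apply: (@cintg_le _ (fun x => `|B| * normc (f x))).
- by cm.
- by move=> x; rewrite normcM ler_wpM2r// (le_trans (gB x))// ler_norm.
- by apply: nnZr_lty => //; cm.
Qed.

Lemma cintgZ f (c : R[i]) : cintg f -> cintg (fun x => c * f x).
Proof. by move=> fi; apply: (@cintgMb f (fun=> c) (normc c)) => //; cm. Qed.

Lemma cintg_sum I (s : seq I) (f : I -> T -> R[i]) : (forall i, cintg (f i)) ->
  cintg (fun x => \sum_(i <- s) f i x).
Proof.
move=> fi; elim: s => [|i s IH]; last first.
  by under eq_fun do rewrite big_cons; exact: cintgD.
under eq_fun do rewrite big_nil; split; first exact: cmeas_cst.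
by rewrite normc0 integral0.
Qed.

Lemma cintD f g : cintg f -> cintg g -> cint (fun x => f x + g x) = cint f + cint g.
Proof.
move=> /cintg_ReIm[f1 f2] /cintg_ReIm[g1 g2]; rewrite /cint.
have -> : (fun x => Re (f x + g x)) = fun x => Re (f x) + Re (g x).
  by apply/funext => x; exact: ReD.
have -> : (fun x => Im (f x + g x)) = fun x => Im (f x) + Im (g x).
  by apply/funext => x; exact: ImD.
by rewrite !RintegralD.
Qed.

Lemma cintZ f (c : R[i]) : cintg f -> cint (fun x => c * f x) = c * cint f.
Proof.
move=> /cintg_ReIm[f1 f2]; have Z (a : R) (h : T -> R) : m.-integrable setT (fun x => (h x)%:E) ->
    m.-integrable setT (fun x => (a * h x)%:E).
  by move=> hi; under eq_fun do rewrite EFinM; exact: integrableZl.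
rewrite /cint; case: c => a b.
have -> : (fun x => Re (Complex a b * f x)) = fun x => a * Re (f x) - b * Im (f x).
  by apply/funext => x; exact: ReM.
have -> : (fun x => Im (Complex a b * f x)) = fun x => a * Im (f x) + b * Re (f x).
  by apply/funext => x; exact: ImM.
rewrite [X in Complex X _]RintegralB; try exact: Z; try exact: measurableT.
rewrite [X in Complex _ X]RintegralD; try exact: Z; try exact: measurableT.
by rewrite !RintegralZl.
Qed.

Lemma cintZr f (c : R[i]) : cintg f -> cint (fun x => f x * c) = cint f * c.
Proof. by move=> fi; under eq_fun do rewrite mulrC; rewrite cintZ// mulrC. Qed.

Lemma cint_sum I (s : seq I) (f : I -> T -> R[i]) : (forall i, cintg (f i)) ->
  cint (fun x => \sum_(i <- s) f i x) = \sum_(i <- s) cint (f i).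
Proof.
move=> fi; elim: s => [|i s IH]; last first.
  under eq_fun do rewrite big_cons.
  by rewrite cintD ?IH ?big_cons//; exact: cintg_sum.
under eq_fun do rewrite big_nil.
by rewrite big_nil /cint /Rintegral /= integral0.
Qed.

Lemma cintB f g : cintg f -> cintg g -> cint (fun x => f x - g x) = cint f - cint g.
Proof.
move=> fi gi; under eq_fun do rewrite -(mulN1r (g _)).
by rewrite cintD ?cintZ ?mulN1r//; exact: cintgZ.
Qed.

(** With [z] the integral, [|z|^2] is the integral of [Re (conjc z f)], which is at most [|z|] times
    the integral of [|f|]; then [|z|] is cancelled. *)
Lemma le_cint f : cintg f -> ((normc (cint f))%:E <= \int[m]_x (normc (f x))%:E)%E.
Proof.
move=> fi; have [mf fl] := fi; set z := cint f.
have If0 : (0 <= \int[m]_x (normc (f x))%:E)%E by apply: int_ge0 => x.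
have [->|z0] := eqVneq z 0; first by rewrite normc0.
have nz : 0 < normc z.
  by rewrite lt_neqAle normc_ge0 andbT eq_sym; apply: contra_neq z0 => /eq0_normc.
have : (normc z ^+ 2)%:E = (\int[m]_x (Re (conjc z * f x))%:E)%E.
  have /cintg_ReIm[h _] : cintg (fun x => conjc z * f x) by exact: cintgZ.
  rewrite -[RHS]fineK ?integrable_fin_num//; congr EFin.
  transitivity (Re (z * conjc z)); first by rewrite mulc_conj.
  by rewrite mulrC -cintZ.
move=> zE; rewrite -(@lee_pmul2l _ (normc z)%:E)//.
rewrite -EFinM -expr2 zE -nnZr//; last by cm.
have /cintg_ReIm[h _] : cintg (fun x => conjc z * f x) by exact: cintgZ.
apply: le_integral => //; first by apply/integrableP; split; [by cm|];
  under eq_integral do rewrite abse_EFin ger0_norm ?mulr_ge0//; apply: nnZr_lty => //; cm.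
move=> x _; rewrite lee_fin (le_trans (ler_norm _))// (le_trans (Re_le_normc _))//.
by rewrite normcM normc_conj.
Qed.

Lemma cint_dct (f_ : nat -> T -> R[i]) f (g : T -> R) :
  (forall k, cmeas (f_ k)) -> cmeas f -> (forall x, ccvg (f_ ^~ x) (f x)) ->
  (forall k x, normc (f_ k x) <= g x) -> mfunT g -> (\int[m]_x (g x)%:E < +oo)%E ->
  ccvg (fun k => cint (f_ k)) (cint f).
Proof.
move=> mf_ mf cf fg mg gi.
have g0 x : 0 <= g x by exact: le_trans (normc_ge0 _) (fg 0%N x).
have ig : m.-integrable setT (fun x => (g x)%:E).
  by apply/integrableP; split; [by mfun|under eq_integral do rewrite abse_EFin ger0_norm//].
have H (h_ : nat -> T -> R) (h : T -> R) : (forall k, mfunT (h_ k)) ->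
    mfunT h -> (forall x, h_ k x @[k --> \oo] --> h x) ->
    (forall k x, `|h_ k x| <= g x) -> (\int[m]_x h_ k x) @[k --> \oo] --> \int[m]_x h x.
  move=> mh_ mh ch hg.
  have [] := @dominated_convergence _ _ _ m setT measurableT (fun k x => (h_ k x)%:E)
    (fun x => (h x)%:E) (fun x => (g x)%:E).
  - by move=> k; mfun.
  - by mfun.
  - by apply: aeW => x _; apply: cvg_EFin; [exact: nearW|exact: ch].
  - exact: ig.
  - by apply: aeW => x k _; rewrite lee_fin.
  move=> hi _ hc; rewrite /Rintegral.
  by apply: fine_cvg; rewrite fineK//; exact: integrable_fin_num.
split; apply: H => //=.
- by move=> k; have [] := mf_ k.
- by have [] := mf.
- by move=> x; have [] := cf x.
- by move=> k x; exact: le_trans (Re_le_normc _) (fg k x).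
- by move=> k; have [] := mf_ k.
- by have [] := mf.
- by move=> x; have [] := cf x.
- by move=> k x; exact: le_trans (Im_le_normc _) (fg k x).
Qed.

End cint.

Arguments cint : simpl never.

Section cfubini.
Context d1 d2 (T1 : measurableType d1) (T2 : measurableType d2) (R : realType).
Variables (m1 : {sigma_finite_measure set T1 -> \bar R}) (m2 : {sigma_finite_measure set T2 -> \bar R}).

Let measurable_param_real (F : T1 -> T2 -> R) : mfunT (fun z => F z.1 z.2) ->
  mfunT (fun x => \int[m2]_y F x y).
Proof.
move=> mF; rewrite /Rintegral; under eq_fun do rewrite integralE.
apply: (measurableT_comp (fine_measurable measurableT)).
have mE : mfunT (fun z => (F z.1 z.2)%:E) by mfun.
apply: emeasurable_funB.
  apply: (@measurable_fun_tonelli _ _ _ _ _ m2 (fun x => (fun y => (F x y)%:E)^\+%E)) => //.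
  rewrite (_ : (fun z => _) = (fun z => (F z.1 z.2)%:E)^\+%E); first exact: measurable_funepos.
  by apply/funext => z; rewrite !funeposE.
apply: (@measurable_fun_tonelli _ _ _ _ _ m2 (fun x => (fun y => (F x y)%:E)^\-%E)) => //.
rewrite (_ : (fun z => _) = (fun z => (F z.1 z.2)%:E)^\-%E); first exact: measurable_funeneg.
by apply/funext => z; rewrite !funenegE.
Qed.

Lemma cmeas_param (F : T1 -> T2 -> R[i]) : cmeas (fun z => F z.1 z.2) -> cmeas (fun x => cint m2 (F x)).
Proof.
move=> [h1 h2]; split; rewrite /=.
  exact: (measurable_param_real (F := fun x y => Re (F x y))).
exact: (measurable_param_real (F := fun x y => Im (F x y))).
Qed.

Lemma cmeas_fix (F : T1 -> T2 -> R[i]) x : cmeas (fun z => F z.1 z.2) -> cmeas (F x).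
Proof.
by move=> mF; apply: (cmeas_comp (h := fun y => (x, y)) mF); exact: measurable_fun_pair.
Qed.

Lemma cmeas_fix2 (F : T1 -> T2 -> R[i]) y : cmeas (fun z => F z.1 z.2) -> cmeas (F ^~ y).
Proof.
by move=> mF; apply: (cmeas_comp (h := fun x => (x, y)) mF); exact: measurable_fun_pair.
Qed.

(** Integrability of the sections is asked at every point rather than almost every one, which keeps
    exceptional null sets out of the argument. *)
Lemma cfubini (F : T1 -> T2 -> R[i]) : cmeas (fun z => F z.1 z.2) ->
  (forall x, \int[m2]_y (normc (F x y))%:E < +oo)%E ->
  (forall y, \int[m1]_x (normc (F x y))%:E < +oo)%E ->
  (\int[m1]_x \int[m2]_y (normc (F x y))%:E < +oo)%E ->
  cint m1 (fun x => cint m2 (F x)) = cint m2 (fun y => cint m1 (F ^~ y)).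
Proof.
move=> mF F1 F2 FI.
have i1 x : cintg m2 (F x) by split; [exact: cmeas_fix|exact: F1].
have i2 y : cintg m1 (F ^~ y) by split; [exact: cmeas_fix2|exact: F2].
have ip : cintg (m1 \x m2)%E (fun z => F z.1 z.2).
  split => //; rewrite (@fubini_tonelli1 _ _ _ _ _ m1 m2).
  - exact: FI.
  - by cm.
  - by move=> z; rewrite lee_fin.
have H (h : R[i] -> R) : (forall x, m2.-integrable setT (fun y => (h (F x y))%:E)) ->
    (forall y, m1.-integrable setT (fun x => (h (F x y))%:E)) ->
    (m1 \x m2)%E.-integrable setT (fun z => (h (F z.1 z.2))%:E) ->
    \int[m1]_x (\int[m2]_y h (F x y)) = \int[m2]_y (\int[m1]_x h (F x y)).
  move=> h1 h2 hp; rewrite /Rintegral; congr fine.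
  under eq_integral => x _ do rewrite fineK ?integrable_fin_num//.
  under [RHS]eq_integral => y _ do rewrite fineK ?integrable_fin_num//.
  exact: (@Fubini _ _ _ _ _ m1 m2 (fun z => (h (F z.1 z.2))%:E)).
rewrite /cint /=; congr Complex; (apply: H => [x|y|]).
- by have [] := cintg_ReIm (i1 x).
- by have [] := cintg_ReIm (i2 y).
- by have [] := cintg_ReIm ip.
- by have [] := cintg_ReIm (i1 x).
- by have [] := cintg_ReIm (i2 y).
- by have [] := cintg_ReIm ip.
Qed.

End cfubini.

Section affine_complex.
Context {R : realType}.

Let Rint_comp d (T : measurableType d) (m : {measure set T -> \bar R})
    (phi : T -> T) (c : R) (f : T -> R) : 0 <= c ->
  (forall g : T -> \bar R, mfunT g -> (forall x, 0 <= g x)%E ->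
    (\int[m]_x g (phi x) = c%:E * \int[m]_x g x)%E) -> m.-integrable setT (fun x => (f x)%:E) ->
  \int[m]_x f (phi x) = c * \int[m]_x f x.
Proof.
move=> c0 H fi; have mf := measurable_int _ fi.
rewrite /Rintegral [in LHS]integralE [in RHS]integralE.
have p0 : (\int[m]_x ((fun x => (f x)%:E)^\+ x) \is a fin_num)%E.
  exact: integrable_pos_fin_num.
have n0 : (\int[m]_x ((fun x => (f x)%:E)^\- x) \is a fin_num)%E.
  exact: integrable_neg_fin_num.
have -> : (\int[m]_x ((fun x => (f (phi x))%:E)^\+ x) = c%:E * \int[m]_x ((fun x => (f x)%:E)^\+ x))%E.
  rewrite -(H (fun x => (f x)%:E)^\+%E)//; last exact: measurable_funepos.
  by apply: eq_integral => x _; rewrite !funeposE.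
have -> : (\int[m]_x ((fun x => (f (phi x))%:E)^\- x) = c%:E * \int[m]_x ((fun x => (f x)%:E)^\- x))%E.
  rewrite -(H (fun x => (f x)%:E)^\-%E)//; last exact: measurable_funeneg.
  by apply: eq_integral => x _; rewrite !funenegE.
by rewrite -(fineK p0) -(fineK n0) -!EFinM -!EFinB /= mulrBr.
Qed.

(** A change of variables known for nonnegative functions transfers to complex ones through positive
    and negative parts of the components. *)
Lemma cint_comp d (T : measurableType d) (m : {measure set T -> \bar R})
    (phi : T -> T) (c : R) (f : T -> R[i]) : 0 <= c ->
  (forall g : T -> \bar R, mfunT g -> (forall x, 0 <= g x)%E ->
    (\int[m]_x g (phi x) = c%:E * \int[m]_x g x)%E) ->
  cintg m f -> cint m (fun x => f (phi x)) = c%:C%C * cint m f.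
Proof.
move=> c0 H /cintg_ReIm[f1 f2].
rewrite /cint (Rint_comp (f := fun x => Re (f x)) c0 H f1).
rewrite (Rint_comp (f := fun x => Im (f x)) c0 H f2).
by apply/eqP; rewrite eq_complex /= !mul0r subr0 addr0 !eqxx.
Qed.

Local Notation leb := (@lebesgue_measure R).

Lemma cint1_opp (f : R -> R[i]) : cintg leb f -> cint leb (fun x => f (- x)) = cint leb f.
Proof.
move=> fi; transitivity ((1 : R)%:C%C * cint leb f); last by rewrite mul1r.
refine (@cint_comp _ _ leb (fun x => - x) 1 f _ _ fi) => // g mg g0.
have N1 : (-1 : R) != 0 by rewrite oppr_eq0 oner_neq0.
rewrite mul1e -[RHS]mul1e -[X in X%:E]invr1 -(normrN1 R) -(int1_affine 0 N1)//.
by apply: eq_integral => x _; rewrite addr0 mulN1r.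
Qed.

End affine_complex.

Local Notation dotmx := Defs.dotmx.

(** * Fourier transform and convolution of bounded integrable functions *)

Section fourier_api.
Context {R : realType} {n : nat}.
Local Notation V := 'rV[R]_n.
Local Notation mu := (@lebesgue_rV R n).
Implicit Types (f g nu : V -> R[i]) (x y xi : V).

Lemma cint_affine (c : R) (h : V) f : c != 0 -> cintg mu f ->
  cint mu (fun x => f (c *: x + h)) = (`|c|^-1 ^+ n)%:C%C * cint mu f.
Proof.
move=> c0 fi; apply: (cint_comp (phi := fun x : V => c *: x + h)) => //.
by move=> g mg g0; exact: int_affine.
Qed.

Lemma cint_subl (z : V) f : cintg mu f -> cint mu (fun x => f (z - x)) = cint mu f.
Proof.
move=> fi; rewrite -[RHS]mul1r.
apply: (cint_comp (phi := fun x : V => z - x) (c := 1)) => // g mg g0.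
by rewrite mul1e; exact: int_subl.
Qed.

Lemma cintg_affine (c : R) (h : V) f : c != 0 -> cintg mu f -> cintg mu (fun x => f (c *: x + h)).
Proof.
move=> c0 [mf fi]; split; first by cm.
rewrite (int_affine h c0 (f := fun x => (normc (f x))%:E))//; try by cm.
by rewrite lte_mul_pinfty// lee_fin exprn_ge0// invr_ge0.
Qed.

Lemma cintg_subl (z : V) f : cintg mu f -> cintg mu (fun x => f (z - x)).
Proof.
move=> [mf fi]; split; first by cm.
by rewrite (int_subl z (f := fun x => (normc (f x))%:E))//; cm.
Qed.

Lemma dotmxC x y : dotmx x y = dotmx y x.
Proof. by apply: eq_bigr => i _; rewrite mulrC. Qed.
Lemma dotmxDl x y z : dotmx (x + y) z = dotmx x z + dotmx y z.
Proof. by rewrite /dotmx -big_split; apply: eq_bigr => i _; rewrite mxE mulrDl. Qed.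
Lemma dotmxZl (c : R) x y : dotmx (c *: x) y = c * dotmx x y.
Proof. by rewrite /dotmx mulr_sumr; apply: eq_bigr => i _; rewrite mxE mulrA. Qed.
Lemma dotmxNl x y : dotmx (- x) y = - dotmx x y.
Proof. by rewrite -scaleN1r dotmxZl mulN1r. Qed.
Lemma dotmxBl x y z : dotmx (x - y) z = dotmx x z - dotmx y z.
Proof. by rewrite dotmxDl dotmxNl. Qed.
Lemma dotmxNr x y : dotmx x (- y) = - dotmx x y.
Proof. by rewrite dotmxC dotmxNl dotmxC. Qed.
Lemma dotmxZr (c : R) x y : dotmx x (c *: y) = c * dotmx x y.
Proof. by rewrite dotmxC dotmxZl dotmxC. Qed.

Lemma measurable_dotmx d (T : measurableType d) (a b : T -> V) : mfunT a -> mfunT b ->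
  mfunT (fun t => dotmx (a t) (b t)).
Proof. by move=> ma mb; rewrite /dotmx; mfun. Qed.

Definition ec (t : R) : R[i] := cexpi (2 * pi * t).

Lemma normc_ec t : normc (ec t) = 1. Proof. exact: normc_cexpi. Qed.
Lemma ecD s t : ec (s + t) = ec s * ec t.
Proof. by rewrite /ec mulrDr cexpiD. Qed.
Lemma ec0 : ec 0 = 1. Proof. by rewrite /ec mulr0 cexpi0. Qed.
Lemma ecN t : ec (- t) = conjc (ec t).
Proof. by rewrite /ec mulrN /cexpi cosN sinN. Qed.

Lemma fourierE f xi : fourier f xi = cint mu (fun x => f x * ec (- dotmx x xi)).
Proof. by rewrite /fourier; under eq_fun do rewrite -mulrN. Qed.

Lemma invfourierE f xi : invfourier f xi = cint mu (fun x => f x * ec (dotmx xi x)).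
Proof. by []. Qed.

Lemma invfourier_fourier f xi : invfourier f xi = fourier f (- xi).
Proof.
by rewrite fourierE invfourierE; under eq_fun do rewrite dotmxC -[dotmx _ xi]opprK -dotmxNr.
Qed.

Definition N1 f : R := fine (\int[mu]_x (normc (f x))%:E).

Lemma N1_ge0 f : 0 <= N1 f.
Proof. by rewrite fine_ge0// integral_ge0// => x _; rewrite lee_fin. Qed.

Lemma N1E f : cintg mu f -> (\int[mu]_x (normc (f x))%:E = (N1 f)%:E)%E.
Proof.
by move=> [_ fi]; rewrite fineK// ge0_fin_numE// integral_ge0// => x _; rewrite lee_fin.
Qed.

Lemma normc_cint_N1 f : cintg mu f -> normc (cint mu f) <= N1 f.
Proof. by move=> fi; rewrite -lee_fin -N1E//; exact: le_cint. Qed.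

Lemma N1_char f (th : V -> R) : N1 (fun x => f x * ec (th x)) = N1 f.
Proof. by rewrite /N1; under eq_integral do rewrite normcM normc_ec mulr1. Qed.

Lemma cintg_char f (th : V -> R) : mfunT th -> cintg mu f -> cintg mu (fun x => f x * ec (th x)).
Proof.
move=> mth fi; under eq_fun do rewrite mulrC.
apply: (cintgMb (B := 1)) => //; last by move=> x; rewrite normc_ec.
by rewrite /ec; cm.
Qed.

Lemma normc_fourier f xi : cintg mu f -> normc (fourier f xi) <= N1 f.
Proof.
move=> fi; rewrite fourierE -(N1_char f (fun x => - dotmx x xi)).
by apply: normc_cint_N1; apply: cintg_char => //; apply/measurable_opprl/measurable_dotmx; mfun.
Qed.

End fourier_api.

Ltac mdot := try apply: measurable_opprl; apply: measurable_dotmx; mfun.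

Section fourier_conv.
Context {R : realType} {n : nat}.
Local Notation V := 'rV[R]_n.
Local Notation mu := (@lebesgue_rV R n).
Implicit Types (f g nu : V -> R[i]) (x y xi : V).

(** Bounded and integrable: a class closed under convolution and contained in L^2, on which the
    qualitative hypotheses of Fourier analysis are easy to check. *)
Definition nice f := [/\ cmeas f, (exists B : R, forall x, normc (f x) <= B) & cintg mu f].

Definition cscont f := scont (fun x => Re (f x)) /\ scont (fun x => Im (f x)).

Lemma cscontP f : cscont f <-> forall u x, vcvg u x -> ccvg (fun k => f (u k)) (f x).
Proof.
split=> [[h1 h2] u x ux|h]; first by split; [exact: h1|exact: h2].
by split=> u x /h [].
Qed.

Lemma cscont_cmeas f : cscont f -> cmeas f.
Proof. by move=> [h1 h2]; split; exact: scont_measurable. Qed.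

Lemma vcvgP (u : nat -> V) x : vcvg u x -> forall y, dotmx (u k) y @[k --> \oo] --> dotmx x y.
Proof.
move=> ux y; rewrite /dotmx.
have H (s : seq 'I_n) : \sum_(i <- s) u k ord0 i * y ord0 i @[k --> \oo] -->
    \sum_(i <- s) x ord0 i * y ord0 i.
  elim: s => [|i s IH].
    by rewrite big_nil; under eq_fun do rewrite big_nil; exact: cvg_cst.
  rewrite big_cons; under eq_fun do rewrite big_cons.
  by apply: cvgD => //; apply: cvgM; [exact: ux|exact: cvg_cst].
exact: H.
Qed.

Lemma ccvg_ec (u : nat -> R) (l : R) : u k @[k --> \oo] --> l -> ccvg (fun k => ec (u k)) (ec l).
Proof.
move=> ul; split; rewrite /ec/=.
  apply: continuous_cvg; first exact: continuous_cos.
  by apply: cvgM => //; exact: cvg_cst.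
apply: continuous_cvg; first exact: continuous_sin.
by apply: cvgM => //; exact: cvg_cst.
Qed.

Lemma cmeas_ec d (T : measurableType d) (th : T -> R) : mfunT th -> cmeas (fun t => ec (th t)).
Proof. by move=> mth; rewrite /ec; cm. Qed.

Lemma cscont_invfourier f : cintg mu f -> cscont (invfourier f).
Proof.
move=> fi; have [mf fl] := fi; apply/cscontP => u x ux.
apply: (@cint_dct _ _ _ mu (fun k y => f y * ec (dotmx (u k) y)) _ (fun y => normc (f y))).
- by move=> k; apply: cmeasM => //; apply/cmeas_ec/measurable_dotmx; mfun.
- by apply: cmeasM => //; apply/cmeas_ec/measurable_dotmx; mfun.
- move=> y; apply: ccvgM; first exact: ccvg_cst.
  by apply: ccvg_ec; exact: vcvgP.
- by move=> k y; rewrite normcM normc_ec mulr1.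
- by cm.
- exact: fl.
Qed.

Lemma vcvgN (u : nat -> V) x : vcvg u x -> vcvg (fun k => - u k) (- x).
Proof. by move=> h i; rewrite mxE; under eq_fun do rewrite mxE; apply: cvgN; exact: h. Qed.

Lemma vcvgB y (u : nat -> V) x : vcvg u x -> vcvg (fun k => u k - y) (x - y).
Proof.
move=> h i; rewrite mxE; under eq_fun do rewrite mxE.
by apply: cvgD; [exact: h|exact: cvg_cst].
Qed.

Lemma cscont_fourier f : cintg mu f -> cscont (fourier f).
Proof.
move=> /cscont_invfourier /cscontP h; apply/cscontP => u x /vcvgN /h.
by rewrite invfourier_fourier opprK; under eq_fun do rewrite invfourier_fourier opprK.
Qed.

Lemma normc_invfourier f xi : cintg mu f -> normc (invfourier f xi) <= N1 f.
Proof. by move=> fi; rewrite invfourier_fourier; exact: normc_fourier. Qed.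

Definition convol k f x := cint mu (fun y => k (x - y) * f y).

Arguments convol : simpl never.

Lemma cintg_conv k f x (B : R) : cmeas k -> (forall x, normc (k x) <= B) ->
  cintg mu f -> cintg mu (fun y => k (x - y) * f y).
Proof.
move=> mk kB fi; apply: (cintgMb (B := B)) => //.
by apply: (cmeas_comp mk); mfun.
Qed.

Lemma normc_conv k f x (B : R) : cmeas k -> (forall x, normc (k x) <= B) ->
  cintg mu f -> normc (convol k f x) <= B * N1 f.
Proof.
move=> mk kB fi; have B0 : 0 <= B by exact: le_trans (normc_ge0 _) (kB 0).
have [mf fl] := fi.
rewrite -lee_fin EFinM -N1E// -nnZr//; last by cm.
apply: le_trans (le_cint _) _; first exact: cintg_conv kB _.
by apply: nn_le => // y; rewrite lee_fin normcM ler_wpM2r.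
Qed.

Lemma cmeas_conv k f : cmeas k -> cmeas f -> cmeas (convol k f).
Proof.
move=> mk mf; apply: (cmeas_param mu (F := fun x y => k (x - y) * f y)).
apply: cmeasM; first by apply: (cmeas_comp mk); mfun.
by apply: (cmeas_comp mf); mfun.
Qed.

Lemma cscont_convol k f (B : R) : cscont k -> (forall x, normc (k x) <= B) ->
  cintg mu f -> cscont (convol k f).
Proof.
move=> ck kB fi; have [mf fl] := fi; have mk := cscont_cmeas ck.
have B0 : 0 <= B by exact: le_trans (normc_ge0 _) (kB 0).
apply/cscontP => u x ux.
apply: (@cint_dct _ _ _ mu (fun j y => k (u j - y) * f y) _ (fun y => B * normc (f y))).
- by move=> j; apply: cmeasM => //; apply: (cmeas_comp mk); mfun.
- by apply: cmeasM => //; apply: (cmeas_comp mk); mfun.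
- move=> y; apply: ccvgM; last exact: ccvg_cst.
  by apply: (cscontP k).1 => //; exact: vcvgB.
- by move=> j y; rewrite normcM ler_wpM2r.
- by mfun; cm.
- by apply: nnZr_lty => //; cm.
Qed.

Lemma conv_tonelli k f : cintg mu k -> cintg mu f ->
  (\int[mu]_x \int[mu]_y (normc (k (x - y) * f y))%:E = (N1 k * N1 f)%:E)%E.
Proof.
move=> ki fi; have [mk _] := ki; have [mf _] := fi.
rewrite tonelli//; last first.
  by cm.
under eq_integral => y _.
  under eq_integral do rewrite normcM mulrC EFinM.
  rewrite nnZ//; last by cm; apply: (cmeas_comp mk); mfun.
  rewrite (int_shift (- y) (f := fun x => (normc (k x))%:E))//; last by cm.
  rewrite N1E// muleC.
  over.
rewrite nnZ//; [by rewrite N1E//|exact: N1_ge0|by cm].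
Qed.

Lemma nice_conv k f : nice k -> nice f -> nice (convol k f).
Proof.
move=> [mk [B kB] ki] [mf _ fi].
have mc := cmeas_conv mk mf.
split=> //; first by exists (B * N1 f) => x; exact: normc_conv.
split=> //; apply: (le_lt_via (N1 k * N1 f)%:E); last exact: ltry.
rewrite -conv_tonelli//; apply: nn_le => // x.
by apply: le_cint; exact: cintg_conv kB _.
Qed.

Lemma fourier_conv k f xi : nice k -> nice f -> fourier (convol k f) xi = fourier k xi * fourier f xi.
Proof.
move=> [mk [B kB] ki] [mf [B' fB'] fi].
have Bf : (\int[mu]_x (normc (f x))%:E < +oo)%E by case: fi.
rewrite !fourierE.
transitivity (cint mu (fun x => cint mu (fun y => (k (x - y) * f y) * ec (- dotmx x xi)))).
  congr cint; apply/funext => x; rewrite cintZr//; exact: cintg_conv kB _.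
have mF : cmeas (fun z : V * V => k (z.1 - z.2) * f z.2 * ec (- dotmx z.1 xi)).
  apply: cmeasM; last by apply/cmeas_ec/measurable_opprl/measurable_dotmx; mfun.
  by apply: cmeasM; [apply: (cmeas_comp mk)|apply: (cmeas_comp mf)]; mfun.
rewrite (cfubini (F := fun x y => k (x - y) * f y * ec (- dotmx x xi)))//.
- transitivity (cint mu (fun y => (f y * ec (- dotmx y xi)) * cint mu (fun x => k x * ec (- dotmx x xi)))).
    congr cint; apply/funext => y.
    have ci : cintg mu (fun x => k x * ec (- dotmx x xi)).
      by apply: cintg_char => //; mdot.
    rewrite -[cint mu _ in RHS]mul1r.
    have := cint_affine (- y) (oner_neq0 R) ci.
    rewrite normr1 invr1 expr1n => <-; rewrite -cintZ; last first.
      have := cintg_affine (- y) (oner_neq0 R) ci; exact.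
    congr cint; apply/funext => x; rewrite scale1r dotmxBl opprB ecD.
    rewrite (_ : ec (dotmx y xi) = conjc (ec (- dotmx y xi))); last by rewrite -ecN opprK.
    have := mulc_conj (ec (- dotmx y xi)); rewrite normc_ec expr1n.
    set e := ec (- dotmx y xi) => E.
    transitivity (k (x - y) * f y * ec (- dotmx x xi) * (e * conjc e)); first by rewrite E mulr1.
    by ring.
  rewrite cintZr; last by apply: cintg_char => //; mdot.
  by rewrite mulrC.
- move=> x; under eq_integral do rewrite normcM normc_ec mulr1.
  by case: (cintg_conv x mk kB fi).
- move=> y; under eq_integral do rewrite normcM normc_ec mulr1 normcM mulrC EFinM.
  rewrite nnZ//; last by cm; apply: (cmeas_comp mk); mfun.
  rewrite (int_shift (- y) (f := fun x => (normc (k x))%:E))//; last by cm.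
  by rewrite N1E// -EFinM ltry.
- under eq_integral do under eq_integral do rewrite normcM normc_ec mulr1.
  by rewrite conv_tonelli// ltry.
Qed.

(** Fubini for the kernel [e(y . xi)]. It is used in place of Parseval's identity, since it asks
    only for integrability of the two functions. *)
Lemma invfourier_duality f nu : cintg mu f -> cintg mu nu ->
  cint mu (fun y => f y * invfourier nu y) = cint mu (fun xi => invfourier f xi * nu xi).
Proof.
move=> fi vi; have [mf fl] := fi; have [mv vl] := vi.
have mF : cmeas (fun z : V * V => f z.1 * (nu z.2 * ec (dotmx z.1 z.2))).
  apply: cmeasM; first by apply: (cmeas_comp mf); mfun.
  by apply: cmeasM; [apply: (cmeas_comp mv)|apply/cmeas_ec/measurable_dotmx]; mfun.
have mc (a : V) g : cintg mu g -> cintg mu (fun x => g x * ec (dotmx a x)).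
  by move=> gi; apply: cintg_char => //; mdot.
transitivity (cint mu (fun y => cint mu (fun xi => f y * (nu xi * ec (dotmx y xi))))).
  by congr cint; apply/funext => y; rewrite cintZ//; exact: mc.
rewrite (cfubini (F := fun y xi => f y * (nu xi * ec (dotmx y xi))))//.
- congr cint; apply/funext => xi; rewrite invfourierE mulrC -cintZ; last exact: mc.
  by congr cint; apply/funext => y; rewrite dotmxC; ring.
- move=> x; under eq_integral do rewrite normcM normcM normc_ec mulr1.
  by apply: nnZr_lty => //; cm.
- move=> y; under eq_integral do rewrite normcM normcM normc_ec mulr1 mulrC.
  by apply: nnZr_lty => //; cm.
- under eq_integral => x _.
    under eq_integral do rewrite normcM normcM normc_ec mulr1.
    rewrite nnZr//; last by cm.
    rewrite N1E// muleC.
    over.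
  rewrite nnZ//; [by rewrite N1E// -EFinM ltry|exact: N1_ge0|by cm].
Qed.

(** The inverse transform of [nu] need not be integrable, so [fourier_conv] does not apply; duality
    against the reflected translate of [k] is used instead. *)
Lemma conv_invfourier k nu x : nice k -> cintg mu nu ->
  convol k (invfourier nu) x = invfourier (fun xi => fourier k xi * nu xi) x.
Proof.
move=> [mk _ ki] vi; rewrite /convol.
have ki' : cintg mu (fun y => k (x - y)) by exact: cintg_subl.
rewrite (invfourier_duality ki' vi) invfourierE.
congr cint; apply/funext => xi; rewrite mulrAC; congr (_ * _).
rewrite invfourierE fourierE -cintZr; last first.
  by apply: cintg_char => //; mdot.
rewrite -(cint_subl x (f := fun y => k y * ec (- dotmx y xi) * ec (dotmx x xi))); last first.
  under eq_fun do rewrite mulrC; apply: cintgZ.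
  by apply: cintg_char => //; mdot.
congr cint; apply/funext => y; rewrite -mulrA -ecD; congr (_ * ec _).
by rewrite dotmxBl (dotmxC y) opprB subrK.
Qed.

Lemma invfourier_conv g f x : cintg mu g -> nice f ->
  convol (invfourier g) f x = invfourier (fun xi => g xi * fourier f xi) x.
Proof.
move=> gi [mf [B fB] fi].
have cc : convol (invfourier g) f x = convol f (invfourier g) x.
  have [mg gl] := gi.
  have ci : cintg mu (fun y => f (x - y) * invfourier g y).
    under eq_fun do rewrite mulrC; apply: (cintgMb (B := N1 g)).
    - exact: cintg_subl.
    - exact/cscont_cmeas/cscont_invfourier.
    - by move=> y; exact: normc_invfourier.
  rewrite /convol -(cint_subl x ci); congr cint; apply/funext => y.
  by rewrite subKr mulrC.
rewrite cc conv_invfourier//; first by congr invfourier; apply/funext => xi; rewrite mulrC.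
by split => //; exists B.
Qed.

End fourier_conv.

(** * Poisson kernels on the line and their products *)

Section poisson_line.
Context {R : realType}.
Local Notation leb := (@lebesgue_measure R).
Variables (eps : R).
Hypothesis eps0 : 0 < eps.

(** The cosine is increased by 1 to make the integrand nonnegative, so that the fundamental theorem
    of calculus applies on a half line; [cint_pexp] subtracts [int_pexp] again. *)
Let expcos (a t : R) : R := expR (- eps * t) * (1 + cos (a * t)).
Let prim (a t : R) : R := expR (- eps * t) *
  (- eps^-1 + (a * sin (a * t) - eps * cos (a * t)) / (eps ^+ 2 + a ^+ 2)).

Let den_gt0 (a : R) : 0 < eps ^+ 2 + a ^+ 2.
Proof. by rewrite ltr_wpDr ?sqr_ge0// exprn_gt0. Qed.

Let prim_derive (a t : R) : is_derive t (1 : R) (prim a) (expcos a t).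
Proof.
have d1 : is_derive t (1 : R) (fun t : R => - eps * t) (- eps).
  by apply: is_derive_eq; rewrite [LHS]mulr1.
have d2 : is_derive t (1 : R) (fun t : R => a * t) a.
  by apply: is_derive_eq; rewrite [LHS]mulr1.
rewrite /prim /expcos.
apply: is_derive_eq.
rewrite /GRing.scale /=.
have : eps ^+ 2 + a ^+ 2 != 0 by rewrite gt_eqF.
have : eps != 0 by rewrite gt_eqF.
by move=> h1 h2; field; apply/andP.
Qed.

Let prim_cvg (a : R) : prim a t @[t --> +oo] --> (0 : R).
Proof.
pose C := eps^-1 + (`|a| + eps) / (eps ^+ 2 + a ^+ 2).
have dp := den_gt0 a.
have e0 : (expR (- eps * t) * C) @[t --> +oo] --> (0 : R).
  rewrite -[X in _ --> X](mul0r C); apply: cvgM; last exact: cvg_cst.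
  rewrite (_ : (fun t => _) = (fun x => expR (- x)) \o (fun t => eps * t)).
    apply: cvg_comp; last exact: cvgr_expR.
    by apply: gt0_cvgMry => //; exact: cvg_id.
  by apply/funext => t /=; rewrite mulNr.
apply/cvgrPdist_le => e ep; have /cvgrPdist_le/(_ _ ep) := e0.
apply: filterS => t; rewrite !sub0r !normrN => /(le_trans _); apply.
rewrite /prim !normrM ler_wpM2l// (le_trans (ler_normD _ _))//.
have C0 : 0 <= C.
  rewrite addr_ge0 ?invr_ge0 ?(ltW eps0)// divr_ge0 ?(ltW dp)//.
  by rewrite addr_ge0// ltW.
rewrite (ger0_norm C0) normrN gtr0_norm ?invr_gt0// lerD2l normrM.
rewrite [X in _ * X]gtr0_norm ?invr_gt0// ler_wpM2r ?invr_ge0 ?(ltW dp)//.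
rewrite (le_trans (ler_normB _ _))// !normrM lerD// -[leRHS]mulr1.
  by rewrite ler_wpM2l// ler_norml sin_geN1 sin_le1.
by rewrite (gtr0_norm eps0) ler_wpM2l ?(ltW eps0)// ler_norml cos_geN1 cos_le1.
Qed.

Let expcos_half (a : R) : (\int[leb]_(t in `[0%R, +oo[) (expcos a t)%:E =
   (eps^-1 + eps / (eps ^+ 2 + a ^+ 2))%:E)%E.
Proof.
have cp t : {for t, continuous (prim a)}.
  by apply: differentiable_continuous; apply/derivable1_diffP; have [] := prim_derive a t.
rewrite (@ge0_continuous_FTC2y R (expcos a) (prim a) 0 0).
- rewrite -EFinB; congr EFin.
  by rewrite /prim !mulr0 expR0 sin0 cos0; ring.
- by move=> t _; rewrite mulr_ge0 ?expR_ge0// -lerBlDl sub0r cos_geN1.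
- apply: continuous_subspaceT => t; apply: cvgM.
    apply: continuous_comp; last exact: continuous_expR.
    by apply: cvgM; [exact: cvg_cst|exact: cvg_id].
  apply: cvgD; first exact: cvg_cst.
  apply: continuous_comp; last exact: continuous_cos.
  by apply: cvgM; [exact: cvg_cst|exact: cvg_id].
- exact: prim_cvg.
- by move=> t _; have [] := prim_derive a t.
- by apply: cvg_at_right_filter; exact: cp.
- by move=> t _; rewrite derive1E; have [_ ->] := prim_derive a t.
Qed.

Definition pexp (t : R) := expR (- eps * `|t|).

Lemma pexp_ge0 t : 0 <= pexp t. Proof. exact: expR_ge0. Qed.

Lemma pexp_le1 t : pexp t <= 1.
Proof. by rewrite -expR0 ler_expR mulNr oppr_le0 mulr_ge0// ltW. Qed.

Lemma measurable_pexp : mfunT pexp.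
Proof. by rewrite /pexp; mfun. Qed.

Let int_pexp_1cos (a : R) : (\int[leb]_t (pexp t * (1 + cos (a * t)))%:E =
   (2 * (eps^-1 + eps / (eps ^+ 2 + a ^+ 2)))%:E)%E.
Proof.
rewrite ge0_symfun_integralT/=.
- rewrite -set_itvcy.
  rewrite EFinM -expcos_half; congr (_ * _)%E.
  apply: eq_integral => t; rewrite inE/= in_itv/= andbT => t0.
  by rewrite /pexp ger0_norm.
- by move=> t; rewrite mulr_ge0 ?pexp_ge0// -lerBlDl sub0r cos_geN1.
- move=> t; apply: cvgM.
    apply: continuous_comp; last exact: continuous_expR.
    by apply: cvgM; [exact: cvg_cst|apply: norm_continuous].
  apply: cvgD; first exact: cvg_cst.
  apply: continuous_comp; last exact: continuous_cos.
  by apply: cvgM; [exact: cvg_cst|exact: cvg_id].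
- by move=> t /=; rewrite /pexp normrN mulrN cosN.
Qed.

Lemma int_pexp : (\int[leb]_t (pexp t)%:E = (2 / eps)%:E)%E.
Proof.
have := int_pexp_1cos 0.
under eq_integral do rewrite mul0r cos0 mulrC.
rewrite nnZr//; [|exact: measurable_pexp|exact: pexp_ge0].
rewrite expr0n addr0 => E.
have -> : (\int[leb]_t (pexp t)%:E = 2^-1%:E * ((1 + 1)%:E * \int[leb]_t (pexp t)%:E))%E.
  by rewrite muleA -EFinM -[1 + 1]/(2%:R) mulVf// mul1e.
rewrite E -EFinM; congr EFin; have : eps != 0 by rewrite gt_eqF.
by move=> h; field.
Qed.

(** The Poisson kernel of the line, the transform of [pexp]. *)
Definition pker (x : R) := 2 * eps / (eps ^+ 2 + (2 * pi * x) ^+ 2).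

Lemma pker_ge0 x : 0 <= pker x.
Proof. by rewrite /pker divr_ge0 ?mulr_ge0 ?(ltW eps0)// ltW. Qed.

Lemma measurable_pker : mfunT pker.
Proof. by rewrite /pker; mfun. Qed.

Let cintg_pexpM (g : R -> R[i]) : cmeas g -> (forall t, normc (g t) <= 1) ->
  cintg leb (fun t => (pexp t)%:C%C * g t).
Proof.
move=> mg g1; apply: (@cintg_le _ _ _ leb _ pexp).
- by have mp := measurable_pexp; cm.
- by move=> t; rewrite normcM normc_rc ger0_norm ?pexp_ge0// ler_piMr ?pexp_ge0.
- by rewrite int_pexp ltry.
Qed.

Lemma cint_pexp (x : R) : cint leb (fun t => (pexp t)%:C%C * ec (x * t)) = (pker x)%:C%C.
Proof.
have mp := measurable_pexp; pose a := 2 * pi * x.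
have cI (h : R -> R) : mfunT h -> (forall t, `|h t| <= 1) -> cintg leb (fun t => (pexp t * h t)%:C%C).
  move=> mh h1; rewrite (_ : (fun t => _) = fun t => (pexp t)%:C%C * (h t)%:C%C).
    by apply: cintg_pexpM; [cm|move=> t; rewrite normc_rc].
  by apply/funext => t; rewrite rmorphM.
have c1 : cintg leb (fun t => (pexp t * cos (a * t))%:C%C).
  by apply: cI => [|t]; [mfun|rewrite ler_norml cos_geN1 cos_le1].
have c2 : cintg leb (fun t => (pexp t * sin (a * t))%:C%C).
  by apply: cI => [|t]; [mfun|rewrite ler_norml sin_geN1 sin_le1].
have c0 : cintg leb (fun t => (pexp t)%:C%C).
  rewrite (_ : (fun t => _) = fun t => (pexp t * 1)%:C%C).
    by apply: (cI (fun=> 1)) => [|t]; [mfun|rewrite normr1].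
  by apply/funext => t; rewrite mulr1.
have rI (h : R -> R) (v : R) : (\int[leb]_t (h t)%:E = v%:E)%E ->
    cint leb (fun t => (h t)%:C%C) = v%:C%C.
  by move=> E; rewrite /cint /Rintegral /= E integral0.
have E1 : cint leb (fun t => (pexp t * cos (a * t))%:C%C) = (pker x)%:C%C.
  have := rI _ _ (int_pexp_1cos a).
  under eq_fun do rewrite mulrDr mulr1 rmorphD.
  rewrite cintD// (rI _ _ int_pexp) => E.
  rewrite -[LHS](addKr (2 / eps)%:C%C) E -rmorphN -rmorphD.
  congr (_%:C%C); rewrite /pker -/a; have := den_gt0 a.
  by move=> d0; field; rewrite !gt_eqF.
have E2 : cint leb (fun t => (pexp t * sin (a * t))%:C%C) = 0.
  have := cint1_opp c2.
  rewrite (_ : (fun t => _) = fun t => (-1) * (pexp t * sin (a * t))%:C%C); last first.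
    by apply/funext => t; rewrite mulN1r -rmorphN mulrN sinN mulrN /pexp normrN.
  rewrite cintZ// mulN1r => /eqP; rewrite eq_sym -subr_eq0 opprK -mulr2n mulrn_eq0/=.
  by move/eqP.
transitivity (cint leb (fun t => (pexp t * cos (a * t))%:C%C) +
   Complex 0 1 * cint leb (fun t => (pexp t * sin (a * t))%:C%C)).
  rewrite -cintZ// -cintD//; last exact: cintgZ.
  congr cint; apply/funext => t; rewrite /ec /cexpi -/a mulrA.
  by apply/eqP; rewrite eq_complex /=; apply/andP; split; apply/eqP; ring.
by rewrite E1 E2 mulr0 addr0.
Qed.

(** After a dilation this is the integral of [1 / (1 + x^2)] over the line, which equals [pi]. *)
Lemma int_pker : (\int[leb]_x (pker x)%:E = 1)%E.
Proof.
have o0 (x : R) : 0 <= (oneDsqr x)^-1.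
  by rewrite invr_ge0 (le_trans _ (oneDsqr_ge1 _)).
have sym : (\int[leb]_x ((@oneDsqr R x)^-1)%:E = pi%:E)%E.
  rewrite ge0_symfun_integralT.
  - by rewrite -set_itvcy integral0y_oneDsqr -EFinM mulrC divfK.
  - exact: o0.
  - exact: continuous_oneDsqrV.
  - by move=> x /=; rewrite /oneDsqr sqrrN.
have p0 : 0 < (2 * pi / eps : R) by rewrite divr_gt0 ?mulr_gt0 ?pi_gt0.
have c0 : (2 * pi / eps : R) != 0 by rewrite gt_eqF.
have m1 : mfunT (fun x : R => ((@oneDsqr R x)^-1)%:E).
  by rewrite /oneDsqr; mfun.
have := int1_affine 0 c0 m1; rewrite sym => E.
rewrite (_ : (fun x => (pker x)%:E) = fun x => ((2 / eps) * (oneDsqr ((2 * pi / eps) * x + 0))^-1)%:E).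
  rewrite nnZr.
  - rewrite E; last by move=> x; rewrite lee_fin.
    rewrite -!EFinM gtr0_norm//; congr EFin.
    have p1 : (pi : R) != 0 by rewrite gt_eqF ?pi_gt0.
    have e1 : eps != 0 by rewrite gt_eqF.
    transitivity ((eps / eps) * (2 * pi / (2 * pi))); last by rewrite !divff ?mulf_neq0 ?mulr1.
    by rewrite invf_div; ring.
  - by rewrite divr_ge0// ltW.
  - by rewrite /oneDsqr; mfun.
  - by move=> x; exact: o0.
apply/funext => x; congr EFin; rewrite addr0 /pker /oneDsqr.
have := den_gt0 (2 * pi * x) => d0; have : eps != 0 by rewrite gt_eqF.
by move=> e0; field; rewrite e0/= gt_eqF.
Qed.

End poisson_line.

Section cint_prod.
Context {R : realType}.
Local Notation leb := (@lebesgue_measure R).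
Local Notation mu n := (@lebesgue_rV R n).

Let Rint_cons n (f : 'rV[R]_n.+1 -> R) : (mu n.+1).-integrable setT (fun x => (f x)%:E) ->
  (forall a, (mu n).-integrable setT (fun v => (f (rV_cons (a, v)))%:E)) ->
  \int[mu n.+1]_x f x = \int[leb]_a (\int[mu n]_v f (rV_cons (a, v))).
Proof.
move=> fi fa; rewrite /Rintegral; congr fine.
have mf := measurable_int _ fi.
have mc := @measurable_rV_cons R n.
have fi' : (leb \x mu n)%E.-integrable setT ((fun x => (f x)%:E) \o @rV_cons R n).
  apply/integrableP; split; first exact: (measurableT_comp mf).
  move/integrableP : fi => [_].
  rewrite (_ : (mu n.+1 : set _ -> _) = pushforward (leb \x mu n)%E (@rV_cons R n))//.
  rewrite ge0_integral_pushforward//.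
  exact: measurableT_comp.
rewrite (_ : (mu n.+1 : set _ -> _) = pushforward (leb \x mu n)%E (@rV_cons R n))//.
have := @integral_pushforward _ _ _ _ R (@rV_cons R n) mc (leb \x mu n)%E setT
  (fun x => (f x)%:E) mf; rewrite preimage_setT => /(_ fi' measurableT) E.
etransitivity; first exact: E.
rewrite -(@integral12_prod_meas1 _ _ _ _ R leb (mu n) _ fi').
by apply: eq_integral => a _; rewrite fineK//; exact: integrable_fin_num.
Qed.

Let cint_cons n (f : 'rV[R]_n.+1 -> R[i]) : cintg (mu n.+1) f ->
  (forall a, cintg (mu n) (fun v => f (rV_cons (a, v)))) ->
  cint (mu n.+1) f = cint leb (fun a => cint (mu n) (fun v => f (rV_cons (a, v)))).
Proof.
move=> /cintg_ReIm[f1 f2] fa; rewrite /cint /=; congr Complex; apply: Rint_cons => // a.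
  by have [] := cintg_ReIm (fa a).
by have [] := cintg_ReIm (fa a).
Qed.

Lemma cmeas_prod n (G : 'I_n -> R -> R[i]) : (forall i, cmeas (G i)) ->
  cmeas (fun x : 'rV[R]_n => \prod_(i < n) G i (x ord0 i)).
Proof.
move=> mG; have H (s : seq 'I_n) : cmeas (fun x : 'rV[R]_n => \prod_(i <- s) G i (x ord0 i)).
  elim: s => [|i s IH].
    by under eq_fun do rewrite big_nil; exact: cmeas_cst.
  under eq_fun do rewrite big_cons; apply: cmeasM => //.
  by apply: (cmeas_comp (mG i)); mfun.
exact: H.
Qed.

Lemma normc_prod I (s : seq I) (F : I -> R[i]) :
  normc (\prod_(i <- s) F i) = \prod_(i <- s) normc (F i).
Proof.
elim: s => [|i s IH]; first by rewrite !big_nil normc1.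
by rewrite !big_cons normcM IH.
Qed.

Lemma cintg_prod n (g : R -> R) (G : 'I_n -> R -> R[i]) : mfunT g -> (\int[leb]_t (g t)%:E < +oo)%E ->
  (forall i, cmeas (G i)) -> (forall i t, normc (G i t) = g t) ->
  cintg (mu n) (fun x => \prod_(i < n) G i (x ord0 i)).
Proof.
move=> mg gi mG Gg; split; first exact: cmeas_prod.
case: n G mG Gg => [|n] G mG Gg.
  rewrite int_rV0; last by apply/measurable_EFinP/measurable_normc; exact: cmeas_prod.
  exact: ltry.
have g0 t : 0 <= g t by rewrite -(Gg ord0).
under eq_integral do rewrite normc_prod; under eq_integral do under eq_bigr do rewrite Gg.
by rewrite int_prod// ltry.
Qed.

(** One common modulus [g] for all factors reduces the integrability of every partial product to
    [int_prod], and the induction peels off one coordinate at a time. *)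
Lemma cint_prod n (g : R -> R) (G : 'I_n -> R -> R[i]) : mfunT g -> (\int[leb]_t (g t)%:E < +oo)%E ->
  (forall i, cmeas (G i)) -> (forall i t, normc (G i t) = g t) ->
  cint (mu n) (fun x => \prod_(i < n) G i (x ord0 i)) = \prod_(i < n) cint leb (G i).
Proof.
move=> mg gi; elim: n G => [|n IH] G mG Gg.
  rewrite big_ord0 /cint /Rintegral !int_rV0 /=; first by rewrite !big_ord0.
  - by apply/measurable_EFinP; under eq_fun do rewrite big_ord0; exact: measurable_cst.
  - by apply/measurable_EFinP; under eq_fun do rewrite big_ord0; exact: measurable_cst.
have Gi i : cintg leb (G i).
  by split; [exact: mG|under eq_integral do rewrite Gg].
have E a v : \prod_(i < n.+1) G i (rV_cons (a, v) ord0 i) =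
    G ord0 a * \prod_(i < n) G (lift ord0 i) (v ord0 i).
  by rewrite big_ord_recl rV_consE0; under eq_bigr do rewrite rV_consES.
have ip := cintg_prod mg gi (fun i => mG (lift ord0 i)) (fun i t => Gg (lift ord0 i) t).
rewrite cint_cons; first last.
- by move=> a; under eq_fun do rewrite E; exact: cintgZ.
- exact: (cintg_prod mg gi).
under eq_fun do under eq_fun do rewrite E.
under eq_fun do rewrite cintZ//.
rewrite cintZr// (IH (fun i => G (lift ord0 i)))//.
by rewrite big_ord_recl.
Qed.

End cint_prod.

(** * Plancherel's inequalities and Fourier inversion *)

Section plancherel.
Context {R : realType} {n : nat}.
Local Notation V := 'rV[R]_n.
Local Notation mu := (@lebesgue_rV R n).
Implicit Types (f g nu : V -> R[i]) (x y xi : V) (eps : R).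

(** Products of one-dimensional exponentials serve as the damping factor: their transforms [pkern]
    are explicit, nonnegative and of integral 1. *)
Definition pwin eps xi : R := \prod_(i < n) pexp eps (xi ord0 i).
Definition pkern eps x : R := \prod_(i < n) pker eps (x ord0 i).

Lemma pwin_ge0 eps xi : 0 <= pwin eps xi.
Proof. by apply: prodr_ge0 => i _; exact: pexp_ge0. Qed.

Lemma pwin_le1 eps xi : 0 < eps -> pwin eps xi <= 1.
Proof.
move=> e0; rewrite (le_via (\prod_(i < n) (1 : R)))//; last by rewrite big1.
by apply: ler_prod => i _; rewrite pexp_ge0 pexp_le1.
Qed.

Lemma pkern_ge0 eps x : 0 < eps -> 0 <= pkern eps x.
Proof. by move=> e0; apply: prodr_ge0 => i _; exact: pker_ge0. Qed.

Lemma measurable_pwin eps : mfunT (pwin eps).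
Proof. by rewrite /pwin; have := measurable_pexp eps => mp; mfun. Qed.

Lemma measurable_pkern eps : mfunT (pkern eps).
Proof. by rewrite /pkern; have := measurable_pker eps => mp; mfun. Qed.

Lemma int_pkern eps : 0 < eps -> (\int[mu]_x (pkern eps x)%:E = 1)%E.
Proof.
move=> e0; rewrite int_prod ?int_pker ?expr1n//; first exact: measurable_pker.
  by move=> x; exact: pker_ge0.
exact: ltry.
Qed.

Lemma cintg_pwin eps : 0 < eps -> cintg mu (fun x => (pwin eps x)%:C%C).
Proof.
move=> e0; split; first by apply: cmeas_rc; exact: measurable_pwin.
under eq_integral do rewrite normc_rc ger0_norm ?pwin_ge0//.
rewrite int_prod ?int_pexp ?ltry//; first exact: measurable_pexp.
by move=> x; exact: pexp_ge0.
Qed.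

Lemma invfourier_pwin eps x : 0 < eps ->
  invfourier (fun xi => (pwin eps xi)%:C%C) x = (pkern eps x)%:C%C.
Proof.
move=> e0; rewrite invfourierE /pkern rmorph_prod.
have := @cint_prod R n (pexp eps) (fun i t => (pexp eps t)%:C%C * ec (x ord0 i * t))
  (measurable_pexp _).
under [X in _ = X]eq_bigr do rewrite cint_pexp//.
move=> <-; last 3 first.
- by rewrite int_pexp// ltry.
- move=> i; apply: cmeasM; first by apply: cmeas_rc; exact: measurable_pexp.
  by apply: cmeas_ec; mfun.
- by move=> i t; rewrite normcM normc_ec mulr1 normc_rc ger0_norm// pexp_ge0.
congr cint; apply/funext => xi; rewrite big_split /= rmorph_prod; congr (_ * _).
rewrite /dotmx; elim: (index_enum _) => [|i s IH]; first by rewrite !big_nil ec0.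
by rewrite !big_cons ecD IH.
Qed.

Lemma int_sqr_lty f : nice f -> (\int[mu]_x (normc (f x) ^+ 2)%:E < +oo)%E.
Proof.
move=> [mf [B fB] [_ fi]].
apply: (le_lt_via (\int[mu]_x (`|B| * normc (f x))%:E)%E).
  apply: nn_le => x; rewrite lee_fin ?sqr_ge0// expr2 ler_wpM2r//.
  by rewrite (le_trans (fB x))// ler_norm.
by apply: nnZr_lty => //; cm.
Qed.

Lemma nice_fourier f : nice f -> cintg mu (fourier f) -> nice (fourier f).
Proof.
move=> [_ _ fi] Fi; split => //; first by case: Fi.
by exists (N1 f) => x; exact: normc_fourier.
Qed.

Lemma cintg_pwinM eps f (B : R) : 0 < eps -> cmeas f -> (forall x, normc (f x) <= B) ->
  cintg mu (fun x => (pwin eps x)%:C%C * f x).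
Proof.
move=> e0 mf fB; under eq_fun do rewrite mulrC.
by apply: (cintgMb (B := B)) => //; exact: cintg_pwin.
Qed.

Lemma conv_pkern eps f x : 0 < eps -> nice f ->
  invfourier (fun xi => (pwin eps xi)%:C%C * fourier f xi) x = convol (fun y => (pkern eps y)%:C%C) f x.
Proof.
move=> e0 nf; rewrite -invfourier_conv//; last exact: cintg_pwin.
rewrite (_ : (fun y => (pkern eps y)%:C%C) = invfourier (fun xi => (pwin eps xi)%:C%C))//.
by apply/funext => y; rewrite invfourier_pwin.
Qed.

Lemma conj_fourier f xi : cintg mu f -> conjc (fourier f xi) = invfourier (fun x => conjc (f x)) xi.
Proof.
move=> fi; rewrite fourierE invfourierE.
have cc g : cintg mu g -> conjc (cint mu g) = cint mu (fun x => conjc (g x)).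
  move=> /cintg_ReIm[g1 g2]; rewrite /cint /=; congr Complex.
    by congr Rintegral; apply/funext => x; case: (g x).
  transitivity (\int[mu]_x ((-1) * Im (g x))).
    by rewrite RintegralZl// mulN1r.
  by congr Rintegral; apply/funext => x; rewrite mulN1r; case: (g x).
rewrite cc; last by apply: cintg_char => //; mdot.
congr cint; apply/funext => x.
have -> : ec (dotmx xi x) = conjc (ec (- dotmx x xi)) by rewrite -ecN opprK dotmxC.
exact: rmorphM.
Qed.

(** With the damping [pwin], the left side becomes the pairing of [f] with its convolution by the
    kernel [pkern] of mass 1, hence is at most the right side; Fatou removes the damping. *)
Lemma plancherel_le f : nice f ->
  (\int[mu]_xi (normc (fourier f xi) ^+ 2)%:E <= \int[mu]_x (normc (f x) ^+ 2)%:E)%E.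
Proof.
move=> nf; have [mf [B fB] fi] := nf.
have mF : cmeas (fourier f) by exact/cscont_cmeas/cscont_fourier.
pose e k : R := k.+1%:R^-1; have e0 k : 0 < e k by rewrite invr_gt0.
apply: (@fatou_le _ _ _ mu (fun k xi => pwin (e k) xi * normc (fourier f xi) ^+ 2)).
- move=> k; apply: measurable_funM; first exact: measurable_pwin.
  apply: measurable_funX; exact: measurable_normc.
- by move=> k x; rewrite mulr_ge0// ?pwin_ge0// sqr_ge0.
- move=> xi; rewrite -[X in _ --> X]mul1r; apply: cvgM; last exact: cvg_cst.

  have ez : e k @[k --> \oo] --> (0 : R) by exact: cvg_harmonic.
  have H (s : seq 'I_n) : \prod_(i <- s) pexp (e k) (xi ord0 i) @[k --> \oo] --> \prod_(i <- s) (1 : R).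
    elim: s => [|i s IH].
      by rewrite big_nil; under eq_fun do rewrite big_nil; exact: cvg_cst.
    rewrite big_cons; under eq_fun do rewrite big_cons.
    apply: cvgM => //; rewrite -expR0; apply: continuous_cvg; first exact: continuous_expR.
    by rewrite -(mul0r `|xi ord0 i|) -oppr0; apply: cvgM; [exact: cvgN|exact: cvg_cst].
  by have := H (index_enum 'I_n); rewrite big1_eq.
move=> k.
have nui : cintg mu (fun xi => (pwin (e k) xi)%:C%C * fourier f xi).
  by apply: (cintg_pwinM (B := N1 f)) => // x; exact: normc_fourier.
have cfi : cintg mu (fun x => conjc (f x)).
  by split; [cm|under eq_integral do rewrite normc_conj; case: fi].
have E : (\int[mu]_xi (pwin (e k) xi * normc (fourier f xi) ^+ 2)%:E =
   (Re (cint mu (fun y => conjc (f y) * convol (fun y => (pkern (e k) y)%:C%C) f y)))%:E)%E.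
  have -> : (fun y => conjc (f y) * convol (fun y => (pkern (e k) y)%:C%C) f y) =
      fun y => conjc (f y) * invfourier (fun xi => (pwin (e k) xi)%:C%C * fourier f xi) y.
    by apply/funext => y; rewrite conv_pkern.
  rewrite invfourier_duality//.
  have -> : (fun xi => invfourier (fun x => conjc (f x)) xi * ((pwin (e k) xi)%:C%C * fourier f xi)) =
      fun xi => (pwin (e k) xi * normc (fourier f xi) ^+ 2)%:C%C.
    apply/funext => xi; rewrite -conj_fourier//.
    transitivity ((pwin (e k) xi)%:C%C * (fourier f xi * conjc (fourier f xi))).
      by ring.
    by rewrite mulc_conj -rmorphM.
  rewrite /cint /= /Rintegral fineK// ge0_fin_numE; last first.
    by apply: int_ge0 => xi; rewrite mulr_ge0 ?pwin_ge0 ?sqr_ge0.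
  have Fi : cintg mu (fun xi => (pwin (e k) xi)%:C%C * (fourier f xi * conjc (fourier f xi))).
    apply: (cintg_pwinM (B := N1 f * N1 f)) => //.
      by apply: cmeasM => //; exact: cmeas_conj.
    by move=> x; rewrite normcM normc_conj ler_pM// normc_fourier.
  case: Fi => _; congr (_ < _)%E; apply: eq_integral => xi _.
  rewrite mulc_conj -rmorphM normc_rc ger0_norm//.
  by rewrite mulr_ge0 ?pwin_ge0 ?sqr_ge0.
rewrite E.
have ci : cintg mu (fun y => conjc (f y) * convol (fun y => (pkern (e k) y)%:C%C) f y).
  under eq_fun do rewrite mulrC; have [c1 c2] := cfi.
  under eq_fun do rewrite -conv_pkern//.
  apply: (cintgMb (B := N1 (fun xi => (pwin (e k) xi)%:C%C * fourier f xi))) => //.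
    by have /cscont_cmeas := cscont_invfourier nui.
  by move=> x; exact: normc_invfourier.
apply: (le_via (normc (cint mu (fun y => conjc (f y) * convol (fun y => (pkern (e k) y)%:C%C) f y)))%:E).
  by rewrite lee_fin (le_trans (ler_norm _))// Re_le_normc.
apply: (le_trans (le_cint ci)).
have mp := measurable_pkern (e k); have p0 x := pkern_ge0 x (e0 k).
have pc x : cintg mu (fun y => (pkern (e k) (x - y))%:C%C * f y).
  under eq_fun do rewrite mulrC; apply: (cintgMb (B := B)) => //.
  apply: (cintg_subl x (f := fun y => (pkern (e k) y)%:C%C)).
  split; first by cm.
  under eq_integral do rewrite normc_rc ger0_norm//.
  by rewrite int_pkern// ltry.
have m2 : mfunT (fun z : V * V => pkern (e k) (z.1 - z.2)).
  by apply: (measurableT_comp mp); mfun.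
(* Schur's test with [|f x| |f y| <= (|f x|^2 + |f y|^2) / 2]: each half integrates to half the
   square norm because the kernel has mass 1 in either variable. *)
apply: (le_via (\int[mu]_x \int[mu]_y
   (pkern (e k) (x - y) * (normc (f x) ^+ 2 / 2) + pkern (e k) (x - y) * (normc (f y) ^+ 2 / 2))%:E)%E).
  apply: nn_le => // x; rewrite normcM normc_conj EFinM.
  apply: (le_via ((normc (f x))%:E * \int[mu]_y (pkern (e k) (x - y) * normc (f y))%:E)%E).
    rewrite lee_wpmul2l// (le_trans (le_cint (pc x)))//; apply: nn_le => // y.
    by rewrite normcM normc_rc ger0_norm.
  rewrite -nnZr//; last 2 first.
  - by cm; apply: (measurableT_comp mp); mfun.
  - by move=> y; rewrite mulr_ge0.
  apply: nn_le => y; rewrite lee_fin ?mulr_ge0//.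
  rewrite -mulrDr mulrCA ler_wpM2l// -mulrDl ler_pdivlMr//.
  have := sqr_ge0 (normc (f x) - normc (f y)); rewrite sqrrB.
  by move=> h; rewrite mulr_natr; move: h; rewrite addrAC subr_ge0.
under eq_integral => x _.
  rewrite nnD//; last 4 first.
  - by apply: measurable_funM; [apply: (measurableT_comp mp); mfun|mfun].
  - by apply: measurable_funM; [apply: (measurableT_comp mp); mfun|cm].
  - by move=> y; rewrite mulr_ge0// divr_ge0// sqr_ge0.
  - by move=> y; rewrite mulr_ge0// divr_ge0// sqr_ge0.
  over.
have mt (a b : V -> R) : mfunT a -> mfunT b ->
    mfunT (fun z : V * V => (pkern (e k) (z.1 - z.2) * b z.2)%:E) /\
    mfunT (fun z : V * V => (pkern (e k) (z.1 - z.2) * a z.1)%:E).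
  by move=> ma mb; split; apply/measurable_EFinP; apply: measurable_funM => //; mfun.
have mh : mfunT (fun x => normc (f x) ^+ 2 / 2) by cm.
have h0 x : 0 <= normc (f x) ^+ 2 / 2 by rewrite divr_ge0// sqr_ge0.
have [t1 t2] := mt _ _ mh mh.
rewrite ge0_integralD//; last 4 first.
- by move=> x _; apply: int_ge0 => y; rewrite mulr_ge0.
- by apply: measurable_fun_tonelli => // x y; rewrite lee_fin mulr_ge0.
- by move=> x _; apply: int_ge0 => y; rewrite mulr_ge0.
- by apply: measurable_fun_tonelli => // x y; rewrite lee_fin mulr_ge0.
rewrite [X in (_ + X)%E]tonelli//; last by move=> x y; rewrite lee_fin mulr_ge0.
have I1 x : (\int[mu]_y (pkern (e k) (x - y) * (normc (f x) ^+ 2 / 2))%:E =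
    (normc (f x) ^+ 2 / 2)%:E)%E.
  under eq_integral do rewrite mulrC.
  rewrite nnZr//; last by apply: (measurableT_comp mp); mfun.
  rewrite (int_subl x (f := fun y => (pkern (e k) y)%:E))//; try by mfun.
  by rewrite int_pkern// mule1.
have I2 y : (\int[mu]_x (pkern (e k) (x - y) * (normc (f y) ^+ 2 / 2))%:E =
    (normc (f y) ^+ 2 / 2)%:E)%E.
  under eq_integral do rewrite mulrC.
  rewrite nnZr//; last by apply: (measurableT_comp mp); mfun.
  rewrite (int_shift (- y) (f := fun y => (pkern (e k) y)%:E))//; try by mfun.
  by rewrite int_pkern// mule1.
under eq_integral do rewrite I1.
under [X in (_ + X)%E]eq_integral do rewrite I2.
rewrite -nnD//; apply: nn_le => x; first by rewrite lee_fin addr_ge0.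
by rewrite -splitr.
Qed.

Let e (j : nat) : R := j.+1%:R^-1.
Let e0 j : 0 < e j. Proof. by rewrite invr_gt0. Qed.
Let ez : e j @[j --> \oo] --> (0 : R). Proof. exact: cvg_harmonic. Qed.

Let pwin_cvg xi : pwin (e j) xi @[j --> \oo] --> (1 : R).
Proof.
have H (s : seq 'I_n) : \prod_(i <- s) pexp (e j) (xi ord0 i) @[j --> \oo] --> \prod_(i <- s) (1 : R).
  elim: s => [|i s IH].
    by rewrite big_nil; under eq_fun do rewrite big_nil; exact: cvg_cst.
  rewrite big_cons; under eq_fun do rewrite big_cons.
  apply: cvgM => //; rewrite -expR0; apply: continuous_cvg; first exact: continuous_expR.
  by rewrite -(mul0r `|xi ord0 i|) -oppr0; apply: cvgM; [exact: cvgN|exact: cvg_cst].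
by have := H (index_enum 'I_n); rewrite big1_eq.
Qed.

(** The damped inverse transforms converge in two ways: by domination to the inverse transform of
    [fourier f], and, as means of [f (x - e u)] against [pkern 1], to [f x] by continuity. *)
Lemma fourier_inversion f : nice f -> cscont f -> cintg mu (fourier f) ->
  forall x, invfourier (fourier f) x = f x.
Proof.
move=> nf cf Fi x; have [mf [B fB] fi] := nf; have [mF _] := Fi.
apply: (@ccvg_unique _ (fun j => convol (fun y => (pkern (e j) y)%:C%C) f x)).
  have -> : (fun j => convol (fun y => (pkern (e j) y)%:C%C) f x) =
     fun j => invfourier (fun xi => (pwin (e j) xi)%:C%C * fourier f xi) x.
    by apply/funext => j; rewrite conv_pkern.
  apply: (@cint_dct _ _ _ mu (fun j xi => (pwin (e j) xi)%:C%C * fourier f xi * ec (dotmx x xi))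
     _ (fun xi => normc (fourier f xi))).
  - move=> j; have mp := measurable_pwin (e j); apply: cmeasM; first by cm.
    by apply/cmeas_ec/measurable_dotmx; mfun.
  - by apply: cmeasM => //; apply/cmeas_ec/measurable_dotmx; mfun.
  - move=> xi; apply: ccvgM; last exact: ccvg_cst.
    rewrite -[X in ccvg _ X]mul1r; apply: ccvgM; last exact: ccvg_cst.
    by split; [exact: pwin_cvg|exact: cvg_cst].
  - move=> j xi; rewrite !normcM normc_ec mulr1 normc_rc ger0_norm ?pwin_ge0//.
    by rewrite ler_piMl// pwin_le1.
  - by cm.
  - by case: Fi.
have mp1 := measurable_pkern (1 : R).
have p10 y := @pkern_ge0 1 y ltr01.
have i1 : cintg mu (fun u => (pkern 1 u)%:C%C : R[i]).
  split; first by cm.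
  under eq_integral do rewrite normc_rc ger0_norm//.
  by rewrite int_pkern// ltry.
have E j : convol (fun y => (pkern (e j) y)%:C%C) f x =
    cint mu (fun u => (pkern 1 u)%:C%C * f (x - e j *: u)).
  have mpj := measurable_pkern (e j).
  have pj : cintg mu (fun y => (pkern (e j) y)%:C%C).
    split; first by cm.
    under eq_integral do rewrite normc_rc ger0_norm ?pkern_ge0//.
    by rewrite int_pkern// ltry.
  have ci : cintg mu (fun y => (pkern (e j) y)%:C%C * f (x - y)).
    under eq_fun do rewrite mulrC; apply: (cintgMb (B := B)) => //.
    by apply: (cmeas_comp mf); mfun.
  transitivity (cint mu (fun y => (pkern (e j) y)%:C%C * f (x - y))).
    rewrite /convol -(cint_subl x ci); congr cint; apply/funext => y.
    by rewrite subKr.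
  have ej0 : e j != 0 by rewrite gt_eqF.
  have := cint_affine 0 ej0 ci.
  set I := (X in _ = _ * X) => EI.
  transitivity ((`|e j| ^+ n)%:C%C * ((`|e j|^-1 ^+ n)%:C%C * I)).
    by rewrite mulrA -rmorphM -exprMn mulfV ?normr_eq0// expr1n mul1r.
  rewrite -EI -cintZ; last exact: (cintg_affine 0 ej0 ci).
  congr cint; apply/funext => u; rewrite addr0 mulrA -rmorphM; congr (_%:C%C * _).
  rewrite /pkern gtr0_norm// -[X in _ ^+ X](card_ord n) -prodr_const -big_split /=.
  apply: eq_bigr => i _; rewrite mxE /pker.
  have d1 : 1 ^+ 2 + (2 * pi * u ord0 i) ^+ 2 != 0.
    by rewrite gt_eqF// expr1n ltr_wpDr// sqr_ge0.
  rewrite (_ : e j ^+ 2 + _ = e j ^+ 2 * (1 ^+ 2 + (2 * pi * u ord0 i) ^+ 2)); last by ring.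
  by move: d1; set D := 1 ^+ 2 + _ => d1; field; rewrite d1 ej0.
have -> : (fun j => convol (fun y => (pkern (e j) y)%:C%C) f x) =
    fun j => cint mu (fun u => (pkern 1 u)%:C%C * f (x - e j *: u)) by apply/funext.
have -> : f x = cint mu (fun u => (pkern 1 u)%:C%C * f x).
  rewrite cintZr// (_ : cint _ _ = 1) ?mul1r//.
  by rewrite /cint /Rintegral /= int_pkern// integral0.
apply: (@cint_dct _ _ _ mu (fun j u => (pkern 1 u)%:C%C * f (x - e j *: u)) _ (fun u => B * pkern 1 u)).
- move=> j; apply: cmeasM; first by cm.
  by apply: (cmeas_comp mf); mfun.
- by cm.
- move=> u; apply: ccvgM; first exact: ccvg_cst.
  apply: (cscontP f).1 => // i.
  rewrite -[X in _ --> X]subr0; under eq_fun do rewrite !mxE.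
  apply: cvgB; first exact: cvg_cst.
  by rewrite -(mul0r (u ord0 i)); apply: cvgM => //; exact: cvg_cst.
- by move=> j u; rewrite normcM normc_rc ger0_norm// mulrC ler_wpM2r.
- by mfun.
- rewrite nnZr ?int_pkern ?mule1 ?ltry//.
  exact: le_trans (normc_ge0 _) (fB 0).
Qed.

(** The transform is a product of two square integrable functions; this makes inversion available
    for convolutions without any smoothness. *)
Lemma cintg_fourier_conv (k : V -> R[i]) f : nice k -> nice f -> cintg mu (fourier (convol k f)).
Proof.
move=> nk nf; have [_ _ ki] := nk; have [_ _ fi] := nf; have [_ _ ui] := nice_conv nk nf.
apply: (@cintg_le _ _ _ mu _ (fun xi => normc (fourier k xi) ^+ 2 + normc (fourier f xi) ^+ 2)).
- exact/cscont_cmeas/cscont_fourier.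
- move=> xi; rewrite fourier_conv// normcM -subr_ge0.
  set s := normc _; set t := normc _.
  have := sqr_ge0 (s - t); have : 0 <= s ^+ 2 + t ^+ 2 by rewrite addr_ge0// sqr_ge0.
  by rewrite sqrrB; lra.
have mFk : cmeas (fourier k) by exact/cscont_cmeas/cscont_fourier.
have mFf : cmeas (fourier f) by exact/cscont_cmeas/cscont_fourier.
apply: nnD_lty; try by cm.
- by move=> xi; exact: sqr_ge0.
- by move=> xi; exact: sqr_ge0.
- by apply: le_lt_trans (plancherel_le nk) _; exact: int_sqr_lty.
- by apply: le_lt_trans (plancherel_le nf) _; exact: int_sqr_lty.
Qed.

Lemma invfourier_L2 nu : nice nu ->
  (\int[mu]_x (normc (invfourier nu x) ^+ 2)%:E <= \int[mu]_x (normc (nu x) ^+ 2)%:E)%E.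
Proof.
move=> nn; apply: le_trans (plancherel_le nn); have [_ _ ni] := nn.
have -> : (fun x => (normc (invfourier nu x) ^+ 2)%:E) =
   fun x => (fun x => (normc (fourier nu x) ^+ 2)%:E) (0 - x).
  by apply/funext => x; rewrite sub0r -invfourier_fourier.
rewrite (int_subl 0 (f := fun x => (normc (fourier nu x) ^+ 2)%:E))//;
  last by move=> x; rewrite lee_fin sqr_ge0.
have : cmeas (fourier nu) by exact/cscont_cmeas/cscont_fourier.
by move=> h; apply/measurable_EFinP/measurable_funX/measurable_normc.
Qed.

(** Inversion turns the upper bound for the inverse transform into the reverse inequality. *)
Lemma plancherel_ge f : nice f -> cscont f -> cintg mu (fourier f) ->
  (\int[mu]_x (normc (f x) ^+ 2)%:E <= \int[mu]_x (normc (fourier f x) ^+ 2)%:E)%E.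
Proof.
move=> nf cf Fi; apply: le_trans (invfourier_L2 (nice_fourier nf Fi)).
by under [leRHS]eq_integral do rewrite fourier_inversion//.
Qed.

Lemma convol_L2 (k : V -> R[i]) f (a : R) : nice k -> cscont k -> nice f ->
  (forall xi, normc (fourier k xi) <= a) -> (\int[mu]_x (normc (convol k f x) ^+ 2)%:E <=
   (a ^+ 2)%:E * \int[mu]_x (normc (f x) ^+ 2)%:E)%E.
Proof.
move=> nk ck nf ka; have [mk [B kB] ki] := nk; have [mf _ fi] := nf.
have a0 : 0 <= a by exact: le_trans (normc_ge0 _) (ka 0).
have cu : cscont (convol k f) by exact: cscont_convol kB fi.
have mFf : cmeas (fourier f) by exact/cscont_cmeas/cscont_fourier.
apply: le_trans (plancherel_ge (nice_conv nk nf) cu (cintg_fourier_conv nk nf)) _.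
apply: (le_via (\int[mu]_x (a ^+ 2 * normc (fourier f x) ^+ 2)%:E)%E).
  apply: nn_le => xi; rewrite lee_fin ?sqr_ge0// fourier_conv// normcM exprMn.
  by rewrite ler_wpM2r ?sqr_ge0// ler_sqr ?nnegrE.
rewrite nnZr ?sqr_ge0//; last 2 first.
- by cm.
- by move=> x; exact: sqr_ge0.
by rewrite lee_wpmul2l ?lee_fin ?sqr_ge0//; exact: plancherel_le.
Qed.

End plancherel.

(** * Layer-cake integrals *)

Section layer_cake.
Context {R : realType}.
Local Notation leb := (@lebesgue_measure R).

(** For positive [a] and nonnegative [X] this is [X^a / a]; two one-sided bounds with unequal
    constants are all that is established, and they suffice for the norm estimates. *)
Definition layer (a X : R) : \bar R := (\int[leb]_t (t `^ (a - 1) * (0 < t < X)%R%:R)%:E)%E.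

Let int_powR (a e X : R) : 0 < a -> 0 < e -> e < X ->
  (\int[leb]_(t in `[e, X]) (t `^ (a - 1))%:E = ((X `^ a - e `^ a) / a)%:E)%E.
Proof.
move=> a0 e0 eX; have X0 : 0 < X by exact: lt_trans eX.
have d (t : R) : 0 < t -> is_derive t (1 : R) (fun t => t `^ a / a) (t `^ (a - 1)).
  move=> t0; have h := is_derive1_powR a t0.
  apply: is_derive_eq; rewrite scaler0 add0r /GRing.scale /=.
  by rewrite mulrA mulVf ?gt_eqF// mul1r.
have c (b t : R) : 0 < t -> {for t, continuous (fun t => t `^ b)}.
  move=> t0; apply: differentiable_continuous; apply/derivable1_diffP.
  by have [] := is_derive1_powR b t0.
have cF (t : R) : 0 < t -> {for t, continuous (fun t => t `^ a / a)}.
  by move=> t0; apply: cvgM; [exact: c|exact: cvg_cst].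
rewrite (@continuous_FTC2 R (fun t => t `^ (a - 1)) (fun t => t `^ a / a) e X)//.
- by rewrite -EFinB mulrBl.
- apply: continuous_in_subspaceT => t; rewrite inE/= in_itv/= => /andP[et _].
  by apply: c; exact: lt_le_trans et.
- split.
  + by move=> t; rewrite in_itv/= => /andP[et _]; have [] := d t (lt_trans e0 et).
  + by apply: cvg_at_right_filter; exact: cF.
  + by apply: cvg_at_left_filter; exact: cF.
- move=> t; rewrite in_itv/= => /andP[et _].
  by rewrite derive1E; have [_ ->] := d t (lt_trans e0 et).
Qed.

Lemma layer_le a X : 0 < a -> 0 <= X -> (layer a X <= (X `^ a / a)%:E)%E.
Proof.
move=> a0 X0; pose e k : R := k.+1%:R^-1; have e0 k : 0 < e k by rewrite invr_gt0.
apply: (@fatou_le _ _ _ leb (fun k t => t `^ (a - 1) * (e k <= t <= X)%R%:R * (t < X)%R%:R)).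
- by move=> k; mfun.
- by move=> k t; rewrite !mulr_ge0// powR_ge0.
- move=> t; have [t0|t0] := ltP 0 t; last first.
    rewrite mulr0; apply: cvg_near_cst; apply: nearW => k.
    by rewrite leNgt (le_lt_trans t0 (e0 k))/= mulr0 mul0r.
  have [tX|tX] := ltP t X; last first.
    by rewrite mulr0; apply: cvg_near_cst; apply: nearW => k; rewrite mulr0.
  have ez : e j @[j --> \oo] --> (0 : R) by exact: cvg_harmonic.
  apply: cvg_near_cst; near=> k; rewrite mulr1 (ltW tX) andbT.
  suff -> : e k <= t by [].
  by near: k; exact: (cvgr_le _ ez).
move=> k; have [eX|eX] := ltP (e k) X; last first.
  rewrite integral0_eq ?lee_fin ?divr_ge0 ?powR_ge0 ?(ltW a0)// => t _.
  case: ltP => tX; last by rewrite mulr0.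
  by rewrite leNgt (lt_le_trans tX eX)/= mulr0 mul0r.
apply: (le_via (\int[leb]_(t in `[e k, X]) (t `^ (a - 1))%:E)%E).
  rewrite [leRHS]integral_mkcond; apply: nn_le => t.
    by rewrite lee_fin !mulr_ge0// powR_ge0.
  rewrite patchE mem_setE in_itv/=; case: ifP => _; last by rewrite mulr0 mul0r.
  by rewrite lee_fin mulr1; case: ltP => _; rewrite ?mulr1// mulr0 powR_ge0.
rewrite int_powR// lee_fin ler_pM2r ?invr_gt0// gerBl powR_ge0//.
Unshelve. all: by end_near. Qed.

(** Only the part over [[X/2, X]] is kept, away from the singularity at 0; hence the factor
    [1 - 2^-a]. *)
Lemma layer_ge a X : 0 < a -> 0 <= X -> (((1 - 2^-1 `^ a) / a * X `^ a)%:E <= layer a X)%E.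
Proof.
move=> a0; rewrite le_eqVlt => /predU1P[<-|X0].
  rewrite powR0 ?gt_eqF// mulr0; apply: integral_ge0 => t _.
  by rewrite lee_fin mulr_ge0// powR_ge0.
have hX : X / 2 < X by rewrite ltr_pdivrMr// ltr_pMr// ltr1n.
have h0 : 0 < X / 2 by rewrite divr_gt0.
have -> : ((1 - 2^-1 `^ a) / a * X `^ a)%:E = (\int[leb]_(t in `[(X / 2)%R, X%R]) (t `^ (a - 1))%:E)%E.
  rewrite int_powR// powRM ?invr_ge0// ?(ltW X0)//; congr EFin.
  by field; rewrite gt_eqF.
rewrite -integral_itv_bndo_bndc; last first.
  by apply/measurable_EFinP; apply: measurable_funTS; mfun.
rewrite integral_mkcond; apply: nn_le => t.
  by rewrite patchE; case: ifP => _ //; rewrite lee_fin powR_ge0.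
rewrite patchE mem_setE in_itv/=; case: ifPn => [/andP[h1 h2]|_].
  by rewrite (lt_le_trans h0 h1) h2/= mulr1.
by rewrite lee_fin mulr_ge0// powR_ge0.
Qed.

Lemma layer_tonelli d (T : measurableType d) (m : {sigma_finite_measure set T -> \bar R})
    (a : R) (c g : T -> R) : mfunT c -> mfunT g -> (forall x, 0 <= c x) ->
  (\int[m]_x \int[leb]_t (c x * (t `^ a * (0 < t < g x)%R%:R))%:E =
   \int[leb]_t \int[m]_x (c x * (t `^ a * (0 < t < g x)%R%:R))%:E)%E.
Proof.
move=> mc mg c0; pose F (x : T) (t : R) : \bar R := (c x * (t `^ a * (0 < t < g x)%R%:R))%:E.
rewrite (@tonelli _ _ _ _ _ m leb F)//; last first.
  by move=> x t; rewrite lee_fin !mulr_ge0// powR_ge0.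
have m1 := @measurable_fst _ _ T (measurableTypeR R).
have m2 := @measurable_snd _ _ T (measurableTypeR R).
have mc' : mfunT (fun z : T * measurableTypeR R => c z.1).
  exact: measurableT_comp mc m1.
have mg' : mfunT (fun z : T * measurableTypeR R => g z.1).
  exact: measurableT_comp mg m1.
apply/measurable_EFinP/measurable_funM => //; apply: measurable_funM.
  exact: measurable_powRl m2.
apply/measurable_boolr/measurable_and; apply: measurable_fun_ltr => //.
Qed.

Lemma layer_const_gt0 (a : R) : 0 < a -> 0 < (1 - 2^-1 `^ a) / a.
Proof.
move=> a0; rewrite divr_gt0// subr_gt0.
have := @gt0_ltr_powR R a a0 2^-1 1.
by rewrite powR1 => -> //; rewrite ?in_itv/= ?invr_ge0 ?invf_lt1// ?nnegrE ?invr_ge0// ltr1n.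
Qed.

End layer_cake.

(** * Dyadic cells and averages *)

Section dyadic.
Context {R : realType} {n : nat}.
Local Notation V := 'rV[R]_n.
Local Notation mu := (@lebesgue_rV R n).
Implicit Types (w : V -> R) (x y z : V) (j k : int).

Lemma measurable_mem d (T : measurableType d) (A : set T) : measurable A -> mfunT (fun t => t \in A).
Proof.
move=> mA; apply: (@measurable_fun_bool _ _ _ _ true); rewrite setTI.
by apply: measurable_eq mA; apply/seteqP; split => t /= h; [exact: set_mem|exact/mem_set].
Qed.

Definition sc k : R := 2 ^ k.

Lemma sc_gt0 k : 0 < sc k. Proof. by rewrite exprz_gt0. Qed.
Lemma sc_ge0 k : 0 <= sc k. Proof. exact/ltW/sc_gt0. Qed.
Lemma sc_neq0 k : sc k != 0. Proof. by rewrite gt_eqF// sc_gt0. Qed.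
Lemma scD j k : sc (j + k) = sc j * sc k.
Proof. by rewrite /sc expfzDr// pnatr_eq0. Qed.
Lemma scN k : sc (- k) = (sc k)^-1. Proof. by rewrite /sc invr_expz. Qed.
Lemma scNr k : sc (- k) * sc k = 1. Proof. by rewrite scN mulVf ?sc_neq0. Qed.
Lemma sc_nat (m : nat) : sc m = 2 ^+ m. Proof. by []. Qed.
Lemma sc_le j k : (j <= k)%R -> sc j <= sc k.
Proof. by move=> jk; rewrite /sc ler_eXz2l// ltr1n. Qed.
Hint Resolve sc_gt0 sc_ge0 : core.

(** Lying in the same half-open dyadic cube of side [sc (- k)]; a larger [k] means finer cubes. *)
Definition same k x y := [forall i, Num.floor (sc k * x ord0 i) == Num.floor (sc k * y ord0 i)].

Lemma sameP k x y : reflect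
  (forall i, Num.floor (sc k * x ord0 i) = Num.floor (sc k * y ord0 i)) (same k x y).
Proof. by apply: (iffP forallP) => h i; apply/eqP; exact: h. Qed.

Lemma same_sym k x y : same k x y = same k y x.
Proof. by apply/sameP/sameP => h i; rewrite h. Qed.
Lemma same_trans k y x z : same k x y -> same k y z -> same k x z.
Proof. by move=> /sameP h1 /sameP h2; apply/sameP => i; rewrite h1 h2. Qed.

Lemma same_eql k x y z : same k x y -> same k x z = same k y z.
Proof.
move=> xy; apply/idP/idP; last exact: same_trans.
by apply: same_trans; rewrite same_sym.
Qed.

(** The endpoints of the coarser intervals belong to the finer grid, so the finer floor decides in
    which coarser interval a point lies. *)
Lemma floor_coarse j k (a b : R) : (j <= k)%R -> Num.floor (sc k * a) = Num.floor (sc k * b) ->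
  Num.floor (sc j * a) = Num.floor (sc j * b).
Proof.
move=> jk; have [m ->] : exists m : nat, k = j + m%:Z.
  by exists `|k - j|%N; rewrite gez0_abs ?subr_ge0// subrKC.
rewrite scD sc_nat => E; apply: floor_def.
set u := Num.floor (sc j * b); have /andP[u1 u2] := floor_itv (sc j * b).
have m0 : (0 : R) < 2 ^+ m by rewrite exprn_gt0.
have e1 : (u * 2 ^+ m)%:~R <= sc j * 2 ^+ m * b.
  by rewrite intrM rmorphXn/= mulrAC ler_pM2r.
have e2 : sc j * 2 ^+ m * b < ((u + 1) * 2 ^+ m)%:~R.
  by rewrite intrM rmorphXn/= mulrAC ltr_pM2r.
have f1 : u * 2 ^+ m <= Num.floor (sc j * 2 ^+ m * a) by rewrite E floor_ge_int.
have f2 : Num.floor (sc j * 2 ^+ m * a) < (u + 1) * 2 ^+ m by rewrite E floor_lt_int.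
move: f1 f2; rewrite floor_ge_int floor_lt_int !intrM !rmorphXn/= mulrAC ler_pM2r// ltr_pM2r//.
by move=> -> ->.
Qed.

Lemma same_coarse j k x y : (j <= k)%R -> same k x y -> same j x y.
Proof. by move=> jk /sameP h; apply/sameP => i; exact: floor_coarse jk (h i). Qed.

Lemma same_dist k x y : same k x y -> `|x - y| < sc (- k).
Proof.
move=> /sameP h; apply/norm_ltP => // i; rewrite !mxE scN.
have := floor_itv (sc k * x ord0 i); rewrite h; set u := Num.floor _ => /andP[h1 h2].
have /andP[h3 h4] := floor_itv (sc k * y ord0 i).
rewrite -(ltr_pM2l (sc_gt0 k)) mulfV ?sc_neq0// -[X in X * _](gtr0_norm (sc_gt0 k)).
rewrite -normrM mulrBr ltr_norml; move: h2 h3 h4; rewrite -/u intrD => h2 h3 h4.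
by apply/andP; split; lra.
Qed.

Lemma measurable_floor_eq d (T : measurableType d) (a b : T -> R) : mfunT a -> mfunT b ->
  mfunT (fun t => Num.floor (a t) == Num.floor (b t)).
Proof.
move=> ma mb.
have mf : mfunT (fun r : R => (Num.floor r)%:~R : R).
  apply: nondecreasing_measurable => // x y xy; rewrite ler_int; exact: le_floor.
rewrite (_ : (fun t => _) = fun t => ((Num.floor (a t))%:~R == (Num.floor (b t))%:~R :> R)).
  by apply: measurable_fun_eqr; [exact: (measurableT_comp mf ma)|exact: (measurableT_comp mf mb)].
by apply/funext => t; rewrite eqr_int.
Qed.

Lemma measurable_all d (T : measurableType d) (I : finType) (b : I -> T -> bool) :
  (forall i, mfunT (b i)) -> mfunT (fun t => [forall i, b i t]).
Proof.
move=> mb; have H (s : seq I) : mfunT (fun t => all (fun i => b i t) s).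
  elim: s => [|i s IH] /=; first exact: measurable_cst.
  exact: measurable_and.
rewrite (_ : (fun t => _) = fun t => all (fun i => b i t) (enum I)); first exact: H.
apply/funext => t; apply/forallP/allP => [h i _|h i]; first exact: h.
by apply: h; rewrite mem_enum.
Qed.

Lemma measurable_same d (T : measurableType d) k (a b : T -> V) : mfunT a -> mfunT b ->
  mfunT (fun t => same k (a t) (b t)).
Proof. by move=> ma mb; apply: measurable_all => i; apply: measurable_floor_eq; mfun. Qed.

Lemma int_same k x : (\int[mu]_y (same k x y)%:R%:E = ((sc (- k)) ^+ n)%:E)%E.
Proof.
pose A (i : 'I_n) : set (measurableTypeR R) := [set` `[(Num.floor (sc k * x ord0 i))%:~R / sc k,
     (Num.floor (sc k * x ord0 i) + 1)%:~R / sc k[].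
have mA i : measurable (A i) by exact: measurable_itv.
rewrite (_ : (fun y => _) = fun y => (\1_[set y : V | forall i, A i (y ord0 i)] y)%:E).
  rewrite integral_indic//=; last exact: measurable_rV_box.
  rewrite setIT lebesgue_rV_box//.
  under eq_bigr => i _.
    rewrite /A lebesgue_measure_itv/= lte_fin ltr_pM2r ?invr_gt0// ltr_int ltrDl ltr01.
    rewrite -EFinB -mulrBl intrD addrC addKr mul1r -scN.
    over.
  by rewrite /= prodEFin prodr_const card_ord.
apply/funext => y; rewrite indicE; congr ((nat_of_bool _)%:R%:E); apply/idP/idP => [/sameP h|].
  rewrite inE => i; rewrite /A/= in_itv/= ler_pdivrMr// ltr_pdivlMr// (mulrC (y ord0 i)) h.
  exact: floor_itv.
rewrite inE => h; apply/sameP => i; have := h i; rewrite /A/= in_itv/= ler_pdivrMr// ltr_pdivlMr// (mulrC (y ord0 i)).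
by move=> /floor_def <-.
Qed.

Definition cavg k w x : \bar R := ((sc k ^+ n)%:E * \int[mu]_y (w y * (same k x y)%:R)%:E)%E.

(** The normalisation is that of a cube of side [sc (- k)], so this is [2^n] times the true mean
    over the ball; [cavg_le_bavg] then holds without a constant. *)
Definition bavg k w x : \bar R := ((sc k ^+ n)%:E * \int[mu]_y (w y * (`|y - x| < sc (- k))%R%:R)%:E)%E.

Lemma scn_ge0 k : 0 <= sc k ^+ n. Proof. by rewrite exprn_ge0. Qed.
Hint Resolve scn_ge0 : core.

Lemma scn_inv k : sc k ^+ n * sc (- k) ^+ n = 1.
Proof. by rewrite -exprMn mulrC scNr expr1n. Qed.

Lemma measurable_cavg k w : mfunT w -> (forall y, 0 <= w y) -> mfunT (cavg k w).
Proof.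
move=> mw w0; rewrite /cavg; apply: emeasurable_funM; first exact: measurable_cst.
apply: (@measurable_fun_tonelli _ _ _ _ _ mu (fun x y => (w y * (same k x y)%:R)%:E)).
  apply/measurable_EFinP/measurable_funM; first by mfun.
  by apply/measurable_boolr/measurable_same; mfun.
by move=> x y; rewrite lee_fin mulr_ge0.
Qed.

Lemma measurable_bavg k w : mfunT w -> (forall y, 0 <= w y) -> mfunT (bavg k w).
Proof.
move=> mw w0; rewrite /bavg; apply: emeasurable_funM; first exact: measurable_cst.
apply: (@measurable_fun_tonelli _ _ _ _ _ mu (fun x y => (w y * (`|y - x| < sc (- k))%R%:R)%:E)).
  by mfun.
by move=> x y; rewrite lee_fin mulr_ge0.
Qed.

Lemma cavg_same k w x y : same k x y -> cavg k w x = cavg k w y.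
Proof.
by move=> xy; congr (_ * _)%E; apply: eq_integral => z _; rewrite (same_eql z xy).
Qed.

Lemma cavg_ge0 k w x : (forall y, 0 <= w y) -> (0 <= cavg k w x)%E.
Proof.
by move=> w0; rewrite mule_ge0// integral_ge0// => y _; rewrite lee_fin mulr_ge0.
Qed.

Lemma bavg_ge0 k w x : (forall y, 0 <= w y) -> (0 <= bavg k w x)%E.
Proof.
by move=> w0; rewrite mule_ge0// integral_ge0// => y _; rewrite lee_fin mulr_ge0.
Qed.

Lemma cavg_le_bavg k w x : (forall y, 0 <= w y) -> (cavg k w x <= bavg k w x)%E.
Proof.
move=> w0; rewrite lee_wpmul2l//; apply: nn_le => y; first by rewrite lee_fin mulr_ge0.
rewrite lee_fin ler_wpM2l// ler_nat; case h: (same k x y) => //=.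
by rewrite distrC (same_dist h).
Qed.

Lemma bavg_le_cst k w x (B : R) : mfunT w -> (forall y, 0 <= w y <= B) ->
  (bavg k w x <= (2 ^+ n * B)%:E)%E.
Proof.
move=> mw wB; have B0 : 0 <= B by have /andP[h1 h2] := wB 0; exact: le_trans h2.
apply: (le_via ((sc k ^+ n)%:E * \int[mu]_y (B * (`|y - x| < sc (- k))%R%:R)%:E)%E).
  rewrite lee_wpmul2l//; apply: nn_le => y; first by have /andP[h _] := wB y; rewrite lee_fin mulr_ge0.
  by rewrite lee_fin ler_wpM2r//; have /andP[] := wB y.
rewrite nnZr//; last by mfun.
rewrite int_ball// -!EFinM lee_fin exprMn mulrCA (mulrC (sc k ^+ n)) -!mulrA.
by rewrite (mulrC (sc _ ^+ n)) scn_inv mulr1 mulrC.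
Qed.

(** Tonelli: averaging over cells is symmetric, and it fixes the indicator of a union of cells. *)
Lemma cavg_saturated k w (A : V -> bool) : mfunT w -> (forall y, 0 <= w y) ->
  mfunT A -> (forall x y, same k x y -> A x = A y) ->
  (\int[mu]_x ((A x)%:R%:E * cavg k w x) = \int[mu]_y ((A y)%:R * w y)%:E)%E.
Proof.
move=> mw w0 mA sA.
transitivity (\int[mu]_x \int[mu]_y (sc k ^+ n * ((A x)%:R * (w y * (same k x y)%:R)))%:E)%E.
  apply: eq_integral => x _; rewrite /cavg muleCA -nnZr//; last 2 first.
  - by apply: measurable_funM => //; apply/measurable_boolr/measurable_same; mfun.
  - by move=> y; rewrite mulr_ge0.
  rewrite -nnZr//.
  - apply: measurable_funM; first by mfun.
    by apply: measurable_funM => //; apply/measurable_boolr/measurable_same; mfun.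
  - by move=> y; rewrite !mulr_ge0.
rewrite tonelli.
- apply: eq_integral => y _.
  rewrite (_ : (fun x => _) = fun x => ((sc k ^+ n * ((A y)%:R * w y)) * (same k y x)%:R)%:E).
    rewrite nnZr//.
    + by rewrite int_same -EFinM mulrAC scn_inv mul1r.
    + by rewrite !mulr_ge0.
    + by apply/measurable_boolr/measurable_same; mfun.
  apply/funext => x; congr EFin; rewrite (same_sym k y x).
  by case h: (same k x y); rewrite ?mulr0// !mulr1 (sA _ _ h).
- apply/measurable_EFinP; apply: measurable_funM; first by mfun.
  apply: measurable_funM; first by apply: measurable_boolr; apply: (measurableT_comp mA); mfun.
  apply: measurable_funM; first by mfun.
  by apply/measurable_boolr/measurable_same; mfun.
- by move=> x y; rewrite lee_fin !mulr_ge0.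
Qed.

Lemma cavg_parent k w x : (forall y, 0 <= w y) -> (cavg k w x <= (2 ^+ n)%:E * cavg (k - 1) w x)%E.
Proof.
move=> w0; rewrite muleA -EFinM -exprMn -[X in X * sc _]/(sc 1) -scD addrC subrK.
rewrite lee_wpmul2l//; apply: nn_le => y; first by rewrite lee_fin mulr_ge0.
rewrite lee_fin ler_wpM2l// ler_nat; case h: (same k x y) => //=.
by rewrite (@same_coarse (k - 1) k)// gerBl.
Qed.

End dyadic.
#[global] Hint Extern 0 (is_true (@Order.lt _ _ _ (sc _))) => exact: sc_gt0 : core.
#[global] Hint Extern 0 (is_true (@Order.le _ _ _ (sc _))) => exact: sc_ge0 : core.

Lemma ler_term (R : realDomainType) (I : finType) (a : I -> R) v :
  (forall i, 0 <= a i) -> a v <= \sum_i a i.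
Proof. by move=> a0; rewrite (bigD1 v)//= lerDl sumr_ge0. Qed.

(** * The maximal function *)

Section maximal.
Context {R : realType} {n : nat}.
Local Notation V := 'rV[R]_n.
Local Notation mu := (@lebesgue_rV R n).
Implicit Types (w : V -> R) (x y z : V) (j k : int).

Section stopping.
Variables (w : V -> R) (lam : R) (k0 : int).
Hypotheses (mw : mfunT w) (w0 : forall y, 0 <= w y) (lam0 : 0 < lam).
Hypothesis H0 : forall k x, (k <= k0)%R -> (cavg k w x <= lam%:E)%E.

(** The points whose averages, counted from generation [k0], first exceed [lam] at step [m]. Each
    set is a union of cells, and together they play the part of the maximal Calderon-Zygmund
    cubes. *)
Definition stopping (m : nat) : set V := [set x | (lam%:E < cavg (k0 + m%:Z) w x)%E /\
    forall j : nat, (j < m)%N -> (cavg (k0 + j%:Z) w x <= lam%:E)%E].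

Lemma stoppingE : \bigcup_m stopping m = [set x | exists k, (lam%:E < cavg k w x)%E].
Proof.
apply/seteqP; split => x /= [].
  by move=> m _ [h _]; exists (k0 + m%:Z).
move=> k hk.
have kk : (k0 <= k)%R.
  by rewrite leNgt; apply/negP => /ltW/(H0 x); rewrite leNgt hk.
have [m0 Em] : exists m : nat, k = k0 + m%:Z.
  by exists `|k - k0|%N; rewrite gez0_abs ?subr_ge0// subrKC.
have ex : exists m : nat, (lam%:E < cavg (k0 + m%:Z) w x)%E by exists m0; rewrite -Em.
exists (ex_minn ex) => //; case: ex_minnP => m h hm; split=> // j jm.
by rewrite leNgt; apply/negP => /hm; rewrite leqNgt jm.
Qed.

Lemma stopping_same m x y : same (k0 + m%:Z) x y -> stopping m x -> stopping m y.
Proof.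
move=> xy [h1 h2]; split; first by rewrite -(cavg_same w xy).
move=> j jm; rewrite -(@cavg_same _ _ (k0 + j%:Z) w x y) ?h2//.
by apply: same_coarse xy; rewrite lerD2l lez_nat ltnW.
Qed.

Lemma trivIset_stopping : trivIset setT stopping.
Proof.
apply/trivIsetP => i j _ _; rewrite neq_ltn => /orP[ij|ij]; apply/seteqP; split => // x.
  by move=> [[h _] [_ /(_ _ ij)]]; rewrite leNgt h.
by move=> [[_ /(_ _ ij) h'] [h _]]; move: h'; rewrite leNgt h.
Qed.

Lemma measurable_stopping m : measurable (stopping m).
Proof.
have ml k : measurable [set x : V | (lam%:E < cavg k w x)%E].
  rewrite -[X in measurable X]setTI.
  apply: emeasurable_fun_o_infty => //; exact: measurable_cavg.
have mg k : measurable [set x : V | (cavg k w x <= lam%:E)%E].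
  rewrite -[X in measurable X]setTI.
  apply: emeasurable_fun_infty_c => //; exact: measurable_cavg.
rewrite (_ : stopping m = [set x | (lam%:E < cavg (k0 + m%:Z) w x)%E] `&`
   \bigcap_(j in `I_m) [set x | (cavg (k0 + j%:Z) w x <= lam%:E)%E]); last first.
  by apply/seteqP; split => x [].
by apply: measurableI => //; apply: bigcap_measurableType.
Qed.

(** The averages exceed [lam] on this set, and since it is a union of cells the integral of the
    averages over it is that of [w]. *)
Lemma stopping_int m : (lam%:E * mu (stopping m) <= \int[mu]_(x in stopping m) (w x)%:E)%E.
Proof.
have mS := measurable_stopping m.
rewrite -integral_cst// (_ : (\int[mu]_(x in stopping m) (w x)%:E)%E =
   (\int[mu]_x ((x \in stopping m)%:R * w x)%:E)%E); last first.
  rewrite integral_mkcond; apply: eq_integral => x _.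
  by rewrite patchE; case: ifP => _; rewrite ?mul1r ?mul0r.
rewrite -(@cavg_saturated _ _ (k0 + m%:Z))//.
- rewrite integral_mkcond; apply: nn_le => x.
    by rewrite patchE; case: ifP => _ //; rewrite lee_fin ltW.
  rewrite patchE; case: ifPn; last by rewrite mul0e.
  by rewrite inE => -[h _]; rewrite mul1e ltW.
- exact: measurable_mem.
- move=> x y xy; apply/idP/idP; rewrite !inE; first exact: stopping_same.
  by apply: stopping_same; rewrite same_sym.
Qed.

Lemma mu_stopping : (mu (\bigcup_m stopping m) = \sum_(0 <= m <oo) mu (stopping m))%E.
Proof.
rewrite measure_bigcup//=; first by apply: eq_eseriesl => m; rewrite in_setT.
- by move=> m _; exact: measurable_stopping.
- exact: trivIset_stopping.
Qed.

Lemma weak_dyadic : (lam%:E * mu (\bigcup_m stopping m) <= \int[mu]_x (w x)%:E)%E.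
Proof.
rewrite mu_stopping -nneseriesZl//.
apply: (le_via (\sum_(0 <= m <oo) \int[mu]_(x in stopping m) (w x)%:E)%E).
  by apply: lee_nneseries => m _ //; [rewrite mule_ge0// lee_fin ltW|exact: stopping_int].
rewrite -ge0_integral_bigcup//.
- rewrite integral_mkcond; apply: nn_le => x; rewrite patchE; case: ifP => _ //.
- exact: measurable_stopping.
- by apply/measurable_EFinP; apply: measurable_funTS.
- exact: trivIset_stopping.
Qed.

End stopping.

Lemma mu_shift (A : set V) h : measurable A -> mu [set x | A (x + h)] = mu A.
Proof.
move=> mA; have mA' : measurable [set x | A (x + h)].
  have : mfunT (fun x : V => x + h) by mfun.
  by move=> /(_ measurableT _ mA); rewrite setTI.
rewrite -[in LHS](setIT [set x | A (x + h)]) -[in RHS](setIT A) -!integral_indic//.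
rewrite -[RHS](int_shift h (f := fun x => (\1_A x)%:E))//.
exact/measurable_EFinP.
Qed.

Definition nbr (v : {ffun 'I_n -> 'I_3}) : V := \row_i ((v i)%:R - 1).

Let floor_near (a b c : R) : 0 < c -> c * `|a - b| <= 1 ->
  exists u : 'I_3, Num.floor (c * a) = Num.floor (c * b + (u%:R - 1)).
Proof.
move=> c0 h; set fa := Num.floor (c * a); set fb := Num.floor (c * b).
have /andP[a1 a2] := floor_itv (c * a); have /andP[b1 b2] := floor_itv (c * b).
have h' : `|c * a - c * b| <= 1 by rewrite -mulrBr normrM gtr0_norm.
move: h'; rewrite ler_norml => /andP[h1 h2].
rewrite -/fa -/fb in a1 a2 b1 b2; rewrite !intrD in a2 b2.
have d1 : fa <= fb + 1.
  by rewrite -ltzD1 -(ltr_int R) !intrD; lra.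
have d2 : fb <= fa + 1.
  by rewrite -ltzD1 -(ltr_int R) !intrD; lra.
have F (z : int) : Num.floor (c * b + z%:~R) = fb + z.
  by rewrite floorDrz ?intr_int// intrKfloor.
have [e|[e|e]] : fa = fb - 1 \/ fa = fb \/ fa = fb + 1.
  by move: d1 d2; clear; lia.
- by exists 0; rewrite (_ : _ - 1 = (-1)%:~R) ?F// sub0r mulrN1z.
- by exists 1; rewrite (_ : _ - 1 = 0%:~R) ?F ?addr0// subrr.
- by exists (inord 2); rewrite inordK// (_ : _ - 1 = 1%:~R) ?F// mulr1z; lra.
Qed.

(** At a distance of at most one side, the floors of each coordinate differ by at most 1. *)
Lemma nbr_same k x y : sc k * `|x - y| <= 1 -> exists v, same k x (y + sc (- k) *: nbr v).
Proof.
move=> h.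
have H i : exists u : 'I_3, Num.floor (sc k * x ord0 i) = Num.floor (sc k * y ord0 i + (u%:R - 1)).
  apply: floor_near => //; apply: le_trans h; rewrite ler_wpM2l//.
  by have := coor_le_norm (x - y) i; rewrite !mxE.
have [v hv] := choice H.
exists [ffun i => v i]; apply/sameP => i; rewrite hv !mxE ffunE mulrDr mulrA.
by rewrite (mulrC (sc k) (sc (- k))) scNr mul1r.
Qed.

Hypothesis n_gt0 : (0 < n)%N.

Lemma sc_small (e : R) : 0 < e -> exists k0, forall k, (k <= k0)%R -> sc k ^+ n <= e.
Proof.
move=> e0; pose m := Num.bound e^-1; exists (- m%:Z) => k km.
have k1 : sc k <= 1 :> R.
  by rewrite -[leRHS](_ : sc 0 = 1)//; apply: sc_le; rewrite (le_trans km)// oppr_le0.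
apply: (le_via (sc k)).
  by rewrite -[leRHS]expr1 ler_wiXn2l.
apply: (le_trans (sc_le km)); rewrite scN sc_nat invf_ple ?posrE ?exprn_gt0//.
have := archi_boundP (ltW (_ : 0 < e^-1)); rewrite invr_gt0 => /(_ e0) /ltW/le_trans; apply.
by rewrite -natrX ler_nat ltnW// ltn_expl.
Qed.

(** An average is at most [2^(kn)] times the total mass, which tends to 0 as [k] decreases because
    [n] is positive. This gives the stopping sets their starting generation. *)
Lemma cavg_small w (lam : R) : mfunT w -> (forall y, 0 <= w y) ->
  0 < lam -> (\int[mu]_x (w x)%:E < +oo)%E ->
  exists k0, forall k x, (k <= k0)%R -> (cavg k w x <= lam%:E)%E.
Proof.
move=> mw w0 l0 wi.
have w0i : (0 <= \int[mu]_x (w x)%:E)%E by apply: int_ge0 => x.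
have wf : (\int[mu]_x (w x)%:E \is a fin_num)%E by rewrite ge0_fin_numE.
set W := fine (\int[mu]_x (w x)%:E)%E.
have W0 : 0 <= W by exact: fine_ge0.
have W1 : 0 < W + 1 by rewrite ltr_wpDl.
have [k0 hk0] := sc_small (divr_gt0 l0 W1); exists k0 => k x /hk0 h.
apply: (le_via ((sc k ^+ n)%:E * W%:E)%E).
  rewrite lee_wpmul2l ?lee_fin ?scn_ge0// fineK//; apply: nn_le => y.
    by rewrite lee_fin mulr_ge0.
  by rewrite lee_fin ler_piMr// lern1 leq_b1.
rewrite -EFinM lee_fin -(@ler_pM2r _ (W + 1)^-1) ?invr_gt0//.
rewrite (le_trans _ h)// -mulrA ler_piMr ?scn_ge0// ler_pdivrMr// mul1r.
by rewrite lerDl.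
Qed.

(* The ball of radius [2 ^ - k] is covered by the neighbours of a dyadic cell; if one
   of them has a large average then [x] is a neighbour of a stopping cell, and
   translations preserve the measure. *)
Lemma weak_ball w (lam : R) : mfunT w -> (forall y, 0 <= w y) ->
  0 < lam -> (\int[mu]_x (w x)%:E < +oo)%E -> (mu [set x | exists k, (lam%:E < bavg k w x)%E] <=
   (#|{ffun 'I_n -> 'I_3}|%:R ^+ 2 / lam)%:E * \int[mu]_x (w x)%:E)%E.
Proof.
move=> mw w0 l0 wi.
set C : R := #|_|%:R; have C0 : 0 < C by rewrite ltr0n card_ffun !card_ord expn_gt0.
have lC0 : 0 < lam / C by rewrite divr_gt0.
have [k0 H0] := cavg_small mw w0 lC0 wi.
pose S := stopping w (lam / C) k0.
have mS m : measurable (S m) by exact: measurable_stopping.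
pose N v m : set V := [set x | S m (x + sc (- (k0 + m%:Z)) *: nbr v)].
have mN v m : measurable (N v m).
  have : mfunT (fun x : V => x + sc (- (k0 + m%:Z)) *: nbr v) by mfun.
  by move=> /(_ measurableT _ (mS m)); rewrite setTI.
have mL : measurable [set x : V | exists k, (lam%:E < bavg k w x)%E].
  rewrite (_ : mkset _ = \bigcup_(k in [set: int]) [set x : V | (lam%:E < bavg k w x)%E]).
    apply: countable_bigcupT_measurable => [|k]; first exact: countableP.
    rewrite -[X in measurable X]setTI.
    by apply: emeasurable_fun_o_infty => //; exact: measurable_bavg.
  by apply/seteqP; split => x /= [k]; [move=> h; exists k|move=> _ h; exists k].
have sub x : (exists k, (lam%:E < bavg k w x)%E) -> exists v m, N v m x.
  move=> [k hk].
  have [v hv] : exists v, ((lam / C)%:E < cavg k w (x + sc (- k) *: nbr v))%E.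
    apply: contrapT => /forallNP h; move: hk; rewrite ltNge => /negP; apply.
    apply: (le_via (\sum_(v : {ffun 'I_n -> 'I_3}) cavg k w (x + sc (- k) *: nbr v))%E).
      rewrite /cavg -ge0_sume_distrr; last first.
        by move=> v _; apply: int_ge0 => y; rewrite mulr_ge0.
      rewrite lee_wpmul2l ?lee_fin ?scn_ge0// -ge0_integral_sum//; last 2 first.
      - move=> v; apply/measurable_EFinP/measurable_funM; first by mfun.
        by apply/measurable_boolr/measurable_same; mfun.
      - by move=> v y _; rewrite lee_fin mulr_ge0.
      apply: nn_le => y; first by rewrite lee_fin mulr_ge0.
      rewrite sumEFin lee_fin -mulr_sumr ler_wpM2l// -natr_sum ler_nat.
      case h2: (_ < _) => //.
      have [v hv] : exists v, same k y (x + sc (- k) *: nbr v).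
        by apply: nbr_same; rewrite -(scNr k) mulrC ler_wpM2r// ltW.
      by rewrite (bigD1 v)//= same_sym hv.
    apply: (le_via (\sum_(v : {ffun 'I_n -> 'I_3}) (lam / C)%:E)%E).
      by apply: lee_sum => v _; rewrite leNgt; apply/negP; exact: h.
    by rewrite sumEFin lee_fin sumr_const -mulr_natr divfK// gt_eqF.
  have [m Sm] : exists m, S m (x + sc (- k) *: nbr v).
    have : (\bigcup_m S m) (x + sc (- k) *: nbr v).
      by rewrite stoppingE//; exists k.
    by move=> [m _ h]; exists m.
  pose j := k0 + m%:Z.
  have jk : (j <= k)%R.
    rewrite leNgt; apply/negP => kj; case: Sm => _.
    have k0k : (k0 <= k)%R by rewrite leNgt; apply/negP => /ltW/(H0 _ (x + sc (- k) *: nbr v)); rewrite leNgt hv.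
    have Ek : k = k0 + `|k - k0|%N%:Z by rewrite gez0_abs ?subr_ge0// subrKC.
    move=> /(_ `|k - k0|%N); rewrite -Ek => h; move: hv; rewrite ltNge h//.
    by rewrite -ltz_nat gez0_abs ?subr_ge0// ltrBlDl.
  have nv : `|nbr v| <= 1.
    apply/norm_leP => // i; rewrite mxE ler_norml.
    have : (v i < 3)%N by [].
    by case: (v i) => -[|[|[|//]]] ? _ /=; apply/andP; split; lra.
  (* The shift by [sc (- k)] is at most one cell of the coarser generation [j], so [x] itself is a
     neighbour, at scale [j], of the stopping cell. *)
  have [v' hv'] : exists v', same j (x + sc (- k) *: nbr v) (x + sc (- j) *: nbr v').
    apply: nbr_same; rewrite addrAC subrr add0r normrZ gtr0_norm// mulrA -scD.
    apply: (le_via (sc (j - k))); first by rewrite ler_piMr.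
    by rewrite -[leRHS](_ : sc 0 = 1)//; apply: sc_le; rewrite subr_le0.
  by exists v', m; exact: stopping_same hv' Sm.
have mU v : measurable (\bigcup_m N v m) by exact: bigcup_measurable.
apply: (le_via (\sum_(v : {ffun 'I_n -> 'I_3}) mu (\bigcup_m N v m))%E).
  rewrite -(setIT [set x | _]) -integral_indic//.
  under [leRHS]eq_bigr => v _ do rewrite -(setIT (\bigcup_m _)) -integral_indic//.
  rewrite -ge0_integral_sum//; last by move=> v; exact/measurable_EFinP.
  apply: nn_le => x; first by rewrite lee_fin.
  rewrite sumEFin lee_fin indicE; case h: (_ \in _); last by rewrite sumr_ge0.
  have [v [m Nx]] : exists v m, N v m x by apply: sub; exact: (set_mem h).
  have Ux : (\bigcup_m N v m) x by exists m.
  have U1 : \1_(\bigcup_m N v m) x = 1 :> R by rewrite indicE (mem_set Ux).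
  rewrite -U1; apply: (ler_term (a := fun v => \1_(\bigcup_m N v m) x)) => i.
  by rewrite indicE ler0n.
have NS v : (mu (\bigcup_m N v m) <= mu (\bigcup_m S m))%E.
  rewrite [leRHS](mu_stopping (lam / C) k0 mw w0).
  apply: (le_via (\sum_(0 <= m <oo) mu (N v m))%E).
    by apply: measure_sigma_subadditive; [exact: mN|exact: mU|].
  apply: lee_nneseries => m _ //; rewrite /N mu_shift//; exact: mS.
apply: (le_via (C%:E * mu (\bigcup_m S m))%E).
  apply: (le_via (\sum_(v : {ffun 'I_n -> 'I_3}) mu (\bigcup_m S m))%E).
    by apply: lee_sum => v _; exact: NS.
  rewrite /C -sum1_card natr_sum -sumEFin ge0_sume_distrl//.
  by apply: lee_sum => v _; rewrite mul1e.
have h := weak_dyadic k0 mw w0 lC0.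
rewrite expr2 -mulrA EFinM -muleA lee_wpmul2l ?lee_fin ?(ltW C0)//.
rewrite -(@lee_pmul2l _ (lam / C)%:E)// ?lte_fin// muleA -EFinM.
by rewrite mulrA divfK ?gt_eqF// divff ?gt_eqF// mul1e.
Qed.

(** Centred maximal function over dyadic radii. It is applied to bounded [w], for which the supremum
    is finite and [fine] loses nothing. *)
Definition Mx w x : R := fine (ereal_sup (range (fun k => bavg k w x))).

Section bounded.
Variables (w : V -> R) (B : R).
Hypotheses (mw : mfunT w) (wB : forall y, 0 <= w y <= B).

Let w0 y : 0 <= w y. Proof. by have /andP[] := wB y. Qed.

Let sup_fin x : (ereal_sup (range (fun k => bavg k w x)) \is a fin_num)%E.
Proof.
have h0 : (0 <= ereal_sup (range (fun k => bavg k w x)))%E.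
  by apply: le_trans (bavg_ge0 0 x w0) _; apply: ereal_sup_ubound; exists 0.
rewrite ge0_fin_numE//; apply: (le_lt_via (2 ^+ n * B)%:E); last exact: ltry.
by apply: ge_ereal_sup => _ [k _ <-]; exact: bavg_le_cst.
Qed.

Lemma MxE x : (Mx w x)%:E = ereal_sup (range (fun k => bavg k w x)).
Proof. by rewrite fineK. Qed.

Lemma bavg_le_Mx k x : (bavg k w x <= (Mx w x)%:E)%E.
Proof. by rewrite MxE; apply: ereal_sup_ubound; exists k. Qed.

Lemma Mx_ge0 x : 0 <= Mx w x.
Proof. by rewrite -lee_fin; apply: le_trans (bavg_ge0 0 x w0) (bavg_le_Mx 0 x). Qed.

Lemma Mx_le x (c : R) : (forall k, (bavg k w x <= c%:E)%E) -> Mx w x <= c.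
Proof. by move=> h; rewrite -lee_fin MxE; apply: ge_ereal_sup => _ [k _ <-]. Qed.

Lemma Mx_bounded x : Mx w x <= 2 ^+ n * B.
Proof. by apply: Mx_le => k; exact: bavg_le_cst. Qed.

Lemma Mx_gtP x (c : R) : c < Mx w x <-> exists k, (c%:E < bavg k w x)%E.
Proof.
split=> [|[k hk]]; last by rewrite -lte_fin (lt_le_trans hk)// bavg_le_Mx.
move=> h; apply: contrapT => /forallNP h'; move: h; rewrite ltNge => /negP; apply.
by apply: Mx_le => k; rewrite leNgt; apply/negP; exact: h'.
Qed.

Lemma measurable_Mx : mfunT (Mx w).
Proof.
apply: (measurability _ (RGenOInfty.measurableE R)) => //.
move=> _ [_ [c ->] <-]; rewrite setTI.
apply: (measurable_eq (B := \bigcup_(k in [set: int]) [set x : V | (c%:E < bavg k w x)%E])).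
  apply/seteqP; split => x /=; rewrite in_itv/= andbT.
    by move=> /Mx_gtP[k hk]; exists k.
  by move=> [k _ hk]; apply/Mx_gtP; exists k.
apply: countable_bigcupT_measurable => [|k]; first exact: countableP.
rewrite -[X in measurable X]setTI.
by apply: emeasurable_fun_o_infty => //; exact: measurable_bavg.
Qed.

Lemma bavg_Mx k x : (\int[mu]_y (w y * (`|y - x| < sc (- k))%R%:R)%:E <= (sc (- k) ^+ n * Mx w x)%:E)%E.
Proof.
have := bavg_le_Mx k x; rewrite /bavg.
rewrite -(@lee_pmul2l _ (sc (- k) ^+ n)%:E)// ?lte_fin ?exprn_gt0// muleA -!EFinM.
by rewrite mulrC scn_inv mul1e.
Qed.

End bounded.

Lemma measure_gt_int (g : V -> R) (c : R) : mfunT g ->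
  (mu [set x | (c < g x)%R] = \int[mu]_x (c < g x)%R%:R%:E)%E.
Proof.
move=> mg; have mA : measurable [set x | c < g x].
  rewrite -[X in measurable X]setTI; apply: (measurable_eq (B := setT `&` g @^-1` `]c, +oo[%classic)).
    by apply/seteqP; split => x /=; rewrite in_itv/= andbT.
  by apply: mg => //; exact: measurable_itv.
rewrite -(setIT [set x | _]) -integral_indic//; apply: eq_integral => x _.
rewrite indicE; congr ((nat_of_bool _)%:R%:E).
by apply/idP/idP => [/set_mem//|h]; exact/mem_set.
Qed.

Lemma bavgD k w1 w2 x : mfunT w1 -> mfunT w2 -> (forall y, 0 <= w1 y) -> (forall y, 0 <= w2 y) ->
  bavg k (fun y => w1 y + w2 y) x = (bavg k w1 x + bavg k w2 x)%E.
Proof.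
move=> m1 m2 p1 p2; rewrite /bavg -ge0_muleDr; last 2 first.
- by apply: int_ge0 => y; rewrite mulr_ge0.
- by apply: int_ge0 => y; rewrite mulr_ge0.
rewrite -nnD; first by congr (_ * _)%E; apply: eq_integral => y _; rewrite mulrDl.
- by mfun.
- by mfun.
- by move=> y; rewrite mulr_ge0.
- by move=> y; rewrite mulr_ge0.
Qed.

(* The part of [w] below [t / 2 ^ n.+1] contributes at most [t / 2] to the averages. *)
Lemma max_strong (v : R) : 1 < v -> exists2 A : R, 0 <= A &
  forall w (B : R), mfunT w -> (forall y, 0 <= w y <= B) ->
  (\int[mu]_x (Mx w x `^ v)%:E <= A%:E * \int[mu]_x (w x `^ v)%:E)%E.
Proof.
move=> v1; have v0 : 0 < v by exact: lt_trans v1.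
have v10 : 0 < v - 1 by rewrite subr_gt0.
pose c0 : R := (1 - 2^-1 `^ v) / v; have c00 : 0 < c0 := layer_const_gt0 v0.
pose C : R := #|{ffun 'I_n -> 'I_3}|%:R; pose D : R := 2 ^+ n.+1.
have C0 : 0 <= C by [].
have D0 : 0 < D by rewrite exprn_gt0.
exists (c0^-1 * (2 * C ^+ 2 * (D `^ (v - 1) / (v - 1)))).
  by rewrite !mulr_ge0 ?invr_ge0 ?powR_ge0 ?exprn_ge0 ?(ltW c00) ?(ltW v10).
move=> w B mw wB; have w0 y : 0 <= w y by have /andP[] := wB y.
have mM : mfunT (Mx w) := measurable_Mx mw wB.
have M0 := Mx_ge0 mw wB.
have wv0 x : 0 <= w x `^ v by exact: powR_ge0.
have Iv0 : (0 <= \int[mu]_x (w x `^ v)%:E)%E by apply: int_ge0 => x.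
rewrite EFinM -muleA -(@lee_pmul2l _ c0%:E)// ?lte_fin// -nnZr//; last 3 first.
- exact: ltW.
- by mfun.
- by move=> x; exact: powR_ge0.
rewrite [leRHS]muleA -EFinM divff ?gt_eqF// mul1e.
have [Ivoo|Ivoo] := ltP (\int[mu]_x (w x `^ v)%:E)%E +oo%E; last first.
  have -> : (\int[mu]_x (w x `^ v)%:E = +oo)%E by apply/eqP; rewrite eq_le Ivoo leey.
  have C1 : 0 < C by rewrite ltr0n card_ffun !card_ord expn_gt0.
  by rewrite gt0_muley ?leey// lte_fin !mulr_gt0 ?invr_gt0 ?powR_gt0 ?exprn_gt0.
have weak (t : R) : 0 < t -> (mu [set x | (t < Mx w x)%R] <=
    (2 * C ^+ 2 / t)%:E * \int[mu]_x (w x * (t / D < w x)%R%:R)%:E)%E.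
  move=> t0; pose w1 x := w x * (w x <= t / D)%R%:R; pose w2 x := w x * (t / D < w x)%R%:R.
  have mw1 : mfunT w1 by rewrite /w1; mfun.
  have mw2 : mfunT w2 by rewrite /w2; mfun.
  have tD : 0 < t / D by rewrite divr_gt0.
  have w10 y : 0 <= w1 y <= t / D.
    by rewrite /w1; case: (leP (w y) (t / D)) => h /=; [rewrite mulr1 w0 h|rewrite mulr0 lexx ltW].
  have w20 y : 0 <= w2 y <= B.
    rewrite /w2; have /andP[h1 h2] := wB y.
    by case: (ltP (t / D) (w y)) => _ /=; [rewrite mulr1 h1 h2|rewrite mulr0 lexx (le_trans h1 h2)].
  have t2 : 0 < t / 2 by rewrite divr_gt0.
  (* Where [t / D < w] one has [w <= (t / D)^(1-v) w^v], so the finiteness of the right side makes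
     [w2] integrable, as the weak type bound requires. *)
  have i2 : (\int[mu]_x (w2 x)%:E < +oo)%E.
    apply: (le_lt_via (\int[mu]_x (((t / D) `^ (v - 1))^-1 * w x `^ v)%:E)%E).
      apply: nn_le => x; first by have /andP[h _] := w20 x; rewrite lee_fin.
      rewrite lee_fin /w2; case: (ltP (t / D) (w x)) => h /=; last by rewrite mulr0 mulr_ge0 ?invr_ge0 ?powR_ge0.
      rewrite mulr1 -ler_pdivrMl ?invr_gt0 ?powR_gt0// invrK mulrC -(mulr_powRB1 (w0 x) v0).
      by rewrite ler_wpM2l// ge0_ler_powR ?nnegrE// ltW.
    by apply: nnZr_lty => //; [rewrite invr_ge0 powR_ge0|mfun].
  have := weak_ball mw2 (fun y => proj1 (andP (w20 y))) t2 i2.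
  rewrite -/C invf_div (_ : C ^+ 2 * (2 / t) = 2 * C ^+ 2 / t); last by rewrite mulrCA mulrA.
  apply: le_trans; apply: le_measure; rewrite ?inE.
  - rewrite -[X in measurable X]setTI; apply: (measurable_eq (B := setT `&` Mx w @^-1` `]t, +oo[%classic)).
      by apply/seteqP; split => x /=; rewrite in_itv/= andbT.
    by apply: mM => //; exact: measurable_itv.
  - apply: (measurable_eq (B := \bigcup_(k in [set: int]) [set x : V | ((t / 2)%:E < bavg k w2 x)%E])).
      by apply/seteqP; split => x /= [k]; [move=> h; exists k|move=> _ h; exists k].
    apply: countable_bigcupT_measurable => [|k]; first exact: countableP.
    rewrite -[X in measurable X]setTI.
    apply: emeasurable_fun_o_infty => //; apply: measurable_bavg => // y.
    by have /andP[] := w20 y.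
  move=> x /=; rewrite (Mx_gtP mw wB) => -[k hk]; exists k; move: hk.
  have -> : w = fun y => w1 y + w2 y.
    by apply/funext => y; rewrite /w1 /w2 -mulrDr; case: (leP (w y) (t / D)) => _ /=; rewrite ?addr0 ?add0r mulr1.
  rewrite bavgD//; [|by move=> y; have /andP[] := w10 y|by move=> y; have /andP[] := w20 y].
  have b1 : (bavg k w1 x <= (t / 2)%:E)%E.
    rewrite (le_trans (bavg_le_cst _ _ mw1 w10))// lee_fin /D exprS le_eqVlt.
    by apply/orP; left; apply/eqP; field; rewrite gt_eqF ?exprn_gt0.
  move=> h; have := lt_le_trans h (leeD2r (bavg k w2 x) b1).
  have [b2e|b2f] := eqVneq (bavg k w2 x) +oo%E; first by move=> _; rewrite b2e ltry.
  have b2fin : (bavg k w2 x \is a fin_num)%E.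
    by rewrite ge0_fin_numE ?lt_neqAle ?b2f ?leey// bavg_ge0// => y; have /andP[] := w20 y.
  by rewrite -(fineK b2fin) -EFinD !lte_fin; lra.
apply: (le_via (\int[mu]_x \int[lebesgue_measure]_t (t `^ (v - 1) * (0 < t < Mx w x)%R%:R)%:E)%E).
  apply: nn_le => x; first by rewrite lee_fin mulr_ge0 ?powR_ge0// ltW.
  exact: layer_ge.
under eq_integral do under eq_integral do rewrite -[X in X%:E]mul1r.
rewrite (layer_tonelli mu (v - 1) (c := fun=> 1))//.
apply: (le_via (\int[lebesgue_measure]_t \int[mu]_x
    (2 * C ^+ 2 * w x * (t `^ ((v - 1) - 1) * (0 < t < D * w x)%R%:R))%:E)%E).
  apply: nn_le => t.
    by apply: int_ge0 => x; rewrite !mulr_ge0 ?powR_ge0.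
  under eq_integral do rewrite mul1r.
  have [t0|t0] := ltP 0 t; last first.
    rewrite integral0_eq ?integral_ge0// => x _; last by rewrite mulr0.
    by rewrite lee_fin !mulr_ge0// ?exprn_ge0// powR_ge0.
  rewrite [leLHS](_ : _ = ((t `^ (v - 1))%:E * \int[mu]_x (t < Mx w x)%R%:R%:E)%E); last first.
    by rewrite -nnZr ?powR_ge0//; mfun.
  rewrite -measure_gt_int//.
  apply: (le_via ((t `^ (v - 1))%:E * ((2 * C ^+ 2 / t)%:E *
      \int[mu]_x (w x * (t / D < w x)%R%:R)%:E))%E).
    by rewrite lee_wpmul2l ?lee_fin ?powR_ge0//; exact: weak.
  rewrite muleA -EFinM -nnZr//; last 3 first.
  - by rewrite !mulr_ge0 ?powR_ge0 ?invr_ge0 ?exprn_ge0 ?(ltW t0).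
  - by mfun.
  - by move=> x; rewrite mulr_ge0.
  apply: nn_le => x; first by rewrite lee_fin !mulr_ge0 ?powR_ge0 ?invr_ge0 ?exprn_ge0 ?(ltW t0).
  rewrite lee_fin ltr_pdivrMr// (mulrC (w x) D) [t `^ (v - 1 - 1)]powRB; last by rewrite (gt_eqF t0) implybT.
  by rewrite powRr1 ?(ltW t0)//; apply: le_of_eq; ring.
rewrite -(layer_tonelli mu (v - 1 - 1) (c := fun x => 2 * C ^+ 2 * w x)); last 3 first.
- by mfun.
- by mfun.
- by move=> x; rewrite !mulr_ge0 ?exprn_ge0.
rewrite -nnZr//; last 2 first.
- by rewrite !mulr_ge0 ?powR_ge0 ?invr_ge0 ?exprn_ge0 ?(ltW v10).
- by mfun.
apply: nn_le => x; first by apply: int_ge0 => t; rewrite !mulr_ge0 ?exprn_ge0 ?powR_ge0.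
rewrite nnZr; last 3 first.
- by rewrite !mulr_ge0 ?exprn_ge0.
- by mfun.
- by move=> t; rewrite mulr_ge0 ?powR_ge0.
apply: (le_via ((2 * C ^+ 2 * w x)%:E * ((D * w x) `^ (v - 1) / (v - 1))%:E)%E).
  rewrite lee_wpmul2l ?lee_fin ?mulr_ge0 ?exprn_ge0//.
  by apply: layer_le => //; rewrite mulr_ge0// ltW.
rewrite -EFinM lee_fin powRM ?(ltW D0)// -(mulr_powRB1 (w0 x) v0).
by apply: le_of_eq; ring.
Qed.

End maximal.

(** * The sharp function inequality *)

Section sharp.
Context {R : realType} {n : nat}.
Local Notation V := 'rV[R]_n.
Local Notation mu := (@lebesgue_rV R n).
Implicit Types (u v w : V -> R) (x y z : V) (j k : int).

Let Scn_ge0 k : 0 <= sc k ^+ n :> R. Proof. exact: scn_ge0. Qed.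
Hint Resolve Scn_ge0 : core.

Lemma cavg_leD k v w x (c : R) : mfunT v -> (forall y, 0 <= w y) ->
  (forall y, 0 <= v y) -> 0 <= c -> (forall y, same k x y -> w y <= v y + c) ->
  (cavg k w x <= cavg k v x + c%:E)%E.
Proof.
move=> mv w0 v0 c0 h; have ms : mfunT (same k x).
  by apply: measurable_same => //; exact: measurable_cst.
apply: (le_via ((sc k ^+ n)%:E * \int[mu]_y (v y * (same k x y)%:R + c * (same k x y)%:R)%:E)%E).
  rewrite lee_wpmul2l//; apply: nn_le => y; first by rewrite lee_fin mulr_ge0.
  rewrite lee_fin -mulrDl; case hs: (same k x y); last by rewrite !mulr0.
  by rewrite !mulr1 h.
rewrite nnD//; last 4 first.
- by apply: measurable_funM => //; exact: measurable_boolr.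
- by apply: measurable_funM => //; exact: measurable_boolr.
- by move=> y; rewrite mulr_ge0.
- by move=> y; rewrite mulr_ge0.
rewrite nnZr//; last exact: measurable_boolr.
rewrite int_same ge0_muleDr; last 2 first.
- by apply: int_ge0 => y; rewrite mulr_ge0.
- by rewrite -EFinM lee_fin mulr_ge0.
by rewrite (_ : _%:E * (_ * _) = c%:E)%E// -!EFinM mulrCA scn_inv mulr1.
Qed.

Lemma cavg_mono k v w x : (forall y, 0 <= w y) -> (forall y, same k x y -> w y <= v y) ->
  (cavg k w x <= cavg k v x)%E.
Proof.
move=> w0 h; rewrite lee_wpmul2l//; apply: nn_le => y; first by rewrite lee_fin mulr_ge0.
by rewrite lee_fin; case hs: (same k x y); rewrite ?mulr0// !mulr1 h.
Qed.

(** Jensen's inequality in the form [v <= v^2 / (2e) + e / 2], which avoids square roots of extended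
    averages. *)
Lemma cavg_amgm k v x (e : R) : mfunT v -> (forall y, 0 <= v y) -> 0 < e ->
  (cavg k (fun y => (v y ^+ 2)%R) x <= (e ^+ 2)%:E)%E -> (cavg k v x <= e%:E)%E.
Proof.
move=> mv v0 e0 h.
have ms : mfunT (same k x).
  by apply: measurable_same => //; exact: measurable_cst.
apply: (le_via (cavg k (fun y => (2 * e)^-1 * v y ^+ 2)%R x + (e / 2)%:E)%E).
  apply: cavg_leD => //.
  - by mfun.
  - by move=> y; rewrite mulr_ge0 ?invr_ge0 ?mulr_ge0 ?(ltW e0) ?exprn_ge0.
  - by rewrite divr_ge0// ltW.
  move=> y _; rewrite -(@ler_pM2l _ (2 * e)) ?mulr_gt0// mulrDr mulrA divff ?gt_eqF ?mulr_gt0// mul1r.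
  have := sqr_ge0 (v y - e); rewrite sqrrB => h1.
  have -> : 2 * e * (e / 2) = e ^+ 2 by field.
  by rewrite -mulr_natl in h1; nra.
rewrite /cavg (_ : (fun y => _) = fun y => ((2 * e)^-1 * (v y ^+ 2 * (same k x y)%:R))%:E); last first.
  by apply/funext => y; rewrite -mulrA.
rewrite nnZr; last 3 first.
- by rewrite invr_ge0 mulr_ge0// ltW.
- by apply: measurable_funM; [mfun|exact: measurable_boolr].
- by move=> y; rewrite mulr_ge0// exprn_ge0.
rewrite muleCA -[X in (_ * X)%E]/(cavg k (fun y => v y ^+ 2)%R x).
apply: (le_via (((2 * e)^-1)%:E * (e ^+ 2)%:E + (e / 2)%:E)%E).
  by rewrite leeD2r// lee_wpmul2l// lee_fin invr_ge0 mulr_ge0// ltW.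
rewrite -EFinM -EFinD lee_fin; apply: le_of_eq.
by field; rewrite gt_eqF.
Qed.

Lemma stopping_in w (lam : R) (k0 k : int) x : k0 <= k -> (lam%:E < cavg k w x)%E ->
  (\bigcup_m stopping w lam k0 m) x.
Proof.
move=> kk hk; have [m0 Em] : exists m : nat, k = k0 + m%:Z.
  by exists `|k - k0|%N; rewrite gez0_abs ?subr_ge0// subrKC.
have ex : exists m : nat, (lam%:E < cavg (k0 + m%:Z) w x)%E by exists m0; rewrite -Em.
exists (ex_minn ex) => //; case: ex_minnP => m h hm; split=> // j jm.
by rewrite leNgt; apply/negP => /hm; rewrite leqNgt jm.
Qed.

Definition Dx w x : R := fine (ereal_sup (range (fun k => cavg k w x))).

Section bounded.
Variables (u : V -> R) (B : R).
Hypotheses (mu_ : mfunT u) (uB : forall y, 0 <= u y <= B).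

Let u0 y : 0 <= u y. Proof. by have /andP[] := uB y. Qed.

Let cavg_le_cst k x : (cavg k u x <= (2 ^+ n * B)%:E)%E.
Proof. by apply: le_trans (cavg_le_bavg _ _ u0) _; exact: bavg_le_cst. Qed.

Lemma cavg_fin k x : (cavg k u x \is a fin_num)%E.
Proof. by rewrite ge0_fin_numE ?cavg_ge0// (le_lt_trans (cavg_le_cst k x))// ltry. Qed.

Let sup_fin x : (ereal_sup (range (fun k => cavg k u x)) \is a fin_num)%E.
Proof.
have h0 : (0 <= ereal_sup (range (fun k => cavg k u x)))%E.
  by apply: le_trans (cavg_ge0 0 x u0) _; apply: ereal_sup_ubound; exists 0.
rewrite ge0_fin_numE//; apply: (le_lt_via (2 ^+ n * B)%:E); last exact: ltry.
by apply: ge_ereal_sup => _ [k _ <-].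
Qed.

Lemma cavg_le_Dx k x : (cavg k u x <= (Dx u x)%:E)%E.
Proof. by rewrite fineK//; apply: ereal_sup_ubound; exists k. Qed.

Lemma Dx_ge0 x : 0 <= Dx u x.
Proof. by rewrite -lee_fin; apply: le_trans (cavg_ge0 0 x u0) (cavg_le_Dx 0 x). Qed.

Lemma Dx_le x (c : R) : (forall k, (cavg k u x <= c%:E)%E) -> Dx u x <= c.
Proof. by move=> h; rewrite -lee_fin fineK//; apply: ge_ereal_sup => _ [k _ <-]. Qed.

Lemma Dx_le_Mx x : Dx u x <= Mx u x.
Proof.
apply: Dx_le => k; apply: le_trans (cavg_le_bavg _ _ u0) _.
exact: (bavg_le_Mx mu_ uB).
Qed.

Lemma Dx_gtP x (c : R) : c < Dx u x <-> exists k, (c%:E < cavg k u x)%E.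
Proof.
split=> [|[k hk]]; last by rewrite -lte_fin (lt_le_trans hk)// cavg_le_Dx.
move=> h; apply: contrapT => /forallNP h'; move: h; rewrite ltNge => /negP; apply.
by apply: Dx_le => k; rewrite leNgt; apply/negP; exact: h'.
Qed.

Lemma measurable_Dx : mfunT (Dx u).
Proof.
apply: (measurability _ (RGenOInfty.measurableE R)) => //.
move=> _ [_ [c ->] <-]; rewrite setTI.
apply: (measurable_eq (B := \bigcup_(k in [set: int]) [set x : V | (c%:E < cavg k u x)%E])).
  apply/seteqP; split => x /=; rewrite in_itv/= andbT.
    by move=> /Dx_gtP[k hk]; exists k.
  by move=> [k _ hk]; apply/Dx_gtP; exists k.
apply: countable_bigcupT_measurable => [|k]; first exact: countableP.
rewrite -[X in measurable X]setTI.
by apply: emeasurable_fun_o_infty => //; exact: measurable_cavg.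
Qed.

(** Continuity bounds [u] from below on small cells; this takes the place of Lebesgue's
    differentiation theorem. *)
Lemma le_Dx x : scont u -> u x <= Dx u x.
Proof.
move=> cu; rewrite leNgt; apply/negP => h.
pose e := (u x - Dx u x) / 2; have e0 : 0 < e by rewrite divr_gt0// subr_gt0.
have [k hk] : exists k : nat, forall y, same k%:Z x y -> u x - e <= u y.
  apply: contrapT => /forallNP hn.
  have /choice[y hy] : forall k : nat, exists y, same k%:Z x y /\ u y < u x - e.
    move=> k; have /existsNP[y /not_implyP[h1 h2]] := hn k.
    by exists y; split => //; rewrite ltNge; exact/negP.
  have yx : vcvg y x.
    move=> i; apply/cvgrPdist_lt => d d0; near=> k.
    have [h1 _] := hy k; apply: (le_lt_trans (y := `|x - y k|)).
      rewrite (_ : _ - _ = (x - y k) ord0 i); last by rewrite !mxE.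
      exact: coor_le_norm.
    apply: lt_le_trans (same_dist h1) _; rewrite scN sc_nat -exprVn.
    by near: k; apply: (cvgr_le (0 : R)) => //; apply: cvg_expr; rewrite gtr0_norm// invf_lt1// ltr1n.
  have := cu _ _ yx; move/cvgrPdist_lt => /(_ e e0) [N _ hN].
  have := hN N (leqnn N) => /=; have [_ h2] := hy N.
  by move=> /ltr_normlW; lra.
have : (cavg k%:Z (fun=> u x - e)%R x <= cavg k%:Z u x)%E.
  apply: cavg_mono => // y; apply: le_trans (Dx_ge0 x) _.
  by rewrite /e; lra.
rewrite /cavg nnZr//; last 2 first.
- by apply: le_trans (Dx_ge0 x) _; rewrite /e; lra.
- by apply/measurable_boolr/measurable_same => //; exact: measurable_cst.
rewrite int_same -!EFinM mulrCA scn_inv mulr1 => /le_trans/(_ (cavg_le_Dx k%:Z x)).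
by rewrite lee_fin /e; lra.
Unshelve. all: by end_near. Qed.

Hypothesis u2 : (\int[mu]_x (u x ^+ 2)%:E < +oo)%E.
Hypothesis n_gt0 : (0 < n)%N.

(** [u] is square integrable but perhaps not integrable, so the starting generation is found for
    [u^2] and transferred by [cavg_amgm]. *)
Lemma cavg_small_sqr (lam : R) : 0 < lam -> exists k0, forall k x, k <= k0 -> (cavg k u x <= lam%:E)%E.
Proof.
move=> l0; have [||||k0 hk] := @cavg_small _ _ n_gt0 (fun y => u y ^+ 2) (lam ^+ 2) => //.
- by mfun.
- by move=> y; rewrite exprn_ge0.
- by rewrite exprn_gt0.
by exists k0 => k x /hk h; exact: cavg_amgm.
Qed.

Let osc k y : R := `|u y - fine (cavg k u y)|.

Let measurable_osc k : mfunT (osc k).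
Proof.
rewrite /osc; apply: measurable_normrl; apply: measurable_funD => //.
apply: measurable_opprl; apply: measurableT_comp; first exact: fine_measurable.
exact: measurable_cavg.
Qed.

(* On a cell [Q] where averages first exceed [lam], the average over the parent is still at most
   [lam], so there [2 * lam < Dx u] forces the averages of [u] minus the parent average to exceed
   [lam]; these are controlled by the weak type bound and [G]. *)
Lemma good_lambda (G : V -> R) (lam gam : R) : mfunT G -> 0 < lam -> 0 <= gam ->
  (forall k x, (cavg k (osc k) x <= (G x)%:E)%E) ->
  (mu [set x | (2 * lam < Dx u x)%R] <= (2 ^+ n * gam)%:E * mu [set x | (lam < Dx u x)%R] +
     mu [set x | (gam * lam < G x)%R])%E.
Proof.
move=> mG l0 g0 hG; have [k0 H0] := cavg_small_sqr l0.
pose S := stopping u lam k0.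
have mS m : measurable (S m) by exact: measurable_stopping.
have mo k : mfunT (osc k) := measurable_osc k.
have o0 k y : 0 <= osc k y by exact: normr_ge0.
have mgt (f : V -> R) c : mfunT f -> measurable [set x | c < f x].
  move=> mf; rewrite -[X in measurable X]setTI; apply: (measurable_eq (B := setT `&` f @^-1` `]c, +oo[%classic)).
    by apply/seteqP; split => x /=; rewrite in_itv/= andbT.
  by apply: mf => //; exact: measurable_itv.
have mD : mfunT (Dx u) := measurable_Dx.
have -> : [set x | lam < Dx u x] = \bigcup_m S m.
  rewrite stoppingE//; apply/seteqP; split => x /=; by move/Dx_gtP.
pose T m := S m `&` [set x | 2 * lam < Dx u x] `&` ~` [set x | gam * lam < G x].
have mT m : measurable (T m).
  by apply: measurableI; [apply: measurableI => //; exact: mgt|apply: measurableC; exact: mgt].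
apply: (le_via (mu (\bigcup_m T m `|` [set x | gam * lam < G x]))).
  apply: le_measure; rewrite ?inE; first exact: mgt.
    by apply: measurableU; [exact: bigcup_measurable|exact: mgt].
  move=> x /= hx; have [hg|hg] := boolP (gam * lam < G x); [by right|left].
  have : (\bigcup_m S m) x.
    rewrite stoppingE//=; apply/Dx_gtP; apply: le_lt_trans hx.
    by rewrite ler_peMl ?(ltW l0)// ler1n.
  by move=> [m _ Sm]; exists m => //; split; [split|exact/negP].
apply: (le_via (mu (\bigcup_m T m) + mu [set x | (gam * lam < G x)%R])%E).
  by apply: measureU2; [exact: bigcup_measurable|exact: mgt].
rewrite leeD2r// mu_stopping//.
apply: (le_via (\sum_(0 <= m <oo) mu (T m))%E).
  by apply: measure_sigma_subadditive; [exact: mT|exact: bigcup_measurable|].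
rewrite -nneseriesZl//; apply: lee_nneseries => // m _.
pose k := k0 + m%:Z.
(* The cells of [S m] whose parent has small mean oscillation: off the set where [G] is large, every
   point of [T m] lies in one of them. *)
pose A := S m `&` [set x | (cavg (k - 1) (osc (k - 1)) x <= (gam * lam)%:E)%E].
have mA : measurable A.
  apply: measurableI => //; rewrite -[X in measurable X]setTI.
  by apply: emeasurable_fun_infty_c => //; exact: measurable_cavg.
have sA x y : same k x y -> A x -> A y.
  move=> xy [h1 h2]; split; first exact: stopping_same h1.
  by rewrite /= -(cavg_same _ (same_coarse _ xy))// gerBl.
pose v x := (x \in A)%:R * osc (k - 1) x.
have v0 x : 0 <= v x by rewrite mulr_ge0.
have mv : mfunT v.
  by apply: measurable_funM => //; apply/measurable_boolr/measurable_mem.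
have Slow x j : S m x -> j < k -> (cavg j u x <= lam%:E)%E.
  move=> [_ h] jk; have [/H0//|jk0] := leP j k0.
  have Ej : j = k0 + `|j - k0|%N%:Z by rewrite gez0_abs ?subr_ge0 ?ltW// subrKC.
  rewrite Ej; apply: h; rewrite -ltz_nat gez0_abs ?subr_ge0 ?ltW//.
  by rewrite ltrBlDl.
have sub : T m `<=` \bigcup_i stopping v lam k i.
  move=> x [[Sx /Dx_gtP[j hj]] hg].
  have kj : k <= j.
    rewrite leNgt; apply/negP => /(Slow _ _ Sx); rewrite leNgt (le_lt_trans _ hj)//.
    by rewrite lee_fin ler_peMl ?(ltW l0)// ler1n.
  have Ax : A x.
    split=> //=; apply: le_trans (hG _ _) _; rewrite lee_fin leNgt; exact/negP.
  apply: (@stopping_in _ _ _ j) => //.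
  have : (cavg j u x <= cavg j v x + lam%:E)%E.
    apply: cavg_leD => // [|y xy]; first exact: ltW.
    have ky : same k x y by apply: same_coarse xy.
    have Ay : y \in A by apply/mem_set; exact: sA Ax.
    rewrite /v Ay mul1r /osc -(cavg_same u (same_coarse (_ : k - 1 <= k) ky)) ?gerBl//.
    have : fine (cavg (k - 1) u x) <= lam.
      by rewrite -lee_fin fineK ?cavg_fin// Slow// gtrBl.
    by have := ler_norm (u y - fine (cavg (k - 1) u x)); lra.
  move=> /(lt_le_trans hj); rewrite mulr_natl mulr2n EFinD.
  by rewrite lteD2rE.
apply: (le_via (mu (\bigcup_i stopping v lam k i))).
  apply: le_measure; rewrite ?inE//; apply: bigcup_measurable => i _.
  exact: measurable_stopping.
have W := weak_dyadic k mv v0 l0.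
rewrite -(@lee_pmul2l _ lam%:E)// ?lte_fin//; apply: (le_trans W).
rewrite -(@cavg_saturated _ _ k _ (fun x => x \in A))//; last 2 first.
- exact: measurable_mem.
- by move=> x y xy; apply/idP/idP; rewrite !inE; apply: sA => //; rewrite same_sym.
(* Passing from a cell to its parent costs [2^n], and the mean oscillation over the parent is at
   most [gam lam]. *)
apply: (le_via (\int[mu]_x ((2 ^+ n * (gam * lam)) * \1_(S m) x)%:E)%E).
  apply: nn_le => x; first by rewrite mule_ge0// cavg_ge0.
  have [/set_mem[Sx hx]|] := boolP (x \in A); last first.
    by rewrite mul0e lee_fin !mulr_ge0// ltW.
  rewrite mul1e indicE mem_set// mulr1 EFinM; apply: le_trans (cavg_parent _ _ (o0 _)) _.
  by rewrite lee_wpmul2l// lee_fin exprn_ge0.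
rewrite nnZr//; last by rewrite !mulr_ge0// ltW.
rewrite integral_indic// setIT muleA -EFinM; apply: le_of_eq.
by congr (_%:E * _)%E; ring.
Qed.

End bounded.

Lemma measurable_layer2 (a : R) : mfunT (fun X : R => layer a X).
Proof.
rewrite /layer; apply: (@measurable_fun_tonelli _ _ _ _ _ (@lebesgue_measure R)
  (fun X t => (t `^ (a - 1) * (0 < t < X)%R%:R)%:E)); last first.
  by move=> X t; rewrite lee_fin mulr_ge0// powR_ge0.
have m1 := @measurable_fst _ _ (measurableTypeR R) (measurableTypeR R).
have m2 := @measurable_snd _ _ (measurableTypeR R) (measurableTypeR R).
apply/measurable_EFinP/measurable_funM; first exact: measurable_powRl m2.
by apply/measurable_boolr/measurable_and; apply: measurable_fun_ltr.
Qed.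

(** The good-lambda inequality integrated against [t^(p-1)]: its small factor lets the norm of the
    maximal function on the right be absorbed. This is the Fefferman-Stein inequality. *)
Lemma sharp_strong (p : R) : (0 < n)%N -> 2 < p -> exists2 C : R, 0 <= C &
  forall u (B : R) (G : V -> R), scont u -> (forall y, 0 <= u y <= B) ->
    (\int[mu]_x (u x ^+ 2)%:E < +oo)%E -> mfunT G -> (forall y, 0 <= G y) ->
    (forall k x, (cavg k (fun y => `|u y - fine (cavg k u y)|)%R x <= (G x)%:E)%E) ->
    (\int[mu]_x (u x `^ p)%:E <= C%:E * \int[mu]_x (G x `^ p)%:E)%E.
Proof.
move=> n_gt0 p2; have p0 : 0 < p by exact: lt_trans p2.
have p1 : 1 < p by apply: lt_trans p2; rewrite ltr1n.
pose c0 : R := (1 - 2^-1 `^ p) / p; have c00 : 0 < c0 := layer_const_gt0 p0.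
pose c1 : R := c0 * 2^-1 `^ p; have c10 : 0 < c1 by rewrite mulr_gt0// powR_gt0.
(* Chosen so that [2^n gam / p = c1 / 2], half of the constant that the lower layer-cake bound
   leaves on the left. *)
pose gam : R := c1 / 2 * p / 2 ^+ n.
have g0 : 0 < gam by rewrite divr_gt0 ?exprn_gt0// mulr_gt0// divr_gt0.
have [A A0 hA] := @max_strong R n n_gt0 p p1.
exists (2 / c1 * (gam^-1 `^ p / p)).
  by rewrite !mulr_ge0 ?invr_ge0 ?powR_ge0 ?ltW.
move=> u B G cu uB u2 mG G0 hG.
have mu_ := scont_measurable cu.
have u0 y : 0 <= u y by have /andP[] := uB y.
have mD : mfunT (Dx u) := measurable_Dx mu_ uB.
have D0 := Dx_ge0 mu_ uB.
have B0 : 0 <= B by have /andP[h1 h2] := uB 0; exact: le_trans h2.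
(* Absorption needs a finite quantity: [u] is bounded and square integrable, so [u^p] is integrable
   because [p > 2], and the maximal theorem applies. *)
have Dfin : (\int[mu]_x (Dx u x `^ p)%:E < +oo)%E.
  apply: (le_lt_via (\int[mu]_x (Mx u x `^ p)%:E)%E).
    apply: nn_le => x; first by rewrite lee_fin powR_ge0.
    by rewrite lee_fin ge0_ler_powR ?nnegrE ?(ltW p0)// ?(Mx_ge0 mu_ uB)// (Dx_le_Mx mu_ uB).
  apply: le_lt_trans (hA _ _ mu_ uB) _; apply: lte_mul_pinfty; rewrite ?lee_fin//.
  apply: (le_lt_via (\int[mu]_x (B `^ (p - 2) * u x ^+ 2)%:E)%E).
    apply: nn_le => x; first by rewrite lee_fin powR_ge0.
    rewrite lee_fin; have [->|uN] := eqVneq (u x) 0.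
      by rewrite powR0 ?expr0n ?mulr0// gt_eqF.
    rewrite (_ : u x `^ p = u x `^ (p - 2) * u x ^+ 2); last first.
      by rewrite -powR_mulrn// -powRD ?uN ?implybT// subrK.
    rewrite ler_wpM2r ?exprn_ge0//.
    by rewrite ge0_ler_powR ?nnegrE//; [rewrite subr_ge0 ltW|have /andP[] := uB x].
  by apply: nnZr_lty => //; [exact: powR_ge0|mfun|move=> x; exact: exprn_ge0].
have If : (\int[mu]_x (Dx u x `^ p)%:E \is a fin_num)%E.
  by rewrite ge0_fin_numE// integral_ge0// => x _; rewrite lee_fin powR_ge0.
set I := fine (\int[mu]_x (Dx u x `^ p)%:E).
have IE : (\int[mu]_x (Dx u x `^ p)%:E = I%:E)%E by rewrite fineK.
have IG0 : (0 <= \int[mu]_x (G x `^ p)%:E)%E.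
  by apply: int_ge0 => x; rewrite powR_ge0.
have key : (\int[mu]_x layer p (2^-1 * Dx u x) <=
    (2 ^+ n * gam)%:E * \int[mu]_x layer p (Dx u x) + \int[mu]_x layer p (gam^-1 * G x))%E.
  have L (f : V -> R) : mfunT f -> (forall x, 0 <= f x) -> (\int[mu]_x layer p (f x) =
       \int[lebesgue_measure]_t ((t `^ (p - 1) * (0 < t)%R%:R)%:E * mu [set x | (t < f x)%R]))%E.
    move=> mf f0; rewrite /layer.
    under eq_integral do under eq_integral do rewrite -[X in X%:E]mul1r.
    rewrite (layer_tonelli mu (p - 1) (c := fun=> 1))//; apply: eq_integral => t _.
    rewrite measure_gt_int// -nnZr; last 3 first.
    - by rewrite mulr_ge0// powR_ge0.
    - by mfun.
    - by move=> x.
    apply: eq_integral => x _; rewrite mul1r -mulrA; congr ((_ * _)%:E).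
    by case: (0 < t); rewrite /= ?mul1r ?mul0r.
  rewrite !L//; last 4 first.
  - by mfun.
  - by move=> x; rewrite mulr_ge0// invr_ge0 ltW.
  - by mfun.
  - by move=> x; rewrite mulr_ge0.
  have mm (f : V -> R) : mfunT f ->
      mfunT (fun t : measurableTypeR R => ((t `^ (p - 1) * (0 < t)%R%:R)%:E * mu [set x | (t < f x)%R])%E).
    move=> mf; apply: emeasurable_funM; first by mfun.
    under eq_fun do rewrite measure_gt_int//.
    apply: (@measurable_fun_tonelli _ _ _ _ _ mu (fun (t : measurableTypeR R) x => (t < f x)%R%:R%:E)) => //.
    apply/measurable_EFinP/measurable_boolr/measurable_fun_ltr.
      exact: (@measurable_fst _ _ (measurableTypeR R) V).
    exact: measurableT_comp mf (@measurable_snd _ _ (measurableTypeR R) V).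
  rewrite -nnZ//; last 3 first.
  - by rewrite mulr_ge0 ?exprn_ge0 ?ltW.
  - exact: mm.
  - by move=> t; rewrite mule_ge0// lee_fin mulr_ge0// powR_ge0.
  rewrite -ge0_integralD//; last 4 first.
  - move=> t _; apply: mule_ge0; first by rewrite lee_fin mulr_ge0 ?exprn_ge0 ?ltW.
    by rewrite mule_ge0// lee_fin mulr_ge0// powR_ge0.
  - by apply: emeasurable_funM => //; exact: mm.
  - by move=> t _; rewrite mule_ge0// lee_fin mulr_ge0// powR_ge0.
  - by apply: mm; mfun.
  apply: nn_le => t.
    by rewrite mule_ge0// lee_fin mulr_ge0// powR_ge0.
  have [t0|t0] := ltP 0 t; last first.
    by rewrite mulr0 !mul0e mule0 adde0.
  rewrite mulr1 muleCA -ge0_muleDr//; last first.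
    by rewrite mule_ge0// lee_fin mulr_ge0 ?exprn_ge0// ltW.
  rewrite lee_wpmul2l ?lee_fin ?powR_ge0//.
  have -> : [set x | t < 2^-1 * Dx u x] = [set x | 2 * t < Dx u x].
    by apply/seteqP; split => x /=; rewrite -ltr_pdivrMl ?invr_gt0// invrK.
  have -> : [set x | t < gam^-1 * G x] = [set x | gam * t < G x].
    by apply/seteqP; split => x /=; rewrite -ltr_pdivrMl ?invr_gt0// invrK.
  by apply: good_lambda => //; exact: ltW.
have mlay (f : V -> R) : mfunT f -> mfunT (fun x => layer p (f x)).
  by move=> mf; exact: measurableT_comp (measurable_layer2 p) mf.
have lay0 X : (0 <= layer p X)%E.
  by apply: int_ge0 => t; rewrite mulr_ge0// powR_ge0.
have k1 : ((c1 * I)%:E <= (c1 / 2 * I)%:E + (gam^-1 `^ p / p)%:E * \int[mu]_x (G x `^ p)%:E)%E.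
  apply: (le_via (\int[mu]_x layer p (2^-1 * Dx u x))%E).
    rewrite EFinM -IE -nnZr ?(ltW c10)//; last 2 first.
    - by mfun.
    - by move=> x; exact: powR_ge0.
    apply: nn_le => x; first by rewrite lee_fin mulr_ge0 ?powR_ge0 ?(ltW c10).
    apply: le_trans (layer_ge p0 _); last by rewrite mulr_ge0.
    by rewrite powRM// -/c0 mulrA.
  apply: (le_trans key); apply: leeD.
    have -> : c1 / 2 * I = 2 ^+ n * gam * (p^-1 * I).
      by rewrite /gam; field; rewrite gt_eqF ?exprn_gt0// gt_eqF.
    have g1 : 0 <= 2 ^+ n * gam by rewrite mulr_ge0 ?exprn_ge0 ?ltW.
    rewrite [leRHS]EFinM lee_wpmul2l// EFinM -IE -nnZr ?invr_ge0 ?(ltW p0)//; last 2 first.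
    - by mfun.
    - by move=> x; exact: powR_ge0.
    by apply: nn_le => // x; rewrite mulrC; exact: layer_le.
  rewrite -nnZr//; last 3 first.
  - by rewrite divr_ge0 ?powR_ge0 ?ltW.
  - by mfun.
  - by move=> x; exact: powR_ge0.
  apply: nn_le => // x; apply: le_trans (layer_le p0 _) _; first by rewrite mulr_ge0// invr_ge0 ltW.
  by rewrite powRM// ?invr_ge0 ?(ltW g0)// mulrAC.
apply: (le_via I%:E).
  rewrite -IE; apply: nn_le => x; first by rewrite lee_fin powR_ge0.
  by rewrite lee_fin ge0_ler_powR ?nnegrE ?(ltW p0)// (le_Dx mu_ uB).
rewrite EFinM -muleA -(@lee_pmul2l _ (c1 / 2)%:E)// ?lte_fin ?divr_gt0// muleA -!EFinM.
rewrite (_ : c1 / 2 * (2 / c1) = 1) ?mul1e; last by field; rewrite gt_eqF.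
rewrite -(@leeD2lE _ (c1 / 2 * I)%:E)// -EFinD (_ : c1 / 2 * I + c1 / 2 * I = c1 * I)//.
by field.
Qed.

Lemma geom_half N : \sum_(i < N) 2^-1 ^+ i.+1 <= 1 :> R.
Proof.
suff -> : \sum_(i < N) 2^-1 ^+ i.+1 = 1 - 2^-1 ^+ N :> R by rewrite gerBl exprn_ge0// invr_ge0.
elim: N => [|N IH]; first by rewrite big_ord0 expr0 subrr.
by rewrite big_ord_recr/= IH exprS; field.
Qed.

Lemma sc_shell (t : R) k : sc (2 - k) <= t -> exists i : nat, sc (i%:Z + 2 - k) <= t < sc (i%:Z + 3 - k).
Proof.
move=> h; have ex : exists i : nat, t < sc (i%:Z + 3 - k).
  have t0 : 0 <= t * sc k by rewrite mulr_ge0// (le_trans _ h).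
  exists (Num.bound (t * sc k)); rewrite scD scN ltr_pdivlMr//.
  apply: lt_le_trans (archi_boundP t0) _; rewrite scD sc_nat.
  apply: (le_via (2 ^+ Num.bound (t * sc k))).
    by rewrite -natrX ler_nat ltnW// ltn_expl.
  by rewrite ler_peMr ?exprn_ge0// exprn_ege1// ler1n.
case: (ex_minnP ex) => -[|i] hi hm; first by exists 0%N; rewrite hi add0r h.
exists i.+1; rewrite hi andbT leNgt; apply/negP => h'.
have := hm i; rewrite ltnn => hm'; apply: (Bool.diff_false_true); apply: hm'.
by rewrite (_ : i%:Z + 3 - k = i.+1%:Z + 2 - k); [exact: h'|lia].
Qed.

(** Shell by shell, with [Num.sqrt phi <= e / 2 + phi / (2e)]: the kernel decays with power [n + 1]
    against volumes of power [n], and shell [i] contributes at most [4^n e 2^-(i+1)]. *)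
Lemma far_part k z (phi : V -> R) (B e : R) : mfunT phi ->
  (forall y, 0 <= phi y <= B) -> 0 < e -> Mx phi z <= e ^+ 2 ->
  (\int[mu]_y (sc (- k) / `|y - z| ^+ n.+1 * (4 * sc (- k) <= `|y - z|)%R%:R *
     Num.sqrt (phi y))%:E <= (4 ^+ n * e)%:E)%E.
Proof.
move=> mphi phiB e0 hM; have phi0 y : 0 <= phi y by have /andP[] := phiB y.
have four : 4 * sc (- k) = sc (2 - k) :> R.
  by rewrite scD (_ : sc 2 = 4)// /sc -exprnP -natrX.
pose f y := sc (- k) / `|y - z| ^+ n.+1 * (4 * sc (- k) <= `|y - z|)%R%:R * Num.sqrt (phi y).
have f0 y : 0 <= f y by rewrite !mulr_ge0// invr_ge0 exprn_ge0.
have mf : mfunT f by rewrite /f; mfun.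
pose a (i : nat) : R := sc (- k) / sc (i%:Z + 2 - k) ^+ n.+1.
have a0 i : 0 <= a i by rewrite divr_ge0// exprn_ge0.
pose g (i : nat) y := a i * ((2^-1 * e + (2 * e)^-1 * phi y) * (`|y - z| < sc (- (k - i%:Z - 3)))%R%:R).
have e2 : 0 <= (2 * e)^-1 by rewrite invr_ge0 mulr_ge0// ltW.
have e3 : 0 <= 2^-1 * e by rewrite mulr_ge0 ?invr_ge0// ltW.
have g0 i y : 0 <= g i y by rewrite mulr_ge0// mulr_ge0// addr_ge0// mulr_ge0.
have mg i : mfunT (g i) by rewrite /g; mfun.
apply: (fatou_le (f := fun N y => f y * (`|y - z| < sc (N%:Z + 3 - k))%R%:R)).
- by move=> N; apply: measurable_funM => //; mfun.
- by move=> N y; rewrite mulr_ge0.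
- move=> y; apply: cvg_near_cst; rewrite -/(f y).
  have [i hi] : exists i : nat, `|y - z| < sc (i%:Z + 3 - k).
    have t0 : 0 <= `|y - z| * sc k by rewrite mulr_ge0.
    exists (Num.bound (`|y - z| * sc k)); rewrite scD scN ltr_pdivlMr//.
    apply: lt_le_trans (archi_boundP t0) _; rewrite scD sc_nat.
    apply: (le_via (2 ^+ Num.bound (`|y - z| * sc k))).
      by rewrite -natrX ler_nat ltnW// ltn_expl.
    by rewrite ler_peMr ?exprn_ge0// exprn_ege1// ler1n.
  exists i => // N /= iN; rewrite (lt_le_trans hi) ?mulr1//.
  by apply: sc_le; rewrite lerB// lerD2r.
move=> N; apply: (le_via (\int[mu]_y (\sum_(i < N.+1) g i y)%:E)%E).
  apply: nn_le => y; first by rewrite lee_fin mulr_ge0.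
  rewrite lee_fin; case: (ltP `|y - z|) => hN; last by rewrite mulr0 sumr_ge0.
  rewrite mulr1; have [hr|hr] := leP (4 * sc (- k)) `|y - z|; last first.
    by rewrite /f (leNgt (4 * sc _)) hr /= mulr0 mul0r sumr_ge0.
  have [|i /andP[i1 i2]] := @sc_shell `|y - z| k; first by rewrite -four.
  have iN : (i < N.+1)%N.
    rewrite ltnS leqNgt; apply/negP => Ni; have := le_lt_trans i1 hN.
    rewrite ltNge => /negP; apply; apply: sc_le.
    by rewrite lerD2r -[_ + 3]/(_ + (1 + 2)) addrA lerD2r -[1]/(1%:Z) -PoszD lez_nat addn1.
  apply: le_trans (ler_term (a := fun i : 'I_N.+1 => g i y) (Ordinal iN) _); last by move=> j; exact: g0.
  rewrite /f /g hr mulr1 /= (_ : - (k - i%:Z - 3) = i%:Z + 3 - k); last by ring.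
  rewrite i2 mulr1 ler_pM ?sqrtr_ge0//.
  - by rewrite divr_ge0// exprn_ge0.
  - rewrite /a ler_wpM2l// lef_pV2 ?posrE ?exprn_gt0//; last by rewrite (lt_le_trans _ i1).
    by rewrite lerXn2r ?nnegrE.
  rewrite -(@ler_pM2l _ (2 * e)) ?mulr_gt0//.
  have := sqr_ge0 (Num.sqrt (phi y) - e); rewrite sqrrB sqr_sqrtr// => h1.
  rewrite (_ : 2 * e * (2^-1 * e + (2 * e)^-1 * phi y) = e ^+ 2 + phi y); last first.
    by field; rewrite gt_eqF.
  by rewrite -mulr_natl in h1; nra.
rewrite nn_sum//; apply: (le_via (\sum_(i < N.+1) (4 ^+ n * e * 2^-1 ^+ i.+1)%:E)%E); last first.
  rewrite sumEFin lee_fin -mulr_sumr ler_piMr ?geom_half//.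
  by rewrite mulr_ge0 ?exprn_ge0 ?ltW.
apply: lee_sum => i _; rewrite /g nnZr//; last 2 first.
- by mfun.
- by move=> y; rewrite mulr_ge0// addr_ge0// mulr_ge0.
set m := k - i%:Z - 3.
apply: (le_via ((a i)%:E * (2 ^+ n * sc (- m) ^+ n * e)%:E)%E).
  rewrite lee_wpmul2l ?lee_fin//.
  have -> : (\int[mu]_y ((2^-1 * e + (2 * e)^-1 * phi y) * (`|y - z| < sc (- m))%R%:R)%:E =
     (2^-1 * e)%:E * \int[mu]_y (`|y - z| < sc (- m))%R%:R%:E +
     ((2 * e)^-1)%:E * \int[mu]_y (phi y * (`|y - z| < sc (- m))%R%:R)%:E)%E.
    rewrite -!nnZr//; last 3 first.
    - by mfun.
    - by move=> y; rewrite mulr_ge0.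
    - by mfun.
    rewrite -nnD//; last 4 first.
    - by mfun.
    - by mfun.
    - by move=> y; rewrite mulr_ge0.
    - by move=> y; rewrite mulr_ge0// mulr_ge0.
    by apply: eq_integral => y _; rewrite mulrDl mulrA.
  rewrite int_ball// exprMn.
  apply: (le_via ((2^-1 * e)%:E * (2 ^+ n * sc (- m) ^+ n)%:E +
     ((2 * e)^-1)%:E * (sc (- m) ^+ n * e ^+ 2)%:E)%E).
    rewrite leeD2l// lee_wpmul2l ?lee_fin//.
    apply: le_trans (bavg_Mx mphi phiB m z) _.
    by rewrite lee_fin ler_wpM2l// exprn_ge0.
  rewrite -!EFinM -EFinD lee_fin.
  have p1 : 1 <= 2 ^+ n :> R by rewrite exprn_ege1// ler1n.
  have q0 : 0 <= sc (- m) ^+ n * e :> R by rewrite mulr_ge0 ?exprn_ge0 ?ltW.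
  rewrite (_ : (2 * e)^-1 * (sc (- m) ^+ n * e ^+ 2) = 2^-1 * (sc (- m) ^+ n * e)); last first.
    by field; rewrite gt_eqF.
  by nra.
rewrite -EFinM lee_fin /a (_ : sc (- m) = 2 * sc (i%:Z + 2 - k) :> R); last first.
  rewrite -[X in X * _]/(sc 1) -scD; congr sc; rewrite /m; ring.
set s := sc (i%:Z + 2 - k); have s0 : 0 < s :> R by exact: sc_gt0.
rewrite (_ : sc (- k) / s ^+ n.+1 * (2 ^+ n * (2 * s) ^+ n * e) = (2 ^+ n * 2 ^+ n) * e * (sc (- k) / s)); last first.
  have sn : s ^+ n != 0 by rewrite expf_neq0// gt_eqF.
  by rewrite exprMn exprS; field; rewrite ?sn ?gt_eqF.
rewrite -exprMn (_ : 2 * 2 = 4 :> R); last by rewrite -natrM.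
rewrite ler_wpM2l ?mulr_ge0 ?exprn_ge0 ?(ltW e0)// /s scD -[X in _ / (X * _)]/(sc (i + 2)%:Z).
rewrite sc_nat invfM mulrCA divff ?sc_neq0// mulr1 -exprVn.
by apply: ler_wiXn2l; rewrite ?invr_ge0// ?invf_le1// ?ler1n// addn2 ltnW.
Qed.

(** On each ball [u] differs from a constant by [v], controlled in L^2 by the nearby [phi], plus the
    tail of [far_part]. Both are at most a multiple of the root of [Mx phi], which therefore
    majorises the mean oscillation; since [p > 2] the maximal theorem acts in L^(p/2). *)
Lemma sharp_lp (p A : R) : (0 < n)%N -> 2 < p -> 0 <= A -> exists2 C : R, 0 <= C &
  forall u (B : R) (phi : V -> R) (B' : R), scont u -> (forall y, 0 <= u y <= B) ->
    (\int[mu]_x (u x ^+ 2)%:E < +oo)%E -> mfunT phi -> (forall y, 0 <= phi y <= B') ->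
    (forall k z, exists (c : R) (v : V -> R), [/\ mfunT v, forall y, 0 <= v y,
      forall x, `|x - z| < sc (- k) -> (`|u x - c|%:E <= (v x)%:E +
        A%:E * \int[mu]_y (sc (- k) / `|y - z| ^+ n.+1 * (4 * sc (- k) <= `|y - z|)%R%:R *
          Num.sqrt (phi y))%:E)%E & (\int[mu]_y (v y ^+ 2)%:E <=
        A%:E * \int[mu]_y (phi y * (`|y - z| < 4 * sc (- k))%R%:R)%:E)%E]) ->
    (\int[mu]_x (u x `^ p)%:E <= C%:E * \int[mu]_x (phi x `^ (p / 2))%:E)%E.
Proof.
move=> n_gt0 p2 A0; have p0 : 0 < p by exact: lt_trans p2.
have p21 : 1 < p / 2 by rewrite ltr_pdivlMr// mul1r.
have [C C0 hC] := @sharp_strong p n_gt0 p2.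
have [D D0 hD] := @max_strong R n n_gt0 (p / 2) p21.
(* Twice the average of [v] plus twice the tail, each measured in units of the root of [Mx phi]. *)
pose K : R := 2 * ((A + 1) * 2 ^+ n) + 2 * (A * 4 ^+ n).
have K0 : 0 <= K by rewrite addr_ge0// !mulr_ge0 ?exprn_ge0// addr_ge0.
exists (C * (K `^ p * D)); first by rewrite !mulr_ge0 ?powR_ge0.
move=> u B phi B' cu uB u2 mphi phiB h.
have phi0 y : 0 <= phi y by have /andP[] := phiB y.
have mu_ := scont_measurable cu.
have u0 y : 0 <= u y by have /andP[] := uB y.
have mM : mfunT (Mx phi) := measurable_Mx mphi phiB.
have M0 := Mx_ge0 mphi phiB.
apply: le_trans (hC u B (fun x => K * Num.sqrt (Mx phi x)) cu uB u2 _ _ _) _.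
- by mfun.
- by move=> y; rewrite mulr_ge0.
- move=> k z.
  (* A positive [e] stands for the root of [Mx phi], which may vanish while the arithmetic-geometric
     mean steps divide by it. *)
  suff H (e : R) : 0 < e -> Mx phi z <= e ^+ 2 ->
      (cavg k (fun y => `|u y - fine (cavg k u y)|)%R z <= (K * e)%:E)%E.
    apply/lee_addgt0Pr => d d0.
    have d1 : 0 < d / (K + 1) by rewrite divr_gt0// ltr_wpDl.
    apply: le_trans (H (Num.sqrt (Mx phi z) + d / (K + 1)) _ _) _.
    + by rewrite ltr_wpDl.
    + have := sqr_sqrtr (M0 z); have := sqrtr_ge0 (Mx phi z); nra.
    rewrite -EFinD lee_fin mulrDr lerD2l mulrA ler_pdivrMr ?ltr_wpDl//.
    by rewrite mulrC ler_wpM2l ?(ltW d0)// lerDl.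
  move=> e0 hM; have [c [v [mv v0 hv iv]]] := h k z.
  pose E := A * (4 ^+ n * e); pose av := (A + 1) * 2 ^+ n * e.
  have av0 : 0 <= av by rewrite !mulr_ge0 ?exprn_ge0 ?addr_ge0 ?(ltW e0).
  have E0 : 0 <= E by rewrite !mulr_ge0 ?exprn_ge0 ?(ltW e0).
  have hE x : same k z x -> `|u x - c| <= v x + E.
    move=> zx; rewrite -lee_fin; apply: (le_trans (hv x _)).
      by rewrite distrC; exact: same_dist.
    rewrite EFinD leeD2l// /E EFinM lee_wpmul2l ?lee_fin//.
    exact: far_part phiB e0 hM.
  have hav : (cavg k v z <= av%:E)%E.
    apply: cavg_amgm => //; first by rewrite /av !mulr_gt0 ?exprn_gt0// ltr_wpDl.
    apply: (le_via ((sc k ^+ n)%:E * \int[mu]_y (v y ^+ 2)%:E)%E).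
      rewrite lee_wpmul2l ?lee_fin//; apply: nn_le => y.
        by rewrite lee_fin mulr_ge0// exprn_ge0.
      by rewrite lee_fin ler_piMr ?exprn_ge0// lern1 leq_b1.
    apply: (le_via ((sc k ^+ n)%:E * (A%:E * (sc (- (k - 2)) ^+ n * e ^+ 2)%:E))%E).
      rewrite lee_wpmul2l ?lee_fin//; apply: (le_trans iv).
      rewrite lee_wpmul2l ?lee_fin// (_ : 4 * sc (- k) = sc (- (k - 2))); last first.
        by rewrite opprB scD (_ : sc 2 = 4)// /sc -exprnP -natrX.
      apply: le_trans (bavg_Mx mphi phiB _ _) _.
      by rewrite lee_fin ler_wpM2l ?exprn_ge0.
    rewrite -!EFinM lee_fin opprB scD (_ : sc 2 = 4 :> R); last by rewrite /sc -exprnP -natrX.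
    rewrite (_ : _ * (A * _) = (sc k ^+ n * sc (- k) ^+ n) * (A * (2 ^+ n) ^+ 2 * e ^+ 2)); last first.
      rewrite exprMn (_ : 4 ^+ n = (2 ^+ n) ^+ 2 :> R); first by ring.
      by rewrite -exprM mulnC exprM (_ : 2 ^+ 2 = 4 :> R)// -natrX.
    rewrite scn_inv mul1r /av 2!exprMn ler_wpM2r ?exprn_ge0 ?(ltW e0)// ler_wpM2r ?exprn_ge0//.
    by nra.
  have fin x : (cavg k u x \is a fin_num)%E by exact: cavg_fin mu_ uB _ _.
  have osc y : same k z y -> `|u y - fine (cavg k u y)| <= v y + (av + 2 * E).
    move=> zy; have vy : 0 <= v y + 2 * E by rewrite addr_ge0// mulr_ge0.
    have hy := hE y zy; rewrite -(cavg_same u zy).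
    have a1 : fine (cavg k u z) <= av + (u y + v y + 2 * E).
      rewrite -lee_fin fineK//; apply: (le_via (cavg k v z + (u y + v y + 2 * E)%:E)%E).
        apply: cavg_leD => // [|y' zy']; first by rewrite -addrA addr_ge0.
        have := hE y' zy'; move: hy; rewrite !ler_norml => /andP[? ?] /andP[? ?]; lra.
      by rewrite [leRHS]EFinD leeD2r.
    have a2 : u y <= fine (cavg k u z) + (av + (v y + 2 * E)).
      rewrite -lee_fin EFinD fineK//.
      have cst : ((u y)%:E <= cavg k (fun=> u y) z)%E.
        rewrite /cavg nnZr//; last by apply/measurable_boolr/measurable_same => //; exact: measurable_cst.
        by rewrite int_same -!EFinM mulrCA scn_inv mulr1.
      apply: (le_trans cst).
      apply: (le_via (cavg k (fun y => u y + v y)%R z + (v y + 2 * E)%:E)%E).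
        apply: cavg_leD => //; first by mfun.
          by move=> y'; rewrite addr_ge0.
        move=> y' zy'.
        have := hE y' zy'; move: hy; rewrite !ler_norml => /andP[? ?] /andP[? ?]; lra.
      rewrite [X in (_ <= _ + X)%E]EFinD addeA leeD2r//.
      have ms : mfunT (same k z) by apply: measurable_same => //; exact: measurable_cst.
      rewrite /cavg (_ : (fun y => _) = fun y => (u y * (same k z y)%:R + v y * (same k z y)%:R)%:E); last first.
        by apply/funext => y'; rewrite mulrDl.
      rewrite nnD//; last 4 first.
      - by apply: measurable_funM => //; exact: measurable_boolr.
      - by apply: measurable_funM => //; exact: measurable_boolr.
      - by move=> y'; rewrite mulr_ge0.
      - by move=> y'; rewrite mulr_ge0.
      rewrite ge0_muleDr; last 2 first.
      - by apply: integral_ge0 => y' _; rewrite lee_fin mulr_ge0.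
      - by apply: integral_ge0 => y' _; rewrite lee_fin mulr_ge0.
      by rewrite leeD2l.
    by rewrite ler_norml; apply/andP; split; lra.
  apply: (le_via (cavg k v z + (av + 2 * E)%:E)%E).
    by apply: cavg_leD => //; rewrite addr_ge0// mulr_ge0.
  apply: (le_via (av%:E + (av + 2 * E)%:E)%E); first by rewrite leeD2r.
  by rewrite -EFinD lee_fin /av /E /K; apply: le_of_eq; ring.
rewrite EFinM -muleA lee_wpmul2l ?lee_fin// EFinM -muleA.
rewrite (_ : (\int[mu]_x ((K * Num.sqrt (Mx phi x)) `^ p)%:E)%E =
  (\int[mu]_x (K `^ p * (Mx phi x) `^ (p / 2))%:E)%E); last first.
  apply: eq_integral => x _; rewrite powRM//; congr (_ * _)%:E.
  by rewrite -powR12_sqrt// -powRrM mulrC.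
rewrite nnZr ?powR_ge0//; last 2 first.
- by mfun.
- by move=> x; exact: powR_ge0.
by rewrite lee_wpmul2l ?lee_fin ?powR_ge0//; exact: hD.
Qed.

End sharp.

(** * Vector-valued singular integrals and square functions *)

Local Notation window_bounded_by phi D := (forall (xi : 'rV_(_)) j0 M,
  \sum_(i < M) normc (fourier phi (sc (- (j0 + i%:Z)) *: xi)) ^+ 2 <= D).

Section l2.
Context {R : realType} (I : finType).
Implicit Types a b : I -> R[i].

Definition l2 a : R := Num.sqrt (\sum_i normc (a i) ^+ 2).

Let S0 a : 0 <= \sum_i normc (a i) ^+ 2.
Proof. by apply: sumr_ge0 => i _; rewrite exprn_ge0. Qed.

Lemma l2_ge0 a : 0 <= l2 a. Proof. exact: sqrtr_ge0. Qed.

Lemma sqr_l2 a : l2 a ^+ 2 = \sum_i normc (a i) ^+ 2.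
Proof. by rewrite sqr_sqrtr. Qed.

Lemma normc_le_l2 a i : normc (a i) <= l2 a.
Proof.
rewrite -(@ler_sqr _ (normc _)) ?nnegrE ?l2_ge0// sqr_l2.
by apply: (ler_term (a := fun i => normc (a i) ^+ 2)) => j; rewrite exprn_ge0.
Qed.

Lemma l2_le_sum a : l2 a <= \sum_i normc (a i).
Proof.
have s0 : 0 <= \sum_i normc (a i) by exact: sumr_ge0.
rewrite -(@ler_sqr _ (l2 a)) ?nnegrE ?l2_ge0// sqr_l2 expr2 mulr_suml.
by apply: ler_sum => i _; rewrite expr2 ler_wpM2l//; exact: (ler_term (a := fun i => normc (a i))).
Qed.

(** Convexity of the square with weights [l2 a] and [l2 b]; if one of them is 0, that vector
    vanishes. *)
Lemma l2D a b : l2 (fun i => a i + b i) <= l2 a + l2 b.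
Proof.
have [A0|A0] := eqVneq (l2 a) 0.
  rewrite A0 add0r /l2 (_ : \sum_i _ = \sum_i normc (b i) ^+ 2)//; apply: eq_bigr => i _.
  have := normc_le_l2 a i; rewrite A0 => h.
  have /eq0_normc -> : normc (a i) = 0 by apply/eqP; rewrite eq_le h normc_ge0.
  by rewrite add0r.
have [B0|B0] := eqVneq (l2 b) 0.
  rewrite B0 addr0 /l2 (_ : \sum_i _ = \sum_i normc (a i) ^+ 2)//; apply: eq_bigr => i _.
  have := normc_le_l2 b i; rewrite B0 => h.
  have /eq0_normc -> : normc (b i) = 0 by apply/eqP; rewrite eq_le h normc_ge0.
  by rewrite addr0.
have Ap : 0 < l2 a by rewrite lt_def A0 l2_ge0.
have Bp : 0 < l2 b by rewrite lt_def B0 l2_ge0.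
rewrite -(@ler_sqr _ (l2 _)) ?nnegrE ?addr_ge0 ?l2_ge0// sqr_l2.
apply: (le_via (\sum_i ((l2 a + l2 b) * (normc (a i) ^+ 2 / l2 a + normc (b i) ^+ 2 / l2 b)))).
  apply: ler_sum => i _; set x := normc (a i); set y := normc (b i).
  apply: (le_via ((x + y) ^+ 2)).
    by apply: lerXn2r; rewrite ?nnegrE ?addr_ge0 ?normc_ge0//; exact: normcD.
  set A := l2 a in Ap *; set B := l2 b in Bp *.
  rewrite -subr_ge0 (_ : _ - _ = (x * B - y * A) ^+ 2 / (A * B)).
    by rewrite divr_ge0 ?sqr_ge0// mulr_ge0// ltW.
  by field; rewrite !gt_eqF.
by rewrite -mulr_sumr big_split/= -!mulr_suml -!sqr_l2 !expr2 -!mulrA !divff// !mulr1 lexx.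
Qed.

Lemma l2_dist a b : `|l2 a - l2 b| <= l2 (fun i => a i - b i).
Proof.
have l2N c : l2 (fun i => - c i) = l2 c.
  by rewrite /l2; congr Num.sqrt; apply: eq_bigr => i _; rewrite normcNE.
have h1 : l2 a <= l2 (fun i => a i - b i) + l2 b.
  apply: le_trans (l2D _ _).
  by rewrite (_ : (fun i => _) = a)//; apply/funext => i; rewrite subrK.
have h2 : l2 b <= l2 (fun i => a i - b i) + l2 a.
  rewrite -[X in _ <= X + _]l2N; apply: le_trans (l2D _ _).
  by rewrite (_ : (fun i => _) = b)//; apply/funext => i; rewrite opprB subrK.
by rewrite ler_norml; apply/andP; split; lra.
Qed.

Lemma measurable_l2 d (T : measurableType d) (f : I -> T -> R[i]) : (forall i, cmeas (f i)) ->
  mfunT (fun x => l2 (f ^~ x)).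
Proof.
move=> mf; apply: measurable_sqrtl; apply: measurable_sum => i.
exact/measurable_funX/measurable_normc.
Qed.

End l2.

Section vector_valued.
Context {R : realType} {n : nat}.
Local Notation V := 'rV[R]_n.
Local Notation mu := (@lebesgue_rV R n).
Implicit Types (f g : V -> R[i]) (x y z : V).

Lemma cintg_conv_bounded g f x (B : R) : cintg mu g -> cmeas f -> (forall y, normc (f y) <= B) ->
  cintg mu (fun y => g (x - y) * f y).
Proof.
move=> ki mf fB; under eq_fun do rewrite mulrC.
by apply: (cintgMb (B := B)) => //; exact: cintg_subl.
Qed.

(** Truncation to a ball is how a merely bounded function is brought into the class [nice]. *)
Lemma nice_restrict f (A : V -> bool) (B : R) (z : V) (r : R) : cmeas f ->
  (forall y, normc (f y) <= B) -> mfunT A -> 0 < r ->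
  (forall y, A y -> `|y - z| < r) -> nice (fun y => f y * (A y)%:R%:C%C).
Proof.
move=> mf fB mA r0 hA.
have B0 : 0 <= B by exact: le_trans (normc_ge0 _) (fB 0).
have nE y : normc (f y * (A y)%:R%:C%C) = normc (f y) * (A y)%:R by rewrite normcM normc_rc ger0_norm.
have mg : cmeas (fun y => f y * (A y)%:R%:C%C).
  by apply: cmeasM => //; apply: cmeas_rc; exact: measurable_boolr.
split=> //; first by exists B => y; rewrite nE (le_trans _ (fB y))// ler_piMr// lern1 leq_b1.
split=> //; apply: (le_lt_via (\int[mu]_y (B * (`|y - z| < r)%R%:R)%:E)%E).
  apply: nn_le => y; rewrite ?lee_fin// nE ler_pM// ler_nat.
  by case h : (A y) => //=; rewrite hA.
rewrite nnZr//; last by mfun.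
by rewrite int_ball// -EFinM ltry.
Qed.

(* Near a ball the [L^2] bound is used, far from it the smoothness of the kernels. *)
Lemma vector_lp (p D : R) : (0 < n)%N -> 2 < p -> 0 <= D -> exists2 C : R, 0 <= C &
  forall (I J : finType) (K : I -> J -> V -> R[i]) (F : J -> V -> R[i]) (B : R),
  (forall i j, cintg mu (K i j)) -> (forall z h, 4 * `|h| <= `|z| ->
    (\sum_i \sum_j normc (K i j (z + h) - K i j z)) * `|z| ^+ n.+1 <= D * `|h|) ->
  (forall G : J -> V -> R[i], (forall j, nice (G j)) ->
    (\int[mu]_x (\sum_i normc (\sum_j convol (K i j) (G j) x) ^+ 2)%:E <=
     D%:E * \int[mu]_y (\sum_j normc (G j y) ^+ 2)%:E)%E) ->
  (forall j, cmeas (F j)) -> (forall j y, normc (F j y) <= B) ->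
  (forall i j, cscont (convol (K i j) (F j))) -> (forall i j x, normc (convol (K i j) (F j) x) <= B) ->
  (forall i j, \int[mu]_x (normc (convol (K i j) (F j) x) ^+ 2)%:E < +oo)%E ->
  (\int[mu]_x ((\sum_i normc (\sum_j convol (K i j) (F j) x) ^+ 2) `^ (p / 2))%:E <=
   C%:E * \int[mu]_y ((\sum_j normc (F j y) ^+ 2) `^ (p / 2))%:E)%E.
Proof.
move=> n_gt0 p2 D0; have [C C0 hC] := @sharp_lp R n p D n_gt0 p2 D0.
exists C => // I J K F B Ki Ks K2 mF FB uc uB u2.
pose a i x := \sum_j convol (K i j) (F j) x.
pose u x := l2 (a ^~ x).
have mK i j : cmeas (K i j) by have [] := Ki i j.
have ma i : cmeas (a i) by rewrite /a; apply: cmeas_sum => j; exact: cmeas_conv.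
have -> : (\int[mu]_x ((\sum_i normc (a i x) ^+ 2) `^ (p / 2))%:E = \int[mu]_x ((u x) `^ p)%:E)%E.
  apply: eq_integral => x _; rewrite /u /l2 -powR12_sqrt; last first.
    by apply: sumr_ge0 => i _; rewrite exprn_ge0.
  by rewrite -powRrM mulrC.
pose phi y := \sum_j normc (F j y) ^+ 2.
have phi0 y : 0 <= phi y by apply: sumr_ge0 => j _; rewrite exprn_ge0.
have mphi : mfunT phi by apply: measurable_sum => j; exact/measurable_funX/measurable_normc.
have sqb (z : R[i]) : 0 <= normc z ^+ 2 by rewrite exprn_ge0.
have uI : (\int[mu]_x (u x ^+ 2)%:E < +oo)%E.
  have h (N : nat) (x : 'I_N -> R) : (\sum_j x j) ^+ 2 <= N%:R * \sum_j x j ^+ 2.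
    elim: N x => [|N IH] x; first by rewrite !big_ord0 expr0n mulr0.
    rewrite !big_ord_recl/=; have := IH (fun j => x (lift ord0 j)).
    set s := \sum_(i < N) _; set q := \sum_(i < N) _ => h.
    case: N {IH} x @s @q h => [|N] x s q h.
      by rewrite /s /q !big_ord0 !addr0 mul1r.
    have e : 0 <= (N.+1%:R * x ord0 - s) ^+ 2 / N.+1%:R by rewrite divr_ge0// sqr_ge0.
    have -> : N.+2%:R * (x ord0 ^+ 2 + q) = (x ord0 + s) ^+ 2 + (N.+1%:R * x ord0 - s) ^+ 2 / N.+1%:R +
       (1 + N.+1%:R^-1) * (N.+1%:R * q - s ^+ 2).
      rewrite -[N.+2]addn1 natrD; have : N.+1%:R != 0 :> R by rewrite pnatr_eq0.
      by move: (N.+1%:R : R) => t t0; field.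
    by rewrite -addrA lerDl addr_ge0// mulr_ge0// ?subr_ge0// addr_ge0// invr_ge0.
  have h' (x : J -> R) : (\sum_j x j) ^+ 2 <= #|J|%:R * \sum_j x j ^+ 2.
    rewrite (reindex (@enum_val J predT))/=; last by apply: onW_bij; exact: enum_val_bij.
    rewrite [X in _ <= _ * X](reindex (@enum_val J predT))/=; last by apply: onW_bij; exact: enum_val_bij.
    exact: h.
  apply: (le_lt_via (\int[mu]_x (\sum_i #|J|%:R * \sum_j normc (convol (K i j) (F j) x) ^+ 2)%:E)%E).
    apply: nn_le => x; first by rewrite lee_fin exprn_ge0// l2_ge0.
    rewrite lee_fin sqr_l2; apply: ler_sum => i _; apply: le_trans (h' _).
    by rewrite lerXn2r ?nnegrE ?sumr_ge0//; exact: normc_sum.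
  have mc i j : cmeas (convol (K i j) (F j)) by exact: cmeas_conv.
  rewrite nn_sum; last 2 first.
  - move=> i; apply: measurable_funM; first exact: measurable_cst.
    by apply: measurable_sum => j; exact/measurable_funX/measurable_normc.
  - by move=> i x; rewrite mulr_ge0// sumr_ge0.
  rewrite lte_sum_pinfty// => i _; apply: nnZr_lty => //.
  - by apply: measurable_sum => j; exact/measurable_funX/measurable_normc.
  - by move=> x; rewrite sumr_ge0.
  rewrite nn_sum//; last by move=> j; exact/measurable_funX/measurable_normc.
  by rewrite lte_sum_pinfty.
apply: (hC u (\sum_(i : I) \sum_(j : J) B) phi (\sum_(j : J) B ^+ 2)) => //.
- move=> x y xy; rewrite /u /l2; apply: continuous_cvg; first exact: sqrt_continuous.
  have H (s : seq I) : \sum_(i <- s) normc (a i (x k)) ^+ 2 @[k --> \oo] -->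
      \sum_(i <- s) normc (a i y) ^+ 2.
    elim: s => [|i s IH].
      by rewrite big_nil; under eq_fun do rewrite big_nil; exact: cvg_cst.
    rewrite big_cons; under eq_fun do rewrite big_cons.
    apply: cvgD => //; have hc : normc (a i (x k)) @[k --> \oo] --> normc (a i y).
      by apply: ccvg_normc; apply: ccvg_sum => j; exact: (cscontP _).1.
    by under eq_fun do rewrite expr2; rewrite expr2; exact: cvgM.
  exact: H.
- move=> y; rewrite l2_ge0/=; apply: le_trans (l2_le_sum _) _; apply: ler_sum => i _.
  by apply: le_trans (normc_sum _ _) _; apply: ler_sum => j _.
- move=> y; rewrite phi0/=; apply: ler_sum => j _.
  by rewrite lerXn2r ?nnegrE// (le_trans _ (FB j y)).
move=> k z; set r := sc (- k); have r0 : 0 < r :> R by exact: sc_gt0.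
pose near y := (`|y - z| < 4 * r)%R; pose far y := (4 * r <= `|y - z|)%R.
have mnear : mfunT near by rewrite /near; mfun.
have mfar : mfunT far by rewrite /far; mfun.
pose Fn j y := F j y * (near y)%:R%:C%C; pose Ff j y := F j y * (far y)%:R%:C%C.
have FE j : F j = fun y => Fn j y + Ff j y.
  apply/funext => y; rewrite /Fn /Ff /near /far -mulrDr ltNge; case: leP => _ /=.
    by rewrite add0r mulr1.
  by rewrite addr0 mulr1.
have nFn j : nice (Fn j) by apply: (nice_restrict (B := B) (r := 4 * r) (z := z)) => //; rewrite mulr_gt0.
have mFn j : cmeas (Fn j) by have [] := nFn j.
have mFf j : cmeas (Ff j) by apply: cmeasM => //; apply: cmeas_rc; exact: measurable_boolr.
have normM (z' : R[i]) (b : bool) : normc (z' * b%:R%:C%C) = normc z' * b%:R.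
  by rewrite normcM normc_rc ger0_norm.
have FnB j y : normc (Fn j y) <= B by rewrite normM (le_trans _ (FB j y))// ler_piMr// lern1 leq_b1.
have FfB j y : normc (Ff j y) <= B by rewrite normM (le_trans _ (FB j y))// ler_piMr// lern1 leq_b1.
have cE i j x : convol (K i j) (F j) x = convol (K i j) (Fn j) x + convol (K i j) (Ff j) x.
  rewrite /convol -cintD; last 2 first.
  - exact: cintg_conv_bounded (FnB j).
  - exact: cintg_conv_bounded (FfB j).
  by congr cint; apply/funext => y; rewrite {1}FE mulrDr.
pose v x := l2 (fun i => \sum_j convol (K i j) (Fn j) x).
(* The constant subtracted from [u] on the ball is the length, at the centre [z], of the vector
   produced by the far part. *)
exists (l2 (fun i => \sum_j convol (K i j) (Ff j) z)), v; split.
- by apply: measurable_l2 => i; apply: cmeas_sum => j; exact: cmeas_conv.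
- by move=> y; exact: l2_ge0.
- move=> x xz; pose dl i := \sum_j (convol (K i j) (Ff j) x - convol (K i j) (Ff j) z).
  apply: (le_via (v x + l2 dl)%:E).
    rewrite lee_fin; apply: le_trans (l2_dist _ _) _; apply: le_trans (l2D _ _).
    apply: le_of_eq; congr l2; apply/funext => i.
    rewrite /a /dl -big_split -sumrB; apply: eq_bigr => j _ /=.
    by rewrite cE addrA.
  rewrite EFinD leeD2l//.
  apply: (le_via (\sum_i \sum_j \int[mu]_y
      (normc (K i j (x - y) - K i j (z - y)) * (normc (F j y) * (far y)%:R))%:E)%E).
    apply: (le_via (\sum_i \sum_j normc (convol (K i j) (Ff j) x - convol (K i j) (Ff j) z))%:E).
      rewrite lee_fin; apply: le_trans (l2_le_sum _) _; apply: ler_sum => i _; exact: normc_sum.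
    rewrite -sumEFin; apply: lee_sum => i _; rewrite -sumEFin; apply: lee_sum => j _.
    have c1 := cintg_conv_bounded x (Ki i j) (mFf j) (FfB j).
    have c2 := cintg_conv_bounded z (Ki i j) (mFf j) (FfB j).
    rewrite /convol -cintB//; apply: le_trans (le_cint _) _.
      by apply: cintgD => //; under eq_fun do rewrite -mulN1r; exact: cintgZ.
    by apply: nn_le => y; rewrite ?lee_fin// -mulrBl normcM normM lexx.
  have mk i j : mfunT (fun y => normc (K i j (x - y) - K i j (z - y)) * (normc (F j y) * (far y)%:R)).
    apply: measurable_funM.
      apply: measurable_normc; apply: cmeasD; last apply: cmeasN.
        by apply: (cmeas_comp (mK i j)); mfun.
      by apply: (cmeas_comp (mK i j)); mfun.
    by apply: measurable_funM; [exact: measurable_normc|exact: measurable_boolr].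
  have pk i j y : 0 <= normc (K i j (x - y) - K i j (z - y)) * (normc (F j y) * (far y)%:R).
    by rewrite !mulr_ge0.
  under eq_bigr do rewrite -nn_sum//.
  rewrite -nn_sum//; last 2 first.
  - by move=> i; apply: measurable_sum.
  - by move=> i y; exact: sumr_ge0.
  rewrite -nnZr//; last 2 first.
  - apply: measurable_funM; last exact: measurable_sqrtl.
    by apply: measurable_funM; [mfun|exact: measurable_boolr].
  - by move=> y; rewrite !mulr_ge0 ?sqrtr_ge0 ?invr_ge0 ?exprn_ge0 ?(ltW r0).
  apply: nn_le => y; first by rewrite lee_fin; apply: sumr_ge0 => i _; exact: sumr_ge0.
  rewrite lee_fin -/(far y); case hf : (far y); last first.
    rewrite mulr0 mul0r mulr0; apply: sumr_le0 => i _; apply: sumr_le0 => j _.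
    by rewrite !mulr0.
  have yz : 0 < `|y - z| by rewrite (lt_le_trans _ hf)// mulr_gt0.
  have sm : (\sum_i \sum_j normc (K i j (x - y) - K i j (z - y))) <= D * (r / `|y - z| ^+ n.+1).
    rewrite mulrA ler_pdivlMr ?exprn_gt0// -(distrC z y).
    have xE : x - y = (z - y) + (x - z) by rewrite [RHS]addrC -addrA (addrA (- z)) addNr add0r.
    rewrite xE; apply: le_trans (Ks _ _ _) _.
      rewrite (distrC z y); apply: le_trans hf; by rewrite ler_wpM2l// ltW.
    by rewrite ler_wpM2l// ltW.
  rewrite mulr1 [leRHS]mulrA; apply: le_trans (ler_wpM2r _ sm); last exact: sqrtr_ge0.
  rewrite mulr_suml; apply: ler_sum => i _; rewrite mulr_suml; apply: ler_sum => j _.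
  by rewrite mulr1 ler_wpM2l//; exact: (normc_le_l2 (fun j => F j y)).
have -> : (\int[mu]_y (v y ^+ 2)%:E)%E = (\int[mu]_x
   (\sum_i normc (\sum_j convol (K i j) (Fn j) x) ^+ 2)%:E)%E.
  by apply: eq_integral => y _; rewrite sqr_l2.
apply: le_trans (K2 Fn nFn) _; rewrite lee_wpmul2l ?lee_fin//.
apply: nn_le => y; first by rewrite lee_fin sumr_ge0.
rewrite lee_fin mulr_suml; apply: ler_sum => j _.
by rewrite normM exprMn ler_wpM2l// /near; case: ltP => _; rewrite ?expr1n// expr0n.
Qed.

Implicit Types (phi : V -> R[i]) (h xi : V) (j : int).

(* Each term is dominated by an increment of a bounded increasing function. *)
Lemma geom_window (a b : R) : 0 < a -> 0 < b -> exists2 B : R, 0 <= B &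
  forall (g : R -> R) (c : R) (j0 : int) (M : nat), 0 < c ->
  (forall t, 0 < t -> g t <= t `^ a /\ g t <= t `^ (- b)) -> \sum_(i < M) g (sc (j0 + i%:Z) * c) <= B.
Proof.
move=> a0 b0; have p1e (e : R) : 1 `^ e = 1 by rewrite powR1.
have two_a : 1 < 2 `^ a :> R.
  by rewrite -[ltLHS](p1e a) gt0_ltr_powR ?nnegrE// ltr1n.
have two_b : 2 `^ (- b) < 1 :> R.
  rewrite powRN invf_lt1 ?powR_gt0//.
  by rewrite -[ltLHS](p1e b) gt0_ltr_powR ?nnegrE// ltr1n.
pose A := (2 `^ a - 1)^-1 : R; have A0 : 0 < A by rewrite invr_gt0 subr_gt0.
pose A' := (1 - 2 `^ (- b))^-1 : R; have A'0 : 0 < A' by rewrite invr_gt0 subr_gt0.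
(* Doubling [t] adds exactly [t^a] through the first summand while [2t <= 1], and exactly [t^(-b)]
   through the second once [2t > 1]; [A] and [A'] are the factors of the two geometric series. *)
pose P (t : R) := A * Num.min t 1 `^ a - A' * 2 `^ b * Num.max (2 * t) 1 `^ (- b).
have two0 : 0 <= 2 :> R by [].
have m0 (t : R) : 0 < t -> 0 < Num.min t 1 by move=> t0; rewrite lt_min t0 ltr01.
have M0 (t : R) : 0 < Num.max (2 * t) 1 by rewrite lt_max ltr01 orbT.
have mono (x y : R) : 0 < x -> x <= y -> x `^ a <= y `^ a.
  move=> x0 xy; have y0 := lt_le_trans x0 xy.
  by rewrite ge0_ler_powR ?nnegrE ?(ltW a0) ?(ltW x0) ?(ltW y0).
have anti (x y : R) : 0 < x -> x <= y -> y `^ (- b) <= x `^ (- b).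
  move=> x0 xy; have y0 := lt_le_trans x0 xy.
  rewrite !powRN lef_pV2 ?posrE ?powR_gt0//.
  by rewrite ge0_ler_powR ?nnegrE ?(ltW b0) ?(ltW x0) ?(ltW y0).
exists (A + A' * 2 `^ b); first by rewrite addr_ge0 ?mulr_ge0 ?powR_ge0// ltW.
move=> g c j0 M c0 hg.
have step t : 0 < t -> g t <= P (2 * t) - P t.
  move=> t0; have t20 : 0 < 2 * t by rewrite mulr_gt0.
  have [g1 g2] := hg t t0; have tt : t <= 2 * t by rewrite ler_peMl ?(ltW t0)// ler1n.
  have mm : Num.min t 1 `^ a <= Num.min (2 * t) 1 `^ a.
    by apply: mono; rewrite ?m0// le_min !ge_min lexx tt orbT.
  have MM : Num.max (2 * (2 * t)) 1 `^ (- b) <= Num.max (2 * t) 1 `^ (- b).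
    by apply: anti => //; rewrite ge_max !le_max lexx orbT ler_pM2l// tt.
  have Ab : 0 <= A' * 2 `^ b by rewrite mulr_ge0 ?powR_ge0// ltW.
  have dec : 0 <= A' * 2 `^ b * (Num.max (2 * t) 1 `^ (- b) - Num.max (2 * (2 * t)) 1 `^ (- b)).
    by rewrite mulr_ge0// subr_ge0.
  have inc : 0 <= A * (Num.min (2 * t) 1 `^ a - Num.min t 1 `^ a).
    by rewrite mulr_ge0 ?subr_ge0// ltW.
  have PE : P (2 * t) - P t = A * (Num.min (2 * t) 1 `^ a - Num.min t 1 `^ a) +
      A' * 2 `^ b * (Num.max (2 * t) 1 `^ (- b) - Num.max (2 * (2 * t)) 1 `^ (- b)).
    by rewrite /P; ring.
  have [h|h] := leP (2 * t) 1.
    apply: le_trans g1 _; rewrite PE (min_l h) (min_l (le_trans tt h)).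
    have -> : A * ((2 * t) `^ a - t `^ a) = t `^ a.
      rewrite powRM ?(ltW t0)// /A; have : 2 `^ a - 1 != 0 by rewrite subr_eq0 gt_eqF.
      by move: (2 `^ a) (t `^ a) => u v uN; field.
    by rewrite lerDl.
  apply: le_trans g2 _; rewrite PE (max_l (ltW h)) max_l; last first.
    by move: h; lra.
  have -> : A' * 2 `^ b * ((2 * t) `^ (- b) - (2 * (2 * t)) `^ (- b)) = t `^ (- b).
    rewrite (powRM _ two0 (ltW t20)) (powRM _ two0 (ltW t0)) /A'.
    have -> : 2 `^ b = (2 `^ (- b))^-1 :> R by rewrite powRN invrK.
    have : 1 - 2 `^ (- b) != 0 :> R by rewrite subr_eq0 gt_eqF.
    have : 2 `^ (- b) != 0 :> R by rewrite gt_eqF// powR_gt0.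
    by move: (2 `^ (- b)) (t `^ (- b)) => u v u0 u1; field; rewrite u0 u1.
  by rewrite lerDr.
have sum : \sum_(i < M) g (sc (j0 + i%:Z) * c) <= P (sc (j0 + M%:Z) * c) - P (sc j0 * c).
  elim: M => [|M IH]; first by rewrite big_ord0 addr0 subrr.
  rewrite big_ord_recr/=; have := step (sc (j0 + M%:Z) * c) (mulr_gt0 (sc_gt0 _) c0).
  rewrite mulrA -[X in P (X * _ * _)](_ : sc 1 = 2)// -scD.
  rewrite (_ : 1 + (j0 + M%:Z) = j0 + M.+1%:Z); last by lia.
  by move=> h; lra.
apply: (le_trans sum).
have p1 (t : R) : 0 < t -> P t <= A.
  move=> t0; rewrite /P lerBlDr -[leLHS]addr0; apply: lerD; last by rewrite !mulr_ge0 ?powR_ge0// ltW.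
  rewrite -[leRHS]mulr1 ler_pM2l// -[leRHS](p1e a); apply: mono; first exact: m0.
  by rewrite ge_min lexx orbT.
have p2 (t : R) : 0 < t -> - P t <= A' * 2 `^ b.
  move=> t0; rewrite /P opprB lerBlDr -[leLHS]addr0; apply: lerD; last by rewrite !mulr_ge0 ?powR_ge0// ltW.
  rewrite -[leRHS]mulr1 ler_pM2l ?mulr_gt0 ?powR_gt0// -[leRHS](p1e (- b)); apply: anti => //.
  by rewrite le_max lexx orbT.
by apply: lerD; [apply: p1|apply: p2]; rewrite mulr_gt0.
Qed.

(** Normalised in L^1, so that on the transform side it is a dilation without a factor. *)
Definition dil phi j x : R[i] := (sc j ^+ n)%:C%C * phi (sc j *: x).

Lemma nice_dil phi j : nice phi -> nice (dil phi j).
Proof.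
move=> [mp [B pB] pi]; have mphi : cmeas (fun x => phi (sc j *: x)).
  by apply: (cmeas_comp mp); mfun.
split; first by apply: cmeasM => //; exact: cmeas_cst.
  exists (sc j ^+ n * B) => x; rewrite normcM normc_rc ger0_norm ?exprn_ge0//.
  by rewrite ler_wpM2l// exprn_ge0.
apply: cintgZ; have := cintg_affine 0 (sc_neq0 (R := R) j) pi.
by under eq_fun do rewrite addr0.
Qed.

Lemma cscont_dil phi j : cscont phi -> cscont (dil phi j).
Proof.
move=> cp; apply/cscontP => u x ux; apply: ccvgM; first exact: ccvg_cst.
apply: (cscontP phi).1 => // i; rewrite mxE; under eq_fun do rewrite mxE.
by apply: cvgM => //; exact: cvg_cst.
Qed.

Lemma fourier_dil phi j xi : nice phi -> fourier (dil phi j) xi = fourier phi (sc (- j) *: xi).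
Proof.
move=> np; have [_ _ pi] := np; rewrite !fourierE.
have E : (fun x => dil phi j x * ec (- dotmx x xi)) = fun x => (sc j ^+ n)%:C%C *
    (fun y => phi y * ec (- dotmx y (sc (- j) *: xi))) (sc j *: x + 0).
  apply/funext => x; rewrite /dil addr0 mulrA dotmxZl dotmxZr mulrA -scD subrr.
  by rewrite (_ : sc 0 = 1)// mul1r.
have ci : cintg mu (fun y => phi y * ec (- dotmx y (sc (- j) *: xi))).
  by apply: cintg_char => //; mdot.
rewrite E cintZ; last exact: cintg_affine (sc_neq0 (R := R) j) ci.
rewrite (cint_affine 0 (sc_neq0 (R := R) j) ci) mulrA -rmorphM/= gtr0_norm// -exprMn divff ?sc_neq0//.
by rewrite expr1n mul1r.
Qed.

(** The gradient estimate of a Schwartz function, kept in two forms: the first serves the dilates of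
    scale above the size of the argument, the second those of smaller scale. *)
Definition smooth_kernel phi (D : R) := forall x h, 4 * `|h| <= `|x| ->
  normc (phi (x + h) - phi x) <= D * `|h| /\ normc (phi (x + h) - phi x) * `|x| ^+ n.+2 <= D * `|h|.

(** With [t = sc j |z|], the dilate of index [j] contributes [t^(n+1) min(1, t^-(n+2))], at most
    [t^(n+1)] and at most [t^-1], so the sum is geometric in both directions and independent of the
    window. *)
Lemma smooth_kernel_window phi (D : R) : (0 < n)%N -> 0 <= D -> smooth_kernel phi D ->
  exists2 D' : R, 0 <= D' & forall j0 M z h, 4 * `|h| <= `|z| ->
  (\sum_(i < M) normc (dil phi (j0 + i%:Z) (z + h) - dil phi (j0 + i%:Z) z)) * `|z| ^+ n.+1
    <= D' * `|h|.
Proof.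
move=> n_gt0 D0 hs.
have n1 : 0 < n.+1%:R :> R by rewrite ltr0n.
have [B B0 hB] := geom_window n1 (ltr01 : 0 < 1 :> R).
exists (D * B); first by rewrite mulr_ge0.
move=> j0 M z h hz; have [z0|z0] := eqVneq `|z| 0.
  have h0 : `|h| = 0.
    by apply/eqP; rewrite eq_le normr_ge0 andbT; move: hz; rewrite z0; lra.
  by rewrite z0 expr0n mulr0 h0 mulr0.
have zp : 0 < `|z| by rewrite lt_def z0 normr_ge0.
pose g (t : R) := t ^+ n.+1 * Num.min 1 (t ^- n.+2).
have := hB g `|z| j0 M zp; set S := \sum_(i < M) g _ => hS.
apply: (le_via (D * `|h| * S)); last first.
  rewrite mulrAC ler_wpM2r// ler_wpM2l//; apply: hS => t t0; rewrite /g; split.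
    by rewrite powR_mulrn ?(ltW t0)// ler_piMr ?exprn_ge0 ?(ltW t0)// ge_min lexx.
  rewrite powRN powRr1 ?(ltW t0)//; apply: (le_via (t ^+ n.+1 * t ^- n.+2)).
    by rewrite ler_wpM2l ?exprn_ge0 ?(ltW t0)// ge_min lexx orbT.
  rewrite (exprS t n.+1) invfM mulrCA divff ?mulr1// expf_neq0// gt_eqF//.
rewrite mulr_suml mulr_sumr; apply: ler_sum => i _; set j := j0 + i%:Z.
have sj : 0 < sc j :> R by exact: sc_gt0.
have jz : 4 * `|sc j *: h| <= `|sc j *: z|.
  by rewrite !normrZ (gtr0_norm sj) mulrCA ler_pM2l.
have [h1 h2] := hs _ _ jz; move: h1 h2; rewrite !normrZ (gtr0_norm sj) => h1 h2.
rewrite /dil -mulrBr scalerDr normcM normc_rc ger0_norm ?exprn_ge0 ?(ltW sj)//.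
set d := normc _ in h1 h2 *; set t := sc j * `|z| in h2 *.
have t0 : 0 < t by rewrite mulr_gt0.
have hd : d <= D * (sc j * `|h|) * Num.min 1 (t ^- n.+2).
  have Dh : 0 <= D * (sc j * `|h|) by rewrite !mulr_ge0// ltW.
  by rewrite minr_pMr// mulr1 le_min h1 ler_pdivlMr ?exprn_gt0.
apply: (le_via (sc j ^+ n * (D * (sc j * `|h|) * Num.min 1 (t ^- n.+2)) * `|z| ^+ n.+1)).
  by rewrite ler_wpM2r ?exprn_ge0// ler_wpM2l ?exprn_ge0// ltW.
rewrite /g -/t (_ : t ^+ n.+1 = sc j ^+ n * sc j * `|z| ^+ n.+1).
  by apply: le_of_eq; ring.
by rewrite /t exprMn exprSr.
Qed.

Variables (phi : V -> R[i]) (D : R).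
Hypotheses (n_gt0 : (0 < n)%N) (D0 : 0 <= D) (nphi : nice phi) (cphi : cscont phi).
Hypothesis sphi : smooth_kernel phi D.
Hypothesis wphi : window_bounded_by phi D.

Let nd j : nice (dil phi j). Proof. exact: nice_dil. Qed.
Let cd j : cscont (dil phi j). Proof. exact: cscont_dil. Qed.

Definition sqf (j0 : int) (M : nat) f x : R :=
  \sum_(i < M) normc (convol (dil phi (j0 + i%:Z)) f x) ^+ 2.

Lemma sqf_L2 j0 M f : nice f ->
  (\int[mu]_x (sqf j0 M f x)%:E <= D%:E * \int[mu]_x (normc (f x) ^+ 2)%:E)%E.
Proof.
move=> nf; have [mf _ fi] := nf.
have mFf : cmeas (fourier f) by exact/cscont_cmeas/cscont_fourier.
have nc j := nice_conv (nd j) nf.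
have mc j : cmeas (convol (dil phi j) f) by have [] := nc j.
rewrite nn_sum; last 2 first.
- by move=> i; exact/measurable_funX/measurable_normc.
- by move=> i x; rewrite exprn_ge0.
have cc j : cscont (convol (dil phi j) f) by have [_ [B hB] _] := nd j; exact: cscont_convol hB fi.
apply: (le_via (\sum_(i < M) \int[mu]_xi (normc (fourier phi (sc (- (j0 + i%:Z)) *: xi)) ^+ 2 *
    normc (fourier f xi) ^+ 2)%:E)%E).
  apply: lee_sum => i _.
  apply: le_trans (plancherel_ge (nc _) (cc _) (cintg_fourier_conv (nd _) nf)) _.
  apply: nn_le => xi; rewrite lee_fin ?exprn_ge0//.
  by rewrite fourier_conv// fourier_dil// normcM exprMn.
have mF : cmeas (fourier phi) by have [_ _ ?] := nphi; exact/cscont_cmeas/cscont_fourier.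
rewrite -nn_sum; last 2 first.
- move=> i; apply: measurable_funM; apply/measurable_funX/measurable_normc => //.
  by apply: (cmeas_comp mF); mfun.
- by move=> i x; rewrite mulr_ge0// exprn_ge0.
apply: (le_via (\int[mu]_xi (D * normc (fourier f xi) ^+ 2)%:E)%E).
  apply: nn_le => xi.
    by rewrite lee_fin; apply: sumr_ge0 => i _; rewrite mulr_ge0// exprn_ge0.
  by rewrite lee_fin -mulr_suml ler_wpM2r ?exprn_ge0.
rewrite nnZr//; last 2 first.
- by cm.
- by move=> x; rewrite exprn_ge0.
by rewrite lee_wpmul2l ?lee_fin//; exact: plancherel_le.
Qed.

(** [vector_lp] with one input and [M] outputs; its hypotheses hold uniformly over windows, so the
    constant does not see [M]. *)
Lemma sqf_high (p : R) : 2 < p -> exists2 C : R, 0 <= C & forall j0 M f, nice f ->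
  (\int[mu]_x (sqf j0 M f x `^ (p / 2))%:E <= C%:E * \int[mu]_x ((normc (f x) ^+ 2) `^ (p / 2))%:E)%E.
Proof.
move=> p2; have [D' D'0 hD'] := smooth_kernel_window n_gt0 D0 sphi.
have [C C0 hC] := @vector_lp p (D + D') n_gt0 p2 (addr_ge0 D0 D'0).
exists C => // j0 M f nf; have [mf [B fB] fi] := nf.
pose K (i : 'I_M) (j : 'I_1) := dil phi (j0 + i%:Z).
have nc (i : 'I_M) : nice (convol (dil phi (j0 + i%:Z)) f) by exact: nice_conv.
have [Bc Bc0 hBc] : exists2 Bc : R, 0 <= Bc & forall (i : 'I_M) x, normc (convol (dil phi (j0 + i%:Z)) f x) <= Bc.
  have /choice[b hb] : forall i : 'I_M, exists b : R, forall x, normc (convol (dil phi (j0 + i%:Z)) f x) <= b.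
    by move=> i; have [_ [b hb] _] := nc i; exists b.
  have b0 i : 0 <= b i := le_trans (normc_ge0 _) (hb i 0).
  exists (\sum_i b i); first exact: sumr_ge0.
  move=> i x; apply: le_trans (hb i x) _.
  by apply: ler_term => j; exact: le_trans (normc_ge0 _) (hb j 0).
have := hC 'I_M 'I_1 K (fun=> f) (B + Bc).

have B0 : 0 <= B by exact: le_trans (normc_ge0 _) (fB 0).
have s1 (a : 'I_1 -> R[i]) : \sum_j a j = a ord0 by rewrite big_ord1.
have s1' (a : 'I_1 -> R) : \sum_j a j = a ord0 by rewrite big_ord1.
move=> H; apply: le_trans (le_trans (H _ _ _ _ _ _ _ _) _).
- apply: nn_le => x; rewrite lee_fin ?powR_ge0//.
  by rewrite /sqf (eq_bigr (fun i => normc (\sum_(j < 1) convol (K i j) f x) ^+ 2))// => i _; rewrite s1.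
- by move=> i j; have [] := nd (j0 + i%:Z).
- move=> z h hz; under eq_bigr do rewrite s1'.
  apply: le_trans (hD' j0 M z h hz) _; rewrite ler_wpM2r// lerDr//.
- move=> G nG; under eq_integral do under eq_bigr do rewrite s1.
  under [in leRHS]eq_integral do rewrite s1'.
  apply: le_trans (sqf_L2 j0 M (nG ord0)) _; rewrite lee_wpmul2r// ?lee_fin ?lerDl//.
  by apply: int_ge0 => x; rewrite exprn_ge0.
- by [].
- by move=> _ y; rewrite (le_trans (fB y))// lerDl.
- by move=> i j; have [_ [b hb] _] := nd (j0 + i%:Z); exact: cscont_convol hb fi.
- by move=> i j x; rewrite (le_trans (hBc i x))// lerDr.
- by move=> i j; apply: int_sqr_lty; exact: nc.
- by under eq_integral do rewrite s1'.
Qed.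

(** Cauchy-Schwarz in frequency, where the window bound controls one of the two factors. *)
Lemma conv_sum_L2 j0 M (G : 'I_M -> V -> R[i]) : (forall i, nice (G i)) ->
  (\int[mu]_x (normc (\sum_(i < M) convol (dil phi (j0 + i%:Z)) (G i) x) ^+ 2)%:E <=
   D%:E * \int[mu]_x (\sum_(i < M) normc (G i x) ^+ 2)%:E)%E.
Proof.
move=> nG.
have nc (i : 'I_M) : nice (convol (dil phi (j0 + i%:Z)) (G i)) by exact: nice_conv.
pose H x := \sum_(i < M) convol (dil phi (j0 + i%:Z)) (G i) x.
have gi (i : 'I_M) : cintg mu (G i) by have [] := nG i.
have ci (i : 'I_M) : cintg mu (convol (dil phi (j0 + i%:Z)) (G i)) by have [] := nc i.
have cc (i : 'I_M) : cscont (convol (dil phi (j0 + i%:Z)) (G i)).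
  by have [_ [b hb] _] := nd (j0 + i%:Z); exact: cscont_convol hb (gi i).
have mF g : cintg mu g -> cmeas (fourier g) by move=> ?; exact/cscont_cmeas/cscont_fourier.
have di j : cintg mu (dil phi j) by have [] := nd j.
have nH : nice H.
  split; first by apply: cmeas_sum => i; have [] := ci i.
    have /choice[b hb] : forall i : 'I_M, exists b : R, forall x, normc (convol (dil phi (j0 + i%:Z)) (G i) x) <= b.
      by move=> i; have [_ [b hb] _] := nc i; exists b.
    exists (\sum_i b i) => x; apply: le_trans (normc_sum _ _) _; exact: ler_sum.
  exact: cintg_sum.
have cH : cscont H.
  by apply/cscontP => u x ux; apply: ccvg_sum => i; exact: (cscontP _).1 (cc i) _ _ ux.
have FH xi : fourier H xi = \sum_(i < M) fourier (dil phi (j0 + i%:Z)) xi * fourier (G i) xi.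
  rewrite fourierE /H; under eq_fun do rewrite mulr_suml.
  rewrite cint_sum; last by move=> i; apply: cintg_char => //; mdot.
  by apply: eq_bigr => i _; rewrite -fourierE fourier_conv.
have Fi : cintg mu (fourier H).
  rewrite (funext FH); apply: cintg_sum => i.
  have := cintg_fourier_conv (nd (j0 + i%:Z)) (nG i); congr cintg.
  by apply/funext => xi; rewrite fourier_conv.
apply: le_trans (plancherel_ge nH cH Fi) _.
apply: (le_via (\int[mu]_xi (D * \sum_(i < M) normc (fourier (G i) xi) ^+ 2)%:E)%E).
  apply: nn_le => xi; rewrite lee_fin ?exprn_ge0// FH.
  have CS (a b : 'I_M -> R[i]) : normc (\sum_i a i * b i) ^+ 2 <=
      (\sum_i normc (a i) ^+ 2) * \sum_i normc (b i) ^+ 2.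
    rewrite -!sqr_l2 -exprMn lerXn2r ?nnegrE ?mulr_ge0 ?l2_ge0//.
    apply: le_trans (normc_sum _ _) _.
    have [A0|A0] := eqVneq (l2 a) 0.
      rewrite A0 mul0r; apply: sumr_le0 => i _; rewrite normcM.
      by have := normc_le_l2 a i; rewrite A0 => h; rewrite mulr_le0_ge0.
    have [B0|B0] := eqVneq (l2 b) 0.
      rewrite B0 mulr0; apply: sumr_le0 => i _; rewrite normcM.
      by have := normc_le_l2 b i; rewrite B0 => h; rewrite mulr_ge0_le0.
    have Ap : 0 < l2 a by rewrite lt_def A0 l2_ge0.
    have Bp : 0 < l2 b by rewrite lt_def B0 l2_ge0.
    apply: (le_via (\sum_i (2^-1 * (l2 b / l2 a * normc (a i) ^+ 2) + 2^-1 * (l2 a / l2 b * normc (b i) ^+ 2)))).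
      apply: ler_sum => i _; rewrite normcM; set x := normc (a i); set y := normc (b i).
      set s := l2 a in Ap *; set t := l2 b in Bp *; rewrite -subr_ge0.
      rewrite (_ : _ - _ = 2^-1 * ((t * x - s * y) ^+ 2 / (s * t))).
        by rewrite mulr_ge0 ?invr_ge0// divr_ge0 ?sqr_ge0// mulr_ge0// ltW.
      by field; rewrite !gt_eqF.
    rewrite big_split/= -!mulr_sumr -!sqr_l2; apply: le_of_eq.
    by field; rewrite A0 B0.
  apply: le_trans (CS _ _) _; rewrite ler_wpM2r ?sumr_ge0// => [i _|]; first by rewrite exprn_ge0.
  by apply: le_trans (wphi xi j0 M); apply: ler_sum => i _; rewrite fourier_dil.
rewrite nnZr//; last 2 first.
- by apply: measurable_sum => i; apply/measurable_funX/measurable_normc/mF.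
- by move=> x; apply: sumr_ge0 => i _; rewrite exprn_ge0.
rewrite !nn_sum; last 4 first.
- by move=> i; have [m _] := gi i; exact/measurable_funX/measurable_normc.
- by move=> i x; rewrite exprn_ge0.
- by move=> i; apply/measurable_funX/measurable_normc/mF.
- by move=> i x; rewrite exprn_ge0.
rewrite lee_wpmul2l ?lee_fin//; apply: lee_sum => i _; exact: plancherel_le.
Qed.

(** An inverse transform is bounded but not known to be integrable; it is cut off to balls, where
    [conv_sum_L2] applies, and Fatou removes the cutoff. *)
Lemma conv_sum_invfourier_L2 j0 M (nu : 'I_M -> V -> R[i]) : (forall i, nice (nu i)) ->
  (\int[mu]_x (normc (\sum_(i < M) convol (dil phi (j0 + i%:Z)) (invfourier (nu i)) x) ^+ 2)%:E <=
   D%:E * \int[mu]_x (\sum_(i < M) normc (invfourier (nu i) x) ^+ 2)%:E)%E.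
Proof.
move=> nnu; have ni (i : 'I_M) : cintg mu (nu i) by have [] := nnu i.
pose F (i : 'I_M) := invfourier (nu i).
have mF i : cmeas (F i) by exact/cscont_cmeas/cscont_invfourier.
have hF i y : normc (F i y) <= N1 (nu i) by exact: normc_invfourier.
pose G (m : nat) (i : 'I_M) y := F i y * (`|y| < m.+1%:R)%R%:R%:C%C.
have nG m i : nice (G m i).
  apply: (@nice_restrict (F i) (fun y => `|y| < m.+1%:R) (N1 (nu i)) 0 m.+1%:R) => //; first by mfun.
  by move=> y; rewrite subr0.
have GF m i y : normc (G m i y) <= normc (F i y).
  by rewrite normcM normc_rc ger0_norm// ler_piMr// lern1 leq_b1.
have mdx j x : cmeas (fun y => dil phi j (x - y)) by have [md _ _] := nd j; apply: (cmeas_comp md); mfun.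
apply: (@fatou_le _ _ _ _ (fun m x => normc (\sum_(i < M) convol (dil phi (j0 + i%:Z)) (G m i) x) ^+ 2)).
- move=> m; apply/measurable_funX/measurable_normc; apply: cmeas_sum => i.
  by have [md _ _] := nd (j0 + i%:Z); have [mg _ _] := nG m i; exact: cmeas_conv.
- by move=> m x; rewrite exprn_ge0.
- move=> x; suff cv : ccvg (fun m => \sum_(i < M) convol (dil phi (j0 + i%:Z)) (G m i) x)
      (\sum_(i < M) convol (dil phi (j0 + i%:Z)) (F i) x).
    by have cn := ccvg_normc cv; apply: cvgM.
  apply: ccvg_sum => i; rewrite /convol.
  have [_ _ di] := nd (j0 + i%:Z); have [_ dl] := cintg_subl x di.
  apply: (@cint_dct _ _ _ _ _ _ (fun y => N1 (nu i) * normc (dil phi (j0 + i%:Z) (x - y)))).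
  + by move=> m; apply: cmeasM => //; have [] := nG m i.
  + exact: cmeasM.
  + move=> y; have E m : (Num.truncn `|y| <= m)%N -> G m i y = F i y.
      move=> h; rewrite /G (_ : `|y| < m.+1%:R) ?mulr1//.
      by apply: lt_le_trans (truncnS_gt _) _; rewrite ler_nat.
    by split; apply: cvg_near_cst; exists (Num.truncn `|y|) => // m /= h; apply/eqP; rewrite E.
  + by move=> m y; rewrite normcM mulrC ler_wpM2r// (le_trans (GF m i y)).
  + by have mn := measurable_normc (mdx (j0 + i%:Z) x); mfun.
  + by apply: nnZr_lty => //; [exact: N1_ge0|exact: measurable_normc].
move=> m; apply: le_trans (conv_sum_L2 j0 (nG m)) _; rewrite lee_wpmul2l ?lee_fin//.
apply: nn_le => x; first by rewrite lee_fin sumr_ge0// => i _; rewrite exprn_ge0.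
by rewrite lee_fin; apply: ler_sum => i _; rewrite lerXn2r ?nnegrE.
Qed.

(** [vector_lp] in the dual situation, with [M] inputs and one output. *)
Lemma conv_sum_high (p : R) : 2 < p -> exists2 C : R, 0 <= C & forall j0 M (nu : 'I_M -> V -> R[i]),
  (forall i, nice (nu i)) ->
  (\int[mu]_x ((normc (\sum_(i < M) convol (dil phi (j0 + i%:Z)) (invfourier (nu i)) x) ^+ 2)
     `^ (p / 2))%:E <=
   C%:E * \int[mu]_x ((\sum_(i < M) normc (invfourier (nu i) x) ^+ 2) `^ (p / 2))%:E)%E.
Proof.
move=> p2; have [D' D'0 hD'] := smooth_kernel_window n_gt0 D0 sphi.
have [C C0 hC] := @vector_lp p (D + D') n_gt0 p2 (addr_ge0 D0 D'0).
exists C => // j0 M nu nnu.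
pose K (j : 'I_1) (i : 'I_M) := dil phi (j0 + i%:Z).
have ni (i : 'I_M) : cintg mu (nu i) by have [] := nnu i.
pose nu' (i : 'I_M) xi := fourier (dil phi (j0 + i%:Z)) xi * nu i xi.
have cE (i : 'I_M) : convol (dil phi (j0 + i%:Z)) (invfourier (nu i)) = invfourier (nu' i).
  by apply/funext => x; exact: conv_invfourier.
have nnu' i : nice (nu' i).
  have [m1 [b1 hb1] i1] := nnu i; have [m2 [b2 hb2] i2] := nd (j0 + i%:Z).
  have mF : cmeas (fourier (dil phi (j0 + i%:Z))) by exact/cscont_cmeas/cscont_fourier.
  split; first exact: cmeasM.
    exists (N1 (dil phi (j0 + i%:Z)) * b1) => x; rewrite normcM ler_pM//.
    exact: normc_fourier.
  by apply: (cintgMb (B := N1 (dil phi (j0 + i%:Z)))) => // x; exact: normc_fourier.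
have ni' (i : 'I_M) : cintg mu (nu' i) by have [] := nnu' i.
pose B := \sum_i (N1 (nu i) + N1 (nu' i)).
have BE i : N1 (nu i) + N1 (nu' i) <= B.
  by apply: (ler_term (a := fun i => N1 (nu i) + N1 (nu' i))) => j; rewrite addr_ge0 ?N1_ge0.
have s1 (a : 'I_1 -> R) : \sum_j a j = a ord0 by rewrite big_ord1.
have H := hC 'I_1 'I_M K (fun i => invfourier (nu i)) B.
under eq_integral do rewrite -(s1 (fun j : 'I_1 => normc (\sum_(i < M) convol (K j i) (invfourier (nu i)) _) ^+ 2)).
apply: H.
- by move=> j i; have [] := nd (j0 + i%:Z).
- move=> z h hz; rewrite s1.
  apply: le_trans (hD' j0 M z h hz) _; rewrite ler_wpM2r// lerDr//.
- move=> G nG; under eq_integral do rewrite s1.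
  apply: le_trans (conv_sum_L2 j0 nG) _; rewrite lee_wpmul2r// ?lee_fin ?lerDl//.
  by apply: int_ge0 => x; rewrite sumr_ge0// => i _; rewrite exprn_ge0.
- by move=> i; exact/cscont_cmeas/cscont_invfourier.
- move=> i y; apply: le_trans (normc_invfourier _ _) _ => //.
  by apply: le_trans (BE i); rewrite lerDl N1_ge0.
- by move=> j i; rewrite cE; exact: cscont_invfourier.
- move=> j i x; rewrite cE; apply: le_trans (normc_invfourier _ _) _ => //.
  by apply: le_trans (BE i); rewrite lerDr N1_ge0.
- move=> j i; rewrite cE; apply: le_lt_trans (invfourier_L2 (nnu' i)) _; exact: int_sqr_lty.
Qed.

End vector_valued.

(** * Weighted bound for a compactly supported kernel *)

Local Notation Mr r w x := (Mx (fun y => w y `^ r) x `^ r^-1).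

Section weighted_piece.
Context {R : realType} {n : nat}.
Local Notation V := 'rV[R]_n.
Local Notation mu := (@lebesgue_rV R n).
Implicit Types (f g k : V -> R[i]) (w : V -> R) (x y z : V).

(** The best choice is [c = X / P]. This is how the Cauchy-Schwarz inequalities for integrals are
    obtained below without dividing by norms that may vanish. *)
Lemma amgm_sqr (X P Q : R) : 0 <= X -> 0 <= P -> 0 <= Q ->
  (forall c, 0 < c -> X <= 2^-1 * (c * P + c^-1 * Q)) -> X ^+ 2 <= P * Q.
Proof.
rewrite le_eqVlt => /predU1P[<-|X0]; first by move=> *; rewrite expr0n mulr_ge0.
rewrite le_eqVlt => /predU1P[<-|P0] Q0 h.
  have Q1 : 0 < Q + 1 by rewrite ltr_wpDl.
  have := h ((Q + 1) / X) (divr_gt0 Q1 X0); rewrite mulr0 add0r invf_div mulrAC mulrA.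
  rewrite ler_pdivlMr// -[X in X -> _]/(is_true (X * (Q + 1) <= 2^-1 * (X * Q))).
  have : 0 <= X * Q by rewrite mulr_ge0// ltW.
  by nra.
have := h (X / P) (divr_gt0 X0 P0); rewrite divfK ?gt_eqF// invf_div mulrAC.
move=> h1; have := ler_wpM2r (ltW X0) h1.
rewrite (_ : 2^-1 * _ * X = 2^-1 * (X * X + P * Q)); last by field; rewrite gt_eqF.
by nra.
Qed.

Lemma convol_CS k g x : cmeas k -> cmeas g ->
  (\int[mu]_y (normc (k y) ^+ 2)%:E < +oo)%E -> (\int[mu]_y (normc (g y) ^+ 2)%:E < +oo)%E ->
  ((normc (convol k g x) ^+ 2)%:E <=
   \int[mu]_y (normc (k y) ^+ 2)%:E * \int[mu]_y (normc (g y) ^+ 2)%:E)%E.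
Proof.
move=> mk mg kf gf.
have sq0 f : (0 <= \int[mu]_y (normc (f y) ^+ 2)%:E)%E.
  by apply: int_ge0 => y; rewrite exprn_ge0.
have kE : (\int[mu]_y (normc (k y) ^+ 2)%:E)%E = (fine (\int[mu]_y (normc (k y) ^+ 2)%:E)%E)%:E.
  by rewrite fineK// ge0_fin_numE.
have gE : (\int[mu]_y (normc (g y) ^+ 2)%:E)%E = (fine (\int[mu]_y (normc (g y) ^+ 2)%:E)%E)%:E.
  by rewrite fineK// ge0_fin_numE.
rewrite kE gE; set P := fine _ in kE *; set Q := fine _ in gE *.
rewrite -EFinM lee_fin; apply: amgm_sqr; rewrite ?fine_ge0// => c c0.
have mkx : cmeas (fun y => k (x - y)) by apply: (cmeas_comp mk); mfun.
have m1 : mfunT (fun y => normc (k (x - y)) ^+ 2) by exact/measurable_funX/measurable_normc.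
have m2 : mfunT (fun y => normc (g y) ^+ 2) by exact/measurable_funX/measurable_normc.
have kxE : (\int[mu]_y (normc (k (x - y)) ^+ 2)%:E)%E = P%:E.
  rewrite (int_subl x (f := fun y => (normc (k y) ^+ 2)%:E))//.
  - by apply/measurable_EFinP/measurable_funX/measurable_normc.
  - by move=> y; rewrite lee_fin exprn_ge0.
have B : (\int[mu]_y (2^-1 * (c * normc (k (x - y)) ^+ 2 + c^-1 * normc (g y) ^+ 2))%:E =
    (2^-1 * (c * P + c^-1 * Q))%:E)%E.
  have p1 y : 0 <= c * normc (k (x - y)) ^+ 2 by rewrite mulr_ge0 ?exprn_ge0// ltW.
  have p2 y : 0 <= c^-1 * normc (g y) ^+ 2 by rewrite mulr_ge0 ?exprn_ge0 ?invr_ge0// ltW.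
  rewrite nnZr//; last 2 first.
  - by mfun.
  - by move=> y; rewrite addr_ge0.
  rewrite nnD//; try by mfun.
  rewrite !nnZr ?invr_ge0 ?(ltW c0)//; try by [move=> y; rewrite exprn_ge0].
  rewrite !EFinM EFinD !EFinM; congr (_ * (_ * _ + _ * _))%E; [exact: kxE|exact: gE].
have le y : normc (k (x - y) * g y) <= 2^-1 * (c * normc (k (x - y)) ^+ 2 + c^-1 * normc (g y) ^+ 2).
  rewrite normcM; set s := normc _; set t := normc _; rewrite -subr_ge0.
  rewrite (_ : _ - _ = 2^-1 * ((c * s - t) ^+ 2 / c)); last by field; rewrite gt_eqF.
  by rewrite mulr_ge0 ?invr_ge0// divr_ge0 ?sqr_ge0// ltW.
have ci : cintg mu (fun y => k (x - y) * g y).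
  by apply: (cintg_le (cmeasM mkx mg) le); rewrite B ltry.
rewrite -lee_fin -B; apply: le_trans (le_cint ci) _.
by apply: nn_le => y; rewrite lee_fin.
Qed.

(** The optimal height is [(Y / A)^(1/r)]. When [A] or [Y] vanishes it degenerates to infinity or 0,
    and the slack [e] pays for a finite positive choice. *)
Lemma interp_eps (A Y r e : R) : 1 < r -> 0 <= A -> 0 <= Y -> 0 < e ->
  exists2 T : R, 0 < T & T * A + T `^ (1 - r) * Y <= 2 * (A `^ (1 - r^-1) * Y `^ r^-1) + e.
Proof.
move=> r1; have r0 : 0 < r by exact: lt_trans r1.
have r10 : 1 - r < 0 by rewrite subr_lt0.
have rr : 0 < 1 - r^-1 by rewrite subr_gt0 invf_lt1.
rewrite le_eqVlt => /predU1P[<-|A0] Y0 e0.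
  have Y1 : 0 < e / (Y + 1) by rewrite divr_gt0// ltr_wpDl.
  exists ((e / (Y + 1)) `^ (1 - r)^-1); first exact: powR_gt0.
  rewrite mulr0 add0r -powRrM mulVf ?lt_eqF// powRr1 ?(ltW Y1)//.
  rewrite (_ : 0 `^ (1 - r^-1) = 0) ?mul0r ?mulr0 ?add0r; last by rewrite powR0 ?gt_eqF.
  by rewrite mulrAC ler_pdivrMr ?ltr_wpDl// ler_wpM2l ?(ltW e0)// lerDl.
move: Y0; rewrite le_eqVlt => /predU1P[<-|Y0].
  exists (e / A); first by rewrite divr_gt0.
  by rewrite divfK ?gt_eqF// mulr0 addr0 lerDr !mulr_ge0 ?powR_ge0.
exists ((Y / A) `^ r^-1); first by apply: powR_gt0; rewrite divr_gt0.
have E1 : (Y / A) `^ r^-1 * A = A `^ (1 - r^-1) * Y `^ r^-1.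
  rewrite powRM ?invr_ge0 ?(ltW Y0) ?(ltW A0)//.
  rewrite -(powR_inv1 (ltW A0)) -powRrM mulN1r.
  rewrite -[X in _ * _ * X](powRr1 (ltW A0)) -mulrA -powRD; last by rewrite (gt_eqF A0) implybT.
  by rewrite mulrC addrC.
have E2 : (Y / A) `^ r^-1 `^ (1 - r) * Y = A `^ (1 - r^-1) * Y `^ r^-1.
  rewrite -E1; have q0 : 0 < Y / A by rewrite divr_gt0.
  have YE : Y = (Y / A) * A by rewrite divfK// gt_eqF.
  rewrite {2}YE mulrA; move: (Y / A) q0 => q q0; congr (_ * A).
  rewrite -powRrM -[X in _ * X = _](powRr1 (ltW q0)) -powRD; last by rewrite (gt_eqF q0) implybT.
  by rewrite mulrBr mulr1 mulVf ?gt_eqF// subrK.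
by rewrite E1 E2 mulr_natl mulr2n lerDl ltW.
Qed.

(** Either [t] is at most [T], or [(t / T)^(r-1)] is at least 1. *)
Lemma powR_split (t T r : R) : 0 <= t -> 0 < T -> 1 < r -> t <= T + T `^ (1 - r) * t `^ r.
Proof.
move=> t0 T0 r1; have [h|h] := leP t T; first by rewrite (le_trans h)// lerDl mulr_ge0// powR_ge0.
have tp := lt_trans T0 h; rewrite -[leLHS]add0r lerD ?(ltW T0)//.
have -> : t `^ r = t `^ (r - 1) * t.
  by rewrite -[X in _ = _ * X](powRr1 t0) -powRD ?subrK// (gt_eqF tp) implybT.
rewrite mulrA ler_peMl// -opprB powRN ler_pdivlMl ?powR_gt0// mulr1.
by rewrite ge0_ler_powR ?nnegrE ?subr_ge0 ?(ltW r1) ?(ltW T0) ?(ltW h).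
Qed.

(* Averaging over the balls of the size of the support of [k]; on each of them the [L^2] bound and
   the Cauchy-Schwarz bound are interpolated by cutting [w] at height [T]. *)
Lemma weighted_piece (r : R) : 1 < r -> exists2 C : R, 0 <= C &
  forall k f w (m : int) (a A B Bw : R), nice k -> cscont k -> nice f ->
  (forall x, sc (- m) <= `|x| -> k x = 0) -> (forall xi, normc (fourier k xi) <= a) -> a ^+ 2 <= A ->
  ((sc (- m) ^+ n)%:E * \int[mu]_x (normc (k x) ^+ 2)%:E <= B%:E)%E ->
  mfunT w -> (forall x, 0 <= w x <= Bw) -> (\int[mu]_x (normc (convol k f x) ^+ 2 * w x)%:E <=
   (C * (A `^ (1 - r^-1) * B `^ r^-1))%:E * \int[mu]_x (normc (f x) ^+ 2 * Mr r w x)%:E)%E.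
Proof.
move=> r1; have r0 : 0 < r by exact: lt_trans r1.
exists (2 ^+ n * (2 * (4 ^+ n) `^ r^-1)).
  by rewrite !mulr_ge0 ?exprn_ge0 ?powR_ge0.
move=> k f w m a A B Bw nk ck nf ks ka aA kB mw wB.
have w0 x : 0 <= w x by have /andP[] := wB x.
have [mk [Bk kBk] ki] := nk; have [mf [Bf fB] fi] := nf.
have A0 : 0 <= A by exact: le_trans (sqr_ge0 _) aA.
set rho := sc (- m) in ks kB *; have rho0 : 0 < rho :> R by exact: sc_gt0.
have k20 : (0 <= \int[mu]_x (normc (k x) ^+ 2)%:E)%E.
  by apply: int_ge0 => x; rewrite exprn_ge0.
have B0 : 0 <= B.
  by rewrite -lee_fin (le_trans _ kB)// mule_ge0// lee_fin exprn_ge0 ?(ltW rho0).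
pose wr y := w y `^ r.
have mwr : mfunT wr by rewrite /wr; mfun.
have wrB y : 0 <= wr y <= Bw `^ r.
  rewrite powR_ge0/= ge0_ler_powR ?nnegrE ?(ltW r0)//; first exact: le_trans (w0 0) (proj2 (andP (wB 0))).
  by have /andP[] := wB y.
pose M y := Mx wr y `^ r^-1; have M0 y : 0 <= M y by exact: powR_ge0.
have mM : mfunT M by apply: measurable_powRl; exact: measurable_Mx wrB.
have mkf : cmeas (convol k f) by exact: cmeas_conv.
pose cst := A `^ (1 - r^-1) * B `^ r^-1; have cst0 : 0 <= cst by rewrite mulr_ge0 ?powR_ge0.
pose u x := normc (convol k f x) ^+ 2 * w x.
have u0 x : 0 <= u x by rewrite mulr_ge0 ?exprn_ge0.
have mu_ : mfunT u by apply: measurable_funM => //; exact/measurable_funX/measurable_normc.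
pose v y := normc (f y) ^+ 2 * M y.
have v0 y : 0 <= v y by rewrite mulr_ge0 ?exprn_ge0.
have mv : mfunT v by apply: measurable_funM => //; exact/measurable_funX/measurable_normc.
have fub (h : V -> R) (s : R) : 0 < s -> mfunT h -> (forall y, 0 <= h y) ->
    (\int[mu]_z \int[mu]_x (h x * (`|x - z| < s)%R%:R)%:E = ((2 * s) ^+ n)%:E * \int[mu]_x (h x)%:E)%E.
  move=> s0 mh h0.
  rewrite (@tonelli _ _ _ _ _ mu mu (fun z x => (h x * (`|x - z| < s)%R%:R)%:E)); last 2 first.
  - by mfun.
  - by move=> z x; rewrite lee_fin mulr_ge0.
  rewrite -nnZr ?exprn_ge0 ?mulr_ge0 ?(ltW s0)//; apply: eq_integral => x _.
  rewrite nnZr//; last by mfun.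
  under eq_integral do rewrite distrC.
  by rewrite int_ball// -EFinM mulrC.
have fubm (h : V -> R) (s : R) : mfunT h -> (forall y, 0 <= h y) ->
    mfunT (fun z => \int[mu]_x (h x * (`|x - z| < s)%R%:R)%:E)%E.
  move=> mh h0; apply: (@measurable_fun_tonelli _ _ _ _ _ mu (fun z x => (h x * (`|x - z| < s)%R%:R)%:E)).
    by mfun.
  by move=> z x; rewrite lee_fin mulr_ge0.
have local z : (\int[mu]_x (u x * (`|x - z| < rho)%R%:R)%:E <=
    (2 * (4 ^+ n) `^ r^-1 * cst)%:E * \int[mu]_y (v y * (`|y - z| < 2 * rho)%R%:R)%:E)%E.
  pose f' y := f y * (`|y - z| < 2 * rho)%R%:R%:C%C.
  have nf' : nice f'.
    apply: (nice_restrict (B := Bf) (r := 2 * rho) (z := z)) => //; first by mfun.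
    by rewrite mulr_gt0.
  have [mf' _ _] := nf'.
  have f'E y : normc (f' y) ^+ 2 = normc (f y) ^+ 2 * (`|y - z| < 2 * rho)%R%:R.
    rewrite normcM normc_rc ger0_norm// exprMn; congr (_ * _).
    by case: ltP; rewrite ?expr1n ?expr0n.
  (* For [x] in the small ball the support of [k] keeps [y] within [2 rho] of [z], so only the
     truncation of [f] matters. *)
  have uz x : `|x - z| < rho -> convol k f x = convol k f' x.
    move=> xz; congr cint; apply/funext => y; rewrite /f'.
    case: ltP => h; rewrite ?mulr1//= mulr0 ks ?mul0r//.
    have : `|y - z| <= `|x - y| + `|x - z|.
      by rewrite (distrC x y) (_ : y - z = y - x + (x - z)) ?ler_normD// addrA subrK.
    by lra.
  pose F := (\int[mu]_y (normc (f' y) ^+ 2)%:E)%E.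
  have Ffin : (F < +oo)%E by exact: int_sqr_lty.
  have F0 : (0 <= F)%E by apply: int_ge0 => y; rewrite exprn_ge0.
  pose W := fine (bavg m wr z).
  have WE : bavg m wr z = W%:E.
    rewrite /W fineK// ge0_fin_numE ?bavg_ge0//; last by move=> y; have /andP[] := wrB y.
    by apply: le_lt_trans (bavg_le_Mx mwr wrB m z) _; exact: ltry.
  have W0 : 0 <= W by rewrite fine_ge0// bavg_ge0// => y; have /andP[] := wrB y.
  have Wi : (\int[mu]_x (wr x * (`|x - z| < rho)%R%:R)%:E = (rho ^+ n * W)%:E)%E.
    by rewrite EFinM -WE /bavg muleA -EFinM mulrC scn_inv mul1e.
  have H (T : R) : 0 < T -> (\int[mu]_x (u x * (`|x - z| < rho)%R%:R)%:E <=
      (T * A + T `^ (1 - r) * (B * W))%:E * F)%E.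
    move=> T0; have TT0 : 0 <= T `^ (1 - r) by exact: powR_ge0.
    pose g x := normc (convol k f' x) ^+ 2.
    have g0 x : 0 <= g x by rewrite exprn_ge0.
    have mg : mfunT g by apply/measurable_funX/measurable_normc/cmeas_conv.
    apply: (le_via (\int[mu]_x (T * g x + T `^ (1 - r) * (g x * (wr x * (`|x - z| < rho)%R%:R)))%:E)%E).
      apply: nn_le => x; first by rewrite lee_fin mulr_ge0.
      rewrite lee_fin; case h: (_ < _); last first.
        by rewrite mulr0 !mulr0 addr0 mulr_ge0// ltW.
      rewrite !mulr1 /u uz// -/(g x); have := powR_split (w0 x) T0 r1; rewrite -/(wr x) => hw.
      apply: le_trans (ler_wpM2l (g0 x) hw) _.
      by apply: le_of_eq; ring.
    have q0 x : 0 <= g x * (wr x * (`|x - z| < rho)%R%:R).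
      by rewrite !mulr_ge0//; have /andP[] := wrB x.
    have mq : mfunT (fun x => g x * (wr x * (`|x - z| < rho)%R%:R)) by mfun.
    rewrite nnD//; last 4 first.
    - by mfun.
    - by mfun.
    - by move=> x; rewrite mulr_ge0// ltW.
    - by move=> x; rewrite mulr_ge0.
    rewrite nnZr ?(ltW T0)// nnZr// EFinD ge0_muleDl; last 2 first.
    - by rewrite lee_fin mulr_ge0// ltW.
    - by rewrite lee_fin !mulr_ge0.
    apply: leeD.
      rewrite EFinM -muleA lee_wpmul2l ?lee_fin ?(ltW T0)//.
      apply: le_trans (convol_L2 nk ck nf' ka) _.
      by rewrite lee_wpmul2r ?lee_fin.
    rewrite EFinM -muleA lee_wpmul2l ?lee_fin//.
    pose k2 := (\int[mu]_x (normc (k x) ^+ 2)%:E)%E.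
    have k2fin : (k2 < +oo)%E by exact: int_sqr_lty.
    have gE : forall x, (g x)%:E = (g x)%:E by [].
    have gle x : ((g x)%:E <= k2 * F)%E by exact: convol_CS.
    have kFE : (k2 * F = (fine (k2 * F))%:E)%E.
      by rewrite fineK// ge0_fin_numE ?mule_ge0// lte_mul_pinfty// ge0_fin_numE.
    apply: (le_via (\int[mu]_x (fine (k2 * F)%E * (wr x * (`|x - z| < rho)%R%:R))%:E)%E).
      apply: nn_le => x; first by rewrite lee_fin.
      rewrite lee_fin ler_wpM2r//; first by rewrite mulr_ge0//; have /andP[] := wrB x.
      by rewrite -lee_fin -kFE.
    rewrite nnZr ?fine_ge0 ?mule_ge0//; last 2 first.
    - by mfun.
    - by move=> x; rewrite mulr_ge0//; have /andP[] := wrB x.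
    rewrite -kFE Wi EFinM muleA [X in (X * _)%E]muleAC (muleC k2).
    rewrite (EFinM B) [leRHS]muleAC lee_wpmul2r ?lee_fin//.
    by rewrite lee_wpmul2r.
  have cW0 : 0 <= 2 * (cst * W `^ r^-1) by rewrite !mulr_ge0 ?powR_ge0.
  have H2 : (\int[mu]_x (u x * (`|x - z| < rho)%R%:R)%:E <= (2 * (cst * W `^ r^-1))%:E * F)%E.
    have FE : F = (fine F)%:E by rewrite fineK// ge0_fin_numE.
    have f0 : 0 <= fine F by exact: fine_ge0.
    apply/lee_addgt0Pr => e e0; have e1 : 0 < e / (fine F + 1) by rewrite divr_gt0// ltr_wpDl.
    have [T T0 hT] := interp_eps r1 A0 (mulr_ge0 B0 W0) e1.
    apply: le_trans (H T T0) _; rewrite FE -!EFinM -EFinD lee_fin.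
    apply: le_trans (ler_wpM2r f0 hT) _; rewrite mulrDl powRM// /cst -[A `^ _ * _ * _]mulrA lerD2l.
    by rewrite mulrAC ler_pdivrMr ?ltr_wpDl// ler_wpM2l ?(ltW e0)// lerDl.
  apply: (le_trans H2); rewrite /F.
  under eq_integral do rewrite f'E.
  rewrite -!nnZr//; last 5 first.
  - by rewrite !mulr_ge0 ?powR_ge0.
  - by mfun.
  - by move=> y; rewrite mulr_ge0.
  - by apply: measurable_funM; [exact/measurable_funX/measurable_normc|mfun].
  - by move=> y; rewrite mulr_ge0 ?exprn_ge0.
  apply: nn_le => y; first by rewrite lee_fin !mulr_ge0 ?exprn_ge0 ?powR_ge0.
  rewrite lee_fin; case h: (_ < _); last by rewrite !mulr0.
  rewrite !mulr1 /v.
  (* The ball around [z] is contained in the ball of four times the radius around [y], which costs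
     [4^n] in the normalisation. *)
  have WM : W <= 4 ^+ n * Mx wr y.
    rewrite -lee_fin -WE EFinM; apply: le_trans (lee_wpmul2l _ (bavg_le_Mx mwr wrB (m - 2) y)); last first.
      by rewrite lee_fin exprn_ge0.
    rewrite /bavg muleA -EFinM -exprMn (_ : 4 = sc 2); last by rewrite /sc -exprnP -natrX.
    rewrite -scD addrC subrK lee_wpmul2l ?lee_fin ?exprn_ge0//; apply: nn_le => x.
      by rewrite lee_fin mulr_ge0//; have /andP[] := wrB x.
    rewrite lee_fin ler_wpM2l//; first by have /andP[] := wrB x.
    rewrite ler_nat; case h2: (`|x - z| < _) => //=.
    suff -> : `|x - y| < sc (- (m - 2)) by [].
    rewrite opprB scD (_ : sc 2 = 4); last by rewrite /sc -exprnP -natrX.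
    have : `|x - y| <= `|x - z| + `|y - z|.
      by rewrite (distrC y z) (_ : x - y = x - z + (z - y)) ?ler_normD// addrA subrK.
    by move: h h2; rewrite -/rho; lra.
  have hp : W `^ r^-1 <= (4 ^+ n) `^ r^-1 * M y.
    rewrite /M -powRM ?exprn_ge0//; last exact: Mx_ge0 mwr wrB _.
    by rewrite ge0_ler_powR ?nnegrE ?invr_ge0 ?(ltW r0)// (le_trans W0).
  apply: (le_via (2 * (cst * ((4 ^+ n) `^ r^-1 * M y)) * normc (f y) ^+ 2)).
    by rewrite ler_wpM2r ?exprn_ge0// ler_wpM2l// ler_wpM2l.
  by apply: le_of_eq; ring.
rewrite -(@lee_pmul2l _ ((2 * rho) ^+ n)%:E)// ?lte_fin ?exprn_gt0 ?mulr_gt0//.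
rewrite -(fub u rho)//.
apply: (le_via (\int[mu]_z ((2 * (4 ^+ n) `^ r^-1 * cst)%:E *
    \int[mu]_y (v y * (`|y - z| < 2 * rho)%R%:R)%:E))%E).
  by apply: nn_le => // z; apply: int_ge0 => x; rewrite mulr_ge0.
rewrite nnZ; last 3 first.
- by rewrite !mulr_ge0 ?powR_ge0.
- exact: fubm.
- by move=> z; apply: int_ge0 => x; rewrite mulr_ge0.
rewrite fub ?mulr_gt0// !muleA -!EFinM; apply: le_of_eq.
by congr (_%:E * _)%E; rewrite /cst !exprMn; ring.
Qed.

End weighted_piece.

(** * Multiplication by Gaussians *)

Section gaussian.
Context {R : realType} {n : nat}.
Local Notation V := 'rV[R]_n.
Local Notation mu := (@lebesgue_rV R n).
Implicit Types (f g Q : V -> R[i]) (x y xi : V).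

Let sin_mvt (v : R) : 0 < v -> exists2 c, 0 < c < v & sin v = cos c * v.
Proof.
move=> v0; have [|c] := @MVT R sin cos 0 v v0.
  exact/continuous_subspaceT/continuous_sin.
by rewrite in_itv/= sin0 !subr0 => c1 c2; exists c.
Qed.

Let sin_le_id (v : R) : 0 <= v -> sin v <= v.
Proof.
rewrite le_eqVlt => /predU1P[<-|v0]; first by rewrite sin0.
by have [c _ ->] := sin_mvt v0; rewrite ler_piMl ?cos_le1// ltW.
Qed.

Let one_cos (u : R) : 1 - cos u = 2 * sin (u / 2) ^+ 2.
Proof.
have e : u = u / 2 + u / 2 by field.
by rewrite {1}e cosD -!expr2 sin2cos2; ring.
Qed.

Let one_cos_le (u : R) : 0 <= u <= 1 -> 1 - cos u <= u ^+ 2 / 2.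
Proof.
move=> /andP[u0 u1]; rewrite one_cos; have h0 : 0 <= u / 2 by rewrite divr_ge0.
have s1 := sin_le_id h0; have s0 : 0 <= sin (u / 2).
  apply: sin_ge0_pi; rewrite h0/=; have := @pi_ge2 R; lra.
have : sin (u / 2) ^+ 2 <= (u / 2) ^+ 2 by rewrite lerXn2r ?nnegrE.
rewrite (_ : u ^+ 2 / 2 = 2 * (u / 2) ^+ 2); last by field.
by rewrite ler_pM2l.
Qed.

Let cos_quad (u : R) : 0 <= u <= 1 -> `|cos u - (1 - u ^+ 2 / 2)| <= u ^+ 4.
Proof.
move=> uI; have := one_cos_le uI; have /andP[] := uI; rewrite le_eqVlt => /predU1P[<- _ _|u0 u1 h].
  by rewrite cos0 !expr0n/= mul0r subr0 subrr normr0.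
have hu : 0 < u / 2 by rewrite divr_gt0.
have [c /andP[c0 cu] sE] := sin_mvt hu.
have cI : 0 <= c <= 1 by apply/andP; split; lra.
have c1 := one_cos_le cI.
have c2 : c ^+ 2 <= (u / 2) ^+ 2 by rewrite lerXn2r ?nnegrE// ltW.
have cc : 1 - u ^+ 2 / 8 <= cos c.
  have e2 : (u / 2) ^+ 2 = u ^+ 2 / 4 by field.
  by move: c1 c2; rewrite e2; lra.
have u2 : 0 <= u ^+ 2 <= 1 by rewrite sqr_ge0 exprn_ile1 ?(ltW u0).
have : (1 - u ^+ 2 / 8) ^+ 2 <= cos c ^+ 2.
  have p : 0 <= 1 - u ^+ 2 / 8 by move/andP: u2 => [? ?]; lra.
  by rewrite lerXn2r ?nnegrE// (le_trans p).
have e : 1 - cos u = u ^+ 2 / 2 * cos c ^+ 2 by rewrite one_cos sE; field.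
move=> h2; have h3 : u ^+ 2 / 2 * (1 - u ^+ 2 / 8) ^+ 2 <= 1 - cos u.
  by rewrite e ler_wpM2l// divr_ge0// sqr_ge0.
have -> : u ^+ 4 = u ^+ 2 * u ^+ 2 by rewrite -exprD.
move: u2 h h3; move: (u ^+ 2) (cos u) => t C /andP[t0 t1] h h3.
by rewrite ler_norml; apply/andP; split; nra.
Qed.

Let exp_quad (v : R) : 0 <= v -> `|expR (- v) - (1 - v)| <= v ^+ 2.
Proof.
move=> v0; have h1 := expR_ge1Dx (- v); have h2 := expR_ge1Dx v.
have v1 : 0 < 1 + v by rewrite ltr_wpDr.
have h3 : expR (- v) <= (1 + v)^-1 by rewrite expRN lef_pV2 ?posrE ?expR_gt0.
have h4 : (1 + v)^-1 <= 1 - v + v ^+ 2.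
  rewrite -[leLHS]mul1r ler_pdivrMr// -subr_ge0 (_ : _ - _ = v ^+ 3); last by ring.
  by rewrite exprn_ge0.
by rewrite ler_norml; apply/andP; split; nra.
Qed.

Let pow_dist (a b : R) N : `|a| <= 1 -> `|b| <= 1 -> `|a ^+ N - b ^+ N| <= N%:R * `|a - b|.
Proof.
move=> a1 b1; elim: N => [|N IH]; first by rewrite !expr0 subrr normr0 mul0r.
rewrite !exprS (_ : _ - _ = a * (a ^+ N - b ^+ N) + (a - b) * b ^+ N); last by ring.
apply: le_trans (ler_normD _ _) _; rewrite !normrM -addn1 natrD mulrDl mul1r; apply: lerD.
  by apply: le_trans IH; rewrite ler_piMl.
by rewrite ler_piMr// normrX exprn_ile1.
Qed.

(** With [u = x / m], both [cos u] and [exp(-u^2/2)] are [1 - u^2/2] up to order [u^4]; raising to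
    the power [m^2] multiplies the difference by at most [m^2], which leaves an error of order
    [x^4 / m^2]. *)
Let cos_pow_cvg (x : R) : cos (x / m.+1%:R) ^+ (m.+1 ^ 2) @[m --> \oo] --> expR (- (x ^+ 2 / 2)).
Proof.
have [N0 hN0] : exists N0 : nat, forall m, (N0 <= m)%N -> `|x| / m.+1%:R <= 1.
  exists (Num.bound `|x|) => m hm; rewrite ler_pdivrMr ?ltr0n// mul1r.
  by rewrite (le_trans (ltW (archi_boundP (normr_ge0 x))))// ler_nat ltnW.
have key m : (N0 <= m)%N -> `|cos (x / m.+1%:R) ^+ (m.+1 ^ 2) - expR (- (x ^+ 2 / 2))| <=
    (2 * x ^+ 4) * m.+1%:R^-1.
  move=> /hN0 hm; set t : R := m.+1%:R in hm *; have t0 : 0 < t by rewrite ltr0n.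
  set u := `|x| / t in hm; have u0 : 0 <= u by rewrite divr_ge0// ltW.
  have cE : cos (x / t) = cos u.
    by rewrite -[LHS]cos_norm normrM normfV (gtr0_norm t0).
  have uE : u ^+ 2 = x ^+ 2 / t ^+ 2 by rewrite /u expr_div_n real_normK// num_real.
  have v0 : 0 <= u ^+ 2 / 2 by rewrite divr_ge0// sqr_ge0.
  have eE : expR (- (x ^+ 2 / 2)) = expR (- (u ^+ 2 / 2)) ^+ (m.+1 ^ 2).
    rewrite -expRM_natl uE natrX -/t; congr expR; field.
    by rewrite gt_eqF.
  rewrite cE eE; apply: le_trans (pow_dist _ _ _) _.
  - by rewrite ler_norml cos_geN1 cos_le1.
  - by rewrite ger0_norm ?expR_ge0// -[leRHS]expR0 ler_expR oppr_le0.
  have d : `|cos u - expR (- (u ^+ 2 / 2))| <= 2 * u ^+ 4.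
    have uI : 0 <= u <= 1 by rewrite u0.
    have := cos_quad uI; have := exp_quad v0.
    have -> : u ^+ 4 = u ^+ 2 * u ^+ 2 by rewrite -exprD.
    have := sqr_ge0 (u ^+ 2); rewrite !ler_norml !expr2 => h0 /andP[h1 h2] /andP[h3 h4].
    by apply/andP; split; nra.
  apply: le_trans (ler_wpM2l _ d) _; first by [].
  have uE4 : u ^+ 4 = x ^+ 4 / t ^+ 4.
    by rewrite -[4%N]/(2 * 2)%N exprM uE expr_div_n -!exprM.
  rewrite natrX -/t uE4 (_ : t ^+ 2 * _ = 2 * x ^+ 4 * t ^-2); last by field; rewrite gt_eqF.
  apply: ler_wpM2l; first by rewrite mulr_ge0// exprn_even_ge0.
  rewrite lef_pV2 ?posrE ?exprn_gt0//.
  by rewrite -[leLHS]expr1 ler_weXn2l// ler1n.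
apply/cvgrPdist_lt => e e0.
have c0 : (2 * x ^+ 4) * m.+1%:R^-1 @[m --> \oo] --> (0 : R).
  by rewrite -[X in _ --> X](mulr0 (2 * x ^+ 4)); apply: cvgM; [exact: cvg_cst|exact: cvg_harmonic].
near=> m; rewrite distrC; apply: le_lt_trans (key m _) _; first by near: m; exists N0.
by near: m; exact: (cvgr_lt _ c0).
Unshelve. all: by end_near. Qed.

Lemma ccvg_normc_le (u : nat -> R[i]) (l : R[i]) (a : R) : ccvg u l -> (forall m, normc (u m) <= a) ->
  normc l <= a.
Proof.
move=> ul h; have c := ccvg_normc ul.
by rewrite -(cvg_lim _ c)//; apply: limr_le; [exact: cvgP c|exact: nearW].
Qed.

Lemma fourier_shift f (th xi : V) : fourier (fun x => ec (dotmx x th) * f x) xi = fourier f (xi - th).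
Proof.
rewrite !fourierE; congr cint; apply/funext => x.
rewrite mulrAC -ecD mulrC (dotmxC x (xi - th)) dotmxBl opprB.
by rewrite (dotmxC th) (dotmxC xi).
Qed.

Let fourier_cos (a c : R) (i : 'I_n) N Q : nice Q -> (forall xi, normc (fourier Q xi) <= a) ->
  let Q' x := (cos (c * x ord0 i) ^+ N)%:C%C * Q x in nice Q' /\ forall xi, normc (fourier Q' xi) <= a.
Proof.
move=> nQ aQ; elim: N => [|N [n1 a1]] Q'.
  have -> : Q' = Q by apply/funext => x; rewrite /Q' expr0 mul1r.
  by split.
set Q1 := fun x => _ in n1 a1; have [m1 [B hB] i1] := n1.
have QE : Q' = fun x => (cos (c * x ord0 i))%:C%C * Q1 x.
  by apply/funext => x; rewrite /Q' /Q1 mulrA -rmorphM/= exprS.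
have mc : cmeas (fun x : V => (cos (c * x ord0 i))%:C%C : R[i]) by apply: cmeas_rc; mfun.
have nc x : normc (cos (c * x ord0 i))%:C%C <= 1.
  by rewrite normc_rc ler_norml cos_geN1 cos_le1.
split.
  rewrite QE; split; first exact: cmeasM.
    by exists B => x; rewrite normcM (le_trans _ (hB x))// ler_piMl.
  exact: (cintgMb (B := 1)).
move=> xi; pose th : V := \row_j (if j == i then c / (2 * pi) else 0).
have pi0 : 2 * pi != 0 :> R by rewrite mulf_neq0 ?pnatr_eq0// gt_eqF ?pi_gt0.
have thE x : dotmx x th = c * x ord0 i / (2 * pi).
  rewrite /dotmx (bigD1 i)//= !mxE eqxx big1 ?addr0; last first.
    by move=> j /negbTE ji; rewrite !mxE ji mulr0.
  by rewrite mulrA (mulrC _ c).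
have cE x : (cos (c * x ord0 i))%:C%C = 2^-1%:C%C * (ec (dotmx x th) + ec (dotmx x (- th))).
  rewrite dotmxNr thE /ec mulrN (mulrC (2 * pi)) divfK// /cexpi cosN sinN.
  by apply/eqP; rewrite eq_complex/= !mul0r !subr0 !addr0 subrr mulr0 eqxx andbT; apply/eqP; field.
have fi (t : V) : cintg mu (fun x => ec (dotmx x t) * Q1 x).
  by under eq_fun do rewrite mulrC; apply: cintg_char => //; mdot.
have FE : fourier Q' xi = 2^-1%:C%C * (fourier Q1 (xi - th) + fourier Q1 (xi + th)).
  rewrite QE -fourier_shift -[xi + th]opprK opprD -[- xi - th]opprD opprK -{2}[th]opprK -fourier_shift.
  rewrite !fourierE -cintD; last 2 first.
  - by apply: cintg_char => //; mdot.
  - by apply: cintg_char => //; mdot.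
  rewrite -cintZ; last first.
    by apply: cintgD; apply: cintg_char => //; mdot.
  congr cint; apply/funext => x; rewrite cE; ring.
rewrite FE normcM normc_rc ger0_norm ?invr_ge0//.
have := normcD (fourier Q1 (xi - th)) (fourier Q1 (xi + th)).
have := a1 (xi - th); have := a1 (xi + th).
by move: (normc _) (normc _) (normc _) => p q r; lra.
Qed.

(* Gaussians are limits of powers of cosines, and multiplication by a cosine averages two translates
   of the Fourier transform. *)
Lemma fourier_gauss_le (a c : R) Q : nice Q -> (forall xi, normc (fourier Q xi) <= a) ->
  let Q' x := (expR (- (c * dotmx x x)))%:C%C * Q x in
  0 <= c -> nice Q' /\ forall xi, normc (fourier Q' xi) <= a.
Proof.
(* This [d] gives [exp(-c x^2) = exp(-(d x)^2 / 2)], the limit of [cos(d x / m)^(m^2)]. *)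
move=> nQ aQ Q' c0; pose d := Num.sqrt (2 * c); have d0 : 0 <= d by exact: sqrtr_ge0.
have d2 : d ^+ 2 = 2 * c by rewrite sqr_sqrtr// mulr_ge0.
pose G (s : seq 'I_n) (x : V) := \prod_(i <- s) expR (- ((d * x ord0 i) ^+ 2 / 2)).
have mG s : mfunT (G s).
  elim: s => [|i s IH]; rewrite /G; first by under eq_fun do rewrite big_nil; exact: measurable_cst.
  under eq_fun do rewrite big_cons; apply: measurable_funM => //; mfun.
have G01 s x : 0 <= G s x <= 1.
  rewrite /G; elim: s => [|i s /andP[h1 h2]]; first by rewrite big_nil lexx ler01.
  rewrite big_cons mulr_ge0 ?expR_ge0//= mulr_ile1 ?expR_ge0//.
  by rewrite -expR0 ler_expR oppr_le0 divr_ge0// sqr_ge0.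
suff H s : nice (fun x => (G s x)%:C%C * Q x) /\ forall xi, normc (fourier (fun x => (G s x)%:C%C * Q x) xi) <= a.
  have -> : Q' = fun x => (G (index_enum 'I_n) x)%:C%C * Q x.
    apply/funext => x; rewrite /Q' /G -expR_sum; congr ((expR _)%:C%C * _).
    rewrite /dotmx mulr_sumr -sumrN; apply: eq_bigr => i _.
    by rewrite exprMn d2; field.
  exact: H.
elim: s => [|i s [n1 a1]].
  have -> : (fun x => (G [::] x)%:C%C * Q x) = Q by apply/funext => x; rewrite /G big_nil mul1r.
  by split.
set Q1 := fun x => _ in n1 a1; have [m1 [B hB] i1] := n1.
pose e x := expR (- ((d * x ord0 i) ^+ 2 / 2)).
have me : mfunT e by rewrite /e; mfun.
have e01 x : 0 <= e x <= 1 by rewrite expR_ge0/= -expR0 ler_expR oppr_le0 divr_ge0// sqr_ge0.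
have QE : (fun x => (G (i :: s) x)%:C%C * Q x) = fun x => (e x)%:C%C * Q1 x.
  by apply/funext => x; rewrite /G big_cons rmorphM/= -mulrA.
have n2 : nice (fun x => (e x)%:C%C * Q1 x).
  have ne x : normc (e x)%:C%C <= 1 by have /andP[? ?] := e01 x; rewrite normc_rc ger0_norm.
  split; first by apply: cmeasM => //; exact: cmeas_rc.
    by exists B => x; rewrite normcM (le_trans _ (hB x))// ler_piMl.
  by apply: (cintgMb (B := 1)) => //; exact: cmeas_rc.
rewrite QE; split=> // xi.
have nm m := fourier_cos (d / m.+1%:R) i (m.+1 ^ 2) n1 a1.
apply: (@ccvg_normc_le (fun m => fourier (fun x => (cos (d / m.+1%:R * x ord0 i) ^+ (m.+1 ^ 2))%:C%C * Q1 x) xi));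
  last by move=> m; have [_ ->] := nm m.
rewrite fourierE; under eq_fun do rewrite fourierE.
have mec : cmeas (fun x : V => ec (- dotmx x xi)).
  by apply: cmeas_ec; mdot.
apply: (@cint_dct _ _ _ mu _ _ (fun x => normc (Q1 x))).
- by move=> m; apply: cmeasM => //; have [[]] := nm m.
- by apply: cmeasM => //; have [] := n2.
- move=> x; apply: ccvgM; last exact: ccvg_cst; apply: ccvgM; last exact: ccvg_cst.
  split=> /=; last exact: cvg_cst.
  rewrite (_ : (fun m => _) = fun m => cos (d * x ord0 i / m.+1%:R) ^+ (m.+1 ^ 2)).
    exact: cos_pow_cvg.
  by apply/funext => m; rewrite mulrAC.
- move=> m x; rewrite 2!normcM normc_ec mulr1 normc_rc ler_piMl//.
  by rewrite normrX exprn_ile1// ler_norml cos_geN1 cos_le1.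
- exact: measurable_normc.
- by have [] := i1.
Qed.

End gaussian.

(** * The Bessel weight as an average of Gaussians *)

Section bessel_kernel.
Context {R : realType} {n : nat}.
Local Notation V := 'rV[R]_n.
Local Notation mu := (@lebesgue_rV R n).
Local Notation leb := (@lebesgue_measure R).
Implicit Types (f g Q : V -> R[i]) (w : V -> R) (x y xi : V).

(** Scaling in [t] reduces to [X = 1], so only the finiteness and positivity of the integral matter,
    not its value. With [b = 2 / s] this writes [X^(-s/2)] as an average of exponentials. *)
Lemma subordination (b : R) : 0 < b -> exists2 gam : R, 0 < gam & forall X, 0 < X ->
  (\int[leb]_t (expR (- (`|t| `^ b * X)))%:E = (gam * X `^ (- b^-1))%:E)%E.
Proof.
move=> b0; pose E (t : R) : R := expR (- `|t| `^ b).
have mE : mfunT E by rewrite /E; mfun.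
have E0 t : 0 <= E t by exact: expR_ge0.
(* Makes [(N+1) b >= 2], so that one term of the exponential series bounds [exp(-|t|^b)] by a
   multiple of [t^-2] for [|t| > 1]; a Poisson kernel is then an integrable majorant. *)
pose N := Num.bound (2 / b).
have bN : 2 <= N.+1%:R * b.
  have a0 : 0 <= 2 / b by rewrite divr_ge0 ?(ltW b0).
  have := ltW (archi_boundP a0).
  by rewrite -/N ler_pdivrMr// => /le_trans; apply; rewrite ler_pM2r// ler_nat.
pose c := 1 + N.+1`!%:R : R; have c1 : 1 <= c by rewrite lerDl.
have Ele t : E t <= 2 * c * pi * pker (2 * pi) t.
  have p0 : 0 < pi :> R by exact: pi_gt0.
  have -> : 2 * c * pi * pker (2 * pi) t = 2 * c / (1 + t ^+ 2).
    have t1 : 1 + t ^+ 2 != 0 by rewrite gt_eqF// ltr_wpDr// sqr_ge0.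
    rewrite /pker (_ : (2 * pi) ^+ 2 + _ = 4 * pi ^+ 2 * (1 + t ^+ 2)); last by ring.
    have pN : pi != 0 :> R by rewrite gt_eqF.
    clearbody c; by move: (1 + t ^+ 2) (pi : R) t1 pN {p0} => T q t1 pN; field; rewrite ?t1 ?pN.
  rewrite ler_pdivlMr ?ltr_wpDr ?sqr_ge0//.
  have [t1|t1] := leP `|t| 1.
    have : E t <= 1 by rewrite -expR0 ler_expR oppr_le0 powR_ge0.
    have : t ^+ 2 <= 1 by rewrite -real_normK ?num_real// exprn_ile1.
    by have := E0 t; have := sqr_ge0 t; nra.
  have t0 : 0 < `|t| by exact: lt_trans t1.
  have Et : E t <= N.+1`!%:R / t ^+ 2.
    rewrite /E expRN -[leRHS]invrK lef_pV2 ?posrE ?expR_gt0//; last first.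
      by rewrite invr_gt0 divr_gt0 ?ltr0n ?fact_gt0// -real_normK ?num_real// exprn_gt0.
    have := @expR_ge1Dxn R (`|t| `^ b) N (powR_ge0 _ _); apply: le_trans.
    rewrite invf_div -[leLHS]add0r lerD// ler_wpM2r ?invr_ge0//.
    rewrite -[leRHS]powR_mulrn ?powR_ge0// -powRrM mulrC -real_normK ?num_real//.
    by rewrite -powR_mulrn// ler_powR ?(ltW t1).
  have t2 : 1 <= t ^+ 2 by rewrite -real_normK ?num_real// exprn_ege1 ?(ltW t1).
  have h : E t * t ^+ 2 <= N.+1`!%:R by rewrite -ler_pdivlMr// (lt_le_trans _ t2).
  have f0 : 0 <= N.+1`!%:R :> R by [].
  by have := E0 t; rewrite /c; nra.
have I0 : (0 <= \int[leb]_t (E t)%:E)%E by apply: int_ge0 => t.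
have Ifin : (\int[leb]_t (E t)%:E < +oo)%E.
  apply: (le_lt_via (\int[leb]_t (2 * c * pi * pker (2 * pi) t)%:E)%E).
    by apply: nn_le => t; rewrite lee_fin.
  have pp : 0 < 2 * pi :> R by rewrite mulr_gt0 ?pi_gt0.
  rewrite nnZr; last 3 first.
  - by rewrite !mulr_ge0 ?pi_ge0 ?(le_trans _ c1).
  - exact: measurable_pker.
  - by move=> t; exact: pker_ge0.
  by rewrite int_pker// mule1 ltry.
pose gam := fine (\int[leb]_t (E t)%:E)%E.
have gE : (\int[leb]_t (E t)%:E = gam%:E)%E by rewrite fineK// ge0_fin_numE.
exists gam.
  rewrite -lte_fin -gE; apply: (lt_le_via (\int[leb]_t (expR (-1) * \1_`[(-1)%R, 1%R] t)%:E)%E).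
    rewrite nnZr ?expR_ge0//.
    have lI : leb `[(-1)%R, 1%R]%classic = 2%:E.
      rewrite lebesgue_measure_itv/= lte_fin (lt_trans (ltrN10 _) ltr01) -EFinB opprK.
      by rewrite -natr1 add0r || congr EFin.
    have -> : (\int[leb]_x (\1_`[(-1)%R, 1%R]%classic x)%:E = 2%:E)%E.
      by rewrite integral_indic// setIT.
    by rewrite -EFinM lte_fin mulr_gt0// expR_gt0.
  apply: nn_le => t; first by rewrite lee_fin mulr_ge0 ?expR_ge0// indicE.
  rewrite lee_fin indicE mem_setE in_itv/= -ler_norml; case: (leP `|t| 1) => h /=.
    rewrite mulr1 ler_expR lerN2 -[leRHS](_ : 1 `^ b = 1); last by rewrite powR1.
    by rewrite ge0_ler_powR ?nnegrE ?(ltW b0).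
  by rewrite mulr0.
move=> X X0; pose k := X `^ b^-1; have k0 : 0 < k by rewrite powR_gt0.
have kb : k `^ b = X by rewrite -powRrM mulVf ?gt_eqF// powRr1 ?ltW.
have EE t : expR (- (`|t| `^ b * X)) = E (k * t + 0).
  by rewrite /E addr0 normrM (gtr0_norm k0) powRM ?(ltW k0)// kb mulrC.
under eq_integral do rewrite EE.
have kN : k != 0 by rewrite gt_eqF.
rewrite (int1_affine 0 kN (f := fun t => (E t)%:E))//; last exact/measurable_EFinP.
by rewrite gE -EFinM gtr0_norm// powRN mulrC.
Qed.

(** Cauchy-Schwarz for [F] written as [F / sqrt E] times [sqrt E], with [P] the mass of [E]. *)
Lemma cs_int (P X : R) (E F : R -> R) : 0 < P -> 0 <= X -> mfunT E ->
  mfunT F -> (forall t, 0 < E t) -> (forall t, 0 <= F t) ->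
  (\int[leb]_t (E t)%:E = P%:E)%E -> (X%:E <= \int[leb]_t (F t)%:E)%E ->
  ((X ^+ 2)%:E <= P%:E * \int[leb]_t (F t ^+ 2 / E t)%:E)%E.
Proof.
move=> P0 X0 mE mF E0 F0 EP XF; set Q := (\int[leb]_t (F t ^+ 2 / E t)%:E)%E.
have q0 t : 0 <= F t ^+ 2 / E t by rewrite divr_ge0 ?sqr_ge0// ltW.
have Q0 : (0 <= Q)%E by apply: int_ge0 => t.
have [Qf|] := ltP Q +oo%E; last by rewrite leye_eq => /eqP ->; rewrite gt0_muley ?leey ?lte_fin.
have QE : Q = (fine Q)%:E by rewrite fineK// ge0_fin_numE.
rewrite QE -EFinM lee_fin; apply: amgm_sqr; rewrite ?(ltW P0) ?fine_ge0// => c c0.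
rewrite -lee_fin; apply: (le_trans XF).
apply: (le_via (\int[leb]_t (2^-1 * (c * E t + c^-1 * (F t ^+ 2 / E t)))%:E)%E).
  apply: nn_le => t; first by rewrite lee_fin.
  rewrite lee_fin -subr_ge0 (_ : _ - _ = 2^-1 * ((c * E t - F t) ^+ 2 / (c * E t))).
    by rewrite mulr_ge0 ?invr_ge0// divr_ge0 ?sqr_ge0// mulr_ge0 ?ltW.
  by field; rewrite !gt_eqF.
have mq : mfunT (fun t => F t ^+ 2 / E t) by mfun.
have p1 t : 0 <= c * E t by rewrite mulr_ge0 ?ltW.
have p2 t : 0 <= c^-1 * (F t ^+ 2 / E t) by rewrite mulr_ge0// invr_ge0 ltW.
rewrite nnZr//; last 2 first.
- by apply: measurable_funD; apply: measurable_funM => //; exact: measurable_cst.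
- by move=> t; rewrite addr_ge0.
rewrite nnD//; last 2 first.
- by apply: measurable_funM => //; exact: measurable_cst.
- by apply: measurable_funM => //; exact: measurable_cst.
rewrite nnZr ?(ltW c0)//; last by move=> t; rewrite ltW.
rewrite nnZr ?invr_ge0 ?(ltW c0)// !EFinM EFinD !EFinM; apply: le_of_eq.
by congr (_ * (_ * _ + _ * _))%E; [exact: EP|rewrite -QE].
Qed.

(** Minkowski's integral inequality in L^2(w), in squared form: [E] dominates the norms of the
    slices, one factor [P] comes from Cauchy-Schwarz in [t] and the other from integrating [E]. *)
Lemma subordinate_L2 (gam P kap : R) (J : \bar R) (X w : V -> R) (F : V -> R -> R) (E : R -> R) :
  0 < gam -> 0 < P -> 0 <= kap -> (0 <= J)%E ->
  mfunT X -> (forall x, 0 <= X x) -> mfunT w -> (forall x, 0 <= w x) ->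
  mfunT (fun z : V * measurableTypeR R => F z.1 z.2) -> (forall x t, 0 <= F x t) ->
  mfunT E -> (forall t, 0 < E t) -> (\int[leb]_t (E t)%:E = P%:E)%E ->
  (forall x, ((gam * X x)%:E <= \int[leb]_t (F x t)%:E)%E) ->
  (forall t, \int[mu]_x (F x t ^+ 2 * w x)%:E <= (kap * E t ^+ 2)%:E * J)%E ->
  ((gam ^+ 2)%:E * \int[mu]_x (X x ^+ 2 * w x)%:E <= (P * P * kap)%:E * J)%E.
Proof.
move=> gam0 P0 kap0 J0 mX X0 mw w0 mF2 F0 mE E0 EP XF ub.
have mF x : mfunT (F x).
  exact: measurableT_comp mF2 (measurable_fun_pair (measurable_cst x) (@measurable_id _ (measurableTypeR R) setT)).
have mFt t : mfunT (F ^~ t).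
  exact: measurableT_comp mF2 (measurable_fun_pair (@measurable_id _ V setT) (measurable_cst (t : measurableTypeR R))).
have gX0 x : 0 <= gam * X x by rewrite mulr_ge0// ltW.
have FE0 x t : 0 <= F x t ^+ 2 / E t * w x by rewrite mulr_ge0// divr_ge0 ?sqr_ge0// ltW.
have mFE : mfunT (fun z : V * measurableTypeR R => F z.1 z.2 ^+ 2 / E z.2 * w z.1).
  have m1 := @measurable_fst _ _ V (measurableTypeR R).
  have m2 := @measurable_snd _ _ V (measurableTypeR R).
  apply: measurable_funM; last exact: measurableT_comp mw m1.
  apply: measurable_funM; first exact: measurable_funX.
  by apply: measurable_invl; exact: measurableT_comp mE m2.
rewrite -nnZr ?sqr_ge0//; last 2 first.
- by mfun.
- by move=> x; rewrite mulr_ge0 ?exprn_ge0.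
apply: (le_via (P%:E * \int[mu]_x \int[leb]_t (F x t ^+ 2 / E t * w x)%:E)%E).
  rewrite -nnZ ?(ltW P0)//; last 2 first.
  - by apply: (measurable_fun_tonelli leb (F := fun x t => (F x t ^+ 2 / E t * w x)%:E)) => //; exact/measurable_EFinP.
  - by move=> x; apply: int_ge0 => t.
  apply: nn_le => x; first by rewrite lee_fin !mulr_ge0 ?exprn_ge0 ?(ltW gam0).
  rewrite (_ : (fun t => (F x t ^+ 2 / E t * w x)%:E) = fun t => (w x * (F x t ^+ 2 / E t))%:E); last first.
    by apply/funext => t; rewrite mulrC.
  rewrite nnZr//; last 2 first.
  - by apply: measurable_funM; [exact: (measurable_funX _ (mF x))|exact: measurable_invl].
  - by move=> t; rewrite divr_ge0 ?sqr_ge0// ltW.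
  rewrite mulrA -exprMn mulrC EFinM muleCA lee_wpmul2l ?lee_fin//.
  exact: cs_int (XF x).
rewrite (@tonelli _ _ _ _ _ mu leb (fun x t => (F x t ^+ 2 / E t * w x)%:E))//; last first.
  exact/measurable_EFinP.
apply: (le_via (P%:E * \int[leb]_t ((E t)%:E * (kap%:E * J)))%E).
  rewrite lee_wpmul2l ?lee_fin ?(ltW P0)//; apply: nn_le => t.
    by apply: int_ge0 => x.
  rewrite (_ : (fun x => _) = fun x => ((E t)^-1 * (F x t ^+ 2 * w x))%:E); last first.
    by apply/funext => x; congr EFin; ring.
  rewrite nnZr//; last 3 first.
  - by rewrite invr_ge0 ltW.
  - by apply: measurable_funM => //; exact: measurable_funX.
  - by move=> x; rewrite mulr_ge0 ?sqr_ge0.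
  apply: (le_via ((E t)^-1%:E * ((kap * E t ^+ 2)%:E * J))%E).
    by rewrite lee_wpmul2l ?lee_fin ?invr_ge0 ?(ltW (E0 t))//; exact: ub.
  rewrite !muleA -!EFinM lee_wpmul2r// lee_fin; apply: le_of_eq.
  by field; rewrite gt_eqF.
have kJ0 : (0 <= kap%:E * J)%E by rewrite mule_ge0.
rewrite ge0_integralZr//; last 2 first.
- exact/measurable_EFinP.
- by move=> t _; rewrite lee_fin ltW.
by rewrite EP !muleA -!EFinM.
Qed.

Definition jap y : R := 1 + 4 * pi ^+ 2 * dotmx y y.

Lemma dotmx_ge0 y : 0 <= dotmx y y.
Proof. by apply: sumr_ge0 => i _; rewrite -expr2 sqr_ge0. Qed.

Lemma jap_ge1 y : 1 <= jap y.
Proof.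
have p : 0 <= 4 * pi ^+ 2 :> R by rewrite mulr_ge0// sqr_ge0.
by rewrite /jap lerDl mulr_ge0// dotmx_ge0.
Qed.

Lemma jap_gt0 y : 0 < jap y. Proof. exact: lt_le_trans (jap_ge1 y). Qed.

Lemma measurable_jap : mfunT jap.
Proof. by apply: measurable_funD; [mfun|apply: measurable_funM; [mfun|mdot]]. Qed.

(** The symbol of [(I - Delta)^(-s/2)]; since the kernels are studied in position space, it acts
    there as a plain weight, and [winv (- s)] is its inverse. *)
Definition winv (s : R) y : R[i] := (jap y `^ (- (s / 2)))%:C%C.

Lemma cvg_dotmx (u : nat -> V) x : vcvg u x -> dotmx (u k) (u k) @[k --> \oo] --> dotmx x x.
Proof.
move=> ux; rewrite /dotmx.
have H (s : seq 'I_n) : \sum_(i <- s) u k ord0 i * u k ord0 i @[k --> \oo] -->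
    \sum_(i <- s) x ord0 i * x ord0 i.
  elim: s => [|i s IH]; first by rewrite big_nil; under eq_fun do rewrite big_nil; exact: cvg_cst.
  rewrite big_cons; under eq_fun do rewrite big_cons.
  by apply: cvgD => //; apply: cvgM.
exact: H.
Qed.

Lemma cvg_jap (u : nat -> V) x : vcvg u x -> jap (u k) @[k --> \oo] --> jap x.
Proof. by move=> /cvg_dotmx h; apply: cvgD; [exact: cvg_cst|apply: cvgM => //; exact: cvg_cst]. Qed.

Lemma cscont_winv s : cscont (winv s).
Proof.
apply/cscontP => u x ux; split; last exact: cvg_cst.
have jE y : jap y `^ (- (s / 2)) = expR (- (s / 2) * ln (jap y)) by rewrite /powR gt_eqF ?jap_gt0.
rewrite /= jE; under eq_fun do rewrite /= jE.
apply: continuous_cvg; first exact: continuous_expR.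
apply: cvgM; first exact: cvg_cst.
by apply: continuous_cvg; [exact/continuous_ln/jap_gt0|exact: cvg_jap].
Qed.

Lemma normc_winv_le1 s y : 0 <= s -> normc (winv s y) <= 1.
Proof.
move=> s0; rewrite normc_rc ger0_norm ?powR_ge0// powRN invf_le1 ?powR_gt0 ?jap_gt0//.
rewrite -[leLHS](_ : 1 `^ (s / 2) = 1); last by rewrite powR1.
by rewrite ge0_ler_powR ?nnegrE ?divr_ge0 ?jap_ge1// ltW ?jap_gt0.
Qed.

Lemma nice_mulb (a : V -> R[i]) Q : cmeas a -> (forall y, normc (a y) <= 1) -> nice Q ->
  nice (fun y => a y * Q y).
Proof.
move=> ma a1 [m [B hB] i]; split; first exact: cmeasM.
  by exists B => y; rewrite normcM (le_trans _ (hB y))// ler_piMl.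
exact: (cintgMb (B := 1)).
Qed.

Lemma cscontM (a : V -> R[i]) Q : cscont a -> cscont Q -> cscont (fun y => a y * Q y).
Proof.
by move=> ca cQ; apply/cscontP => u x ux; apply: ccvgM; exact: (cscontP _).1.
Qed.

Section pieces.
Variables (s : R) (Q : V -> R[i]).
Hypotheses (s0 : 0 < s) (nQ : nice Q) (cQ : cscont Q).

Let b : R := 2 / s.
Let b0 : 0 < b. Proof. by rewrite divr_gt0. Qed.

Definition subk (t : R) y : R[i] := (expR (- (`|t| `^ b * jap y)))%:C%C.

Lemma cmeas_subk2 : cmeas (fun z : measurableTypeR R * V => subk z.1 z.2).
Proof.
have m1 := @measurable_fst _ _ (measurableTypeR R) V.
have m2 := measurableT_comp measurable_jap (@measurable_snd _ _ (measurableTypeR R) V).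
apply: cmeas_rc; apply: measurable_expRl; apply: measurable_opprl; apply: measurable_funM => //.
exact/measurable_powRl/measurable_normrl.
Qed.

Lemma normc_subk t y : normc (subk t y) <= 1.
Proof.
rewrite normc_rc ger0_norm ?expR_ge0// -[leRHS]expR0 ler_expR oppr_le0.
by rewrite mulr_ge0 ?powR_ge0// ltW ?jap_gt0.
Qed.

Lemma cscont_subk t : cscont (subk t).
Proof.
apply/cscontP => u x ux; split; last exact: cvg_cst.
apply: continuous_cvg; first exact: continuous_expR.
by apply: cvgN; apply: cvgM; [exact: cvg_cst|exact: cvg_jap].
Qed.

Let cmeas_subk t : cmeas (subk t).
Proof. exact: cmeas_fix cmeas_subk2. Qed.

Lemma nice_subk t : nice (fun y => subk t y * Q y).
Proof. by apply: nice_mulb => // y; exact: normc_subk. Qed.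

Lemma fourier_subk (a : R) t xi : (forall xi, normc (fourier Q xi) <= a) ->
  normc (fourier (fun y => subk t y * Q y) xi) <= expR (- (`|t| `^ b)) * a.
Proof.
move=> aQ; have [|n1 a1] := @fourier_gauss_le R n a (`|t| `^ b * (4 * pi ^+ 2)) Q nQ aQ.
  have p : 0 <= 4 * pi ^+ 2 :> R by rewrite mulr_ge0// sqr_ge0.
  by rewrite mulr_ge0// powR_ge0.
set Q1 := fun y => _ in n1 a1; have [_ _ i1] := n1.
have -> : (fun y => subk t y * Q y) = fun y => (expR (- (`|t| `^ b)))%:C%C * Q1 y.
  apply/funext => y; rewrite /subk /Q1 mulrA -rmorphM/= -expRD; congr ((expR _)%:C%C * _).
  by rewrite /jap; ring.
rewrite fourierE; under eq_fun do rewrite -mulrA.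
rewrite cintZ; last by apply: cintg_char => //; mdot.
rewrite -fourierE normcM normc_rc ger0_norm ?expR_ge0//.
by rewrite ler_wpM2l ?expR_ge0.
Qed.

Variable gam : R.
Hypothesis gam0 : 0 < gam.
Hypothesis subE : forall X, 0 < X ->
  (\int[leb]_t (expR (- (`|t| `^ b * X)))%:E = (gam * X `^ (- b^-1))%:E)%E.

Let winvE y : (\int[leb]_t (normc (subk t y))%:E = (gam * jap y `^ (- (s / 2)))%:E)%E.
Proof.
under eq_integral do rewrite normc_rc ger0_norm ?expR_ge0//.
by rewrite subE ?jap_gt0// /b invf_div.
Qed.

(** Fubini for the subordination formula. The inner map [h] allows the reflected translates that
    occur in convolutions. *)
Lemma cint_subk (h : V -> V) (F : V -> R[i]) : mfunT h -> cintg mu F ->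
  gam%:C%C * cint mu (fun y => winv s (h y) * F y) =
  cint leb (fun t => cint mu (fun y => subk t (h y) * F y)).
Proof.
move=> mh Fi; have [mF Fl] := Fi.
pose H (t : measurableTypeR R) y := subk t (h y) * F y.
have mH : cmeas (fun z => H z.1 z.2).
  have m2 := @measurable_snd _ _ (measurableTypeR R) V.
  apply: cmeasM.
    apply: (cmeas_comp cmeas_subk2 (h := fun z : measurableTypeR R * V => (z.1, h z.2))).
    by apply: measurable_fun_pair => //; exact: measurableT_comp mh m2.
  by apply: (cmeas_comp mF); exact: (@measurable_snd _ _ (measurableTypeR R) V).
have I1 t : (\int[mu]_y (normc (H t y))%:E < +oo)%E.
  by have [_] := cintgMb Fi (cmeas_comp (cmeas_subk t) mh) (fun y => normc_subk t (h y)).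
have I2E y : (\int[leb]_t (normc (H t y))%:E = (gam * jap (h y) `^ (- (s / 2)) * normc (F y))%:E)%E.
  under eq_integral do rewrite normcM mulrC.
  rewrite nnZr//; last by apply: measurable_normc; exact: cmeas_fix2 cmeas_subk2.
  by rewrite winvE -EFinM mulrC.
have g1 y : gam * jap (h y) `^ (- (s / 2)) * normc (F y) <= gam * normc (F y).
  rewrite ler_wpM2r// ler_piMr ?(ltW gam0)//.
  by have := normc_winv_le1 (h y) (ltW s0); rewrite normc_rc ger0_norm ?powR_ge0.
have I3 : (\int[leb]_t \int[mu]_y (normc (H t y))%:E < +oo)%E.
  rewrite (@tonelli _ _ _ _ _ leb mu (fun t y => (normc (H t y))%:E)); last 2 first.
  - by apply/measurable_EFinP; exact: measurable_normc mH.
  - by move=> t y; rewrite lee_fin.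
  under eq_integral do rewrite I2E.
  apply: (le_lt_via (\int[mu]_y (gam * normc (F y))%:E)%E).
    by apply: nn_le => y; rewrite lee_fin// !mulr_ge0 ?powR_ge0 ?(ltW gam0).
  by apply: nnZr_lty; rewrite ?(ltW gam0)//; exact: measurable_normc.
rewrite [RHS](cfubini (m1 := leb) (m2 := mu) mH)//.
- rewrite -cintZ; last first.
    by apply: (cintgMb (B := 1)) => //; [exact: cmeas_comp (cscont_cmeas (cscont_winv _)) mh|move=> y; exact/normc_winv_le1/ltW].
  congr cint; apply/funext => y; rewrite mulrA.
  have si : cintg leb (fun t => subk t (h y)).
    by split; [exact: cmeas_fix2 cmeas_subk2|rewrite winvE ltry].
  rewrite /H cintZr//; congr (_ * _).
  rewrite /cint /= (_ : \int[leb]_x 0 = 0); last by rewrite /Rintegral integral0.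
  by rewrite /Rintegral subE ?jap_gt0// /b invf_div /winv -rmorphM.
- by move=> y; rewrite I2E ltry.
Qed.

Let cmeas_cint_subk (F : V -> R[i]) : cmeas F ->
  cmeas (fun t : measurableTypeR R => cint mu (fun y => subk t y * F y)).
Proof.
move=> mF; apply: (cmeas_param mu (F := fun (t : measurableTypeR R) y => subk t y * F y)).
apply: cmeasM; first exact: cmeas_subk2.
by apply: (cmeas_comp mF); exact: (@measurable_snd _ _ (measurableTypeR R) V).
Qed.

(** [winv s] is an average of Gaussian factors, none of which increases the sup norm of the
    transform. *)
Lemma fourier_winv_le (a : R) xi : (forall xi, normc (fourier Q xi) <= a) ->
  normc (fourier (fun y => winv s y * Q y) xi) <= a.
Proof.
move=> aQ; have [mQ _ Qi] := nQ.
have a0 : 0 <= a by exact: le_trans (normc_ge0 _) (aQ 0).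
have Fi : cintg mu (fun y => Q y * ec (- dotmx y xi)).
  by apply: cintg_char => //; mdot.
have [mF _] := Fi.
have ib : (\int[leb]_t (normc (cint mu (fun y => subk t y * (Q y * ec (- dotmx y xi)))))%:E <=
    (gam * a)%:E)%E.
  apply: (le_via (\int[leb]_t (a * expR (- (`|t| `^ b * 1)))%:E)%E).
    apply: nn_le => t; rewrite lee_fin// mulr1 mulrC.
    have := fourier_subk t xi aQ; rewrite fourierE.
    by under [in X in X -> _]eq_fun do rewrite -mulrA.
  rewrite nnZr//; last by mfun.
  by rewrite subE// powR1 mulr1 -EFinM mulrC.
rewrite -(ler_pM2l gam0) -{1}(gtr0_norm gam0) -normc_rc -normcM fourierE.
under eq_fun do rewrite -mulrA.
rewrite (cint_subk (@measurable_id _ V setT))// -lee_fin; apply: (le_trans _ ib); apply: le_cint.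
split; first exact: cmeas_cint_subk.
by apply: le_lt_trans ib _; exact: ltry.
Qed.

Variables (r : R).
Hypothesis r1 : 1 < r.

(* On the support of [Q] the Gaussian factors decay like [expR (- q * `|t| `^ b)] in [L^2], which is
   where the factor [(sc (- m) ^+ 2) `^ (- s)] comes from after integration in [t]. *)
Lemma bessel_kernel (C : R) f w (m : int) (a D Bw : R) : nice f ->
  (forall x, sc (- m) <= `|x| -> Q x = 0) -> (forall x, dotmx x x < (sc (- m) / 4) ^+ 2 -> Q x = 0) ->
  (forall xi, normc (fourier Q xi) <= a) ->
  ((sc (- m) ^+ n)%:E * \int[mu]_x (normc (Q x) ^+ 2)%:E <= D%:E)%E ->
  mfunT w -> (forall x, 0 <= w x <= Bw) -> 0 <= C ->
  (forall k D', nice k -> cscont k -> (forall x, sc (- m) <= `|x| -> k x = 0) ->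
    (forall xi, normc (fourier k xi) <= a) ->
    ((sc (- m) ^+ n)%:E * \int[mu]_x (normc (k x) ^+ 2)%:E <= D'%:E)%E ->
    (\int[mu]_x (normc (convol k f x) ^+ 2 * w x)%:E <= (C * ((a ^+ 2) `^ (1 - r^-1) * D' `^ r^-1))%:E *
     \int[mu]_x (normc (f x) ^+ 2 * Mr r w x)%:E)%E) ->
  (\int[mu]_x (normc (convol (fun y => winv s y * Q y) f x) ^+ 2 * w x)%:E <=
   (C * (r^-1 * pi ^+ 2 / 4) `^ (- s) * (sc (- m) ^+ 2) `^ (- s) *
     ((a ^+ 2) `^ (1 - r^-1) * D `^ r^-1))%:E * \int[mu]_x (normc (f x) ^+ 2 * Mr r w x)%:E)%E.
Proof.
move=> nf sQ sQ' aQ DQ mw wB C0 WP.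
have [mQ [BQ hBQ] Qi] := nQ; have [mf [Bf hBf] fi] := nf.
have w0 x : 0 <= w x by have /andP[] := wB x.
have a0 : 0 <= a by exact: le_trans (normc_ge0 _) (aQ 0).
have Q20 : (0 <= \int[mu]_x (normc (Q x) ^+ 2)%:E)%E.
  by apply: int_ge0 => x; rewrite exprn_ge0.
have D0 : 0 <= D by rewrite -lee_fin (le_trans _ DQ)// mule_ge0// lee_fin exprn_ge0.
have rV0 : 0 < r^-1 by rewrite invr_gt0 (lt_trans ltr01).
set J := (\int[mu]_x (normc (f x) ^+ 2 * Mr r w x)%:E)%E.
have J0 : (0 <= J)%E by apply: int_ge0 => x; rewrite mulr_ge0 ?exprn_ge0 ?powR_ge0.
set S := sc (- m) in sQ sQ' DQ WP *; have S0 : 0 < S :> R by exact: sc_gt0.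
(* On the support of [Q] one has [|x| >= S / 4], so [jap x >= pi^2 S^2 / 4], and the square in the
   L^2 norm doubles the exponent. *)
pose q : R := pi ^+ 2 / 2 * S ^+ 2.
have q0 : 0 < q by rewrite mulr_gt0 ?exprn_gt0// divr_gt0 ?exprn_gt0 ?pi_gt0.
(* The power [1/r] in the interpolated bound divides [q] by [r]; the further 2 lets [E t ^+ 2] carry
   the whole decay. *)
pose q' := r^-1 * q / 2; have q'0 : 0 < q' by rewrite divr_gt0// mulr_gt0.
pose E (t : R) : R := expR (- (`|t| `^ b * q')).
have E0 t : 0 < E t by exact: expR_gt0.
have mE : mfunT E by rewrite /E; mfun.
pose P := gam * q' `^ (- b^-1); have P0 : 0 < P by rewrite mulr_gt0// powR_gt0.
have EP : (\int[leb]_t (E t)%:E = P%:E)%E by exact: subE.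
pose K t y := subk t y * Q y.
have nK t : nice (K t) by exact: nice_subk.
have cK t : cscont (K t) by apply: cscontM => //; exact: cscont_subk.
have KE t : ((S ^+ n)%:E * \int[mu]_x (normc (K t x) ^+ 2)%:E <= (D * expR (- (`|t| `^ b * q)))%:E)%E.
  apply: (le_via ((S ^+ n)%:E * \int[mu]_x (expR (- (`|t| `^ b * q)) * normc (Q x) ^+ 2)%:E)%E).
    rewrite lee_wpmul2l ?lee_fin ?exprn_ge0 ?(ltW S0)//; apply: nn_le => x.
      by rewrite lee_fin exprn_ge0.
    rewrite lee_fin normcM exprMn; have [h|h] := ltP (dotmx x x) ((S / 4) ^+ 2).
      by rewrite sQ'// normc0 expr0n !mulr0.
    rewrite ler_wpM2r ?exprn_ge0// normc_rc ger0_norm ?expR_ge0// -expRM_natl ler_expR.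
    rewrite mulrN lerN2 (mulrCA 2) ler_wpM2l ?powR_ge0// /jap /q.
    have p0 : 0 <= pi ^+ 2 :> R by exact: sqr_ge0.
    have : pi ^+ 2 * (S / 4) ^+ 2 <= pi ^+ 2 * dotmx x x by rewrite ler_wpM2l.
    have -> : pi ^+ 2 / 2 * S ^+ 2 = 8 * (pi ^+ 2 * (S / 4) ^+ 2) by field.
    by rewrite -(mulrA 4); move: (pi ^+ 2 * _) (pi ^+ 2 * _) => u v; lra.
  rewrite nnZr ?expR_ge0//; last 2 first.
  - exact/measurable_funX/measurable_normc.
  - by move=> x; rewrite exprn_ge0.
  by rewrite muleCA EFinM muleC lee_wpmul2r ?lee_fin ?expR_ge0.
have ub t : (\int[mu]_x (normc (convol (K t) f x) ^+ 2 * w x)%:E <=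
    (C * ((a ^+ 2) `^ (1 - r^-1) * D `^ r^-1) * E t ^+ 2)%:E * J)%E.
  have aK xi : normc (fourier (K t) xi) <= a.
    by apply: le_trans (fourier_subk t xi aQ) _; rewrite ler_piMl// -[leRHS]expR0 ler_expR oppr_le0 powR_ge0.
  apply: le_trans (WP (K t) _ (nK t) (cK t) _ aK (KE t)) _.
    by move=> x /sQ h; rewrite /K h mulr0.
  rewrite lee_wpmul2r// lee_fin powRM ?expR_ge0//; apply: le_of_eq.
  rewrite -mulrA; congr (_ * _); rewrite -mulrA; congr (_ * (_ * _)).
  have pE v : expR v `^ r^-1 = expR (r^-1 * v) by rewrite /powR gt_eqF ?expR_gt0// expRK.
  rewrite pE /E -expRM_natl; congr expR; rewrite /q'.
  clearbody q; by move: (`|t| `^ b) (r^-1) => u v; field.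
pose X x := normc (convol (fun y => winv s y * Q y) f x).
pose F x t := normc (convol (K t) f x).
have mF2 : mfunT (fun z : V * measurableTypeR R => F z.1 z.2).
  apply: measurable_normc.
  have m1 := @measurable_fst _ _ V (measurableTypeR R).
  have m2 := @measurable_snd _ _ V (measurableTypeR R).
  apply: (cmeas_param mu (F := fun (z : V * measurableTypeR R) y => subk z.2 (z.1 - y) * Q (z.1 - y) * f y)).
  have mz : mfunT (fun u : (V * measurableTypeR R) * V => u.1.1 - u.2).
    apply: measurable_addV; first exact: measurableT_comp m1 measurable_fst.
    apply: measurable_oppV; exact: measurable_snd.
  apply: cmeasM; last by apply: (cmeas_comp mf); exact: measurable_snd.
  apply: cmeasM; last exact: (cmeas_comp mQ).
  apply: (cmeas_comp cmeas_subk2 (h := fun u : (V * measurableTypeR R) * V => (u.1.2, u.1.1 - u.2))).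
  by apply: measurable_fun_pair => //; exact: measurableT_comp m2 measurable_fst.
have mF x : mfunT (F x).
  have := measurableT_comp mF2 (measurable_fun_pair (measurable_cst x) (@measurable_id _ (measurableTypeR R) setT)).
  by [].
have XF x : ((gam * X x)%:E <= \int[leb]_t (F x t)%:E)%E.
  have ci : cintg mu (fun y => Q (x - y) * f y) by exact: cintg_conv hBQ fi.
  have mxy : mfunT (fun y : V => x - y) by mfun.
  have cE : gam%:C%C * convol (fun y => winv s y * Q y) f x = cint leb (fun t => convol (K t) f x).
    rewrite /convol; under eq_fun do rewrite -mulrA.
    rewrite (_ : (fun t => _) = fun t => cint mu (fun y => subk t (x - y) * (Q (x - y) * f y))).
      exact: (cint_subk mxy ci).
    by apply/funext => t; congr (cint mu _); apply/funext => y; rewrite /K mulrA.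
  have [Ff|] := ltP (\int[leb]_t (F x t)%:E)%E +oo%E; last by rewrite leye_eq => /eqP ->; rewrite leey.
  rewrite /X -{1}(gtr0_norm gam0) -normc_rc -normcM cE; apply: le_cint; split => //.
  apply: (cmeas_param mu (F := fun (t : measurableTypeR R) y => K t (x - y) * f y)).
  have m2 := @measurable_snd _ _ (measurableTypeR R) V.
  have mx2 : mfunT (fun z : measurableTypeR R * V => x - z.2) by exact: measurableT_comp mxy m2.
  apply: cmeasM; last by apply: (cmeas_comp mf).
  apply: cmeasM; last exact: (cmeas_comp mQ).
  apply: (cmeas_comp cmeas_subk2 (h := fun z : measurableTypeR R * V => (z.1, x - z.2))).
  by apply: measurable_fun_pair => //; exact: measurable_fst.
pose kap := C * ((a ^+ 2) `^ (1 - r^-1) * D `^ r^-1).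
have kap0 : 0 <= kap by rewrite !mulr_ge0 ?powR_ge0.
rewrite -(@lee_pmul2l _ (gam ^+ 2)%:E)// ?lte_fin ?exprn_gt0//.
have mX : mfunT X.
  apply/measurable_normc/cmeas_conv => //.
  by apply: cmeasM => //; exact: cscont_cmeas (cscont_winv _).
apply: le_trans (subordinate_L2 gam0 P0 kap0 J0 mX (fun x => normc_ge0 _) mw w0 mF2
  (fun x t => normc_ge0 _) mE E0 EP XF ub) _.
rewrite muleA -EFinM lee_wpmul2r// lee_fin; apply: le_of_eq.
have PE : P * P = gam ^+ 2 * ((r^-1 * pi ^+ 2 / 4) `^ (- s) * (S ^+ 2) `^ (- s)).
  rewrite -powRM ?sqr_ge0//; last first.
    by rewrite divr_ge0// mulr_ge0 ?sqr_ge0// ltW.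
  have -> : r^-1 * pi ^+ 2 / 4 * S ^+ 2 = q' by rewrite /q' /q; field; rewrite gt_eqF ?(lt_trans ltr01 r1).
  rewrite /P mulrACA -expr2; congr (_ * _); rewrite -powRD; last by rewrite (gt_eqF q'0) implybT.
  by congr (_ `^ _); rewrite /b invf_div; field.
by rewrite PE /kap; ring.
Qed.

End pieces.

End bessel_kernel.

Local Notation annular Psi := (forall xi, fourier Psi xi != 0 -> 4^-1 < dotmx xi xi < 4).

(** * Level sets and the Lorentz norm *)

Section lorentz.
Context {R : realType} {n : nat}.
Local Notation V := 'rV[R]_n.
Local Notation mu := (@lebesgue_rV R n).
Local Notation leb := (@lebesgue_measure R).
Implicit Types (h : V -> R[i]).

Lemma measurable_level h (c : R) : cmeas h -> measurable [set y | c < normc (h y)].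
Proof.
move=> mh; rewrite -[X in measurable X]setTI.
apply: (measurable_eq (B := setT `&` (fun y => normc (h y)) @^-1` `]c, +oo[%classic)).
  by apply/seteqP; split => x /=; rewrite in_itv/= andbT.
by apply: (measurable_normc mh) => //; exact: measurable_itv.
Qed.

Lemma rearrangement_ge h (c t : R) : cmeas h ->
  (t%:E <= mu [set y | (c < normc (h y))%R])%E -> (c%:E <= rearrangement h t)%E.
Proof.
move=> mh ht; apply: le_ereal_inf_tmp => _ [r [r0 hr] <-].
rewrite lee_fin leNgt; apply/negP => rc.
have := lt_le_trans hr ht; rewrite ltNge => /negP; apply.
apply: le_measure; rewrite ?inE; [exact: measurable_level|exact: measurable_level|].
by move=> y /=; exact: lt_trans.
Qed.

Lemma rearrangement_ge0 h t : (0 <= rearrangement h t)%E.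
Proof. by apply: le_ereal_inf_tmp => _ [r [r0 hr] <-]; rewrite lee_fin. Qed.

Lemma sum_sc_le (i0 : int) M : \sum_(i < M) sc (i0 + i%:Z) <= sc (i0 + M%:Z) :> R.
Proof.
elim: M => [|M IH]; first by rewrite big_ord0.
rewrite big_ord_recr/= (_ : i0 + M.+1%:Z = i0 + M%:Z + 1); last by lia.
by rewrite [leRHS]scD (_ : sc 1 = 2)// mulr_natr mulr2n lerD2r.
Qed.

(* The rearrangement is at least [sc i] below the measure of the level set, and the sum of the levels
   is at most twice the largest one. *)
Lemma lorentz_levels (q : R) : 0 < q -> exists2 C : R, 0 <= C &
  forall h (i0 : int) M (x : 'I_M -> R), cmeas h -> (forall i, 0 <= x i) ->
  (forall i, (x i)%:E <= mu [set y | (sc (i0 + i%:Z) < normc (h y))%R])%E ->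
  ((\sum_(i < M) sc (i0 + i%:Z) * x i `^ q^-1)%:E <= C%:E * lorentz1 q h)%E.
Proof.
move=> q0; pose a := q^-1; have a0 : 0 < a by rewrite invr_gt0.
pose c : R := (1 - 2^-1 `^ a) / a; have c0 : 0 < c := layer_const_gt0 a0.
exists (2 / c); first by rewrite divr_ge0// ltW.
move=> h i0 M x mh x0 hx.
suff H : ((2^-1 * c * \sum_(i < M) sc (i0 + i%:Z) * x i `^ a)%:E <= lorentz1 q h)%E.
  have k0 : 0 < 2^-1 * c by rewrite mulr_gt0.
  rewrite -(@lee_pmul2l _ (2^-1 * c)%:E)// ?lte_fin// muleA -!EFinM.
  by rewrite (_ : 2^-1 * c * (2 / c) = 1) ?mul1e//; field; rewrite gt_eqF.
have F0 (i : 'I_M) t : 0 <= sc (i0 + i%:Z) * (t `^ (a - 1) * (0 < t < x i)%R%:R).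
  by rewrite !mulr_ge0 ?powR_ge0.
have mF (i : 'I_M) : mfunT (fun t => sc (i0 + i%:Z) * (t `^ (a - 1) * (0 < t < x i)%R%:R)).
  by mfun.
apply: (le_via (\int[leb]_t (2^-1 * \sum_(i < M) sc (i0 + i%:Z) * (t `^ (a - 1) * (0 < t < x i)%R%:R))%:E)%E).
  rewrite nnZr//; last 2 first.
  - exact: measurable_sum.
  - by move=> t; exact: sumr_ge0.
  rewrite nn_sum// -mulrA EFinM lee_wpmul2l ?lee_fin//.
  rewrite mulr_sumr -sumEFin; apply: lee_sum => i _.
  rewrite nnZr//; last 2 first.
  - by mfun.
  - by move=> t; rewrite mulr_ge0 ?powR_ge0.
  by rewrite mulrCA EFinM lee_wpmul2l ?lee_fin//; exact: layer_ge.
rewrite /lorentz1 [leRHS]integral_mkcond; apply: nn_le => t.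
  by rewrite lee_fin mulr_ge0// sumr_ge0.
rewrite patchE mem_setE in_itv/= andbT; case: ifPn => [t0|t0]; last first.
  rewrite lee_fin pmulr_rle0//; apply: sumr_le0 => i _.
  by rewrite /= !mulr0.
rewrite -/a; set Y := rearrangement h t; have Y0 : (0 <= Y)%E by exact: rearrangement_ge0.
apply: (le_via ((2^-1 * \sum_(i < M) sc (i0 + i%:Z) * (t < x i)%R%:R)%:E * (t `^ (a - 1))%:E)%E).
  rewrite -EFinM lee_fin -mulrA mulr_suml ler_wpM2l//; apply: ler_sum => i _.
  by rewrite -mulrA (mulrC (t `^ _)).
rewrite lee_wpmul2r ?lee_fin ?powR_ge0//.
have hY (i : 'I_M) : t < x i -> ((sc (i0 + i%:Z))%:E <= Y)%E.
  by move=> /ltW tx; apply: rearrangement_ge => //; apply: le_trans (hx i); rewrite lee_fin.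
elim: M x {x0 hx F0 mF} hY => [|M IH] x hY.
  by rewrite big_ord0 mulr0.
rewrite big_ord_recr/=; case: (ltP t (x ord_max)) => h1; last first.
  rewrite /= mulr0 addr0; apply: (IH (fun i => x (widen_ord (leqnSn M) i))) => i hi.
  exact: (hY (widen_ord (leqnSn M) i)).
apply: le_trans (hY ord_max h1); rewrite lee_fin /= mulr1 mulrDr.
have : \sum_(i < M) sc (i0 + i%:Z) * (t < x (widen_ord (leqnSn M) i))%R%:R <= sc (i0 + M%:Z) :> R.
  apply: le_trans (sum_sc_le i0 M); apply: ler_sum => i _.
  by rewrite ler_piMr// lern1 leq_b1.
by move=> /=; lra.
Qed.

Lemma sum_cauchy (I : finType) (x b : I -> R) : (forall i, 0 <= x i) -> (forall i, 0 <= b i) ->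
  (forall i, b i = 0 -> x i = 0) -> (\sum_i x i) ^+ 2 <= (\sum_i b i) * \sum_i (x i ^+ 2 / b i).
Proof.
move=> x0 b0 bx; apply: amgm_sqr.
- exact: sumr_ge0.
- exact: sumr_ge0.
- by apply: sumr_ge0 => i _; rewrite divr_ge0 ?sqr_ge0.
move=> c c0; rewrite 2!mulr_sumr -big_split/= mulr_sumr; apply: ler_sum => i _.
have [bi|bi] := eqVneq (b i) 0; first by rewrite bx// bi expr0n /= mul0r !mulr0 addr0 mulr0.
have bp : 0 < b i by rewrite lt_def bi b0.
rewrite -subr_ge0 (_ : _ - _ = 2^-1 * ((c * b i - x i) ^+ 2 / (c * b i))).
  by rewrite mulr_ge0// divr_ge0 ?sqr_ge0// mulr_ge0// ltW.
by field; rewrite bi gt_eqF.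
Qed.

(** Minkowski's inequality in L^2(w), obtained from Cauchy-Schwarz with the norms [b i] as weights.
    They are divided by, so an index with [b i = 0] has to carry the zero function. *)
Lemma minkowski_fin (I : finType) (X : I -> V -> R[i]) (b : I -> R) (w : V -> R) (kap : R) (J : \bar R) :
  (forall i, cmeas (X i)) -> mfunT w -> (forall x, 0 <= w x) ->
  (forall i, 0 <= b i) -> (forall i, b i = 0 -> forall x, X i x = 0) -> 0 <= kap -> (0 <= J)%E ->
  (forall i, \int[mu]_x (normc (X i x) ^+ 2 * w x)%:E <= (b i ^+ 2 * kap)%:E * J)%E ->
  (\int[mu]_x (normc (\sum_i X i x) ^+ 2 * w x)%:E <= ((\sum_i b i) ^+ 2 * kap)%:E * J)%E.
Proof.
move=> mX mw w0 b0 bX kap0 J0 hX; set B := \sum_i b i; have B0 : 0 <= B by exact: sumr_ge0.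
have q0 i x : 0 <= (b i)^-1 * (normc (X i x) ^+ 2 * w x).
  by rewrite mulr_ge0 ?invr_ge0// mulr_ge0 ?exprn_ge0.
have mq i : mfunT (fun x => (b i)^-1 * (normc (X i x) ^+ 2 * w x)).
  have mn := measurable_normc (mX i).
  by apply: measurable_funM => //; apply: measurable_funM => //; exact: measurable_funX.
apply: (le_via (\int[mu]_x (B * \sum_i ((b i)^-1 * (normc (X i x) ^+ 2 * w x)))%:E)%E).
  apply: nn_le => x; first by rewrite lee_fin mulr_ge0 ?exprn_ge0.
  rewrite lee_fin; apply: (le_via ((\sum_i normc (X i x)) ^+ 2 * w x)).
    rewrite ler_wpM2r// lerXn2r ?nnegrE ?normc_ge0//; last exact: normc_sum.
    exact: sumr_ge0.
  have zX i : b i = 0 -> normc (X i x) = 0 by move=> h; rewrite bX// normc0.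
  have := sum_cauchy (fun i => normc_ge0 (X i x)) b0 zX; rewrite -/B => h.
  apply: le_trans (ler_wpM2r (w0 x) h) _; rewrite -(mulrA B) mulr_suml ler_wpM2l//.
  by apply: ler_sum => i _; rewrite mulrA [(b i)^-1 * _]mulrC.
rewrite nnZr//; last 2 first.
- exact: measurable_sum.
- by move=> x; exact: sumr_ge0.
rewrite nn_sum//; apply: (le_via (B%:E * \sum_i ((b i * kap)%:E * J))%E).
  rewrite lee_wpmul2l ?lee_fin//; apply: lee_sum => i _.
  rewrite nnZr ?invr_ge0//; last 2 first.
  - by apply: measurable_funM => //; exact/measurable_funX/measurable_normc.
  - by move=> x; rewrite mulr_ge0 ?exprn_ge0.
  apply: (le_via ((b i)^-1%:E * ((b i ^+ 2 * kap)%:E * J))%E).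
    by rewrite lee_wpmul2l ?lee_fin ?invr_ge0.
  rewrite muleA -EFinM lee_wpmul2r// lee_fin.
  have [->|bi] := eqVneq (b i) 0; first by rewrite invr0 !mul0r.
  by apply: le_of_eq; field.
rewrite -ge0_sume_distrl; last by move=> i _; rewrite lee_fin mulr_ge0.
by rewrite sumEFin -mulr_suml -/B muleA -EFinM expr2 mulrA.
Qed.

End lorentz.

(** * Annular pieces of one level *)

Section band_pieces.
Context {R : realType} {n : nat}.
Local Notation V := 'rV[R]_n.
Local Notation mu := (@lebesgue_rV R n).
Implicit Types (f g h : V -> R[i]) (w : V -> R) (x y z xi : V) (l : int).
Variable Psi : V -> R[i].
Hypotheses (nPsi : nice Psi) (cPsi : cscont Psi) (FPsi : cintg mu (fourier Psi)).
Hypothesis sPsi : annular Psi.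

(** A transform by origin, but used as a cutoff to the annulus [|y| ~ 2^l] of position space. *)
Definition band l y : R[i] := fourier (dil Psi l) y.

Lemma bandE l y : band l y = fourier Psi (sc (- l) *: y).
Proof. exact: fourier_dil. Qed.

Let nd l : nice (dil Psi l). Proof. exact: nice_dil. Qed.
Let cd l : cscont (dil Psi l). Proof. exact: cscont_dil. Qed.
Let id l : cintg mu (dil Psi l). Proof. by have [] := nd l. Qed.

Lemma cintg_band l : cintg mu (band l).
Proof.
have := cintg_affine 0 (sc_neq0 (R := R) (- l)) FPsi; congr cintg; apply/funext => y.
by rewrite addr0 bandE.
Qed.

Lemma N1_dil l : N1 (dil Psi l) = N1 Psi.
Proof.
have [mp _ pi] := nPsi; apply: EFin_inj; rewrite -!N1E//.
pose F y : \bar R := (normc (Psi y))%:E.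
rewrite (_ : (fun y => _) = fun y => ((sc l ^+ n)%:E * F (sc l *: y + 0)%R)%E); last first.
  by apply/funext => y; rewrite normcM normc_rc ger0_norm ?exprn_ge0// addr0 EFinM.
have mP : mfunT F by apply/measurable_EFinP; exact: measurable_normc.
have mS : mfunT (fun y : V => sc l *: y + 0) by mfun.
rewrite nnZ ?exprn_ge0//; last 2 first.
- by apply/measurable_EFinP; exact: (measurable_normc (cmeas_comp mp mS)).
- by move=> y; rewrite /F lee_fin.
rewrite (int_affine 0 (sc_neq0 (R := R) l) (f := F))//; last by move=> y; rewrite /F lee_fin.
rewrite muleA -EFinM (gtr0_norm (sc_gt0 _)) -exprMn divff ?sc_neq0// expr1n mul1e//.
Qed.

Lemma normc_band l y : normc (band l y) <= N1 Psi.
Proof. by rewrite -(N1_dil l); exact: normc_fourier. Qed.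

Lemma cscont_band l : cscont (band l). Proof. exact: cscont_fourier. Qed.

Lemma band_supp l y : band l y != 0 -> 4^-1 * sc l ^+ 2 < dotmx y y < 4 * sc l ^+ 2.
Proof.
rewrite bandE => /sPsi; rewrite dotmxZl dotmxZr mulrA -expr2 scN => /andP[h1 h2].
have s0 : 0 < sc l ^+ 2 :> R by rewrite exprn_gt0.
rewrite exprVn mulrC ltr_pdivrMr// in h2; rewrite exprVn mulrC ltr_pdivlMr// in h1.
by rewrite h1 h2.
Qed.

Lemma sqr_norm_le_dotmx y : `|y| ^+ 2 <= dotmx y y.
Proof.
have h : `|y| <= Num.sqrt (dotmx y y).
  apply/norm_leP; first exact: sqrtr_ge0.
  move=> i; rewrite -sqrtr_sqr; apply: ler_wsqrtr.
  by rewrite /dotmx (bigD1 i)//= expr2 lerDl sumr_ge0// => j _; rewrite -expr2 sqr_ge0.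
by rewrite -(sqr_sqrtr (dotmx_ge0 y)) lerXn2r ?nnegrE ?sqrtr_ge0.
Qed.

Lemma band_out l y : sc (l + 1) <= `|y| -> band l y = 0.
Proof.
move=> h; apply/eqP; apply: contraT => /band_supp/andP[_].
rewrite ltNge => /negP; case; apply: le_trans (sqr_norm_le_dotmx y).
have -> : 4 * sc l ^+ 2 = sc (l + 1) ^+ 2 :> R.
  by rewrite scD (_ : sc 1 = 2)// exprMn mulrC -natrX.
by rewrite lerXn2r ?nnegrE.
Qed.

Lemma band_in l y : dotmx y y < (sc (l + 1) / 4) ^+ 2 -> band l y = 0.
Proof.
move=> h; apply/eqP; apply: contraT => /band_supp/andP[h1 _].
have e : (sc (l + 1) / 4) ^+ 2 = 4^-1 * sc l ^+ 2 :> R.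
  by rewrite scD (_ : sc 1 = 2)//; field.
by have := lt_trans h1 h; rewrite e ltxx.
Qed.

Section piece.
Variables (l : int) (h : V -> R[i]) (H e : R).
Hypotheses (mh : cmeas h) (hH : forall z, normc (h z) <= H) (H0 : 0 <= H).
Hypothesis he : (\int[mu]_z (h z != 0)%:R%:E <= e%:E)%E.

Let e0 : 0 <= e.
Proof. by rewrite -lee_fin; apply: le_trans he; apply: int_ge0 => z. Qed.

Let h_le z : normc (h z) <= H * (h z != 0)%:R.
Proof. by case: eqVneq => [->|_]; rewrite ?mulr1// normc0 mulr0. Qed.

Let mnz : mfunT (fun z => h z != 0).
Proof.
have -> : (fun z => h z != 0) = fun z => (0 < normc (h z))%R.
  by apply/funext => z; rewrite lt_def normc_ge0 andbT; congr (~~ _); apply/eqP/eqP => [->|/eq0_normc//]; rewrite normc0.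
have mn := measurable_normc mh; mfun.
Qed.

Let h1 : (\int[mu]_z (normc (h z))%:E <= (H * e)%:E)%E.
Proof.
apply: (le_via (\int[mu]_z (H * (h z != 0)%:R)%:E)%E); first by apply: nn_le => z; rewrite lee_fin.
rewrite nnZr//; last exact: measurable_boolr.
by rewrite EFinM lee_wpmul2l ?lee_fin.
Qed.

Let h2 : (\int[mu]_z (normc (h z) ^+ 2)%:E <= (H ^+ 2 * e)%:E)%E.
Proof.
apply: (le_via (\int[mu]_z (H ^+ 2 * (h z != 0)%:R)%:E)%E).
  apply: nn_le => z; first by rewrite lee_fin exprn_ge0.
  rewrite lee_fin; case: (eqVneq (h z) 0) => [->|_]; first by rewrite normc0 expr0n mulr0.
  by rewrite mulr1 lerXn2r ?nnegrE.
rewrite nnZr ?sqr_ge0//; last exact: measurable_boolr.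
by rewrite [leRHS]EFinM lee_wpmul2l ?lee_fin ?sqr_ge0.
Qed.

Lemma nice_level : nice h.
Proof.
split=> //; first by exists H.
by split=> //; apply: le_lt_trans h1 _; exact: ltry.
Qed.
Let nh := nice_level.
Let hi : cintg mu h. Proof. by have [] := nh. Qed.

(** The annular part, in position, of the inverse transform of a level [h]; the factor [winv s] that
    restores the kernel is multiplied on later. *)
Definition bpiece y : R[i] := band l y * invfourier h y.

Lemma cscont_bpiece : cscont bpiece.
Proof. by apply: cscontM; [exact: cscont_band|exact: cscont_invfourier]. Qed.

Let N0 : 0 <= N1 Psi. Proof. exact: N1_ge0. Qed.

Lemma normc_invfourier_level y : normc (invfourier h y) <= H * e.
Proof.
apply: le_trans (normc_invfourier y hi) _.
by rewrite -lee_fin -N1E.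
Qed.

Lemma nice_bpiece : nice bpiece.
Proof.
have mi : cmeas (invfourier h) by exact/cscont_cmeas/cscont_invfourier.
split; first exact/cscont_cmeas/cscont_bpiece.
  exists (N1 Psi * (H * e)) => y; rewrite normcM ler_pM//; first exact: normc_band.
  exact: normc_invfourier_level.
rewrite /bpiece; under eq_fun do rewrite mulrC.
exact: (cintgMb (cintg_band l) mi normc_invfourier_level).
Qed.

(** Duality moves the inverse transform from [h] to the cutoff, and inversion for the dilate of
    [Psi] identifies the result. *)
Lemma fourier_bpiece xi : fourier bpiece xi = cint mu (fun z => h z * dil Psi l (z - xi)).
Proof.
rewrite fourierE.
rewrite (_ : (fun x => _) = fun y => (band l y * ec (- dotmx y xi)) * invfourier h y); last first.
  by apply/funext => y; rewrite /bpiece mulrAC.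
have bi : cintg mu (fun y => band l y * ec (- dotmx y xi)).
  by apply: cintg_char; [mdot|exact: cintg_band].
rewrite invfourier_duality//; congr cint; apply/funext => z; rewrite mulrC; congr (_ * _).
rewrite -[RHS](fourier_inversion (nd l) (cd l) (cintg_band l)) !invfourierE; congr cint.
apply/funext => y; rewrite -/(band l y) -mulrA -ecD dotmxBl (dotmxC xi) addrC //.
Qed.

(** The sup norm is put on [h] and the L^1 norm on the dilate for the first bound, and conversely
    for the second. *)
Lemma fourier_bpiece_le (B : R) xi : (forall x, normc (Psi x) <= B) ->
  normc (fourier bpiece xi) <= H * N1 Psi /\ normc (fourier bpiece xi) <= B * (H * (sc l ^+ n * e)).
Proof.
move=> PB; have B0 : 0 <= B by exact: le_trans (normc_ge0 _) (PB 0).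
have [md _ _] := nd l.
have mds : cmeas (fun z => dil Psi l (z - xi)) by apply: (cmeas_comp md); mfun.
have dB z : normc (dil Psi l (z - xi)) <= sc l ^+ n * B.
  by rewrite normcM normc_rc ger0_norm ?exprn_ge0// ler_wpM2l ?exprn_ge0.
have ci : cintg mu (fun z => h z * dil Psi l (z - xi)).
  by under eq_fun do rewrite mulrC; exact: (cintgMb hi mds dB).
rewrite fourier_bpiece; split; rewrite -lee_fin; apply: (le_trans (le_cint ci)).
  rewrite -(N1_dil l) EFinM -(N1E (id l)).
  have mn := measurable_normc md.
  rewrite -(int_shift (- xi) (f := fun y => (normc (dil Psi l y))%:E))//; last exact/measurable_EFinP.
  rewrite -nnZr//; last by apply: measurable_normc.
  by apply: nn_le => z; rewrite lee_fin// normcM ler_wpM2r.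
apply: (le_via (\int[mu]_z (sc l ^+ n * B * normc (h z))%:E)%E).
  by apply: nn_le => z; rewrite lee_fin// normcM mulrC ler_wpM2r.
have sB : 0 <= sc l ^+ n * B by rewrite mulr_ge0 ?exprn_ge0.
rewrite nnZr//; last exact: measurable_normc.
rewrite (_ : B * _ = sc l ^+ n * B * (H * e)); last by ring.
by rewrite [leRHS]EFinM lee_wpmul2l ?lee_fin.
Qed.

(** The first bound is Plancherel for [h], the second the sup bound on a set of size comparable to
    [2^(ln)]; they change roles at [t = 1]. *)
Lemma bpiece_L2 : let t := sc l ^+ n * e in
  ((sc (l + 1) ^+ n)%:E * \int[mu]_x (normc (bpiece x) ^+ 2)%:E <=
     (2 ^+ n * (N1 Psi ^+ 2 * H ^+ 2) * t)%:E)%E /\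
  ((sc (l + 1) ^+ n)%:E * \int[mu]_x (normc (bpiece x) ^+ 2)%:E <=
     (8 ^+ n * (N1 Psi ^+ 2 * H ^+ 2) * t ^+ 2)%:E)%E.
Proof.
move=> t; have S1 : sc (l + 1) ^+ n = 2 ^+ n * sc l ^+ n :> R.
  by rewrite scD (_ : sc 1 = 2)// exprMn mulrC.
have mi : cmeas (invfourier h) by exact/cscont_cmeas/cscont_invfourier.
split.
  apply: (le_via ((sc (l + 1) ^+ n)%:E * (N1 Psi ^+ 2 * (H ^+ 2 * e))%:E)%E); last first.
    by rewrite -EFinM lee_fin S1 /t; apply: le_of_eq; ring.
  rewrite lee_wpmul2l ?lee_fin ?exprn_ge0//.
  apply: (le_via (\int[mu]_x (N1 Psi ^+ 2 * normc (invfourier h x) ^+ 2)%:E)%E).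
    apply: nn_le => x; first by rewrite lee_fin exprn_ge0.
    rewrite lee_fin normcM exprMn ler_wpM2r ?exprn_ge0// lerXn2r ?nnegrE//.
    exact: normc_band.
  rewrite nnZr ?sqr_ge0//; last 2 first.
  - exact/measurable_funX/measurable_normc.
  - by move=> x; rewrite exprn_ge0.
  rewrite [leRHS]EFinM lee_wpmul2l ?lee_fin ?sqr_ge0//.
  exact: le_trans (invfourier_L2 nh) h2.
apply: (le_via ((sc (l + 1) ^+ n)%:E * ((N1 Psi * (H * e)) ^+ 2 * (2 * sc (l + 1)) ^+ n)%:E)%E); last first.
  rewrite -EFinM lee_fin !exprMn S1 /t.
  have -> : 8 ^+ n = 2 ^+ n * 2 ^+ n * 2 ^+ n :> R by rewrite -!exprMn -!natrM.
  by apply: le_of_eq; ring.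
rewrite lee_wpmul2l ?lee_fin ?exprn_ge0//.
apply: (le_via (\int[mu]_x ((N1 Psi * (H * e)) ^+ 2 * (`|x - 0| < sc (l + 1))%R%:R)%:E)%E).
  apply: nn_le => x; first by rewrite lee_fin exprn_ge0.
  rewrite lee_fin subr0; case: ltP => hx; last first.
    by rewrite /bpiece band_out// mul0r normc0 expr0n mulr0.
  rewrite mulr1 lerXn2r ?nnegrE ?mulr_ge0// normcM ler_pM//; first exact: normc_band.
  exact: normc_invfourier_level.
by rewrite nnZr ?sqr_ge0// ?int_ball// -?EFinM//; mfun.
Qed.

End piece.

End band_pieces.

(** * Gains of the pieces and slicing into levels *)

Section band_windows.
Context {R : realType} {n : nat}.
Local Notation V := 'rV[R]_n.
Local Notation mu := (@lebesgue_rV R n).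
Implicit Types (f g h k : V -> R[i]) (w : V -> R) (x y z xi : V) (l : int).

Lemma convolD k1 k2 f x : nice k1 -> nice k2 -> cintg mu f ->
  convol (fun y => k1 y + k2 y) f x = convol k1 f x + convol k2 f x.
Proof.
move=> [m1 [B1 b1] _] [m2 [B2 b2] _] fi; rewrite -cintD; [|exact: cintg_conv b1 fi|exact: cintg_conv b2 fi].
by congr cint; apply/funext => y; rewrite mulrDl.
Qed.

Lemma niceD f g : nice f -> nice g -> nice (fun x => f x + g x).
Proof.
move=> [m1 [B1 b1] i1] [m2 [B2 b2] i2]; split; [exact: cmeasD| |exact: cintgD].
by exists (B1 + B2) => x; apply: le_trans (normcD _ _) _; exact: lerD.
Qed.

Lemma niceZ (c : R[i]) f : nice f -> nice (fun x => c * f x).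
Proof.
move=> [m [B b] i]; split; [by apply: cmeasM => //; exact: cmeas_cst| |exact: cintgZ].
by exists (normc c * B) => x; rewrite normcM ler_wpM2l.
Qed.

Lemma nice0 : nice (fun _ : V => 0 : R[i]).
Proof.
have z x : normc (0 : R[i]) <= (0 : R) by rewrite normc0.
split; [exact: cmeas_cst|by exists 0|]; split; first exact: cmeas_cst.
under eq_integral do rewrite normc0.
by rewrite integral0 ltry.
Qed.

Lemma nice_sum I (s : seq I) (f : I -> V -> R[i]) : (forall i, nice (f i)) ->
  nice (fun x => \sum_(i <- s) f i x).
Proof.
move=> nf; elim: s => [|i s IH]; first by under eq_fun do rewrite big_nil; exact: nice0.
by under eq_fun do rewrite big_cons; exact: niceD.
Qed.

Lemma convol_suml I (s : seq I) (k : I -> V -> R[i]) f x : (forall i, nice (k i)) -> cintg mu f ->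
  convol (fun y => \sum_(i <- s) k i y) f x = \sum_(i <- s) convol (k i) f x.
Proof.
move=> nk fi; rewrite /convol -cint_sum; last first.
  by move=> i; have [m [B b] _] := nk i; exact: cintg_conv b fi.
by congr cint; apply/funext => y; rewrite mulr_suml.
Qed.

Lemma cscont_sum I (s : seq I) (f : I -> V -> R[i]) : (forall i, cscont (f i)) ->
  cscont (fun x => \sum_(i <- s) f i x).
Proof. by move=> cf; apply/cscontP => u x ux; apply: ccvg_sum => i; exact: (cscontP _).1. Qed.

Lemma fourier_sum I (s : seq I) (f : I -> V -> R[i]) xi : (forall i, cintg mu (f i)) ->
  fourier (fun x => \sum_(i <- s) f i x) xi = \sum_(i <- s) fourier (f i) xi.
Proof.
move=> fi; rewrite fourierE; under [RHS]eq_bigr do rewrite fourierE.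
rewrite -cint_sum; last first.
  by move=> i; apply: cintg_char => //; mdot.
by congr cint; apply/funext => y; rewrite mulr_suml.
Qed.

Lemma fourierB f g xi : cintg mu f -> cintg mu g ->
  fourier (fun x => f x - g x) xi = fourier f xi - fourier g xi.
Proof.
move=> fi gi; rewrite !fourierE -cintB.
- by congr cint; apply/funext => y; rewrite mulrBl.
- by apply: cintg_char => //; mdot.
- by apply: cintg_char => //; mdot.
Qed.

Variable Psi : V -> R[i].
Hypotheses (nPsi : nice Psi) (cPsi : cscont Psi) (FPsi : cintg mu (fourier Psi)).
Hypothesis sPsi : annular Psi.

Lemma band0 l : band Psi l 0 = 0.
Proof.
apply/eqP; apply: contraT => /(band_supp nPsi sPsi)/andP[+ _].
have -> : dotmx (0 : V) 0 = 0 by rewrite -(scale0r 0) dotmxZl mul0r.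
by have := @sc_gt0 R l; nra.
Qed.

Lemma dotmx_gt0 y : y != 0 -> 0 < dotmx y y.
Proof.
move=> y0; rewrite lt_def dotmx_ge0 andbT; apply: contra y0 => /eqP e.
have := sqr_norm_le_dotmx y; rewrite e -normr_eq0 => h.
by rewrite -sqrf_eq0 eq_le h sqr_ge0.
Qed.

(** At each [y] only the scales within a factor 2 of [|y|] contribute. The count is phrased as a sum
    of a function [g] lying below both [t] and [1/t], so that [geom_window] bounds it. *)
Lemma band_window : exists2 B : R, 0 <= B & forall (j0 : int) M y,
  \sum_(i < M) normc (band Psi (j0 + i%:Z) y) <= B.
Proof.
have [B B0 hB] := geom_window (@ltr01 R) (@ltr01 R).
exists (N1 Psi * 2 * B) => [|j0 M y]; first by rewrite !mulr_ge0 ?N1_ge0.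
have [->|y0] := eqVneq y 0.
  rewrite big1 => [|i _]; first by rewrite !mulr_ge0 ?N1_ge0.
  by rewrite band0 normc0.
have d0 := dotmx_gt0 y0; have d1 : 0 < Num.sqrt (dotmx y y) by rewrite sqrtr_gt0.
have c0 : 0 < (Num.sqrt (dotmx y y))^-1 by rewrite invr_gt0.
pose g (t : R) : R := 2^-1 * (2^-1 < t < 2)%R%:R.
have gle t : 0 < t -> g t <= t `^ 1 /\ g t <= t `^ (- 1).
  move=> t0; rewrite powRr1 ?(ltW t0)// powRN powRr1 ?(ltW t0)// /g.
  have ti : 0 < t^-1 by rewrite invr_gt0.
  case: (boolP (_ && _)) => [/andP[h1 h2]|_] /=; last by rewrite mulr0 (ltW t0) (ltW ti).
  rewrite mulr1 (ltW h1); split=> //.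
  by rewrite lef_pV2 ?posrE// ltW.
have := hB g _ j0 M c0 gle; rewrite -(ler_pM2l (ltr0n R 2)).
rewrite mulr_sumr => h; rewrite -mulrA; apply: le_trans (ler_wpM2l (N1_ge0 Psi) h).
rewrite mulr_sumr; apply: ler_sum => i _; rewrite /g.
case: (eqVneq (band Psi (j0 + i%:Z) y) 0) => [->|b0].
  by rewrite normc0 !mulr_ge0 ?N1_ge0.
have /andP[h1 h2] := band_supp nPsi sPsi b0.
have S0 : 0 < sc (j0 + i%:Z) :> R by exact: sc_gt0.
set S := sc _ in h1 h2 S0 *.
have e1 : 2^-1 < S / Num.sqrt (dotmx y y).
  rewrite ltr_pdivlMr// -(@ltr_pXn2r _ 2)// ?nnegrE ?mulr_ge0 ?(ltW d1) ?(ltW S0)//.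
  by rewrite exprMn sqr_sqrtr ?(ltW d0)//; move: h2; rewrite -/S; nra.
have e2 : S / Num.sqrt (dotmx y y) < 2.
  rewrite ltr_pdivrMr// -(@ltr_pXn2r _ 2)// ?nnegrE ?mulr_ge0 ?(ltW d1) ?(ltW S0)//.
  by rewrite exprMn sqr_sqrtr ?(ltW d0)//; move: h1; rewrite -/S; nra.
by rewrite e1 e2 /= mulr1 mulfV// mulr1; exact: normc_band.
Qed.

(* With [u = 2^l e^(1/n)], this is the gain [u^(-s) min(u^n, u^(n/(2r)))] of a piece of a level of
   measure [e]; it is summable over dyadic [u] exactly when [n/(2r) < s < n]. *)
Definition gain (s r u : R) : R := u `^ (- s) * Num.min (u `^ n%:R) (u `^ (n%:R / (2 * r))).

Lemma gain_le s r u : 0 < u -> gain s r u <= u `^ (n%:R - s) /\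
  gain s r u <= u `^ (- (s - n%:R / (2 * r))).
Proof.
move=> u0; have e0 a b : u `^ (a + b) = u `^ a * u `^ b by rewrite powRD// (gt_eqF u0) implybT.
rewrite /gain; split.
  by rewrite addrC e0 ler_wpM2l ?powR_ge0// ge_min lexx.
by rewrite opprB addrC e0 ler_wpM2l ?powR_ge0// ge_min lexx orbT.
Qed.

(** [weighted_piece] bounds the Gaussian-damped kernels and [bessel_kernel] restores the Bessel
    factor; which of the bounds of [fourier_bpiece_le] and [bpiece_L2] is fed in depends on the size
    of [t]. *)
Lemma piece_bound (s r : R) : (0 < n)%N -> 0 < s -> 1 < r -> exists2 C : R, 0 <= C &
  forall l h f w (H e Bw : R), cmeas h -> (forall z, normc (h z) <= H) -> 0 < H -> 0 < e ->
  (\int[mu]_z (h z != 0)%:R%:E <= e%:E)%E -> nice f -> mfunT w -> (forall x, 0 <= w x <= Bw) ->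
  (\int[mu]_x (normc (convol (fun y => winv s y * bpiece Psi l h y) f x) ^+ 2 * w x)%:E <=
   ((H * e `^ (s / n%:R) * gain s r (sc l * e `^ n%:R^-1)) ^+ 2 * C)%:E *
   \int[mu]_x (normc (f x) ^+ 2 * Mr r w x)%:E)%E.
Proof.
move=> n_gt0 s0 r1; have r0 : 0 < r by exact: lt_trans r1.
have n0 : 0 < n%:R :> R by rewrite ltr0n.
have [C C0 WP] := @weighted_piece R n r r1.
have [b [b0 [gam [gam0 subE]]]] : exists b : R, b = 2 / s /\ exists gam : R, 0 < gam /\
    forall X, 0 < X -> (\int[lebesgue_measure]_t (expR (- (`|t| `^ b * X)))%:E = (gam * X `^ (- b^-1))%:E)%E.
  exists (2 / s); split=> //; have s2 : 0 < 2 / s by rewrite divr_gt0.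
  by have [gam g0 hg] := subordination s2; exists gam.
have [_ [BP hBP] _] := nPsi.
pose c2 := 1 + BP ^+ 2 + 8 ^+ n * N1 Psi ^+ 2.
have n8 : 1 <= 8 ^+ n :> R by rewrite exprn_ege1// ler1n.
have n28 : 2 ^+ n <= 8 ^+ n :> R by rewrite lerXn2r ?nnegrE// ler_nat.
have N2 : 0 <= N1 Psi ^+ 2 by exact: sqr_ge0.
have B2 : 0 <= BP ^+ 2 by exact: sqr_ge0.
have c20 : 0 < c2 by rewrite /c2; nra.
exists (C * (r^-1 * pi ^+ 2 / 4) `^ (- s) * c2).
  by rewrite mulr_ge0 ?(ltW c20)// mulr_ge0 ?powR_ge0.
move=> l h f w H e Bw mh hH H0 e0 he nf mw wB.
set J := (\int[mu]_x (normc (f x) ^+ 2 * _)%:E)%E.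
have J0 : (0 <= J)%E by apply: int_ge0 => x; rewrite mulr_ge0 ?powR_ge0 ?exprn_ge0.
have nQ := nice_bpiece nPsi FPsi l mh hH (ltW H0) he.
have cQ := cscont_bpiece nPsi l mh hH (ltW H0) he.
have sE : - - (l + 1) = l + 1 by rewrite opprK.
set u := sc l * e `^ n%:R^-1; have u0 : 0 < u by rewrite mulr_gt0// powR_gt0.
pose t := sc l ^+ n * e.
have tu : t = u `^ n%:R.
  by rewrite powR_mulrn ?(ltW u0)// exprMn -[X in _ = _ * X]powR_mulrn ?powR_ge0// -powRrM mulVf ?gt_eqF// powRr1 ?(ltW e0).
have t0 : 0 < t by rewrite tu powR_gt0.
have [q1 q2] := bpiece_L2 nPsi sPsi l mh hH (ltW H0) he.
suff [a [D [ha hD haD]]] : exists a D, [/\ forall xi, normc (fourier (bpiece Psi l h) xi) <= a,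
    ((sc (l + 1) ^+ n)%:E * \int[mu]_x (normc (bpiece Psi l h x) ^+ 2)%:E <= D%:E)%E &
    (a ^+ 2) `^ (1 - r^-1) * D `^ r^-1 <= c2 * H ^+ 2 * Num.min (u `^ n%:R) (u `^ (n%:R / (2 * r))) ^+ 2].
  have := @bessel_kernel R n s (bpiece Psi l h) s0 nQ cQ gam gam0 _ r r1 C f w (- (l + 1)) a D Bw nf.
  rewrite sE -b0 => /(_ subE) BK.
  apply: le_trans (BK _ _ ha hD mw wB C0 _) _.
  - by move=> x hx; rewrite /bpiece (band_out nPsi sPsi)// mul0r.
  - by move=> x hx; rewrite /bpiece (band_in nPsi sPsi)// mul0r.
  - move=> k D' nk ck sk ak kD; apply: (WP k f w (- (l + 1)) a (a ^+ 2) D' Bw) => //; by rewrite sE.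
  rewrite lee_wpmul2r// lee_fin.
  set G := Num.min _ _ in haD *; rewrite /gain -/G.
  set K := C * _; have K0 : 0 <= K by rewrite mulr_ge0 ?powR_ge0.
  have -> : (H * e `^ (s / n%:R) * (u `^ (- s) * G)) ^+ 2 * (K * c2) =
      K * ((e `^ (s / n%:R) * u `^ (- s)) ^+ 2 * (c2 * H ^+ 2 * G ^+ 2)) by ring.
  rewrite -mulrA ler_wpM2l// ler_pM ?powR_ge0 ?mulr_ge0 ?powR_ge0//.
  have -> : e `^ (s / n%:R) * u `^ (- s) = sc l `^ (- s).
    rewrite /u powRM ?powR_ge0// mulrCA -powRrM -powRD ?(gt_eqF e0) ?implybT//.
    by rewrite (_ : s / n%:R + n%:R^-1 * - s = 0) ?powRr0 ?mulr1//; ring.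
  rewrite -powR_mulrn ?powR_ge0// -powRrM mulrC powRrM powR_mulrn ?powR_ge0//.
  rewrite lerXn2r ?nnegrE ?powR_ge0// !powRN lef_pV2 ?posrE ?powR_gt0//.
  by rewrite ge0_ler_powR ?nnegrE ?(ltW s0)//; apply: sc_le; rewrite lerDl.
have k0 : 0 < c2 * H ^+ 2 by rewrite mulr_gt0// exprn_gt0.
have r'0 : 0 < r^-1 by rewrite invr_gt0.
have r'1 : 0 <= 1 - r^-1 by rewrite subr_ge0 invf_le1// ltW.
have hF xi := fourier_bpiece_le nPsi cPsi FPsi l mh hH (ltW H0) he xi hBP.
have BP0 : 0 <= BP by exact: le_trans (normc_ge0 _) (hBP 0).
have ku (x v : R) : 0 < x -> 0 <= v -> x `^ (1 - r^-1) * (x * v) `^ r^-1 = x * v `^ r^-1.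
  move=> x0 v0; rewrite powRM ?(ltW x0)// mulrA -powRD ?(gt_eqF x0) ?implybT// subrK.
  by rewrite powRr1 ?(ltW x0).
have mono (x y a D : R) : 0 <= a -> a ^+ 2 <= x -> 0 <= D -> D <= y ->
    (a ^+ 2) `^ (1 - r^-1) * D `^ r^-1 <= x `^ (1 - r^-1) * y `^ r^-1.
  move=> a0 ax D0 Dy; have x0 : 0 <= x := le_trans (sqr_ge0 a) ax.
  by rewrite ler_pM ?powR_ge0// ge0_ler_powR ?nnegrE ?sqr_ge0 ?(ltW r'0)//; exact: le_trans Dy.
have um : u `^ (n%:R / (2 * r)) = t `^ (2 * r)^-1 by rewrite powRrM -tu.
have r2 : 0 < (2 * r)^-1 by rewrite invr_gt0 mulr_gt0.
have H2 : 0 <= H ^+ 2 by exact: sqr_ge0.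
(* Small [t]: the L^1 norm of [h] makes the sup of the transform proportional to [t] and the energy
   to [t^2], so every interpolation between them yields [t^2]. *)
have [t1|t1] := lerP t 1.
  have -> : Num.min (u `^ n%:R) (u `^ (n%:R / (2 * r))) = t.
    rewrite -tu um; apply/min_idPl; apply: ger1_powR; first by rewrite t0.
    by rewrite invf_le1 ?mulr_gt0//; nra.
  exists (BP * (H * t)), (c2 * H ^+ 2 * t ^+ 2); split.
  - by move=> xi; have [_] := hF xi.
  - apply: le_trans q2 _; rewrite lee_fin -!/t ler_wpM2r ?sqr_ge0// mulrA ler_wpM2r ?sqr_ge0//.
    by rewrite /c2; nra.
  have t2 : 0 < t ^+ 2 by rewrite exprn_gt0.
  apply: (le_via ((c2 * H ^+ 2 * t ^+ 2) `^ (1 - r^-1) * (c2 * H ^+ 2 * t ^+ 2 * 1) `^ r^-1)).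
    have kt : 0 <= c2 * H ^+ 2 * t ^+ 2 := mulr_ge0 (ltW k0) (ltW t2).
    apply: mono; [exact: mulr_ge0 BP0 (mulr_ge0 (ltW H0) (ltW t0))| |exact: kt|by rewrite mulr1].
    have -> : (BP * (H * t)) ^+ 2 = BP ^+ 2 * H ^+ 2 * t ^+ 2 by ring.
    rewrite ler_wpM2r ?(ltW t2)// ler_wpM2r//.
    by rewrite /c2; nra.
  by rewrite (ku _ 1 (mulr_gt0 k0 t2) ler01) powR1 mulr1.
have -> : Num.min (u `^ n%:R) (u `^ (n%:R / (2 * r))) = t `^ (2 * r)^-1.
  rewrite -tu um; apply/min_idPr; apply: ler1_powR; first exact: ltW.
  by rewrite invf_le1 ?mulr_gt0//; nra.
(* Large [t]: the sup of the transform has no decay and the energy is proportional to [t], hence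
   [t^(1/r)], the square of [t^(1/(2r))]. *)
exists (H * N1 Psi), (2 ^+ n * (N1 Psi ^+ 2 * H ^+ 2) * t); split=> //.
- by move=> xi; have [] := hF xi.
apply: (le_via ((c2 * H ^+ 2) `^ (1 - r^-1) * (c2 * H ^+ 2 * t) `^ r^-1)).
  apply: mono.
  - by rewrite mulr_ge0 ?N1_ge0 ?(ltW H0).
  - by rewrite exprMn mulrC ler_wpM2r// /c2; nra.
  - by rewrite mulr_ge0 ?(ltW t0)// mulr_ge0 ?exprn_ge0// mulr_ge0.
  - by rewrite ler_wpM2r ?(ltW t0)// mulrA ler_wpM2r// /c2; nra.
rewrite ku ?(ltW t0)// -[leRHS]mulr1; apply: le_of_eq.
rewrite mulr1 -[X in _ = _ * X]powR_mulrn ?powR_ge0// -powRrM; congr (_ * _ `^ _).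
by field; rewrite gt_eqF.
Qed.

Definition slice h (i : int) z : R[i] := h z * ((sc i < normc (h z)) && (normc (h z) <= sc (i + 1)))%R%:R%:C%C.

Lemma normc_slice h i z : normc (slice h i z) <= sc (i + 1).
Proof.
rewrite normcM normc_rc; case: (boolP (_ && _)) => [/andP[_ h1]|_] /=.
  by rewrite normr1 mulr1.
by rewrite normr0 mulr0.
Qed.

Lemma cmeas_slice h i : cmeas h -> cmeas (slice h i).
Proof.
move=> mh; have mn := measurable_normc mh.
by apply: cmeasM => //; apply: cmeas_rc; mfun.
Qed.

Lemma addrSz (i : int) (M : nat) : i + M%:Z + 1 = i + M.+1%:Z.
Proof. by lia. Qed.

Lemma sum_slice h (i0 : int) M z : \sum_(i < M) slice h (i0 + i%:Z) z =
  h z * ((sc i0 < normc (h z)) && (normc (h z) <= sc (i0 + M%:Z)))%R%:R%:C%C.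
Proof.
elim: M => [|M IH].
  by rewrite big_ord0 addr0; case: (ltP (sc i0)) => h1 /=; rewrite ?mulr0.
rewrite big_ord_recr/= IH /slice -mulrDr; congr (_ * _).
rewrite addrSz.
have h1 : sc (i0 + M%:Z) <= sc (i0 + M.+1%:Z) :> R by apply: sc_le; lia.
have h2 : sc i0 <= sc (i0 + M%:Z) :> R by apply: sc_le; lia.
case: (ltP (sc (i0 + M%:Z)) (normc (h z))) => h3 /=.
  by rewrite (le_lt_trans h2 h3) andbF add0r.
by rewrite addr0 (le_trans h3 h1).
Qed.

Lemma slice_level h i (e : R) : cmeas h ->
  (mu [set y | (sc i < normc (h y))%R] <= e%:E)%E -> (\int[mu]_z (slice h i z != 0)%:R%:E <= e%:E)%E.
Proof.
move=> mh; rewrite measure_gt_int; last exact: measurable_normc.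
move=> he; apply: (le_trans _ he); apply: nn_le => z; first by rewrite lee_fin.
rewrite lee_fin ler_nat; case: (ltP (sc i) (normc (h z))) => h1; first by rewrite leq_b1.
by rewrite /slice ltNge h1 /= mulr0 eqxx.
Qed.

Section levels.
Variables (s : R) (h : V -> R[i]) (C L : R).
Hypotheses (s0 : 0 < s) (sn : s < n%:R) (mh : cmeas h) (C0 : 0 <= C).
Hypothesis lev : forall (i0 : int) M (x : 'I_M -> R), (forall i, 0 <= x i) ->
  (forall i, (x i)%:E <= mu [set y | (sc (i0 + i%:Z) < normc (h y))%R])%E ->
  \sum_(i < M) sc (i0 + i%:Z) * x i `^ (s / n%:R) <= C * L.

Let n0 : 0 < n%:R :> R. Proof. exact: lt_trans sn. Qed.

Definition levm (i : int) : R := fine (mu [set y | (sc i < normc (h y))%R]).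

Lemma levm_ge0 i : 0 <= levm i.
Proof. exact: fine_ge0. Qed.

Lemma CL_ge0 : 0 <= C * L.
Proof.
have := @lev 0 1 (fun=> 0) (fun=> lexx _) (fun=> measure_ge0 _ _).
by rewrite big_ord1 powR0 ?mulr0// mulf_neq0 ?invr_neq0// gt_eqF.
Qed.

(** A level set of infinite measure would admit any [x] in [lev]; the value [X] makes its single
    term equal to [C L + 1], a contradiction. *)
Lemma levmE i : (mu [set y | (sc i < normc (h y))%R] = (levm i)%:E)%E.
Proof.
rewrite fineK// ge0_fin_numE// ltNge leye_eq; apply/negP => /eqP oo.
pose X := ((C * L + 1) / sc i) `^ (n%:R / s).
have := @lev i 1 (fun=> X) (fun=> powR_ge0 _ _); rewrite big_ord1 addr0 /X -powRrM.
rewrite (_ : n%:R / s * (s / n%:R) = 1); last by field; rewrite !gt_eqF.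
rewrite powRr1; last by rewrite divr_ge0// addr_ge0// CL_ge0.
rewrite mulrCA divff ?sc_neq0// mulr1 => H; suff : C * L + 1 <= C * L by lra.
by apply: H => k; rewrite ord1 addr0 oo leey.
Qed.

Lemma sum_levm (i0 : int) M : \sum_(i < M) sc (i0 + i%:Z) * levm (i0 + i%:Z) `^ (s / n%:R) <= C * L.
Proof. by apply: lev => i; [exact: levm_ge0|rewrite levmE]. Qed.

Lemma levm_le i : levm i `^ (s / n%:R) <= C * L * sc (- i).
Proof.
have := sum_levm i 1; rewrite big_ord1 addr0 => H.
by rewrite scN ler_pdivlMr// mulrC.
Qed.

(* [|h| <= sum 2^(i+1) 1_{2^i < |h|}], and a level of measure [e] contributes at most
   [e^(1-s/n)] times what it contributes to the Lorentz norm. *)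
Lemma tail_small (eps : R) : 0 < eps -> exists2 I : nat, sc (- I%:Z) <= eps &
  (\int[mu]_z (normc (h z) * (sc I < normc (h z))%R%:R)%:E <= eps%:E)%E.
Proof.
move=> e0; pose th := s / n%:R; have th0 : 0 < th by rewrite divr_gt0.
have th1 : th < 1 by rewrite ltr_pdivrMr// mul1r.
pose kap := (1 - th) / th; have kap0 : 0 < kap by rewrite divr_gt0// subr_gt0.
pose A := C * L + 1; have A0 : 0 < A by have := CL_ge0; rewrite /A; lra.
(* Chosen to make the power [1 - th] of the measure at most [eps / (2A)] for all levels from [I] on,
   through [1 - th = th kap]. *)
pose eta := Num.min eps ((eps / (2 * A)) `^ kap^-1 / A).
have eA0 : 0 < eps / (2 * A) by rewrite divr_gt0// mulr_gt0.
have eta0 : 0 < eta by rewrite lt_min e0 divr_gt0// powR_gt0.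
have [I hI] : exists I : nat, sc (- I%:Z) <= eta.
  exists (Num.truncn eta^-1).+1; rewrite scN sc_nat -[leRHS]invrK lef_pV2 ?posrE ?exprn_gt0 ?invr_gt0//.
  apply: le_trans (ltW (truncnS_gt _)) _; rewrite -natrX ler_nat; exact: ltnW (ltn_expl _ _).
exists I; first by apply: le_trans hI _; rewrite ge_min lexx.
have small (i : int) : I%:Z <= i -> levm i <= levm i `^ th * (eps / (2 * A)).
  move=> Ii; have [->|l0] := eqVneq (levm i) 0; first by rewrite mulr_ge0 ?powR_ge0// ltW.
  have lp : 0 < levm i by rewrite lt_def l0 levm_ge0.
  rewrite -[leLHS]powRr1 ?levm_ge0// -[in leLHS](subrK th 1) addrC powRD ?(gt_eqF lp) ?implybT//.
  rewrite ler_wpM2l ?powR_ge0//.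
  have -> : 1 - th = th * kap by rewrite /kap mulrCA divff ?gt_eqF// mulr1.
  have -> : eps / (2 * A) = ((eps / (2 * A)) `^ kap^-1) `^ kap.
    by rewrite -powRrM mulVf ?gt_eqF// powRr1 ?(ltW eA0).
  rewrite powRrM.
  rewrite ge0_ler_powR ?nnegrE ?powR_ge0 ?(ltW kap0)//.
  apply: le_trans (levm_le i) _; apply: (le_via (A * eta)).
    rewrite ler_pM ?CL_ge0//; first by rewrite /A lerDl.
    by apply: le_trans hI; apply: sc_le; rewrite lerN2.
  by rewrite mulrC -ler_pdivlMr// ge_min lexx orbT.
pose F M z : R := normc (h z) * ((sc I < normc (h z)) && (normc (h z) <= sc (I%:Z + M%:Z)))%R%:R.
have mn := measurable_normc mh.
apply: (@fatou_le _ _ _ _ F).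
- by move=> k; rewrite /F; mfun.
- by move=> k z; rewrite /F mulr_ge0.
- move=> z; pose M0 := Num.truncn (normc (h z)).
  apply: cvg_near_cst; exists M0.+1 => // M /= hM; apply/eqP; rewrite /F (_ : _ <= sc _) ?andbT//.
  apply: le_trans (ltW (truncnS_gt _)) _; apply: (le_via (sc M%:Z)); last by apply: sc_le; lia.
  rewrite sc_nat -natrX ler_nat; apply: leq_trans hM _; exact: ltnW (ltn_expl _ _).
move=> M; have mI (m : 'I_M) : mfunT (fun z => (sc (I%:Z + m%:Z) < normc (h z))%R%:R : R) by mfun.
apply: (le_via (\int[mu]_z (\sum_(m < M) sc (I%:Z + m%:Z + 1) * (sc (I%:Z + m%:Z) < normc (h z))%R%:R)%:E)%E).
  apply: nn_le => z; first by rewrite lee_fin mulr_ge0.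
  rewrite lee_fin {mI}; elim: M => [|M IH].
    by rewrite big_ord0 /F addr0; case: (ltP (sc I)) => h1 /=; rewrite ?mulr0.
  rewrite big_ord_recr/=; have [h1|h1] := lerP (normc (h z)) (sc (I%:Z + M%:Z)).
    apply: le_trans (_ : F M z <= _); last by rewrite mulr0 addr0.
    rewrite /F h1 andbT ler_wpM2l// ler_nat; by case: (_ < _) => //=; exact: leq_b1.
  rewrite mulr1 /F; apply: (le_via (sc (I%:Z + M%:Z + 1))).
    case: (boolP (_ && _)) => [/andP[_ h2]|_]; rewrite ?mulr0// mulr1; apply: le_trans h2 _.
    by rewrite addrSz.
  by rewrite lerDr sumr_ge0// => m _; rewrite mulr_ge0.
rewrite nn_sum//; [|by move=> m; mfun|by move=> m z; rewrite mulr_ge0].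
apply: (le_via (\sum_(m < M) (2 * (eps / (2 * A)) * (sc (I%:Z + m%:Z) * levm (I%:Z + m%:Z) `^ th))%:E)%E).
  apply: lee_sum => m _; rewrite nnZr// -measure_gt_int// levmE -EFinM lee_fin.
  rewrite scD (_ : sc 1 = 2)//; have Im : I%:Z <= I%:Z + m%:Z by rewrite lerDl.
  have := ler_wpM2l (mulr_ge0 (sc_ge0 (R := R) (I%:Z + m%:Z)) (ler0n R 2)) (small _ Im).
  by move=> /le_trans; apply; apply: le_of_eq; ring.
rewrite sumEFin lee_fin -mulr_sumr.
apply: le_trans (ler_wpM2l _ (sum_levm _ _)) _; first by rewrite mulr_ge0// ltW.
have := CL_ge0; rewrite /A => cl.
have -> : 2 * (eps / (2 * (C * L + 1))) * (C * L) = eps * (C * L / (C * L + 1)) by field; rewrite gt_eqF// ltr_wpDl.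
by rewrite ler_piMr ?(ltW e0)// ler_pdivrMr ?ltr_wpDl// mul1r lerDl.
Qed.

End levels.

End band_windows.

(** The partition of unity in the form that finite sums can use: at each nonzero point the symmetric
    windows are eventually exactly 1. *)
Local Notation resolves Psi := (forall y : 'rV_(_), y != 0 -> exists N0 : nat, forall N : nat,
  (N0 <= N)%N -> \sum_(j < N.*2.+1) band Psi (- N%:Z + j%:Z) y = 1).

(** * The weighted estimate for one rescaled multiplier *)

Section single_scale.
Context {R : realType} {n : nat}.
Local Notation V := 'rV[R]_n.
Local Notation mu := (@lebesgue_rV R n).
Implicit Types (f g h k K : V -> R[i]) (w : V -> R) (x y z xi : V) (l : int).

Lemma measurable_sc (j : int) (f : V -> R) : mfunT f -> mfunT (fun x => f (sc j *: x)).
Proof. by move=> mf; apply: (measurableT_comp mf); mfun. Qed.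

Lemma int_sc (j : int) (f : V -> R) : mfunT f -> (forall x, 0 <= f x) ->
  (\int[mu]_x (f x)%:E = (sc j ^+ n)%:E * \int[mu]_x (f (sc j *: x))%:E)%E.
Proof.
move=> mf f0; rewrite (int_scale (sc_neq0 (R := R) j) (f := fun x => (f x)%:E))//; last exact/measurable_EFinP.
by rewrite muleA -EFinM gtr0_norm// -exprMn mulfV ?sc_neq0// expr1n mul1e.
Qed.

(** Exact, because the radii are dyadic and the dilation is by a power of 2: the scales are merely
    shifted. *)
Lemma Mx_dil w (j : int) y : mfunT w -> (forall x, 0 <= w x) ->
  Mx (fun x => w (sc j *: x)) y = Mx w (sc j *: y).
Proof.
move=> mw w0; rewrite /Mx; congr (fine (ereal_sup _)).
have bE (k : int) : bavg k (fun x => w (sc j *: x)) y = bavg (k - j) w (sc j *: y).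
  rewrite /bavg (@int_sc (- j) (fun z => w (sc j *: z) * _))//; last 2 first.
  - by apply: measurable_funM; [exact: measurable_sc|mfun].
  - by move=> z; rewrite mulr_ge0.
  rewrite muleA -EFinM -exprMn -scD; congr (_ * _)%E; apply: eq_integral => z _.
  rewrite scalerA [sc j * _]mulrC scNr scale1r; congr (_ * (nat_of_bool _)%:R)%:E.
  have -> : z - sc j *: y = sc j *: (sc (- j) *: z - y) by rewrite scalerBr scalerA mulrC scNr scale1r.
  by rewrite normrZ gtr0_norm// opprB scD ltr_pM2l.
apply/seteqP; split => _ [k _ <-]; first by exists (k - j).
by exists (k + j) => //; rewrite bE addrK.
Qed.

Variables (Psi : V -> R[i]) (s r : R).
Hypotheses (nPsi : nice Psi) (cPsi : cscont Psi) (FPsi : cintg mu (fourier Psi)).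
Hypothesis sPsi : annular Psi.
Hypotheses (n_gt0 : (0 < n)%N) (s0 : 0 < s) (sn : s < n%:R) (r1 : 1 < r) (rs : n%:R / (2 * r) < s).

Let n0 : 0 < n%:R :> R. Proof. by rewrite ltr0n. Qed.

Let qs : (n%:R / s)^-1 = s / n%:R. Proof. by rewrite invf_div. Qed.

Lemma sqr_normcD (a b : R[i]) : normc (a + b) ^+ 2 <= 2 * normc a ^+ 2 + 2 * normc b ^+ 2.
Proof.
have h := normcD a b; apply: (le_via ((normc a + normc b) ^+ 2)).
  by rewrite lerXn2r ?nnegrE ?addr_ge0.
by rewrite -subr_ge0 (_ : _ - _ = (normc a - normc b) ^+ 2) ?sqr_ge0//; ring.
Qed.

Lemma normc_fourier_winv (Q : V -> R[i]) (a : R) xi : nice Q ->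
  (forall xi, normc (fourier Q xi) <= a) -> normc (fourier (fun y => winv s y * Q y) xi) <= a.
Proof.
move=> nQ aQ; have s2 : 0 < 2 / s by rewrite divr_gt0.
by have [gam g0 hg] := subordination s2; exact: (@fourier_winv_le R n s Q s0 nQ gam g0 hg a xi aQ).
Qed.

Lemma lorentz_lev : exists2 C : R, 0 <= C & forall h (L : R), cmeas h ->
  (lorentz1 (n%:R / s) h <= L%:E)%E -> forall (i0 : int) M (x : 'I_M -> R), (forall i, 0 <= x i) ->
  (forall i, (x i)%:E <= mu [set y | (sc (i0 + i%:Z) < normc (h y))%R])%E ->
  \sum_(i < M) sc (i0 + i%:Z) * x i `^ (s / n%:R) <= C * L.
Proof.
have [C C0 hC] := @lorentz_levels R n (n%:R / s) (divr_gt0 n0 s0).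
exists C => // h L mh hL i0 M x x0 hx; rewrite -lee_fin EFinM; have := hC h i0 M x mh x0 hx.
by rewrite qs => /le_trans; apply; rewrite lee_wpmul2l ?lee_fin.
Qed.

(** For a level of measure [e], [gain_le] and [geom_window] sum the bounds over all bands to a
    constant independent of [e]; what remains is the sum over levels in the Lorentz norm.
    Minkowski's inequality keeps the bound independent of the numbers of bands and levels. *)
Lemma pieces_bound : exists2 C : R, 0 <= C & forall h (L : R), cmeas h ->
  (lorentz1 (n%:R / s) h <= L%:E)%E -> forall f w (Bw : R) (j0 i0 : int) (M M' : nat), nice f ->
  mfunT w -> (forall x, 0 <= w x <= Bw) -> (\int[mu]_x (normc (\sum_(q : 'I_M * 'I_M')
      convol (fun y => winv s y * bpiece Psi (j0 + q.1%:Z) (slice h (i0 + q.2%:Z)) y) f x) ^+ 2 * w x)%:E <=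
   (C * L ^+ 2)%:E * \int[mu]_x (normc (f x) ^+ 2 * Mr r w x)%:E)%E.
Proof.
have [C1 C10 hC1] := lorentz_lev.
have [C2 C20 hC2] := piece_bound nPsi cPsi FPsi sPsi n_gt0 s0 r1.
have a0 : 0 < n%:R - s by rewrite subr_gt0.
have b0 : 0 < s - n%:R / (2 * r) by rewrite subr_gt0.
have [B B0 hB] := geom_window a0 b0.
exists ((2 * B * C1) ^+ 2 * C2) => [|h L mh hL f w Bw j0 i0 M M' nf mw wB].
  by rewrite mulr_ge0// exprn_ge0// mulr_ge0// mulr_ge0.
have lev := hC1 h L mh hL.
have lE := levmE s0 sn lev; have l0 i := levm_ge0 h i.
have ms i := cmeas_slice i mh.
have hs i z := normc_slice h i z.
have es i : (\int[mu]_z (slice h i z != 0)%:R%:E <= (levm h i)%:E)%E.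
  by apply: slice_level => //; rewrite lE.
have w0 x : 0 <= w x by have /andP[] := wB x.
set J := (\int[mu]_x (normc (f x) ^+ 2 * _)%:E)%E.
have J0 : (0 <= J)%E by apply: int_ge0 => x; rewrite mulr_ge0 ?powR_ge0 ?exprn_ge0.
have g0 u : 0 <= @gain R n s r u by rewrite mulr_ge0 ?powR_ge0// le_min !powR_ge0.
pose b (q : 'I_M * 'I_M') : R := sc (i0 + q.2%:Z + 1) * levm h (i0 + q.2%:Z) `^ (s / n%:R) *
  @gain R n s r (sc (j0 + q.1%:Z) * levm h (i0 + q.2%:Z) `^ n%:R^-1).
have bb q : 0 <= b q by rewrite mulr_ge0// mulr_ge0 ?powR_ge0.
have nb l i := nice_bpiece nPsi FPsi l (ms i) (hs i) (sc_ge0 _) (es i).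
have cb l i := cscont_bpiece nPsi l (ms i) (hs i) (sc_ge0 _) (es i).
have nwb l i : nice (fun y => winv s y * bpiece Psi l (slice h i) y).
  apply: nice_mulb (nb l i); first exact/cscont_cmeas/cscont_winv.
  by move=> y; apply: normc_winv_le1; exact: ltW.
have [mf _ fi] := nf.
have H (q : 'I_M * 'I_M') : (\int[mu]_x (normc (convol (fun y => winv s y * bpiece Psi (j0 + q.1%:Z) (slice h (i0 + q.2%:Z)) y) f x) ^+ 2 * w x)%:E
    <= (b q ^+ 2 * C2)%:E * J)%E /\ (b q = 0 -> forall x,
      convol (fun y => winv s y * bpiece Psi (j0 + q.1%:Z) (slice h (i0 + q.2%:Z)) y) f x = 0).
  (* [piece_bound] asks for a positive measure; the pieces of a level of measure zero vanish
     identically. *)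
  set l := j0 + _; set i := i0 + _; have [z|nz] := eqVneq (levm h i) 0.
    have zc x : convol (fun y => winv s y * bpiece Psi l (slice h i) y) f x = 0.
      rewrite /convol (_ : (fun y => _) = fun y => 0 * f y).
        by rewrite cintZ// mul0r.
      apply/funext => y; congr (_ * _); apply: eq0_normc.
      have := normc_invfourier_level (ms i) (hs i) (sc_ge0 _) (es i) (x - y).
      rewrite z mulr0 => h0; apply/eqP; rewrite eq_le normc_ge0 andbT !normcM.
      by rewrite (_ : normc (invfourier _ _) = 0) ?mulr0//; apply/eqP; rewrite eq_le h0 normc_ge0.
    split=> // ; under eq_integral do rewrite zc normc0 expr0n mul0r.
    by rewrite integral0 mule_ge0// lee_fin mulr_ge0// exprn_ge0.
  have lp : 0 < levm h i by rewrite lt_def nz l0.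
  split=> [|/eqP]; first exact: hC2 (ms i) (hs i) (sc_gt0 _) lp (es i) nf mw wB.
  rewrite gt_eqF// !mulr_gt0 ?powR_gt0//; set u := sc _ * _.
    by rewrite mulr_gt0// powR_gt0.
  have u0 : 0 < u by rewrite mulr_gt0// powR_gt0.
  by rewrite lt_min !powR_gt0.
have mX (q : 'I_M * 'I_M') : cmeas (convol (fun y => winv s y * bpiece Psi (j0 + q.1%:Z) (slice h (i0 + q.2%:Z)) y) f).
  by have [m _ _] := nwb (j0 + q.1%:Z) (i0 + q.2%:Z); exact: cmeas_conv.
have := minkowski_fin mX mw w0 bb (fun q => (H q).2) C20 J0 (fun q => (H q).1).
move=> /le_trans; apply; rewrite lee_wpmul2r// lee_fin [leRHS]mulrAC ler_wpM2r//.
have sb0 : 0 <= \sum_q b q by exact: sumr_ge0.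
have CL : 0 <= C1 * L := CL_ge0 s0 sn lev.
rewrite -exprMn lerXn2r ?nnegrE//; first by rewrite -!mulrA mulr_ge0// mulr_ge0.
rewrite -(pair_bigA _ (fun j i => b (j, i)))/= exchange_big/=.
apply: (le_via (\sum_(i < M') 2 * B * (sc (i0 + i%:Z) * levm h (i0 + i%:Z) `^ (s / n%:R)))).
  apply: ler_sum => i _; rewrite /b/= -mulr_sumr scD (_ : sc 1 = 2)//.
  have [z|nz] := eqVneq (levm h (i0 + i%:Z)) 0.
    by rewrite z powR0 ?mulr0 ?mul0r// mulf_neq0 ?invr_neq0// gt_eqF.
  have lp : 0 < levm h (i0 + i%:Z) by rewrite lt_def nz l0.
  have := hB (@gain R n s r) (levm h (i0 + i%:Z) `^ n%:R^-1) j0 M (powR_gt0 _ lp) (fun t t0 => @gain_le R n s r t t0).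
  set S := \sum_(_ < _) _; set T := sc _; set Y := _ `^ _ => hS.
  have -> : T * 2 * Y * S = 2 * (T * Y) * S by ring.
  have -> : 2 * B * (T * Y) = 2 * (T * Y) * B by ring.
  by rewrite ler_wpM2l// mulr_ge0// mulr_ge0 ?powR_ge0// /T sc_ge0.
rewrite -mulr_sumr -!mulrA ler_wpM2l// ler_wpM2l//.
exact: (sum_levm s0 sn lev).
Qed.

Lemma winvK y : winv s y * winv (- s) y = 1.
Proof.
rewrite /winv -rmorphM/= -powRD ?(gt_eqF (jap_gt0 y)) ?implybT//.
by rewrite mulNr opprK addNr powRr0.
Qed.

Section window.
Variables (K h : V -> R[i]) (BK : R).
Hypotheses (cK : cscont K) (hK : forall y, normc (K y) <= BK) (mh : cmeas h).
Hypothesis rep : forall l xi, cintg mu (fun z => h z * dil Psi l (z - xi)) /\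
  fourier (fun y => winv (- s) y * (band Psi l y * K y)) xi = cint mu (fun z => h z * dil Psi l (z - xi)).

Let BK0 : 0 <= BK. Proof. exact: le_trans (normc_ge0 _) (hK 0). Qed.

(** An annular piece of the kernel multiplied by the inverse of [winv s]; by [rep] its transform is
    [h] integrated against translates of a dilate of [Psi]. *)
Let RR l y : R[i] := winv (- s) y * (band Psi l y * K y).

Lemma cscont_RR l : cscont (RR l).
Proof. by apply: cscontM; [exact: cscont_winv|apply: cscontM => //; exact: cscont_band]. Qed.

(** On an annulus the growing weight [winv (- s)] is bounded, here by [W]. *)
Lemma nice_RR l : nice (RR l).
Proof.
pose W : R := (1 + 4 * pi ^+ 2 * (4 * sc l ^+ 2)) `^ (s / 2).
have W0 : 0 <= W by exact: powR_ge0.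
have p0 : 0 <= 4 * pi ^+ 2 :> R by rewrite mulr_ge0// sqr_ge0.
have h1 y : normc (RR l y) <= W * BK * normc (band Psi l y).
  rewrite 2!normcM; case: (eqVneq (band Psi l y) 0) => [->|b0].
    by rewrite normc0 mul0r !mulr0.
  have /andP[_ h2] := band_supp nPsi sPsi b0.
  rewrite [normc (band _ _ _) * _]mulrC mulrA ler_wpM2r// ler_pM//.
  rewrite normc_rc ger0_norm ?powR_ge0// mulNr opprK ge0_ler_powR ?nnegrE ?divr_ge0 ?(ltW s0) ?(ltW (jap_gt0 y))//.
    by rewrite addr_ge0// mulr_ge0// mulr_ge0// exprn_ge0.
  by rewrite lerD2l ler_wpM2l// ltW.
split; first exact/cscont_cmeas/cscont_RR.
  exists (W * BK * N1 Psi) => y; apply: le_trans (h1 y) _.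
  by rewrite ler_wpM2l ?mulr_ge0//; exact: normc_band.
have [mb bi] := cintg_band nPsi FPsi l; have mn := measurable_normc mb.
apply: (cintg_le _ h1); first exact/cscont_cmeas/cscont_RR.
by apply: nnZr_lty => //; rewrite mulr_ge0.
Qed.

(** What is left over are the values of [h] outside []2^-I, 2^I]]: the small ones are at most [eps]
    and meet the L^1 norm of the dilate, the large ones have small L^1 norm and meet its sup
    norm. *)
Lemma fourier_remainder l (I : nat) (eps BP : R) xi : (forall y, normc (Psi y) <= BP) ->
  (forall i, (mu [set y | (sc i < normc (h y))%R] = (levm h i)%:E)%E) ->
  sc (- I%:Z) <= eps -> (\int[mu]_z (normc (h z) * (sc I < normc (h z))%R%:R)%:E <= eps%:E)%E ->
  normc (fourier (fun y => RR l y - \sum_(i < I.*2) bpiece Psi l (slice h (- I%:Z + i%:Z)) y) xi) <=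
  eps * (N1 Psi + sc l ^+ n * BP).
Proof.
move=> hBP lE eI tI.
have BP0 : 0 <= BP by exact: le_trans (normc_ge0 _) (hBP 0).
have ms i := cmeas_slice i mh.
have es i : (\int[mu]_z (slice h i z != 0)%:R%:E <= (levm h i)%:E)%E by apply: slice_level => //; rewrite lE.
have nb i := nice_bpiece nPsi FPsi l (ms i) (normc_slice h i) (sc_ge0 _) (es i).
have [_ _ iR] := nice_RR l.
have ib i : cintg mu (bpiece Psi l (slice h i)) by have [] := nb i.
have [hi Fi] := rep l xi.
have [md _ di] := nice_dil l nPsi.
have mds : cmeas (fun z => dil Psi l (z - xi)) by apply: (cmeas_comp md); mfun.
have dB z : normc (dil Psi l (z - xi)) <= sc l ^+ n * BP.
  by rewrite normcM normc_rc ger0_norm ?exprn_ge0// ler_wpM2l ?exprn_ge0.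
have si i : cintg mu (fun z => slice h i z * dil Psi l (z - xi)).
  have [_ _ hs] := nice_level (ms i) (normc_slice h i) (sc_ge0 _) (es i).
  by under eq_fun do rewrite mulrC; exact: (cintgMb hs mds dB).
rewrite fourierB//; last by apply: cintg_sum.
rewrite Fi fourier_sum//.
under eq_bigr => i _ do rewrite (fourier_bpiece nPsi cPsi FPsi l (ms _) (normc_slice h _) (sc_ge0 _) (es _)).
rewrite -cint_sum// -cintB//; last exact: cintg_sum.
have ri : cintg mu (fun z => h z * dil Psi l (z - xi) -
    \sum_(i < I.*2) slice h (- I%:Z + i%:Z) z * dil Psi l (z - xi)).
  by have := cintgD hi (cintgZ (-1) (cintg_sum (index_enum 'I_I.*2) (fun i : 'I_I.*2 => si (- I%:Z + i%:Z)))); under eq_fun do rewrite mulN1r.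
rewrite -lee_fin; apply: le_trans (le_cint ri) _.
have mn := measurable_normc mds; have mnh := measurable_normc mh.
apply: (le_via (\int[mu]_z (eps * normc (dil Psi l (z - xi)) +
    sc l ^+ n * BP * (normc (h z) * (sc I < normc (h z))%R%:R))%:E)%E).
  apply: nn_le => z; first by rewrite lee_fin.
  rewrite lee_fin -mulr_suml sum_slice -mulrBl normcM -{1}(mulr1 (h z)) -mulrBr normcM.
  have -> : - I%:Z + (I.*2)%:Z = I%:Z by rewrite -addnn PoszD addKr.
  set t := normc (h z); set d := normc (dil _ _ _).
  have d0 : 0 <= d by exact: normc_ge0.
  have t0 : 0 <= t by exact: normc_ge0.
  have dle : d <= sc l ^+ n * BP := dB z.
  have eps0 : 0 <= eps by exact: le_trans eI.
  have sB : 0 <= sc l ^+ n * BP by exact: le_trans dle.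
  move: (sc l ^+ n * BP) dle sB => S dle sB.
  case: (ltP (sc (- I%:Z)) t) => h1 /=; last first.
    rewrite subr0 normc1 mulr1 ler_wpDr ?mulr_ge0//.
    by rewrite ler_wpM2r// (le_trans h1).
  case: (leP t (sc I%:Z)) => h2 /=.
    by rewrite subrr normc0 mulr0 mul0r mulr0 addr0 mulr_ge0.
  rewrite subr0 normc1 !mulr1 ler_wpDl ?mulr_ge0//.
  by rewrite mulrC ler_wpM2r.
have eps0 : 0 <= eps by exact: le_trans eI.
have sB : 0 <= sc l ^+ n * BP by rewrite mulr_ge0 ?exprn_ge0.
rewrite nnD; [|by mfun|by mfun|by move=> z; rewrite mulr_ge0|by move=> z; rewrite mulr_ge0// mulr_ge0].
rewrite nnZr// nnZr//; [|by mfun|by move=> z; rewrite mulr_ge0].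
rewrite mulrDr [leRHS]EFinD; apply: leeD; last by rewrite [eps * _]mulrC [leRHS]EFinM lee_wpmul2l ?lee_fin.
rewrite (int_shift (- xi) (f := fun y => (normc (dil Psi l y))%:E))//; last exact/measurable_EFinP/measurable_normc.
by rewrite [leRHS]EFinM lee_wpmul2l ?lee_fin// (N1E di) (N1_dil nPsi).
Qed.

End window.

(** Finitely many levels are handled by [pieces_bound]. The remainder is estimated in plain L^2,
    with the weight replaced by its bound [Bw]; the factor so produced depends on the window and on
    [f], but [eps] is chosen after it. *)
Lemma window_conv : exists2 C : R, 0 <= C & forall K h (BK L : R), cscont K ->
  (forall y, normc (K y) <= BK) -> cmeas h ->
  (forall l xi, cintg mu (fun z => h z * dil Psi l (z - xi)) /\
    fourier (fun y => winv (- s) y * (band Psi l y * K y)) xi = cint mu (fun z => h z * dil Psi l (z - xi))) ->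
  (lorentz1 (n%:R / s) h <= L%:E)%E -> forall f w (Bw : R) (j0 : int) (M : nat), nice f ->
  mfunT w -> (forall x, 0 <= w x <= Bw) ->
  (\int[mu]_x (normc (convol (fun y => \sum_(j < M) band Psi (j0 + j%:Z) y * K y) f x) ^+ 2 * w x)%:E <=
   (C * L ^+ 2)%:E * \int[mu]_x (normc (f x) ^+ 2 * Mr r w x)%:E)%E.
Proof.
have [C1 C10 hC1] := lorentz_lev.
have [C C0 hC] := pieces_bound.
exists (2 * C) => [|K h BK L cK hK mh rep hL f w Bw j0 M nf mw wB]; first by rewrite mulr_ge0.
have [_ [BP hBP] _] := nPsi; have BP0 : 0 <= BP by exact: le_trans (normc_ge0 _) (hBP 0).
have lev := hC1 h L mh hL; have lE := levmE s0 sn lev.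
have w0 x : 0 <= w x by have /andP[] := wB x.
have Bw0 : 0 <= Bw by have /andP[a b] := wB 0; exact: le_trans b.
have [mf _ fi] := nf.
pose F2 := fine (\int[mu]_x (normc (f x) ^+ 2)%:E)%E.
have F2E : (\int[mu]_x (normc (f x) ^+ 2)%:E = F2%:E)%E.
  by rewrite fineK// ge0_fin_numE ?int_sqr_lty//; apply: int_ge0 => x; rewrite exprn_ge0.
have F20 : 0 <= F2 by rewrite -lee_fin -F2E; apply: int_ge0 => x; rewrite exprn_ge0.
pose A1 := \sum_(j < M) (N1 Psi + sc (j0 + j%:Z) ^+ n * BP).
have A10 : 0 <= A1 by apply: sumr_ge0 => j _; rewrite addr_ge0 ?N1_ge0// mulr_ge0 ?exprn_ge0.
apply/lee_addgt0Pr => e e0.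
pose E := 2 * Bw * A1 ^+ 2 * F2; have E0 : 0 <= E by rewrite !mulr_ge0// sqr_ge0.
pose eps := Num.min 1 (e / (E + 1)).
have eps0 : 0 < eps by rewrite lt_min ltr01 divr_gt0// ltr_wpDl.
have epsE : eps ^+ 2 * E <= e.
  have e1 : eps <= 1 by rewrite ge_min lexx.
  have e2 : eps * (E + 1) <= e by rewrite -ler_pdivlMr ?ltr_wpDl// ge_min lexx orbT.
  by apply: le_trans e2; rewrite expr2 -mulrA ler_wpM2l ?(ltW eps0)//; nra.
have [I eI tI] := tail_small s0 sn mh C10 lev eps0.
have ms i := cmeas_slice i mh.
have es i : (\int[mu]_z (slice h i z != 0)%:R%:E <= (levm h i)%:E)%E by apply: slice_level => //; rewrite lE.
have nb l i := nice_bpiece nPsi FPsi l (ms i) (normc_slice h i) (sc_ge0 _) (es i).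
have cb l i := cscont_bpiece nPsi l (ms i) (normc_slice h i) (sc_ge0 _) (es i).
pose Q l y := winv (- s) y * (band Psi l y * K y) - \sum_(i < I.*2) bpiece Psi l (slice h (- I%:Z + i%:Z)) y.
have nQ l : nice (Q l).
  have := niceD (nice_RR cK hK l) (niceZ (-1) (nice_sum (index_enum 'I_I.*2) (fun i : 'I_I.*2 => nb l (- I%:Z + i%:Z)))).
  by under eq_fun do rewrite mulN1r.
have cQ l : cscont (Q l).
  apply/cscontP => u x ux; have [a1 a2] := (cscontP _).1 (cscont_RR cK l) u x ux.
  have [b1 b2] : ccvg (fun m : nat => \sum_(i < I.*2) bpiece Psi l (slice h (- I%:Z + i%:Z)) (u m))
      (\sum_(i < I.*2) bpiece Psi l (slice h (- I%:Z + i%:Z)) x).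
    by apply: ccvg_sum => i; exact: (cscontP _).1 (cb l _) u x ux.
  split; rewrite /Q ?ReD ?ImD ?ReN ?ImN.
    by under eq_fun do rewrite ReD ReN; exact: cvgB.
  by under eq_fun do rewrite ImD ImN; exact: cvgB.
pose De y := \sum_(j < M) Q (j0 + j%:Z) y.
have nD : nice De by exact: nice_sum.
have cD : cscont De by exact: cscont_sum.
have FD xi : normc (fourier De xi) <= eps * A1.
  rewrite fourier_sum => [|j]; last by have [] := nQ (j0 + j%:Z).
  apply: le_trans (normc_sum _ _) _; rewrite mulr_sumr; apply: ler_sum => j _.
  exact: (fourier_remainder cK hK mh rep).
have winv1 y : normc (winv s y) <= 1 by apply: normc_winv_le1; exact: ltW.
have mwi : cmeas (winv s : V -> R[i]) by exact/cscont_cmeas/cscont_winv.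
have nwb l i : nice (fun y => winv s y * bpiece Psi l (slice h i) y) by exact: nice_mulb.
have nwD : nice (fun y => winv s y * De y) by exact: nice_mulb.
have cwD : cscont (fun y => winv s y * De y) by apply: cscontM => //; exact: cscont_winv.
pose X1 x := \sum_(q : 'I_M * 'I_I.*2)
  convol (fun y => winv s y * bpiece Psi (j0 + q.1%:Z) (slice h (- I%:Z + q.2%:Z)) y) f x.
pose X2 := convol (fun y => winv s y * De y) f.
have cE x : convol (fun y => \sum_(j < M) band Psi (j0 + j%:Z) y * K y) f x = X1 x + X2 x.
  rewrite /X1 -convol_suml// -convolD//; last exact: nice_sum.
  congr convol; apply/funext => y; rewrite -mulr_sumr -mulrDr /De /Q sumrB.
  rewrite -(pair_bigA _ (fun (j : 'I_M) (i : 'I_I.*2) => bpiece Psi (j0 + j%:Z) (slice h (- I%:Z + i%:Z)) y))/=.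
  by rewrite addrC subrK -mulr_sumr mulrA winvK mul1r.
have mX1 : cmeas X1.
  by apply: cmeas_sum => q; have [m _ _] := nwb (j0 + q.1%:Z) (- I%:Z + q.2%:Z); exact: cmeas_conv.
have mX2 : cmeas X2 by have [m _ _] := nwD; exact: cmeas_conv.
have mn1 := measurable_normc mX1; have mn2 := measurable_normc mX2.
apply: (le_via (\int[mu]_x (2 * (normc (X1 x) ^+ 2 * w x) + 2 * Bw * normc (X2 x) ^+ 2)%:E)%E).
  apply: nn_le => x; first by rewrite lee_fin mulr_ge0 ?exprn_ge0.
  rewrite lee_fin cE; have [_ wb] := andP (wB x).
  have h1 := sqr_normcD (X1 x) (X2 x).
  apply: le_trans (ler_wpM2r (w0 x) h1) _.
  have := ler_wpM2l (exprn_ge0 2 (normc_ge0 (X2 x))) wb.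
  by move: (normc (X1 x) ^+ 2) (normc (X2 x) ^+ 2) (w x) => A B v; lra.
rewrite nnD; last 4 first.
- by mfun.
- by mfun.
- by move=> x; rewrite mulr_ge0// mulr_ge0 ?exprn_ge0.
- by move=> x; rewrite !mulr_ge0 ?exprn_ge0.
rewrite nnZr//; [|by mfun|by move=> x; rewrite mulr_ge0 ?exprn_ge0].
rewrite nnZr ?mulr_ge0//; [|by mfun|by move=> x; rewrite exprn_ge0].
apply: leeD.
  rewrite -mulrA EFinM -muleA lee_wpmul2l ?lee_fin//.
  exact: (hC h L mh hL f w Bw j0 (- I%:Z) M I.*2 nf mw wB).
apply: (le_via ((2 * Bw)%:E * (((eps * A1) ^+ 2)%:E * F2%:E))%E).
  rewrite lee_wpmul2l ?lee_fin ?mulr_ge0// -F2E; apply: convol_L2 => // xi.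
  exact: normc_fourier_winv.
by rewrite -!EFinM lee_fin; apply: le_trans epsE; rewrite /E; apply: le_of_eq; ring.
Qed.

Hypothesis Psum : resolves Psi.

(** All bands vanish at 0, so windows cannot converge to 1 there and a point has to be removed from
    the integral. It is null because it lies in arbitrarily small balls and [n] is positive. *)
Lemma cint_point g x (c : R) : cintg mu g -> (forall y, normc (g y) <= c) ->
  cint mu (fun y => g y * (0 < `|y - x|)%R%:R%:C%C) = cint mu g.
Proof.
move=> gi gc; have c0 : 0 <= c := le_trans (normc_ge0 _) (gc 0).
have mb : cmeas (fun y : V => ((0 < `|y - x|)%R%:R : R)%:C%C) by apply: cmeas_rc; mfun.
have gi' : cintg mu (fun y => g y * (0 < `|y - x|)%R%:R%:C%C).
  under eq_fun do rewrite mulrC; apply: (cintgMb (B := 1) gi mb) => y.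
  by rewrite normc_rc ger0_norm// lern1 leq_b1.
apply/eqP; rewrite -subr_eq0; apply/eqP/eq0_normc; rewrite -cintB//.
set v := normc _; have v0 : 0 <= v by exact: normc_ge0.
apply/eqP; rewrite eq_le v0 andbT leNgt; apply/negP => vp.
have di : cintg mu (fun y => g y * (0 < `|y - x|)%R%:R%:C%C - g y).
  by have := cintgD gi' (cintgZ (-1) gi); under eq_fun do rewrite mulN1r.
have H (rho : R) : 0 < rho -> v <= c * (2 * rho) ^+ n.
  move=> r0; rewrite -lee_fin; apply: le_trans (le_cint di) _.
  apply: (le_via (\int[mu]_y (c * (`|y - x| < rho)%R%:R)%:E)%E).
    apply: nn_le => y; first by rewrite lee_fin.
    rewrite lee_fin; case: (ltP 0 `|y - x|) => h1 /=.
      by rewrite mulr1 subrr normc0 mulr_ge0.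
    by rewrite mulr0 add0r normcNE (le_lt_trans h1 r0) mulr1.
  by rewrite nnZr//; [rewrite int_ball// -EFinM|mfun].
pose t := Num.min 1 (v / (2 * (c + 1))).
have c2 : 0 < 2 * (c + 1) by rewrite mulr_gt0// ltr_wpDl.
have t0 : 0 < t by rewrite lt_min ltr01 divr_gt0.
have tn : t ^+ n <= t.
  by rewrite -[leRHS]expr1 ler_wiXn2l ?(ltW t0)// ge_min lexx.
have := H (t / 2) (divr_gt0 t0 (ltr0n R 2)); rewrite (mulrC 2) divfK ?pnatr_eq0// => h1.
have h2 : t * (2 * (c + 1)) <= v by rewrite -ler_pdivlMr// ge_min lexx orbT.
have h3 := ler_wpM2l c0 tn.
by move: h1 h2 h3 vp t0 c0; move: (t ^+ n) => u; nra.
Qed.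

(** Off the point [y = x] the windows reach 1, and their sums are bounded by [band_window], so
    dominated convergence applies. *)
Lemma convol_windows K f (BK : R) x : cscont K -> (forall y, normc (K y) <= BK) -> nice f ->
  ccvg (fun N : nat => convol (fun y => \sum_(j < N.*2.+1) band Psi (- N%:Z + j%:Z) y * K y) f x)
    (convol K f x).
Proof.
move=> cK hK [mf [Bf hBf] fi]; have mK := cscont_cmeas cK.
have BK0 : 0 <= BK := le_trans (normc_ge0 _) (hK 0).
have Bf0 : 0 <= Bf := le_trans (normc_ge0 _) (hBf 0).
have [B B0 hB] := band_window nPsi sPsi.
have mxK : cmeas (fun y => K (x - y)) by apply: (cmeas_comp mK); mfun.
have mg : cmeas (fun y => K (x - y) * f y) by exact: cmeasM.
rewrite /convol -(@cint_point (fun y => K (x - y) * f y) x (BK * Bf)); last 2 first.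
- exact: cintgMb fi mxK (fun y => hK _).
- by move=> y; rewrite normcM ler_pM.
apply: (@cint_dct _ _ _ _ _ _ (fun y => B * BK * normc (f y))).
- move=> N; apply: cmeasM => //; apply: cmeas_sum => j; apply: cmeasM => //.
  have mb : cmeas (band Psi (- N%:Z + j%:Z)) by exact/cscont_cmeas/cscont_band.
  by apply: (cmeas_comp mb); mfun.
- by apply: cmeasM => //; apply: cmeas_rc; mfun.
- move=> y; have [yx|yx] := eqVneq y x.
    rewrite yx subrr normr0 ltxx /= mulr0; under eq_fun => N.
      rewrite big1 ?mul0r; first over.
      by move=> j _; rewrite (band0 nPsi sPsi) mul0r.
    exact: ccvg_cst.
  have xy : x - y != 0 by rewrite subr_eq0 eq_sym.
  have [N0 hN0] := Psum xy.
  have -> : 0 < `|y - x| by rewrite normr_gt0 subr_eq0.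
  rewrite mulr1; have E N : (N0 <= N)%N ->
      (\sum_(j < N.*2.+1) band Psi (- N%:Z + j%:Z) (x - y) * K (x - y)) * f y = K (x - y) * f y.
    by move=> h; rewrite -mulr_suml hN0// mul1r.
  by split; apply: cvg_near_cst; exists N0 => // N /= h; apply/eqP; rewrite E.
- move=> N y; rewrite -mulr_suml 2!normcM ler_wpM2r// ler_pM//.
  by apply: le_trans (normc_sum _ _) _; exact: hB.
- by have mn := measurable_normc mf; mfun.
- have [_ fl] := fi; apply: nnZr_lty => //; [by rewrite mulr_ge0|exact: measurable_normc].
Qed.

(** What is used of the fact that [h] represents the Bessel potential of [g]: its pairings with all
    translated dilates of [Psi]. *)
Definition scale_rep g h := forall l xi, cintg mu (fun z => h z * dil Psi l (z - xi)) /\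
  fourier (fun y => winv (- s) y * (band Psi l y * invfourier g y)) xi = cint mu (fun z => h z * dil Psi l (z - xi)).

(** The constant of [window_conv] does not depend on the window, so Fatou exhausts the kernel. *)
Lemma unit_scale : exists2 C : R, 0 <= C & forall g h (L : R), cintg mu g -> cmeas h ->
  scale_rep g h -> (lorentz1 (n%:R / s) h <= L%:E)%E ->
  forall f w (Bw : R), nice f -> mfunT w -> (forall x, 0 <= w x <= Bw) ->
  (\int[mu]_x (normc (convol (invfourier g) f x) ^+ 2 * w x)%:E <=
   (C * L ^+ 2)%:E * \int[mu]_x (normc (f x) ^+ 2 * Mr r w x)%:E)%E.
Proof.
have [C C0 hC] := window_conv.
exists C => // g h L gi mh rep hL f w Bw nf mw wB.
have cK := cscont_invfourier gi; have hK y := normc_invfourier y gi.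
have w0 x : 0 <= w x by have /andP[] := wB x.
have [mf _ fi] := nf; have mK := cscont_cmeas cK.
pose k N y := \sum_(j < N.*2.+1) band Psi (- N%:Z + j%:Z) y * invfourier g y.
have mk N : cmeas (convol (k N) f).
  apply: cmeas_conv => //; apply: cmeas_sum => j; apply: cmeasM => //.
  exact/cscont_cmeas/cscont_band.
apply: (@fatou_le _ _ _ _ (fun N x => normc (convol (k N) f x) ^+ 2 * w x)).
- by move=> N; have mn := measurable_normc (mk N); mfun.
- by move=> N x; rewrite mulr_ge0 ?exprn_ge0.
- move=> x; have := ccvg_normc (convol_windows x cK hK nf) => cv.
  by apply: cvgM; [apply: cvgM|exact: cvg_cst].
- by move=> N; exact: (hC _ _ _ L cK hK mh rep hL).
Qed.

Definition single_scale_bound (C : R) := forall g h (L : R), cintg mu g -> cmeas h ->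
  scale_rep g h -> (lorentz1 (n%:R / s) h <= L%:E)%E ->
  forall (j : int) f w (Bw : R), nice f -> mfunT w -> (forall x, 0 <= w x <= Bw) ->
  (\int[mu]_x (normc (invfourier (fun xi => g (sc (- j) *: xi) * fourier f xi) x) ^+ 2 * w x)%:E <=
   (C * L ^+ 2)%:E * \int[mu]_x (normc (f x) ^+ 2 * Mr r w x)%:E)%E.

(** Dilating [f] and [w] by powers of 2 reduces to [unit_scale]: the factors [2^(jn)] cancel and the
    maximal function commutes with the dilation. *)
Lemma single_scale : exists2 C : R, 0 <= C & single_scale_bound C.
Proof.
have [C C0 hC] := unit_scale.
exists C => // g h L gi mh rep hL j f w Bw nf mw wB.
have w0 x : 0 <= w x by have /andP[] := wB x.
pose fj := dil f (- j); have nfj : nice fj by exact: nice_dil.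
pose wj y := w (sc (- j) *: y).
have mwj : mfunT wj by exact: measurable_sc.
have wjB y : 0 <= wj y <= Bw by exact: wB.
pose u := convol (invfourier g) fj.
have [mf [Bf hBf] fi] := nf; have [mfj _ fji] := nfj.
have mu' : cmeas u by apply: cmeas_conv => //; exact/cscont_cmeas/cscont_invfourier.
have ggi : cintg mu (fun xi => g xi * fourier fj xi).
  under eq_fun do rewrite mulrC.
  apply: (cintgMb gi (B := N1 fj)); first exact/cscont_cmeas/cscont_fourier.
  by move=> xi; exact: normc_fourier.
have uE x : invfourier (fun xi => g (sc (- j) *: xi) * fourier f xi) x = (sc j ^+ n)%:C%C * u (sc j *: x).
  rewrite /u invfourier_conv// !invfourierE.
  have ci : cintg mu (fun xi => g xi * fourier fj xi * ec (dotmx (sc j *: x) xi)).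
    by apply: cintg_char => //; mdot.
  have := cint_affine 0 (sc_neq0 (R := R) (- j)) ci.
  rewrite gtr0_norm// -scN opprK => <-; congr cint; apply/funext => xi.
  rewrite addr0 /fj fourier_dil// opprK scalerA [sc j * _]mulrC scNr scale1r; congr (_ * ec _).
  by rewrite dotmxZl dotmxZr mulrA [sc j * _]mulrC scNr mul1r.
have H := hC g h L gi mh rep hL fj wj Bw nfj mwj wjB; rewrite -/u in H.
have mn := measurable_normc mu'.
have mwr : mfunT (fun y => w y `^ r) by exact: measurable_powRl.
have wr0 y : 0 <= w y `^ r by exact: powR_ge0.
have wrB y : 0 <= w y `^ r <= Bw `^ r.
  have /andP[a b] := wB y; rewrite wr0 ge0_ler_powR ?nnegrE//; [exact: ltW (lt_trans _ r1)|exact: le_trans b].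
have MxE' : Mx (fun y => wj y `^ r) = fun y => Mx (fun y => w y `^ r) (sc (- j) *: y).
  by apply/funext => y; exact: (Mx_dil _ _ mwr wr0).
have mM := measurable_Mx mwr wrB.
have mnf := measurable_normc mf; have mnj := measurable_normc mfj.
have c0 : 0 < sc j ^+ n :> R by rewrite exprn_gt0.
have ci0 : 0 <= (sc j ^+ n)^-1 :> R by rewrite invr_ge0 ltW.
rewrite MxE' in H; clear MxE'.
move: mM H; move: (Mx (fun y => w y `^ r)) => m mM H.
set J1 := (\int[mu]_x (normc (fj x) ^+ 2 * _)%:E)%E in H.
set J := (X in (_ <= _ * X)%E).
have J1E : J1 = (((sc j ^+ n)^-1)%:E * J)%E.
  rewrite /J1 (@int_sc j); last 2 first.
  - apply: measurable_funM; first exact: measurable_funX.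
    exact: (measurable_powRl _ (measurable_sc (- j) mM)).
  - by move=> y; rewrite mulr_ge0 ?powR_ge0 ?exprn_ge0.
  rewrite (_ : (fun x => _) = fun x => ((sc j ^+ n)^-1 ^+ 2 * (normc (f x) ^+ 2 * m x `^ r^-1))%:E).
    rewrite nnZr ?sqr_ge0//; last 2 first.
    - by apply: measurable_funM; [exact: measurable_funX|exact: measurable_powRl].
    - by move=> y; rewrite mulr_ge0 ?powR_ge0 ?exprn_ge0.
    by rewrite muleA -EFinM expr2 mulrA mulfV ?gt_eqF// mul1r.
  apply/funext => x; rewrite scalerA scNr scale1r mulrA; congr (_ * _)%:E.
  by rewrite /fj /dil normcM normc_rc scalerA scNr scale1r exprMn -exprVn -scN ger0_norm ?exprn_ge0.
set A := (X in (X <= _)%E).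
have AE : A = ((sc j ^+ n)%:E * \int[mu]_x (normc (u x) ^+ 2 * wj x)%:E)%E.
  rewrite (@int_sc j); last 2 first.
  - by mfun.
  - by move=> y; rewrite mulr_ge0 ?exprn_ge0//; exact: w0.
  rewrite /A (_ : (fun x => _) = fun x => ((sc j ^+ n) ^+ 2 * (normc (u (sc j *: x)) ^+ 2 * w x))%:E).
    rewrite nnZr ?sqr_ge0//; last 2 first.
    - have ms : cmeas (fun x => u (sc j *: x)) by apply: (cmeas_comp mu'); mfun.
      by have mns := measurable_normc ms; mfun.
    - by move=> y; rewrite mulr_ge0 ?exprn_ge0.
    rewrite expr2 EFinM -muleA; congr (_ * (_ * _))%E; apply: eq_integral => x _.
    by rewrite /wj scalerA scNr scale1r.
  by apply/funext => x; rewrite uE normcM normc_rc (gtr0_norm c0) exprMn -mulrA.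
rewrite AE; apply: (le_via ((sc j ^+ n)%:E * ((C * L ^+ 2)%:E * J1))%E).
  by rewrite lee_wpmul2l ?lee_fin// ltW.
by rewrite J1E muleCA (muleA (sc j ^+ n)%:E) -EFinM mulfV ?gt_eqF// mul1e.
Qed.

End single_scale.

(** * Schwartz functions and the decay of their transforms *)

Section smooth_functions.
Context {R : realType} {n : nat}.
Local Notation V := 'rV[R]_n.
Local Notation mu := (@lebesgue_rV R n).
Implicit Types (f : V -> R[i]) (g : V -> R) (x y v xi : V) (i : 'I_n) (s : seq 'I_n) (l : seq ('I_n * R)).

Definition smooth g := forall s x, differentiable (partials s g) x.

Lemma mvt_dir g x v : (forall y, differentiable g y) ->
  exists2 u : R, 0 <= u <= 1 & g (x + v) - g x = 'D_v g (x + u *: v).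
Proof.
move=> dg; pose F (t : R) := g (x + t *: v).
have E (t : R) : (fun h : R => h^-1 *: ((F \o shift t) (h *: (1 : R)) - F t)) =
    (fun h : R => h^-1 *: ((g \o shift (x + t *: v)) (h *: v) - g (x + t *: v))).
  apply/funext => h; rewrite /F /=; congr (_ *: (g _ - _)).
  by rewrite [h *: 1]mulr1 scalerDl addrCA.
have dF (t : R) : is_derive t 1 F ('D_v g (x + t *: v)).
  apply: DeriveDef; first by rewrite /derivable E; exact: diff_derivable.
  by rewrite /derive E.
have cF : {within `[0, 1], continuous F}.
  apply: continuous_subspaceT => t.
  by have [dd _] := dF t; apply: differentiable_continuous; apply/derivable1_diffP.
have [u] := @MVT R F (fun t => 'D_v g (x + t *: v)) 0 1 ltr01 (fun t _ => dF t) cF.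
rewrite in_itv/= => /andP[u0 u1]; rewrite /F scale1r scale0r addr0 subr0 mulr1 => H.
by exists u => //; rewrite !ltW.
Qed.

Lemma derive_lin g y v : differentiable g y -> 'D_v g y = \sum_i v ord0 i * partial i g y.
Proof.
move=> dg; rewrite deriveE// {1}(row_sum_delta v) linear_sum; apply: eq_bigr => i _.
by rewrite linearZ /partial deriveE.
Qed.

Lemma partial_shift i v g : partial i (fun x => g (x + v)) = fun x => partial i g (x + v).
Proof.
apply/funext => x; rewrite /partial /derive.
suff -> : (fun h : R => h^-1 *: (((fun x => g (x + v)) \o shift x) (h *: delta_mx ord0 i) - g (x + v))) =
  (fun h : R => h^-1 *: ((g \o shift (x + v)) (h *: delta_mx ord0 i) - g (x + v))) by [].
by apply/funext => h /=; rewrite addrA.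
Qed.

Lemma differentiable_shift v g x : (forall y, differentiable g y) -> differentiable (fun x => g (x + v)) x.
Proof.
move=> dg; apply: (@differentiable_comp _ _ _ _ (fun x => x + v) g) => //.
Qed.

Definition fd1 (i : 'I_n) (t : R) g : V -> R := fun x => g (x + t *: delta_mx ord0 i) - g x.

Lemma partials_fd1 s i t g : smooth g -> partials s (fd1 i t g) = fd1 i t (partials s g).
Proof.
move=> sg; elim: s => //= j s ->; apply/funext => x; rewrite /fd1 /partial.
rewrite (@deriveB _ _ _ (fun x => partials s g (x + t *: delta_mx ord0 i)) (partials s g)).
- by have := congr1 (@^~ x) (partial_shift j (t *: delta_mx ord0 i) (partials s g)); rewrite /partial /= => ->.
- by apply: diff_derivable; apply: differentiable_shift; exact: sg.
- by apply: diff_derivable; exact: sg.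
Qed.

Lemma smooth_fd1 i t g : smooth g -> smooth (fd1 i t g).
Proof.
move=> sg s x; rewrite partials_fd1//; apply: differentiableB; last exact: sg.
by apply: differentiable_shift; exact: sg.
Qed.

Definition fd l g := foldr (fun p => fd1 p.1 p.2) g l.

Lemma smooth_fd l g : smooth g -> smooth (fd l g).
Proof. by move=> sg; elim: l => //= p l; exact: smooth_fd1. Qed.

Lemma smooth_partial i g : smooth g -> smooth (partial i g).
Proof. by move=> sg s x; have := sg (rcons s i) x; rewrite /partials foldr_rcons. Qed.

Lemma partial_fd i l g : smooth g -> partial i (fd l g) = fd l (partial i g).
Proof.
move=> sg; elim: l => //= p l IH.
by have := @partials_fd1 [:: i] p.1 p.2 _ (smooth_fd l sg); rewrite /= => ->; rewrite IH.
Qed.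

(** Each difference costs one use of the mean value theorem, which trades it for its step times a
    derivative at a nearby point; derivatives commute with the remaining differences. *)
Lemma fd_mvt l g x : smooth g -> (forall p, p \in l -> `|p.2| <= 1) ->
  exists2 y : V, `|y - x| <= (size l)%:R &
  `|fd l g x| <= (\prod_(p <- l) `|p.2|) * `|partials (rev (unzip1 l)) g y|.
Proof.
elim: l g x => [|p l IH] g x sg hl.
  by exists x; rewrite ?subrr ?normr0// big_nil mul1r.
have [u /andP[u0 u1] hu] := @mvt_dir (fd l g) x (p.2 *: delta_mx ord0 p.1) (smooth_fd l sg [::]).
have sp := smooth_partial p.1 sg.
have hl' q : q \in l -> `|q.2| <= 1 by move=> ql; apply: hl; rewrite in_cons ql orbT.
have [y hy1 hy2] := IH (partial p.1 g) (x + u *: (p.2 *: delta_mx ord0 p.1)) sp hl'.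
have p1 : `|p.2| <= 1 by apply: hl; rewrite mem_head.
exists y.
  have -> : y - x = (y - (x + u *: (p.2 *: delta_mx ord0 p.1))) + u *: (p.2 *: delta_mx ord0 p.1).
    by rewrite opprD addrA subrK.
  apply: le_trans (ler_normD _ _) _; rewrite /= -natr1 lerD//.
  rewrite !normrZ ger0_norm//; apply: (le_via (1 * (1 * 1))); last by rewrite !mulr1.
  rewrite ler_pM// ?mulr_ge0// ler_pM//; apply/norm_leP => // j; rewrite mxE.
  by case: (_ && _); rewrite ?normr1// normr0.
rewrite /= {1}/fd1 hu deriveE; last exact: (smooth_fd l sg [::]).
rewrite linearZ -deriveE; last exact: (smooth_fd l sg [::]).
rewrite -/(partial _ _ _) partial_fd// normrZ big_cons -mulrA ler_wpM2l//.
by apply: le_trans hy2 _; rewrite rev_cons /partials foldr_rcons.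
Qed.

(* [enorm] in the definition of Schwartz functions is traded for the sup norm. *)
Definition decays g := forall K : nat, exists2 M : R, 0 <= M & forall x, `|g x| * (1 + `|x|) ^+ K <= M.

Lemma norm_le_enorm x : `|x| <= enorm x.
Proof.
rewrite -(@ler_pXn2r _ 2)// ?nnegrE ?sqrtr_ge0// /enorm sqr_sqrtr ?dotmx_ge0//.
exact: sqr_norm_le_dotmx.
Qed.

Lemma enorm_le_norm x : enorm x <= n%:R * `|x|.
Proof.
rewrite /enorm -(@ler_pXn2r _ 2)// ?nnegrE ?sqrtr_ge0 ?mulr_ge0// sqr_sqrtr ?dotmx_ge0//.
apply: (le_via (\sum_(i < n) `|x| ^+ 2)).
  apply: ler_sum => i _; rewrite -expr2 -real_normK ?num_real// lerXn2r ?nnegrE//.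
  exact: coor_le_norm.
rewrite sumr_const card_ord -[leLHS]mulr_natl exprMn ler_wpM2r ?exprn_ge0//.
by rewrite -natrX ler_nat; case: (n) => // m; rewrite leq_pmulr.
Qed.

Lemma rschwartzP g : rschwartz g <-> smooth g /\ forall s, decays (partials s g).
Proof.
split=> -[sg dg]; split=> //.
  move=> s K; have [M0 h0] := dg 0 s; have [M1 h1] := dg K s.
  have a0 : 0 <= M0 by apply: le_trans (h0 0); rewrite expr0 mul1r.
  have a1 : 0 <= M1 by apply: le_trans (h1 0); rewrite mulr_ge0// exprn_ge0// sqrtr_ge0.
  exists (2 ^+ K * (M0 + M1)) => [|x]; first by rewrite mulr_ge0 ?exprn_ge0// addr_ge0.
  set a := `|partials s g x|; have e0 : 0 <= enorm x by exact: sqrtr_ge0.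
  have xe := norm_le_enorm x.
  have p2 : (1 + `|x|) ^+ K <= 2 ^+ K * (1 + enorm x ^+ K).
    have [x1|x1] := lerP (enorm x) 1.
      apply: (le_via (2 ^+ K)).
        by rewrite lerXn2r ?nnegrE ?addr_ge0// -[2]/(1 + 1) lerD2l (le_trans xe).
      by rewrite ler_peMr ?exprn_ge0// lerDl exprn_ge0.
    apply: (le_via ((2 * enorm x) ^+ K)).
      rewrite lerXn2r ?nnegrE ?addr_ge0 ?mulr_ge0// (_ : 2 * enorm x = enorm x + enorm x); last by ring.
      by rewrite lerD// ltW.
    by rewrite exprMn ler_wpM2l ?exprn_ge0// lerDr.
  have A0 : 0 <= a by exact: normr_ge0.
  apply: le_trans (ler_wpM2l A0 p2) _; rewrite mulrCA ler_wpM2l ?exprn_ge0//.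
  rewrite mulrDr mulr1 lerD//; first by have := h0 x; rewrite expr0 mul1r.
  by rewrite mulrC; exact: h1.
move=> k s; have [M M0 hM] := dg s k; exists (n%:R ^+ k * M) => x.
apply: (le_via ((n%:R * `|x|) ^+ k * `|partials s g x|)).
  by rewrite ler_wpM2r// lerXn2r ?nnegrE ?sqrtr_ge0 ?mulr_ge0//; exact: enorm_le_norm.
rewrite exprMn -mulrA ler_wpM2l ?exprn_ge0// mulrC; apply: le_trans (hM x).
by rewrite ler_wpM2l// lerXn2r ?nnegrE ?addr_ge0// lerDr.
Qed.

Lemma shift_weight x y (m : R) : 0 <= m -> `|y - x| <= m -> 1 + `|x| <= (1 + m) * (1 + `|y|).
Proof.
move=> m0 yx; have : `|x| <= `|y| + `|y - x|.
  by rewrite -{1}(subKr y x) -[y - (y - x)]addrC; apply: le_trans (ler_normD _ _) _; rewrite normrN addrC.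
by have := normr_ge0 y; nra.
Qed.

Lemma decay_shift g s (K : nat) (m : R) : decays (partials s g) -> 0 <= m ->
  exists2 M : R, 0 <= M & forall x y, `|y - x| <= m -> `|partials s g y| * (1 + `|x|) ^+ K <= M.
Proof.
move=> dg m0; have [M M0 hM] := dg K.
exists ((1 + m) ^+ K * M) => [|x y yx]; first by rewrite mulr_ge0// exprn_ge0// addr_ge0.
apply: (le_via (`|partials s g y| * ((1 + m) * (1 + `|y|)) ^+ K)).
  by rewrite ler_wpM2l// lerXn2r ?nnegrE ?addr_ge0 ?mulr_ge0 ?addr_ge0//; exact: shift_weight.
by rewrite exprMn mulrCA ler_wpM2l// exprn_ge0// addr_ge0.
Qed.

Lemma fd_decay g (s : seq 'I_n) (K : nat) : rschwartz g -> exists2 M : R, 0 <= M &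
  forall (t : 'I_n -> R), (forall i, `|t i| <= 1) -> forall x,
  `|fd [seq (i, t i) | i <- s] g x| * (1 + `|x|) ^+ K <= M * \prod_(i <- s) `|t i|.
Proof.
move=> /rschwartzP[sg dg]; have [M M0 hM] := @decay_shift g (rev s) K (size s)%:R (dg _) (ler0n _ _).
exists M => // t t1 x; have hl p : p \in [seq (i, t i) | i <- s] -> `|p.2| <= 1.
  by move=> /mapP[i _ ->]; exact: t1.
have [y hy1 hy2] := fd_mvt x sg hl; rewrite size_map in hy1.
have E : unzip1 [seq (i, t i) | i <- s] = s by rewrite /unzip1 -map_comp map_id.
rewrite E big_map/= in hy2; apply: le_trans (ler_wpM2r _ hy2) _; first by rewrite exprn_ge0// addr_ge0.
by rewrite -mulrA mulrC ler_wpM2r ?prodr_ge0//; exact: hM.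
Qed.

(** [1 + x_i^2 <= (1 + |x|)^2] in every coordinate, so decay of order [2n] lies below a product of
    Poisson kernels, whose integral is known. *)
Lemma weight_pkern x : ((1 + `|x|) ^+ (2 * n))^-1 <= pi ^+ n * pkern (2 * pi) x.
Proof.
have p0 : 0 < pi :> R by exact: pi_gt0.
rewrite exprM.
have -> : (1 + `|x|) ^+ 2 ^- n = \prod_(i < n) ((1 + `|x|) ^+ 2)^-1 by rewrite prodr_const card_ord exprVn.
have -> : pi ^+ n = \prod_(i < n) (pi : R) by rewrite prodr_const card_ord.
rewrite -big_split/=; apply: ler_prod => i _; rewrite invr_ge0 sqr_ge0/= /pker.
have -> : pi * (2 * (2 * pi) / ((2 * pi) ^+ 2 + (2 * pi * x ord0 i) ^+ 2)) = (1 + x ord0 i ^+ 2)^-1.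
  have h : 1 + x ord0 i ^+ 2 != 0 by rewrite gt_eqF// ltr_pwDl// sqr_ge0.
  have -> : (2 * pi) ^+ 2 + (2 * pi * x ord0 i) ^+ 2 = 4 * pi ^+ 2 * (1 + x ord0 i ^+ 2) by ring.
  have pn : pi != 0 :> R by rewrite gt_eqF.
  by move: h pn; move: (1 + _) (pi : R) => w q h pn; field; rewrite h pn.
rewrite lef_pV2 ?posrE ?exprn_gt0 ?ltr_pwDl ?sqr_ge0//.
have := coor_le_norm x i; rewrite -(real_normK (num_real (x ord0 i))).
by have := normr_ge0 (x ord0 i); move: `|x| `|_| => a b; nra.
Qed.

Lemma int_decay (g : V -> R) (M : R) : 0 <= M -> (forall x, 0 <= g x) ->
  (forall x, g x * (1 + `|x|) ^+ (2 * n) <= M) -> (\int[mu]_x (g x)%:E <= (M * pi ^+ n)%:E)%E.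
Proof.
move=> M0 g0 gM; have p0 : 0 < pi :> R by exact: pi_gt0.
have p2 : 0 < 2 * pi :> R by rewrite mulr_gt0.
have c0 : 0 <= M * pi ^+ n by rewrite mulr_ge0// exprn_ge0// ltW.
apply: (le_via (\int[mu]_x (M * pi ^+ n * pkern (2 * pi) x)%:E)%E).
  apply: nn_le => x; rewrite ?lee_fin//.
  have w0 : 0 < (1 + `|x|) ^+ (2 * n) by rewrite exprn_gt0// ltr_pwDl.
  apply: (le_via (M * ((1 + `|x|) ^+ (2 * n))^-1)); first by rewrite ler_pdivlMr.
  by rewrite -mulrA ler_wpM2l//; exact: weight_pkern.
rewrite nnZr//; [by rewrite int_pkern// mule1|exact: measurable_pkern|by move=> x; exact: pkern_ge0].
Qed.

Lemma partial_dir_bound g (v : R) : smooth g -> (forall s, decays (partials s g)) -> forall K : nat,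
  exists2 D : R, 0 <= D & forall x y h, `|y - x| <= v -> `|'D_h g y| * (1 + `|x|) ^+ K <= D * `|h|.
Proof.
move=> sg dg K; have [v0|v0] := ltP v 0.
  by exists 0 => // x y h; rewrite leNgt (lt_le_trans v0).
have /choice[M hM] : forall i, exists M : R, 0 <= M /\
    forall x y, `|y - x| <= v -> `|partial i g y| * (1 + `|x|) ^+ K <= M.
  by move=> i; have [M M0 hM] := @decay_shift g [:: i] K v (dg [:: i]) v0; exists M.
exists (\sum_i M i) => [|x y h yx]; first by apply: sumr_ge0 => i _; have [] := hM i.
rewrite derive_lin; last exact: (sg [::]).
have w0 : 0 <= (1 + `|x|) ^+ K by rewrite exprn_ge0// addr_ge0.
apply: (le_via (\sum_i `|h| * (`|partial i g y| * (1 + `|x|) ^+ K))).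
  rewrite -mulr_sumr -mulr_suml mulrA ler_wpM2r// mulr_sumr; apply: le_trans (ler_norm_sum _ _ _) _.
  by apply: ler_sum => i _; rewrite normrM ler_wpM2r//; exact: coor_le_norm.
rewrite -mulr_sumr mulrC ler_wpM2r//; apply: ler_sum => i _; have [_] := hM i; exact.
Qed.

Lemma schwartz_decay f (K : nat) : schwartz f -> exists2 M : R, 0 <= M &
  forall x, normc (f x) * (1 + `|x|) ^+ K <= M.
Proof.
move=> [/rschwartzP[_ d1] /rschwartzP[_ d2]].
have [M1 a1 h1] := d1 [::] K; have [M2 a2 h2] := d2 [::] K.
exists (M1 + M2) => [|x]; first exact: addr_ge0.
apply: le_trans (lerD (h1 x) (h2 x)); rewrite -mulrDl ler_wpM2r ?exprn_ge0 ?addr_ge0//.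
exact: normc_le_ReIm.
Qed.

Lemma vcvg_norm (u : nat -> V) x : vcvg u x -> `|u k - x| @[k --> \oo] --> (0 : R).
Proof.
move=> ux; have h : \sum_i `|u k ord0 i - x ord0 i| @[k --> \oo] --> (0 : R).
  suff : \sum_i `|u k ord0 i - x ord0 i| @[k --> \oo] --> \sum_(i < n) (0 : R) by rewrite big1.
  elim: (index_enum _) => [|i s IH].
    by rewrite big_nil; under eq_fun do rewrite big_nil; exact: cvg_cst.
  rewrite big_cons; under eq_fun do rewrite big_cons; apply: cvgD => //.
  rewrite -(normr0 R) -(subrr (x ord0 i)).
  by apply: cvg_norm; apply: cvgB; [exact: ux|exact: cvg_cst].
apply: (@squeeze_cvgr _ _ _ _ (fun=> 0) (fun k => \sum_i `|u k ord0 i - x ord0 i|)) => //; last exact: cvg_cst.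
apply: nearW => k; rewrite normr_ge0/=; apply/norm_leP; first exact: sumr_ge0.
by move=> i; rewrite !mxE (bigD1 i)//= lerDl sumr_ge0.
Qed.

Lemma scont_schwartz g : rschwartz g -> scont g.
Proof.
move=> /rschwartzP[sg dg] u x ux.
have [D D0 hD] := @partial_dir_bound g 0 sg dg 0.
have le k : `|g (u k) - g x| <= D * `|u k - x|.
  have [t _ E] := @mvt_dir g x (u k - x) (sg [::]); rewrite (addrC x) subrK in E.
  by rewrite E; have := hD _ _ (u k - x) (_ : `|(x + t *: (u k - x)) - (x + t *: (u k - x))| <= 0); rewrite subrr normr0 lexx expr0 mulr1; apply.
have h0 : g (u k) - g x @[k --> \oo] --> (0 : R).
  apply: norm_cvg0; apply: (@squeeze_cvgr _ _ _ _ (fun=> 0) (fun k => D * `|u k - x|)).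
  - by apply: nearW => k; rewrite normr_ge0 le.
  - exact: cvg_cst.
  - by rewrite -(mulr0 D); apply: cvgM; [exact: cvg_cst|exact: vcvg_norm].
by rewrite -(subrK (g x) (g x)) subrr; under eq_fun do rewrite -(subrK (g x) (g _)); apply: cvgD => //; exact: cvg_cst.
Qed.

Lemma cscont_schwartz f : schwartz f -> cscont f.
Proof. by move=> [h1 h2]; split; exact: scont_schwartz. Qed.

Lemma nice_schwartz f : schwartz f -> nice f.
Proof.
move=> sf; have mf := cscont_cmeas (cscont_schwartz sf).
split=> //.
  have [M M0 hM] := schwartz_decay 0 sf; exists M => x.
  by have := hM x; rewrite expr0 mulr1.
have [M M0 hM] := schwartz_decay (2 * n) sf; split=> //.
by apply: le_lt_trans (int_decay M0 _ hM) _; [|exact: ltry].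
Qed.

(** Mean value theorem: on the segment from [x] to [x + h] with [4 |h| <= |x|], the norm stays
    comparable to [|x|], so the decay of the derivatives can be measured at [x]. *)
Lemma smooth_kernel_schwartz f : schwartz f -> exists2 D : R, 0 <= D & smooth_kernel f D.
Proof.
move=> [/rschwartzP[s1 d1] /rschwartzP[s2 d2]].
have H g : smooth g -> (forall s, decays (partials s g)) -> forall K : nat, exists2 D : R, 0 <= D &
    forall x h, 4 * `|h| <= `|x| -> `|g (x + h) - g x| * `|x| ^+ K <= D * `|h|.
  move=> sg dg K; have [D D0 hD] := @partial_dir_bound g 0 sg dg K.
  exists (2 ^+ K * D) => [|x h hx]; first by rewrite mulr_ge0 ?exprn_ge0.
  have [t /andP[t0 t1] ->] := @mvt_dir g x h (sg [::]); set y := x + t *: h.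
  have hy : `|x| <= 2 * (1 + `|y|).
    have : `|x| <= `|y| + `|t *: h| by rewrite -{1}(addrK (t *: h) x); exact: ler_normB.
    rewrite normrZ ger0_norm// => h1; have h2 := ler_wpM2r (normr_ge0 h) t1.
    by have := normr_ge0 y; have := normr_ge0 h; lra.
  have := hD y y h; rewrite subrr normr0 lexx => /(_ isT) h1.
  apply: (le_via (`|'D_h g y| * (2 * (1 + `|y|)) ^+ K)).
    by rewrite ler_wpM2l// lerXn2r ?nnegrE ?mulr_ge0 ?addr_ge0.
  by rewrite exprMn mulrCA -mulrA ler_wpM2l ?exprn_ge0.
have [A1 a1 h1] := H _ s1 d1 0; have [A2 a2 h2] := H _ s2 d2 0.
have [B1 b1 k1] := H _ s1 d1 n.+2; have [B2 b2 k2] := H _ s2 d2 n.+2.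
exists (A1 + A2 + B1 + B2) => [|x h hx]; first by rewrite !addr_ge0.
have N : normc (f (x + h) - f x) <= `|Re (f (x + h)) - Re (f x)| + `|Im (f (x + h)) - Im (f x)|.
  by apply: le_trans (normc_le_ReIm _) _; rewrite ReD ImD ReN ImN.
have := h1 x h hx; have := h2 x h hx; have := k1 x h hx; have := k2 x h hx.
rewrite !expr0 !mulr1 => q4 q3 q2 q1; have h0 := normr_ge0 h.
have w0 : 0 <= `|x| ^+ n.+2 by rewrite exprn_ge0.
split; first by apply: le_trans N _; nra.
by apply: le_trans (ler_wpM2r w0 N) _; rewrite mulrDl; nra.
Qed.

Lemma fourier_translate f v xi : cintg mu f ->
  fourier (fun x => f (x + v)) xi = ec (dotmx v xi) * fourier f xi.
Proof.
move=> fi; have ci : cintg mu (fun x => f x * ec (- dotmx x xi)).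
  by apply: cintg_char => //; mdot.
rewrite !fourierE -cintZ//.
have := cint_affine v (oner_neq0 R) (cintgZ (ec (dotmx v xi)) ci).
rewrite normr1 invr1 expr1n mul1r => <-; congr cint; apply/funext => x.
by rewrite scale1r mulrCA -ecD dotmxDl opprD addrCA subrr addr0.
Qed.

Definition cfd l f : V -> R[i] := foldr (fun p F x => F (x + p.2 *: delta_mx ord0 p.1) - F x) f l.

Lemma Re_cfd l f x : Re (cfd l f x) = fd l (fun x => Re (f x)) x.
Proof. by elim: l x => //= p l IH x; rewrite ReD ReN !IH. Qed.

Lemma Im_cfd l f x : Im (cfd l f x) = fd l (fun x => Im (f x)) x.
Proof. by elim: l x => //= p l IH x; rewrite ImD ImN !IH. Qed.

Lemma cintg_translate f v : cintg mu f -> cintg mu (fun x => f (x + v)).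
Proof.
move=> fi; have := cintg_affine v (oner_neq0 R) fi.
by under eq_fun do rewrite scale1r.
Qed.

Lemma dotmx_delta i (t : R) xi : dotmx (t *: delta_mx ord0 i) xi = t * xi ord0 i.
Proof.
rewrite /dotmx (bigD1 i)//= !mxE !eqxx mulr1 big1 ?addr0// => j ji.
by rewrite !mxE (negbTE ji) andbF mulr0 mul0r.
Qed.

Lemma fourier_cfd l f xi : cintg mu f -> cintg mu (cfd l f) /\
  fourier (cfd l f) xi = (\prod_(p <- l) (ec (p.2 * xi ord0 p.1) - 1)) * fourier f xi.
Proof.
move=> fi; elim: l => [|p l [IH1 IH2]]; first by rewrite big_nil mul1r.
have ti := cintg_translate (p.2 *: delta_mx ord0 p.1) IH1.
split; first by have := cintgD ti (cintgZ (-1) IH1); rewrite /=; under eq_fun do rewrite mulN1r.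
by rewrite /= fourierB// fourier_translate// IH2 big_cons dotmx_delta -mulrA mulrBl mul1r.
Qed.

Lemma N1_cfd f s : schwartz f -> exists2 C : R, 0 <= C & forall t : 'I_n -> R, (forall i, `|t i| <= 1) ->
  N1 (cfd [seq (i, t i) | i <- s] f) <= C * \prod_(i <- s) `|t i|.
Proof.
move=> [s1 s2]; have [M1 a1 h1] := fd_decay s (2 * n) s1; have [M2 a2 h2] := fd_decay s (2 * n) s2.
have p0 : 0 < pi :> R by exact: pi_gt0.
exists ((M1 + M2) * pi ^+ n) => [|t t1]; first by rewrite mulr_ge0 ?addr_ge0// exprn_ge0// ltW.
have [_ _ fi] := nice_schwartz (conj s1 s2).
have [ci _] := fourier_cfd [seq (i, t i) | i <- s] 0 fi.
have P0 : 0 <= \prod_(i <- s) `|t i| by exact: prodr_ge0.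
rewrite -lee_fin -N1E// -mulrA [pi ^+ n * _]mulrC mulrA; apply: int_decay => // [|x].
  by rewrite mulr_ge0// addr_ge0.
rewrite mulrDl; apply: le_trans (lerD (h1 t t1 x) (h2 t t1 x)); rewrite -mulrDl ler_wpM2r ?exprn_ge0 ?addr_ge0//.
by apply: le_trans (normc_le_ReIm _) _; rewrite Re_cfd Im_cfd.
Qed.

Lemma ec_half : ec (2^-1 : R) = -1.
Proof.
rewrite /ec /cexpi (_ : 2 * pi * 2^-1 = pi :> R); last by field.
by rewrite cospi sinpi; apply/eqP; rewrite eq_complex/= oppr0 !eqxx.
Qed.

(* Differences of step [1/(2 xi_i)] multiply the transform at [xi] by [e(1/2) - 1 = -2], so no limit of
   difference quotients is needed. *)
Lemma fourier_decay f : schwartz f -> exists2 C : R, 0 <= C & forall xi, normc (fourier f xi) <= C * pkern 1 xi.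
Proof.
move=> sf; have [_ _ fi] := nice_schwartz sf.
(* Every coordinate of [A] appears twice: second differences give the decay [xi_i^-2], which is
   integrable in each direction. *)
pose s (A : {set 'I_n}) := enum A ++ enum A.
have /choice[C hC] : forall A : {set 'I_n}, exists C : R, 0 <= C /\ forall t : 'I_n -> R, (forall i, `|t i| <= 1) ->
    N1 (cfd [seq (i, t i) | i <- s A] f) <= C * \prod_(i <- s A) `|t i|.
  by move=> A; have [C C0 h] := N1_cfd (s A) sf; exists C.
pose c : R := 1 + pi ^+ 2; have p2 : 0 <= pi ^+ 2 :> R by exact: sqr_ge0.
have c0 : 0 < c by rewrite ltr_pwDl.
have CS0 : 0 <= \sum_A C A by apply: sumr_ge0 => A _; have [] := hC A.
exists ((\sum_A C A) * c ^+ n) => [|xi]; first by rewrite mulr_ge0// exprn_ge0// ltW.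
(* The coordinates that are small at [xi] are left alone: the bound there needs no decay, and the
   step [1/(2 xi_i)] would exceed 1. *)
pose A : {set 'I_n} := [set i | 2^-1 <= `|xi ord0 i|]%SET.
pose t i : R := if i \in A then (2 * xi ord0 i)^-1 else 0.
have x0 i : i \in A -> 0 < `|xi ord0 i| by rewrite inE; apply: lt_le_trans; rewrite invr_gt0.
have t1 i : `|t i| <= 1.
  rewrite /t; case: ifPn => iA; last by rewrite normr0.
  rewrite normfV normrM ger0_norm// invf_le1 ?mulr_gt0 ?x0//.
  by move: iA; rewrite inE => h; rewrite mulrC -ler_pdivrMr// mul1r.
have [_ hN] := hC A; have := hN t t1.
have [ci Fc] := fourier_cfd [seq (i, t i) | i <- s A] xi fi.
move=> /(le_trans (normc_fourier xi ci)); rewrite Fc normcM big_map/=.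
rewrite (eq_big_seq (fun=> -2 : R[i])); last first.
  move=> i; rewrite mem_cat orbb mem_enum => iA.
  rewrite /t iA (_ : (2 * xi ord0 i)^-1 * xi ord0 i = 2^-1).
    by rewrite ec_half -opprD.
  by have := x0 i iA; rewrite normr_gt0 => h; field.
rewrite /s !big_cat/= !big_enum/= !prodr_const !normcM.
have n2 k : normc ((-2 : R[i]) ^+ k) = 2 ^+ k.
  elim: k => [|k IH]; first by rewrite !expr0 normc1.
  rewrite !exprS normcM IH normcNE; congr (_ * _).
  by rewrite (_ : 2 = (2 : R)%:C%C) ?normc_rc ?ger0_norm// rmorphMn.
rewrite !n2 => H.
have H1 : normc (fourier f xi) <= C A * (\prod_(i in A) `|t i| * \prod_(i in A) `|t i|).
  apply: le_trans H; rewrite ler_peMl//.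
  by rewrite -exprD exprn_ege1// ler1n.
apply: le_trans H1 _; rewrite -mulrA ler_pM//.
- by have [] := hC A.
- by rewrite mulr_ge0// prodr_ge0.
- by rewrite (bigD1 A)//= lerDl sumr_ge0// => B _; have [] := hC B.
have -> : c ^+ n = \prod_(i < n) c by rewrite prodr_const card_ord.
rewrite /pkern -big_split/= -big_split/= big_mkcond/=; apply: ler_prod => i _.
have q0 : 0 < 1 + (2 * pi * xi ord0 i) ^+ 2 by rewrite ltr_pwDl// sqr_ge0.
have xq : xi ord0 i ^+ 2 = `|xi ord0 i| ^+ 2 by rewrite real_normK ?num_real.
rewrite /pker mulr1 expr1n mulrA; case: ifPn => iA.
  rewrite mulr_ge0//= ler_pdivlMr// /t iA -expr2 real_normK ?num_real// exprVn mulrC ler_pdivrMr; last first.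
    by rewrite exprn_even_gt0//= mulf_neq0// -normr_gt0 x0.
  move: iA; rewrite inE => h; rewrite !exprMn xq /c.
  have : 4^-1 <= `|xi ord0 i| ^+ 2.
    by rewrite -[4^-1]/((2 * 2)%:R^-1) natrM invfM -expr2 lerXn2r ?nnegrE ?invr_ge0.
  by move: (`|_| ^+ 2) => w hw; nra.
rewrite ler01/= ler_pdivlMr// mul1r; move: iA; rewrite inE -ltNge => h.
have : `|xi ord0 i| ^+ 2 <= 4^-1.
  by rewrite -[4^-1]/((2 * 2)%:R^-1) natrM invfM -expr2 lerXn2r ?nnegrE ?invr_ge0// ltW.
by rewrite !exprMn xq /c; move: (`|_| ^+ 2) => w hw; nra.
Qed.

Lemma cintg_fourier_schwartz f : schwartz f -> cintg mu (fourier f).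
Proof.
move=> sf; have [C C0 hC] := fourier_decay sf; have [_ _ fi] := nice_schwartz sf.
apply: (cintg_le _ hC); first exact/cscont_cmeas/cscont_fourier.
apply: nnZr_lty => //; [exact: measurable_pkern|by move=> x; exact: pkern_ge0|by rewrite int_pkern// ltry].
Qed.

Lemma partial_affine i (c a : R) v g : (forall y, differentiable g y) ->
  partial i (fun x => c * g (a *: x + v)) = fun x => c * a * partial i g (a *: x + v).
Proof.
move=> dg; apply/funext => x.
have da : differentiable (fun x : V => a *: x + v) x.
  by apply: differentiableD; [apply: differentiableZ|exact: differentiable_cst].
have dc : differentiable (fun x => g (a *: x + v)) x.
  by apply: (@differentiable_comp _ _ _ _ (fun x : V => a *: x + v) g).
have := @deriveZ _ _ _ (fun x => g (a *: x + v)) c x (delta_mx ord0 i) (diff_derivable dc).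
rewrite /partial => ->; rewrite -mulrA; congr (_ * _).
rewrite [RHS]mulrC; have := deriveE (a *: delta_mx ord0 i) (dg (a *: x + v)).
rewrite linearZ -deriveE// mulrC => <-; rewrite /derive.
suff -> : (fun h : R => h^-1 *: (((fun x => g (a *: x + v)) \o shift x) (h *: delta_mx ord0 i) - g (a *: x + v))) =
  (fun h : R => h^-1 *: ((g \o shift (a *: x + v)) (h *: (a *: delta_mx ord0 i)) - g (a *: x + v))) by [].
by apply/funext => h /=; congr (_ *: (g _ - _)); rewrite scalerDr !scalerA [h * a]mulrC addrA.
Qed.

Lemma rschwartz_affine (c a : R) v g : a != 0 -> rschwartz g -> rschwartz (fun x => c * g (a *: x + v)).
Proof.
move=> a0 /rschwartzP[sg dg]; apply/rschwartzP.
have E s : partials s (fun x => c * g (a *: x + v)) = fun x => c * a ^+ size s * partials s g (a *: x + v).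
  elim: s => [|i s IH] /=; first by rewrite expr0 mulr1.
  by rewrite IH partial_affine; [rewrite exprSr mulrA|exact: sg].
split=> [s x|s K]; rewrite E.
  apply: differentiableZ; apply: (@differentiable_comp _ _ _ _ (fun x : V => a *: x + v) (partials s g)); last exact: sg.
  by apply: differentiableD; [apply: differentiableZ|exact: differentiable_cst].
have [M M0 hM] := dg s K; pose B := 1 + `|a|^-1 * (1 + `|v|).
have B0 : 0 <= B by rewrite addr_ge0// mulr_ge0 ?invr_ge0// addr_ge0.
exists (`|c * a ^+ size s| * (B ^+ K * M)) => [|x]; first by rewrite mulr_ge0// mulr_ge0// exprn_ge0.
rewrite normrM -mulrA ler_wpM2l//; set y := a *: x + v.
have hx : 1 + `|x| <= B * (1 + `|y|).
  have ap : 0 < `|a|^-1 by rewrite invr_gt0 normr_gt0.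
  have : `|x| <= `|a|^-1 * (`|y| + `|v|).
    rewrite -{1}(scalerK a0 x) normrZ normfV ler_wpM2l// ?invr_ge0//.
    by rewrite -{1}(addrK v (a *: x)); exact: ler_normB.
  rewrite /B; have := normr_ge0 y; have := normr_ge0 v.
  move: `|x| `|y| `|v| (`|a|^-1) ap => X Y W A A0 W0 Y0 h.
  by have h2 : 0 <= A * (1 + W * Y) by [rewrite mulr_ge0 ?(ltW A0)// addr_ge0// mulr_ge0]; nra.
apply: (le_via (`|partials s g y| * (B * (1 + `|y|)) ^+ K)).
  by rewrite ler_wpM2l// lerXn2r ?nnegrE ?addr_ge0 ?mulr_ge0 ?addr_ge0.
by rewrite exprMn mulrCA ler_wpM2l ?exprn_ge0.
Qed.

Lemma schwartz_affine (c a : R) v f : a != 0 -> schwartz f -> schwartz (fun x => c%:C%C * f (a *: x + v)).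
Proof.
move=> a0 [h1 h2]; split.
  have -> : (fun x => Re (c%:C%C * f (a *: x + v))) = fun x => c * Re (f (a *: x + v)).
    by apply/funext => x; case: (f _) => p q /=; rewrite mul0r subr0.
  exact: (rschwartz_affine _ _ a0 h1).
have -> : (fun x => Im (c%:C%C * f (a *: x + v))) = fun x => c * Im (f (a *: x + v)).
  by apply/funext => x; case: (f _) => p q /=; rewrite mul0r addr0.
exact: (rschwartz_affine _ _ a0 h2).
Qed.

End smooth_functions.

(** * From the representing function to its pairings with [Psi] *)

Section representation.
Context {R : realType} {n : nat}.
Local Notation V := 'rV[R]_n.
Local Notation mu := (@lebesgue_rV R n).
Variables (Psi : V -> R[i]) (s : R).
Hypotheses (sPsi : schwartz Psi) (s0 : 0 < s) (sn : s < n%:R).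
Hypothesis suppPsi : annular Psi.

Lemma bessel_weightE (y : V) : bessel_weight s y = winv (- s) y.
Proof.
by rewrite /bessel_weight /winv mulNr opprK /jap /enorm sqr_sqrtr ?dotmx_ge0.
Qed.

(** The representing identity is tested on translates of the dilates of [Psi], and duality moves the
    transforms to where [scale_rep] has them. The function [g0] of the distribution is compared with
    [g] through integrals only, because it will be equal to it almost everywhere. *)
Lemma represents_scale_rep (g0 g h : V -> R[i]) : cintg mu g ->
  (forall T : V -> R[i], cmeas T -> cint mu (fun x => g0 x * T x) = cint mu (fun x => g x * T x)) ->
  represents h (bessel s (dist_of_fun g0)) -> cmeas h /\ scale_rep Psi s g h.
Proof.
move=> gi g0E [mh hrep]; split=> // l xi.
have nPsi := nice_schwartz sPsi; have cPsi := cscont_schwartz sPsi.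
have FPsi := cintg_fourier_schwartz sPsi.
have sphi : schwartz (fun z => dil Psi l (z - xi)).
  have := schwartz_affine (sc l ^+ n) (- (sc l *: xi)) (sc_neq0 (R := R) l) sPsi; congr schwartz.
  by apply/funext => z; rewrite /dil scalerBr.
have [[c1 c2] E] := hrep _ sphi; have hd := cintgP c1 c2; split=> //.
rewrite -[RHS]E /bessel /dist_invfourier /dist_mul /dist_fourier /dist_of_fun.
have [_ _ di] := nice_dil l nPsi.
have one_c : cscont (fun _ : V => 1 : R[i]) by apply/cscontP => u x _; exact: ccvg_cst.
have one_b (y : V) : normc (1 : R[i]) <= (1 : R) by rewrite normc1.
have [_ _ Ri] := nice_RR nPsi FPsi suppPsi s0 one_c one_b l.
pose T y : R[i] := winv (- s) y * band Psi l y * ec (- dotmx y xi).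
have Ti : cintg mu T.
  apply: cintg_char; first by mdot.
  by move: Ri; under eq_fun do rewrite mulr1.
have FE : fourier (fun x => bessel_weight s x * invfourier (fun z => dil Psi l (z - xi)) x) = invfourier T.
  apply/funext => eta; rewrite fourierE invfourierE.
  have Ei : cintg mu (fun y => T y * ec (dotmx eta y)).
    by apply: cintg_char => //; mdot.
  rewrite -(cint_subl 0 Ei); congr cint; apply/funext => y.
  rewrite bessel_weightE invfourier_fourier fourier_translate// sub0r /T -/(band Psi l (- y)).
  rewrite !(dotmxNl, dotmxNr) !opprK (dotmxC xi) (dotmxC eta).
  have -> : winv (- s) (- y) = winv (- s) y by rewrite /winv /jap dotmxNl dotmxNr opprK.
  by rewrite -!mulrA; congr (_ * _); rewrite mulrCA mulrA mulrC; congr (_ * _); rewrite mulrC.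
rewrite FE fourierE; transitivity (cint mu (fun y => T y * invfourier g y)).
  by congr cint; apply/funext => y; rewrite /T; ring.
rewrite invfourier_duality//; apply: etrans (esym (g0E _ (cscont_cmeas (cscont_invfourier Ti)))).
by congr cint; apply/funext => y; rewrite mulrC.
Qed.

End representation.

(** * Young's inequality and absorption *)

Section young.
Context {R : realType}.

(** Comparing [y] with [(x / d)^(q-1)] decides which of the two terms dominates the product; the
    free [d] is what later makes one of them absorbable. *)
Lemma young_split (q q' d x y : R) : 1 < q -> q' = q / (q - 1) -> 0 < d -> 0 <= x -> 0 <= y ->
  x * y <= d * y `^ q' + d `^ (1 - q) * x `^ q.
Proof.
move=> q1 -> d0 x0 y0; have q10 : 0 < q - 1 by rewrite subr_gt0.
have [->|xn] := eqVneq x 0; first by rewrite mul0r addr_ge0 ?mulr_ge0 ?powR_ge0// ltW.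
have xp : 0 < x by rewrite lt_def xn.
have [yx|yx] := lerP y ((x / d) `^ (q - 1)).
  rewrite ler_wpDl ?mulr_ge0 ?powR_ge0 ?(ltW d0)//.
  apply: le_trans (ler_wpM2l x0 yx) _.
  rewrite powRM ?invr_ge0 ?(ltW d0)// mulrA mulr_powRB1 ?(lt_trans ltr01 q1)// mulrC ler_wpM2r ?powR_ge0//.
  rewrite -powR_inv1 ?(ltW d0)// -powRrM.
  by rewrite (_ : -1 * (q - 1) = 1 - q)//; ring.
have yp : 0 < y by apply: le_lt_trans yx; exact: powR_ge0.
rewrite ler_wpDr ?mulr_ge0 ?powR_ge0 ?(ltW d0)//.
have h : x <= d * y `^ (q - 1)^-1.
  rewrite mulrC -ler_pdivrMr//; have -> : x / d = ((x / d) `^ (q - 1)) `^ (q - 1)^-1.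
    by rewrite -powRrM mulfV ?gt_eqF// powRr1// divr_ge0// ltW.
  by rewrite ge0_ler_powR ?nnegrE ?powR_ge0 ?invr_ge0 ?(ltW q10)// ltW.
apply: le_trans (ler_wpM2r y0 h) _; rewrite -mulrA ler_wpM2l ?(ltW d0)//.
rewrite -[y in _ * y]powRr1// -powRD ?(gt_eqF yp) ?implybT//.
by rewrite (_ : (q - 1)^-1 + 1 = q / (q - 1))//; field; rewrite gt_eqF.
Qed.

Lemma ereal_absorb (I X : \bar R) : (0 <= I -> I < +oo -> 0 <= X -> I <= (2^-1)%:E * I + X ->
  I <= 2%:E * X)%E.
Proof.
case: I => [i| |]//; case: X => [x| |]//= _ _ x0; last by rewrite mulry gtr0_sg// mul1e leey.
by rewrite -EFinM -EFinD !lee_fin; lra.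
Qed.

Lemma sqr_powR_half (a p : R) : 0 <= a -> (a ^+ 2) `^ (p / 2) = a `^ p.
Proof. by move=> a0; rewrite -powR_mulrn// -powRrM mulrCA divff ?mulr1. Qed.

Lemma nn_lin2 d (T : measurableType d) (m : {measure set T -> \bar R}) (U S : T -> R) (a c : R) (X Y : \bar R) :
  0 <= c -> 0 <= a -> mfunT U -> mfunT S -> (forall x, 0 <= U x) -> (forall x, 0 <= S x) ->
  (\int[m]_x (U x)%:E <= X)%E -> (\int[m]_x (S x)%:E <= Y)%E ->
  (\int[m]_x (a * U x + c * S x)%:E <= a%:E * X + c%:E * Y)%E.
Proof.
move=> c0 a0 mU mS U0 S0 hX hY; rewrite nnD; [|by mfun|by mfun|by move=> x; exact: mulr_ge0..].
by rewrite !nnZr//; apply: leeD; rewrite lee_wpmul2l ?lee_fin.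
Qed.

End young.

(** * Windows that reproduce a band *)

Section fat_window.
Context {R : realType} {n : nat}.
Local Notation V := 'rV[R]_n.
Local Notation mu := (@lebesgue_rV R n).
Implicit Types (f g u : V -> R[i]) (w : V -> R) (x y xi : V) (j l : int).
Variable Psi : V -> R[i].
Hypotheses (nPsi : nice Psi) (cPsi : cscont Psi) (FPsi : cintg mu (fourier Psi)).
Hypothesis sPsi : annular Psi.
Hypothesis Psum : resolves Psi.

(** Built from [Psi] itself: convolution with its dilates reproduces anything whose transform lives
    where the corresponding band is nonzero. *)
Definition fat x : R[i] := \sum_(a < 3) dil Psi (a%:Z - 1) x.

Lemma nice_fat : nice fat. Proof. by apply: nice_sum => a; exact: nice_dil. Qed.
Lemma cscont_fat : cscont fat. Proof. by apply: cscont_sum => a; exact: cscont_dil. Qed.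

Lemma fourier_fat j y : fourier fat (sc (- j) *: y) = \sum_(a < 3) band Psi (j - 1 + a%:Z) y.
Proof.
rewrite fourier_sum => [|a]; last by have [] := nice_dil (a%:Z - 1) nPsi.
apply: eq_bigr => a _; transitivity (band Psi (a%:Z - 1) (sc (- j) *: y)); first by [].
rewrite !bandE// scalerA -scD.
by have -> : - (a%:Z - 1) + - j = - (j - 1 + a%:Z) by lia.
Qed.

Lemma band_near l j y : band Psi l y != 0 -> band Psi j y != 0 -> l <= j + 1.
Proof.
move=> /(band_supp nPsi sPsi)/andP[h1 _] /(band_supp nPsi sPsi)/andP[_ h2].
rewrite leNgt; apply/negP => lj.
have h : sc (j + 2) <= sc l :> R by apply: sc_le; lia.
have h' : sc (j + 2) ^+ 2 <= sc l ^+ 2 :> R by rewrite lerXn2r ?nnegrE.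
move: h' h1 h2; rewrite scD (_ : sc 2 = 4); last by rewrite /sc; ring.
by rewrite exprMn; move: (sc j ^+ 2) (sc l ^+ 2) => a b; lra.
Qed.

(** Only bands of adjacent index overlap, so at a point of the [j]-th band just three terms of the
    partition of unity survive. *)
Lemma fat_one j y : band Psi j y != 0 -> fourier fat (sc (- j) *: y) = 1.
Proof.
move=> bj; have y0 : y != 0 by apply: contra bj => /eqP->; rewrite (band0 nPsi sPsi).
(* [N] is large enough for the window to equal 1 at [y] and to contain the three bands around
   [j]. *)
have [N0 hN] := Psum y0; pose N := (N0 + absz j + 1)%N.
have jN : (absz j)%:Z < N%:Z by rewrite /N; lia.
rewrite fourier_fat -(hN N); last by rewrite /N; lia.
pose F (k : nat) := band Psi (- N%:Z + k%:Z) y.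
have [m hm] : exists m : nat, j - 1 + N%:Z = m%:Z by exists (absz (j - 1 + N%:Z)); lia.
rewrite -(big_mkord xpredT F) (@big_cat_nat _ _ _ m) /=; [|lia|lia].
rewrite [X in _ = _ + X](@big_cat_nat _ _ _ (m + 3)) /=; [|lia|lia].
have Z k : ((k < m) || (m + 3 <= k))%N -> F k = 0.
  move=> hk; apply/eqP; apply: contraT => bk.
  by have := band_near bk bj; have := band_near bj bk; move: hk; lia.
rewrite [X in _ = X + _]big1_seq ?add0r; last by move=> k /andP[_]; rewrite mem_index_iota => h; apply: Z; lia.
rewrite [X in _ = _ + X]big1_seq ?addr0; last by move=> k /andP[_]; rewrite mem_index_iota => h; apply: Z; lia.
rewrite -{1}[m]add0n big_addn addKn big_mkord; apply: eq_bigr => a _.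
by rewrite /F; congr (band Psi _ y); lia.
Qed.

Lemma fat_window : exists2 D : R, 0 <= D & forall xi (j0 : int) M,
  \sum_(i < M) normc (fourier fat (sc (- (j0 + i%:Z)) *: xi)) ^+ 2 <= D.
Proof.
have [B B0 hB] := band_window nPsi sPsi; have [_ _ fi] := nice_fat.
exists (N1 fat * (3 * B)) => [|xi j0 M]; first by rewrite !mulr_ge0 ?N1_ge0.
apply: (le_via (\sum_(i < M) N1 fat * \sum_(a < 3) normc (band Psi (j0 + i%:Z - 1 + a%:Z) xi))).
  apply: ler_sum => i _; rewrite expr2 ler_pM//; first exact: normc_fourier.
  by rewrite fourier_fat; exact: normc_sum.
rewrite -mulr_sumr ler_wpM2l ?N1_ge0// exchange_big/=.
have h (a : 'I_3) : \sum_(i < M) normc (band Psi (j0 + i%:Z - 1 + a%:Z) xi) <= B.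
  apply: le_trans (hB (j0 - 1 + a%:Z) M xi); apply: le_of_eq.
  by apply: eq_bigr => i _; congr (normc (band Psi _ xi)); lia.
apply: le_trans (ler_sum _ (fun a _ => h a)) _.
by rewrite sumr_const card_ord mulr_natl.
Qed.

End fat_window.

(** * Changes on null sets *)

Section almost_everywhere.

(** Covers a nonmeasurable [F]: adding [+oo] on [N] to [G] gives a measurable majorant of [F] with
    the same integral, and [F] cut off to the complement of [N] is a minorant. *)
Lemma ge0_int_ae d (T : measurableType d) (R : realType) (m : {measure set T -> \bar R})
  (F G : T -> \bar R) (N : set T) : measurable N -> m N = 0%E -> mfunT G ->
  (forall x, 0 <= F x)%E -> (forall x, 0 <= G x)%E -> (forall x, ~ N x -> F x = G x) ->
  (\int[m]_x F x = \int[m]_x G x)%E.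
Proof.
move=> mN N0 mG F0 G0 FG; have mT : measurable (setT : set T) by exact: measurableT.
pose G2 x := (G x + +oo * (\1_N x)%:E)%E.
have G20 x : (0 <= G2 x)%E by rewrite adde_ge0// mule_ge0// lee_fin.
have mG2 : mfunT G2.
  by apply: emeasurable_funD => //; apply: measurable_funeM; apply/measurable_EFinP; exact: measurable_indic.
have GE : (\int[m]_x G x = \int[m]_(x in setT `\` N) G x)%E by exact: ge0_negligible_integral.
apply/eqP; rewrite eq_le; apply/andP; split.
  apply: (le_via (\int[m]_x G2 x)%E).
    apply: nn_le => // x; rewrite /G2 indicE; case: (boolP (x \in N)) => [xN|/negP xN].
      by rewrite mule1 addeC addye ?leey// gt_eqF// (lt_le_trans ltNy0 (G0 x)).
    by rewrite mule0 adde0 FG// => h; apply: xN; rewrite inE.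
  rewrite GE (ge0_negligible_integral mN mT mG2)//.
  apply: le_of_eq; apply: eq_integral => x; rewrite inE => -[_ xN].
  by rewrite /G2 indicE memNset// mule0 adde0.
rewrite GE (_ : (\int[m]_(x in setT `\` N) G x = \int[m]_(x in setT `\` N) F x)%E); last first.
  by apply: eq_integral => x; rewrite inE => -[_ xN]; rewrite FG.
rewrite integral_mkcond; apply: nn_le => x; rewrite patchE; case: ifP => //.
Qed.

Lemma Rint_ae d (T : measurableType d) (R : realType) (m : {measure set T -> \bar R})
  (f g : T -> R) : mfunT g -> {ae m, forall x, f x = g x} -> (\int[m]_x f x)%R = (\int[m]_x g x)%R.
Proof.
move=> mg [N [mN N0 subN]]; have fg x : ~ N x -> f x = g x by move=> h; apply: contrapT => h'; exact/h/subN.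
have mG : mfunT (fun x => (g x)%:E) by exact/measurable_EFinP.
rewrite /Rintegral [in LHS]integralE [in RHS]integralE; congr (fine (_ - _)%E).
  by apply: (@ge0_int_ae _ _ _ m _ _ N mN N0 (measurable_funepos mG)) => x; [exact: funepos_ge0..|move=> h; rewrite !funeposE fg].
by apply: (@ge0_int_ae _ _ _ m _ _ N mN N0 (measurable_funeneg mG)) => x; [exact: funeneg_ge0..|move=> h; rewrite !funenegE fg].
Qed.

Lemma cint_ae d (T : measurableType d) (R : realType) (m : {measure set T -> \bar R})
  (f g : T -> R[i]) : cmeas g -> {ae m, forall x, f x = g x} -> cint m f = cint m g.
Proof.
move=> [g1 g2] fg; rewrite /cint; congr Complex; apply: Rint_ae => //.
  by apply: filterS fg => x ->.
by apply: filterS fg => x ->.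
Qed.

Lemma ae_scale {R : realType} n (P : 'rV[R]_n -> Prop) (j : int) :
  {ae lebesgue_rV n, forall x, P x} -> {ae lebesgue_rV n, forall x, P (sc j *: x)}.
Proof.
move=> [N [mN N0 subN]]; exists ((fun x => sc j *: x) @^-1` N).
have ms : mfunT (fun x : 'rV[R]_n => sc j *: x) by mfun.
have mN' : measurable ((fun x : 'rV[R]_n => sc j *: x) @^-1` N) by rewrite -[X in measurable X]setTI; exact: ms.
split=> //; last by move=> x /= h; apply: subN.
have := @int_sc R n j (\1_N) (measurable_indic mN) (fun x => ler0n _ _).
have -> : (\int[lebesgue_rV n]_x (\1_N x)%:E = 0)%E by rewrite integral_indic// setIT; exact: N0.
move=> /esym/eqP.
rewrite mule_eq0 eqe gt_eqF ?exprn_gt0//= => /eqP.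
rewrite (_ : (fun x => _) = fun x => (\1_((fun x : 'rV[R]_n => sc j *: x) @^-1` N) x)%:E); last first.
  by apply/funext => x; rewrite !indicE; congr (nat_of_bool _)%:R%:E; apply/idP/idP; rewrite !inE.
by rewrite integral_indic// setIT => h; exact: h.
Qed.

(** At [l = 0] the power need not be differentiable, so that limit is checked by hand. *)
Lemma cvg_powRl {R : realType} (u : nat -> R) (l p : R) : 0 < p -> (forall k, 0 <= u k) ->
  u k @[k --> \oo] --> l -> u k `^ p @[k --> \oo] --> l `^ p.
Proof.
move=> p0 u0 ul; have l0 : 0 <= l.
  by rewrite -(cvg_lim (@Rhausdorff R) ul); apply: limr_ge; [apply/cvg_ex; exists l|exact: nearW].
have [z|nz] := eqVneq l 0; last first.
  have lp : 0 < l by rewrite lt_def nz l0.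
  have c : {for l, continuous (fun x : R => x `^ p)}.
    apply: differentiable_continuous; apply/derivable1_diffP.
    by apply: derivable_powR; rewrite in_itv/= lp.
  exact: (@cvg_comp _ _ _ u (fun x : R => x `^ p) _ (nbhs l) _ ul c).
rewrite z powR0 ?gt_eqF//; rewrite z in ul; apply/cvgrPdist_lt => e e0.
have e1 : 0 < e `^ p^-1 by exact: powR_gt0.
move/cvgrPdist_lt : ul => /(_ _ e1); apply: filterS => k.
rewrite !sub0r !normrN !ger0_norm ?powR_ge0// => h.
have := @gt0_ltr_powR _ p p0 (u k) (e `^ p^-1).
by rewrite !nnegrE (u0 k) powR_ge0 => /(_ isT isT h); rewrite -powRrM mulVf ?gt_eqF// powRr1// ltW.
Qed.

End almost_everywhere.

(** * Bounds in L^p for finite sums of pieces *)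

Section multiplier_family.
Context {R : realType} {n : nat}.
Local Notation V := 'rV[R]_n.
Local Notation mu := (@lebesgue_rV R n).
Implicit Types (f g u : V -> R[i]) (w : V -> R) (x y xi : V) (j l : int) (m : int -> V -> R[i]).
Variables (phi : V -> R[i]) (D r : R).
Hypotheses (n_gt0 : (0 < n)%N) (D0 : 0 <= D) (nphi : nice phi) (cphi : cscont phi).
Hypothesis sphi : smooth_kernel phi D.
Hypothesis wphi : window_bounded_by phi D.
Hypothesis r1 : 1 < r.

Let r0 : 0 < r. Proof. exact: lt_trans r1. Qed.

(** All that the passage from single pieces to their sum uses: the windows [phi] reproduce the
    pieces, and one weighted bound holds for all of them. *)
Definition ss_family (A : R) m := [/\ forall j, nice (m j),
  forall j xi, m j xi != 0 -> fourier phi (sc (- j) *: xi) = 1 &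
  forall j u w (Bw : R), nice u -> mfunT w -> (forall x, 0 <= w x <= Bw) ->
  (\int[mu]_x (normc (invfourier (fun xi => m j xi * fourier u xi) x) ^+ 2 * w x)%:E <=
   A%:E * \int[mu]_x (normc (u x) ^+ 2 * Mr r w x)%:E)%E].

Definition piece m u j x : R[i] := invfourier (fun xi => m j xi * fourier u xi) x.

Definition window_op m (j0 : int) M u x : R[i] := \sum_(i < M) piece m u (j0 + i%:Z) x.

Section family.
Variables (A : R) (m : int -> V -> R[i]).
Hypotheses (A0 : 0 <= A) (fam : ss_family A m).

Let mF u : nice u -> cmeas (fourier u).
Proof. by move=> [_ _ ui]; exact/cscont_cmeas/cscont_fourier. Qed.

Lemma nice_mF j u : nice u -> nice (fun xi => m j xi * fourier u xi).
Proof.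
move=> nu; have [nm _ _] := fam; have [mj [b hb] mi] := nm j; have [_ _ ui] := nu.
split; first by apply: cmeasM => //; exact: mF.
  by exists (b * N1 u) => xi; rewrite normcM ler_pM//; exact: normc_fourier.
under eq_fun do rewrite mulrC; apply: (cintgMb mi (mF nu) (B := N1 u)) => xi.
exact: normc_fourier.
Qed.

Lemma piece_conv j u x : nice u -> convol (dil phi j) (piece m u j) x = piece m u j x.
Proof.
move=> nu; have [_ ms _] := fam; have [_ _ ci] := nice_mF j nu.
rewrite (conv_invfourier _ (nice_dil j nphi) ci); congr invfourier; apply/funext => xi.
have [->|nz] := eqVneq (m j xi) 0; first by rewrite mul0r mulr0.
by rewrite fourier_dil// ms// mul1r.
Qed.

Lemma piece_conv_arg j u x : nice u -> piece m (convol (dil phi j) u) j x = piece m u j x.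
Proof.
move=> nu; have [_ ms _] := fam; rewrite /piece; congr (invfourier _ x); apply/funext => xi.
have [->|nz] := eqVneq (m j xi) 0; first by rewrite !mul0r.
by rewrite fourier_conv//; [rewrite fourier_dil// ms// mul1r|exact: nice_dil].
Qed.

(** Reproduction on the side of the argument replaces [u] by its Littlewood-Paley piece, which lets
    the bounds be summed over [j]. *)
Lemma piece_weighted j u w (Bw : R) : nice u -> mfunT w -> (forall x, 0 <= w x <= Bw) ->
  (\int[mu]_x (normc (piece m u j x) ^+ 2 * w x)%:E <=
   A%:E * \int[mu]_x (normc (convol (dil phi j) u x) ^+ 2 * Mr r w x)%:E)%E.
Proof.
move=> nu mw wB; have [_ _ ss] := fam.
under eq_integral do rewrite -piece_conv_arg//.
by apply: ss mw wB; apply: nice_conv => //; exact: nice_dil.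
Qed.

Lemma cmeas_piece j u : nice u -> cmeas (piece m u j).
Proof. by move=> nu; apply/cscont_cmeas/cscont_invfourier; have [] := nice_mF j nu. Qed.

Lemma pieces_weighted (j0 : int) M u w (Bw : R) : nice u -> mfunT w -> (forall x, 0 <= w x <= Bw) ->
  (\int[mu]_x (\sum_(i < M) normc (piece m u (j0 + i%:Z) x) ^+ 2 * w x)%:E <=
   A%:E * \int[mu]_x (sqf phi j0 M u x * Mr r w x)%:E)%E.
Proof.
move=> nu mw wB; have w0 x : 0 <= w x by have /andP[] := wB x.
have mwr : mfunT (fun y => w y `^ r) by exact: measurable_powRl.
have wrB y : 0 <= w y `^ r <= Bw `^ r.
  have /andP[a b] := wB y; rewrite powR_ge0 ge0_ler_powR ?nnegrE ?(ltW r0)//; exact: le_trans b.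
have mM := measurable_powRl r^-1 (measurable_Mx mwr wrB).
have mc i : cmeas (convol (dil phi (j0 + i%:Z)) u) by have [] := nice_conv (nice_dil (j0 + i%:Z) nphi) nu.
rewrite nn_sum; last 2 first.
- by move=> i; have mn := measurable_normc (cmeas_piece (j0 + i%:Z) nu); mfun.
- by move=> i x; rewrite mulr_ge0 ?exprn_ge0.
under [X in (_ <= _ * X)%E]eq_integral do rewrite /sqf mulr_suml.
rewrite nn_sum; last 2 first.
- by move=> i; apply: measurable_funM => //; exact/measurable_funX/measurable_normc.
- by move=> i x; rewrite mulr_ge0 ?exprn_ge0 ?powR_ge0.
rewrite ge0_sume_distrr; last first.
  by move=> i _; apply: int_ge0 => x; rewrite mulr_ge0 ?exprn_ge0 ?powR_ge0.
by apply: lee_sum => i _; exact: (piece_weighted _ nu mw wB).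
Qed.

End family.

(** Duality is realised by the single weight [w = Phi^(q-1)]. Young's inequality splits the product,
    and the maximal theorem returns a multiple of the left side, absorbed for small [d]. *)
Lemma square_step (p : R) : 2 < p -> 1 - 2 / p < r^-1 -> exists2 C : R, 0 <= C &
  forall A m, 0 <= A -> ss_family A m -> forall (j0 : int) M u, nice u ->
  (\int[mu]_x ((\sum_(i < M) normc (piece m u (j0 + i%:Z) x) ^+ 2) `^ (p / 2))%:E <=
   (C * A `^ (p / 2))%:E * \int[mu]_x (sqf phi j0 M u x `^ (p / 2))%:E)%E.
Proof.
move=> p2 pr; have p0 : 0 < p by exact: lt_trans p2.
pose q := p / 2; have q1 : 1 < q by rewrite ltr_pdivlMr// mul1r.
have q0 : 0 < q by exact: lt_trans q1.
have q10 : 0 < q - 1 by rewrite subr_gt0.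
pose q' := q / (q - 1); have q'0 : 0 < q' by rewrite divr_gt0.
(* The maximal theorem acts on [w^r] in L^v; [1 < v] is exactly the hypothesis on [r]. *)
pose v := q' / r; have v1 : 1 < v.
  rewrite /v /q' ltr_pdivlMr// mul1r ltr_pdivlMr//.
  have h : 1 - 2 / p = (q - 1) / q by rewrite /q; field; rewrite gt_eqF.
  move: pr; rewrite h ltr_pdivrMr// mulrC -[r^-1]div1r mulrA mulr1 ltr_pdivlMr//.
  by rewrite mulrC.
have [A1 A10 hA1] := @max_strong R n n_gt0 v v1.
(* Makes [d A1] at most 1/2, so that the maximal term can be absorbed. *)
pose d : R := (2 * (A1 + 1))^-1; have d0 : 0 < d by rewrite invr_gt0 mulr_gt0// ltr_wpDl.
have dA : d * A1 <= 2^-1.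
  by rewrite /d invfM -mulrA ler_piMr ?invr_ge0// mulrC ler_pdivrMr ?ltr_wpDl// mul1r lerDl.
exists (2 * d `^ (1 - q)) => [|A m A0 fam j0 M u nu]; first by rewrite mulr_ge0 ?powR_ge0.
have mp i := cmeas_piece fam (j0 + i) nu.
pose Phi x : R := \sum_(i < M) normc (piece m u (j0 + i%:Z) x) ^+ 2.
have Phi0 x : 0 <= Phi x by apply: sumr_ge0 => i _; exact: exprn_ge0.
have mPhi : mfunT Phi.
  by apply: measurable_sum => i; exact/measurable_funX/measurable_normc.
pose b : R := \sum_(i < M) N1 (fun xi => m (j0 + i%:Z) xi * fourier u xi) ^+ 2.
have Phib x : Phi x <= b.
  apply: ler_sum => i _; rewrite lerXn2r ?nnegrE ?N1_ge0//; apply: normc_invfourier.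
  by have [] := nice_mF fam (j0 + i%:Z) nu.
pose w x := Phi x `^ (q - 1).
have mw : mfunT w by exact: measurable_powRl.
have wB x : 0 <= w x <= b `^ (q - 1).
  by rewrite powR_ge0 ge0_ler_powR ?nnegrE ?(ltW q10)//; exact: le_trans (Phib x).
have mwr : mfunT (fun y => w y `^ r) by exact: measurable_powRl.
have wrB y : 0 <= w y `^ r <= (b `^ (q - 1)) `^ r.
  have /andP[a c] := wB y; rewrite powR_ge0 ge0_ler_powR ?nnegrE ?(ltW r0)//; exact: le_trans c.
have mM := measurable_Mx mwr wrB.
have M0 y : 0 <= Mx (fun y => w y `^ r) y by exact: Mx_ge0 wrB _.
pose W x := Mr r w x.
have mS : mfunT (sqf phi j0 M u).
  apply: measurable_sum => i; apply/measurable_funX/measurable_normc.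
  by have [] := nice_conv (nice_dil (j0 + i%:Z) nphi) nu.
have S0 x : 0 <= sqf phi j0 M u x by apply: sumr_ge0 => i _; exact: exprn_ge0.
pose I := (\int[mu]_x (Phi x `^ q)%:E)%E.
have I0 : (0 <= I)%E by apply: int_ge0 => x; rewrite powR_ge0.
have PhiE x : Phi x `^ q = Phi x * w x.
  have [z|nz] := eqVneq (Phi x) 0; first by rewrite z powR0 ?gt_eqF// mul0r.
  by rewrite /w -{2}[Phi x]powRr1// -powRD ?nz ?implybT// addrC subrK.
(* The bound [b] and the L^2 norms depend on the window, but they serve only to justify the
   absorption and do not enter the constant. *)
have Ioo : (I < +oo)%E.
  apply: (le_lt_via (\int[mu]_x (b `^ (q - 1) * Phi x)%:E)%E).
    apply: nn_le => x; rewrite lee_fin ?powR_ge0// PhiE mulrC ler_wpM2r//.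
    by have /andP[] := wB x.
  apply: nnZr_lty => //; first exact: powR_ge0.
  rewrite nn_sum; [|by move=> i; exact/measurable_funX/measurable_normc|by move=> i x; exact: exprn_ge0].
  apply/lte_sum_pinfty => i _; apply: le_lt_trans (invfourier_L2 (nice_mF fam (j0 + i%:Z) nu)) _.
  exact: int_sqr_lty (nice_mF fam _ nu).
pose X := (\int[mu]_x (sqf phi j0 M u x `^ (p / 2))%:E)%E.
have X0 : (0 <= X)%E by apply: int_ge0 => x; rewrite powR_ge0.
have WI : (\int[mu]_x (W x `^ q')%:E <= A1%:E * I)%E.
  have WE x : W x `^ q' = Mx (fun y => w y `^ r) x `^ v by rewrite /W -powRrM mulrC.
  have wE x : (w x `^ r) `^ v = Phi x `^ q.
    by rewrite /w -!powRrM; congr (_ `^ _); rewrite /v /q'; field; rewrite !gt_eqF.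
  have H := hA1 _ _ mwr wrB; under eq_integral do rewrite WE.
  apply: (le_trans H); apply: lee_wpmul2l; first by rewrite lee_fin.
  by apply: nn_le => x; [rewrite lee_fin; exact: powR_ge0|rewrite wE].
have mWq := measurable_powRl q' (measurable_powRl r^-1 mM).
have mSq := measurable_powRl q mS.
have A1I : (I <= (2^-1)%:E * I + (d `^ (1 - q) * A `^ q)%:E * X)%E.
  apply: (le_via (\int[mu]_x (\sum_(i < M) normc (piece m u (j0 + i%:Z) x) ^+ 2 * w x)%:E)%E).
    by apply: nn_le => x; rewrite lee_fin ?powR_ge0// PhiE mulr_suml.
  apply: le_trans (pieces_weighted fam j0 M nu mw wB) _.
  apply: (le_via (\int[mu]_x (d * W x `^ q' + d `^ (1 - q) * A `^ q * sqf phi j0 M u x `^ q)%:E)%E).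
    rewrite -nnZr//; last 2 first.
    - by apply: measurable_funM => //; exact: measurable_powRl.
    - by move=> x; rewrite mulr_ge0 ?powR_ge0.
    apply: nn_le => x; first by rewrite lee_fin mulr_ge0// mulr_ge0 ?powR_ge0.
    rewrite lee_fin mulrA -mulrA -(mulrA _ (A `^ q)) -powRM//.
    by rewrite mulrA; apply: young_split => //; rewrite ?mulr_ge0 ?powR_ge0.
  apply: (le_via (d%:E * (A1%:E * I) + (d `^ (1 - q) * A `^ q)%:E * X)%E).
    exact: (nn_lin2 (mulr_ge0 (powR_ge0 _ _) (powR_ge0 _ _)) (ltW d0) mWq mSq
      (fun x => powR_ge0 _ _) (fun x => powR_ge0 _ _) WI (lexx X)).
  have dA' : ((d * A1)%:E <= (2^-1)%:E)%E by rewrite lee_fin.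
  by rewrite muleA -EFinM; apply: leeD; [apply: (lee_wpmul2r I0); exact: dA'|exact: lexx].
apply: le_trans (ereal_absorb I0 Ioo _ A1I) _.
  by rewrite mule_ge0// lee_fin mulr_ge0 ?powR_ge0.
have -> : 2 * d `^ (1 - q) * A `^ (p / 2) = 2 * (d `^ (1 - q) * A `^ q) by rewrite mulrA.
by rewrite [in leRHS]EFinM -[in leRHS]muleA; exact: lexx.
Qed.

(** The sum is bounded by its square function, that one by the square function of [u], and this by
    [u]: [conv_sum_high], [square_step] and [sqf_high] in turn. *)
Lemma high_bound (p : R) : 2 < p -> 1 - 2 / p < r^-1 -> exists2 C : R, 0 <= C &
  forall A m, 0 <= A -> ss_family A m -> forall (j0 : int) M u, nice u ->
  (\int[mu]_x (normc (window_op m j0 M u x) `^ p)%:E <=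
   (C * A `^ (p / 2))%:E * \int[mu]_x (normc (u x) `^ p)%:E)%E.
Proof.
move=> p2 pr; have [C1 C10 h1] := square_step p2 pr.
have [C2 C20 h2] := conv_sum_high n_gt0 D0 nphi cphi sphi wphi p2.
have [C3 C30 h3] := sqf_high n_gt0 D0 nphi cphi sphi wphi p2.
exists (C2 * C1 * C3) => [|A m A0 fam j0 M u nu]; first by rewrite !mulr_ge0.
have pE (a : V -> R[i]) : (\int[mu]_x (normc (a x) `^ p)%:E = \int[mu]_x ((normc (a x) ^+ 2) `^ (p / 2))%:E)%E.
  by apply: eq_integral => x _; rewrite sqr_powR_half.
rewrite !pE; have H := h2 j0 M _ (fun i : 'I_M => nice_mF fam (j0 + i%:Z) nu).
rewrite (_ : (\int[mu]_x _ = \int[mu]_x ((normc (\sum_(i < M) convol (dil phi (j0 + i%:Z)) (piece m u (j0 + i%:Z)) x) ^+ 2) `^ (p / 2))%:E)%E); last first.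
  apply: eq_integral => x _; congr ((normc _ ^+ 2) `^ _)%:E; apply: eq_bigr => i _.
  by rewrite (piece_conv fam (j0 + i%:Z) x nu).
apply: (le_trans H); clear H.
apply: (le_via (C2%:E * ((C1 * A `^ (p / 2))%:E * (C3%:E * \int[mu]_x ((normc (u x) ^+ 2) `^ (p / 2))%:E)))%E).
  rewrite lee_wpmul2l ?lee_fin//; apply: le_trans (h1 A m A0 fam j0 M u nu) _.
  by rewrite lee_wpmul2l ?lee_fin ?mulr_ge0 ?powR_ge0//; exact: h3.
rewrite !muleA -!EFinM lee_wpmul2r//; first by apply: int_ge0 => x; rewrite powR_ge0.
by rewrite lee_fin; apply: le_of_eq; ring.
Qed.

(** The weight is 1, whose maximal function is at most [2^n]; both outer steps are plain L^2
    bounds. *)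
Lemma two_bound : exists2 C : R, 0 <= C &
  forall A m, 0 <= A -> ss_family A m -> forall (j0 : int) M u, nice u ->
  (\int[mu]_x (normc (window_op m j0 M u x) `^ 2)%:E <=
   (C * A)%:E * \int[mu]_x (normc (u x) `^ 2)%:E)%E.
Proof.
pose k : R := (2 ^+ n) `^ r^-1; have k0 : 0 <= k by exact: powR_ge0.
exists (D * k * D) => [|A m A0 fam j0 M u nu]; first by rewrite !mulr_ge0.
have pE (a : V -> R[i]) : (\int[mu]_x (normc (a x) `^ 2)%:E = \int[mu]_x (normc (a x) ^+ 2)%:E)%E.
  by apply: eq_integral => x _; rewrite powR_mulrn.
rewrite !pE; have H := conv_sum_invfourier_L2 D0 nphi cphi wphi j0 (fun i : 'I_M => nice_mF fam (j0 + i%:Z) nu).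
rewrite (_ : (\int[mu]_x _ = \int[mu]_x (normc (\sum_(i < M) convol (dil phi (j0 + i%:Z)) (piece m u (j0 + i%:Z)) x) ^+ 2)%:E)%E); last first.
  apply: eq_integral => x _; congr (normc _ ^+ 2)%:E; apply: eq_bigr => i _.
  by rewrite (piece_conv fam (j0 + i%:Z) x nu).
have w1 (x : V) : 0 <= (1 : R) <= 1 by rewrite ler01 lexx.
have mw1 : mfunT (fun _ : V => 1 : R) by exact: measurable_cst.
have p1B (y : V) : 0 <= (1 : R) `^ r <= 1.
  by have -> : (1 : R) `^ r = 1 by [rewrite powR1]; rewrite ler01 lexx.
have mS : mfunT (sqf phi j0 M u).
  apply: measurable_sum => i; apply/measurable_funX/measurable_normc.
  by have [] := nice_conv (nice_dil (j0 + i%:Z) nphi) nu.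
have S0 x : 0 <= sqf phi j0 M u x by apply: sumr_ge0 => i _; exact: exprn_ge0.
apply: (le_trans H); clear H.
apply: (le_via (D%:E * (A%:E * (k%:E * (D%:E * \int[mu]_x (normc (u x) ^+ 2)%:E))))%E).
  rewrite lee_wpmul2l ?lee_fin//.
  have H := pieces_weighted fam j0 M nu mw1 w1.
  rewrite (_ : (\int[mu]_x _ = \int[mu]_x (\sum_(i < M) normc (piece m u (j0 + i%:Z) x) ^+ 2 * 1)%:E)%E); last first.
    by apply: eq_integral => x _; congr EFin; apply: eq_bigr => i _; rewrite mulr1.
  apply: (le_trans H); rewrite lee_wpmul2l ?lee_fin//; clear H.
  apply: (le_via (\int[mu]_x (k * sqf phi j0 M u x)%:E)%E).
    apply: nn_le => x; first by rewrite lee_fin mulr_ge0 ?powR_ge0.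
    rewrite lee_fin mulrC ler_wpM2r// ge0_ler_powR ?nnegrE ?invr_ge0 ?(ltW r0) ?exprn_ge0//.
      exact: (@Mx_ge0 R n (fun=> 1 `^ r) 1 (measurable_cst _) p1B x).
    apply: (le_via (2 ^+ n * 1)); last by rewrite mulr1.
    exact: (@Mx_bounded R n (fun=> 1 `^ r) 1 (measurable_cst _) p1B x).
  by rewrite nnZr// lee_wpmul2l ?lee_fin//; exact: sqf_L2.
rewrite !muleA -!EFinM lee_wpmul2r//; first by apply: int_ge0 => x; rewrite exprn_ge0.
by rewrite lee_fin; apply: le_of_eq; ring.
Qed.

Definition refl f x : R[i] := f (0 - x).

Lemma nice_refl f : nice f -> nice (refl f).
Proof.
move=> [mf [B hB] fi]; split; [|by exists B => x; exact: hB|exact: cintg_subl].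
by apply: (cmeas_comp mf); mfun.
Qed.

Lemma invfourier_refl f : cintg mu f -> invfourier f = fourier (refl f).
Proof.
move=> fi; apply/funext => xi; rewrite invfourierE fourierE.
have ci : cintg mu (fun x => f x * ec (dotmx xi x)) by apply: cintg_char => //; mdot.
rewrite -(cint_subl 0 ci); congr cint; apply/funext => x.
by rewrite /refl sub0r dotmxNr (dotmxC xi).
Qed.

Lemma refl_refl f : refl (refl f) = f.
Proof. by apply/funext => x; rewrite /refl !sub0r opprK. Qed.

Lemma int_refl (f : V -> R[i]) (p : R) : cmeas f ->
  (\int[mu]_x (normc (refl f x) `^ p)%:E = \int[mu]_x (normc (f x) `^ p)%:E)%E.
Proof.
move=> mf; apply: (int_subl 0 (f := fun x => (normc (f x) `^ p)%:E)).
  by apply/measurable_EFinP; apply: measurable_powRl; exact: measurable_normc.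
by move=> x; rewrite lee_fin powR_ge0.
Qed.

(** As a single inverse transform of an integrable function, the sum of pieces is bounded and
    continuous, and duality can transpose it. *)
Lemma window_opE (A : R) m (j0 : int) M u : ss_family A m -> nice u ->
  cintg mu (fun xi => \sum_(i < M) m (j0 + i%:Z) xi * fourier u xi) /\
  window_op m j0 M u = invfourier (fun xi => \sum_(i < M) m (j0 + i%:Z) xi * fourier u xi).
Proof.
move=> fam nu; have mi i : cintg mu (fun xi => m (j0 + i) xi * fourier u xi) by have [] := nice_mF fam (j0 + i) nu.
split; first by apply: cintg_sum => i; exact: mi.
apply/funext => x; rewrite invfourierE.
have -> : (fun xi => (\sum_(i < M) m (j0 + i%:Z) xi * fourier u xi) * ec (dotmx x xi)) =
  fun xi => \sum_(i < M) m (j0 + i%:Z) xi * fourier u xi * ec (dotmx x xi).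
  by apply/funext => xi; rewrite mulr_suml.
rewrite cint_sum; last by move=> i; apply: cintg_char => //; mdot.
by apply: eq_bigr => i _; rewrite /piece invfourierE.
Qed.

(* The transpose of the window operator is its conjugate by the reflection [x |-> - x]. *)
Lemma window_transpose (A : R) m (j0 : int) M u G : ss_family A m -> nice u -> nice G ->
  cint mu (fun x => G x * window_op m j0 M u x) = cint mu (fun x => refl u x * window_op m j0 M (refl G) x).
Proof.
move=> fam nu nG; have nG' := nice_refl nG; have nu' := nice_refl nu.
have [c1 ->] := window_opE j0 M fam nu; have [c2 ->] := window_opE j0 M fam nG'.
have [_ _ Gi] := nG; have [_ _ ui'] := nu'.
apply: (etrans (invfourier_duality Gi c1)); apply: etrans (esym (invfourier_duality ui' c2)).
rewrite (invfourier_refl Gi) (invfourier_refl ui') refl_refl.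
by congr cint; apply/funext => xi; rewrite -!mulr_suml; ring.
Qed.

Lemma window_bounded (A : R) m (j0 : int) M u : ss_family A m -> nice u ->
  exists2 b : R, 0 <= b & forall x, normc (window_op m j0 M u x) <= b.
Proof.
move=> fam nu; have [c1 ->] := window_opE j0 M fam nu.
by exists (N1 (fun xi => \sum_(i < M) m (j0 + i%:Z) xi * fourier u xi)) => [|x]; [exact: N1_ge0|exact: normc_invfourier].
Qed.

(** Testing against [G], the truncation to a ball of [conj F |F|^(p-2)], and transposing puts the
    dual exponent [q > 2] on the operator, where [high_bound] applies to the same family. The
    truncation makes the absorbed quantity finite. *)
Lemma low_bound (p : R) : 1 < p -> p < 2 -> 2 / p - 1 < r^-1 -> exists2 C : R, 0 <= C &
  forall A m, 0 < A -> ss_family A m -> forall (j0 : int) M u, nice u ->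
  (\int[mu]_x (normc (window_op m j0 M u x) `^ p)%:E <=
   (C * A `^ (p / 2))%:E * \int[mu]_x (normc (u x) `^ p)%:E)%E.
Proof.
move=> p1 p2 pr; have p0 : 0 < p by exact: lt_trans p1.
have p10 : 0 < p - 1 by rewrite subr_gt0.
pose q := p / (p - 1); have q2 : 2 < q by rewrite ltr_pdivlMr//; lra.
have qr : 1 - 2 / q < r^-1.
  by rewrite (_ : 1 - 2 / q = 2 / p - 1)// /q; field; rewrite !gt_eqF.
have [C1 C10 hC1] := high_bound q2 qr.
pose c := 2 * (C1 + 1); have c0 : 0 < c by rewrite mulr_gt0// ltr_wpDl.
exists (2 * c `^ (p - 1)) => [|A m A0 fam j0 M u nu]; first by rewrite mulr_ge0 ?powR_ge0.
(* Makes the term to be absorbed at most half of [I], and gives [d^(1-p)] the required power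
   [A^(p/2)]. *)
pose d := (c * A `^ (q / 2))^-1; have Aq : 0 < A `^ (q / 2) by exact: powR_gt0.
have d0 : 0 < d by rewrite invr_gt0 mulr_gt0.
have dA : d * (C1 * A `^ (q / 2)) <= 2^-1.
  rewrite /d /c; move: Aq; move: (A `^ _) => a Aq.
  rewrite mulrC ler_pdivrMr ?mulr_gt0 ?ltr_wpDl//.
  by have -> : 2^-1 * (2 * (C1 + 1) * a) = C1 * a + a by [field]; rewrite lerDl ltW.
have dE : d `^ (1 - p) = c `^ (p - 1) * A `^ (p / 2).
  have -> : d = (c * A `^ (q / 2)) `^ (-1) by rewrite powR_inv1// mulr_ge0 ?(ltW c0) ?(ltW Aq).
  rewrite -powRrM mulN1r opprB powRM ?(ltW c0) ?(ltW Aq)//.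
  by rewrite -powRrM (_ : q / 2 * (p - 1) = p / 2)// /q; field; rewrite gt_eqF.
have [b b0 hb] := window_bounded j0 M fam nu.
set X := (\int[mu]_x (normc (u x) `^ p)%:E)%E.
have X0 : (0 <= X)%E by apply: int_ge0 => x; rewrite powR_ge0.
have [ci FE] := window_opE j0 M fam nu.
have mF : cmeas (window_op m j0 M u) by rewrite FE; exact/cscont_cmeas/cscont_invfourier.
have mn := measurable_normc mF.
pose F := window_op m j0 M u; pose T (k : nat) x : R := (`|x| < k.+1%:R)%R%:R.
have T01 k x : 0 <= T k x <= 1 by rewrite ler0n lern1 leq_b1.
apply: (@fatou_le _ _ _ _ (fun k x => normc (F x) `^ p * T k x)).
- by move=> k; rewrite /F /T; mfun.
- by move=> k x; rewrite mulr_ge0 ?powR_ge0//; have /andP[] := T01 k x.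
- move=> x; apply: cvg_near_cst; exists (Num.truncn `|x|) => // k /= hk; apply/eqP.
  rewrite /T (_ : `|x| < k.+1%:R) ?mulr1//.
  by apply: lt_le_trans (truncnS_gt _) _; rewrite ler_nat.
(* The exponent is negative. At a zero of [F] the power is 0 by convention, and both [|F| W] and
   [|F|^2 W] take the correct value 0 there. *)
move=> k; pose W x : R := normc (F x) `^ (p - 2).
have mW : mfunT W by rewrite /W /F; mfun.
pose G x : R[i] := conjc (F x) * (W x)%:C%C * (T k x)%:C%C.
have nFW x : normc (conjc (F x) * (W x)%:C%C) = normc (F x) `^ (p - 1).
  rewrite normcM normc_conj normc_rc ger0_norm ?powR_ge0// /W.
  have [z|nz] := eqVneq (normc (F x)) 0; first by rewrite z mul0r powR0// gt_eqF.
  by rewrite -{1}[normc (F x)]powRr1// -powRD ?nz ?implybT//; congr (_ `^ _); ring.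
have nG : nice G.
  apply: (@nice_restrict R n (fun x => conjc (F x) * (W x)%:C%C) (fun y => `|y| < k.+1%:R) (b `^ (p - 1)) 0 k.+1%:R) => //.
  - by apply: cmeasM; [exact: cmeas_conj|exact: cmeas_rc].
  - by move=> y; rewrite nFW ge0_ler_powR ?nnegrE ?(ltW p10)//; exact: hb.
  - by mfun.
  - by move=> y; rewrite subr0.
pose g x := normc (F x) `^ p * T k x.
have g0 x : 0 <= g x by rewrite mulr_ge0 ?powR_ge0//; have /andP[] := T01 k x.
have mg : mfunT g by rewrite /g /F /T; mfun.
have GF x : G x * F x = (g x)%:C%C.
  rewrite /G /g (_ : conjc (F x) * (W x)%:C%C * (T k x)%:C%C * F x = F x * conjc (F x) * (W x)%:C%C * (T k x)%:C%C); last by ring.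
  rewrite mulc_conj -!rmorphM/=.
  congr (_ * _)%:C%C; rewrite /W; have [z|nz] := eqVneq (normc (F x)) 0.
    by rewrite z expr0n mul0r powR0// gt_eqF.
  by rewrite -powR_mulrn// -powRD ?nz ?implybT//; congr (_ `^ _); ring.
pose I := (\int[mu]_x (g x)%:E)%E.
have I0 : (0 <= I)%E by apply: int_ge0 => x.
have nGp x : normc (G x) `^ q = g x.
  rewrite /G normcM nFW normc_rc ger0_norm; last by have /andP[] := T01 k x.
  rewrite powRM ?powR_ge0//.
  rewrite -powRrM (_ : (p - 1) * q = p); last by rewrite /q; field; rewrite gt_eqF.
  by rewrite /g /T; case: (_ < _); rewrite ?powR1// powR0// gt_eqF// (lt_trans _ q2).
have Ioo : (I < +oo)%E.
  have [mG [BG hBG] [_ Gl]] := nG.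
  apply: (le_lt_via (\int[mu]_x (b * normc (G x))%:E)%E); last first.
    by apply: nnZr_lty => //; exact: measurable_normc.
  apply: nn_le => x; rewrite lee_fin// -[leLHS](ger0_norm (g0 x)) -normc_rc -GF normcM mulrC ler_wpM2r//.
have nG' := nice_refl nG; have nu' := nice_refl nu.
have [ci' WE] := window_opE j0 M fam nG'.
have mWi : cmeas (window_op m j0 M (refl G)) by rewrite WE; exact/cscont_cmeas/cscont_invfourier.
have HW := hC1 A m (ltW A0) fam j0 M _ nG'.
have EI : I = (normc (cint mu (fun x => G x * F x)))%:E.
  rewrite (_ : (fun x => G x * F x) = fun x => (g x)%:C%C); last by apply/funext => x; exact: GF.
  rewrite /cint /=; have -> : (\int[mu]_x Im (g x)%:C%C)%R = 0 by rewrite /Rintegral integral0.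
  rewrite normc_rc ger0_norm; last by rewrite /Rintegral fine_ge0.
  by rewrite /Rintegral fineK// ge0_fin_numE.
have H : (I <= (2^-1)%:E * I + (d `^ (1 - p))%:E * X)%E.
  rewrite {1}EI (window_transpose j0 M fam nu nG).
  have [mu' [Bu hBu] ui'] := nu'.
  have [bW bW0 hbW] := window_bounded j0 M fam nG'.
  have cW : cintg mu (fun x => refl u x * window_op m j0 M (refl G) x).
    by under eq_fun do rewrite mulrC; exact: (cintgMb ui' mWi hbW).
  apply: (le_trans (le_cint cW)).
  have mWq := measurable_powRl q (measurable_normc mWi); have muq := measurable_powRl p (measurable_normc mu').
  apply: (le_via (\int[mu]_x (d * normc (window_op m j0 M (refl G) x) `^ q +
      d `^ (1 - p) * normc (refl u x) `^ p)%:E)%E).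
    apply: nn_le => x; first by rewrite lee_fin.
    by rewrite lee_fin normcM; exact: (young_split p1 (erefl _) d0).
  apply: (le_trans (nn_lin2 (powR_ge0 _ _) (ltW d0) mWq muq (fun x => powR_ge0 _ _) (fun x => powR_ge0 _ _) HW (lexx _))).
  have [mu0 _ _] := nu; have [mG0 _ _] := nG; rewrite (int_refl _ mu0) (int_refl _ mG0).
  have -> : (\int[mu]_x (normc (G x) `^ q)%:E = I)%E by apply: eq_integral => x _; rewrite nGp.
  have dA' : ((d * (C1 * A `^ (q / 2)))%:E <= (2^-1)%:E)%E by rewrite lee_fin.
  by rewrite muleA -EFinM; apply: leeD; [apply: (lee_wpmul2r I0); exact: dA'|exact: lexx].
have := ereal_absorb I0 Ioo _ H; rewrite dE muleA -EFinM mulrA; apply.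
by rewrite mule_ge0// lee_fin mulr_ge0 ?powR_ge0.
Qed.

Lemma window_bound (p : R) : 1 < p -> `|1 - 2 / p| < r^-1 -> exists2 C : R, 0 <= C &
  forall A m, 0 < A -> ss_family A m -> forall (j0 : int) M u, nice u ->
  (\int[mu]_x (normc (window_op m j0 M u x) `^ p)%:E <=
   (C * A `^ (p / 2))%:E * \int[mu]_x (normc (u x) `^ p)%:E)%E.
Proof.
move=> p1; rewrite ltr_norml => /andP[pr1 pr2].
have [pl|pg|->] := ltgtP p 2.
- by apply: low_bound => //; lra.
- have [C C0 h] := high_bound pg pr2.
  by exists C => // A m A0; exact: (h A m (ltW A0)).
have [C C0 h] := two_bound.
exists C => // A m A0 fam j0 M u nu; rewrite divff ?pnatr_eq0// powRr1 ?(ltW A0)//.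
exact: (h A m (ltW A0)).
Qed.

End multiplier_family.

(** * From finite windows to the full multiplier *)

Section conclusion.
Context {R : realType} {n : nat}.
Local Notation V := 'rV[R]_n.
Local Notation mu := (@lebesgue_rV R n).
Implicit Types (f g u : V -> R[i]) (x y xi : V).

Lemma cLnormE (p : R) f : cLnorm p f = ((\int[mu]_x (normc (f x) `^ p)%:E) `^ p^-1)%E.
Proof.
rewrite /cLnorm unlock; congr poweR; apply: eq_integral => x _.
by rewrite abse_EFin ger0_norm// poweR_EFin.
Qed.

Lemma smooth_kernel_sum I (s : seq I) (F : I -> V -> R[i]) (D : I -> R) :
  (forall i, smooth_kernel (F i) (D i)) -> smooth_kernel (fun x => \sum_(i <- s) F i x) (\sum_(i <- s) D i).
Proof.
move=> h x v xv; rewrite -sumrB !mulr_suml.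
have w0 : 0 <= `|x| ^+ n.+2 by exact: exprn_ge0.
split; first by apply: le_trans (normc_sum _ _) _; apply: ler_sum => i _; have [] := h i x v xv.
apply: le_trans (ler_wpM2r w0 (normc_sum _ _)) _; rewrite mulr_suml; apply: ler_sum => i _.
by have [] := h i x v xv.
Qed.

Hypothesis n_gt0 : (0 < n)%N.
Variable Psi : V -> R[i].
Hypothesis sPsi : schwartz Psi.
Hypothesis suppPsi : annular Psi.

Let nPsi := nice_schwartz sPsi.
Let cPsi := cscont_schwartz sPsi.
Let FPsi := cintg_fourier_schwartz sPsi.

Lemma smooth_kernel_fat : exists2 D : R, 0 <= D & smooth_kernel (fat Psi) D.
Proof.
have /choice[D hD] : forall a : 'I_3, exists D : R, 0 <= D /\ smooth_kernel (dil Psi (a%:Z - 1)) D.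
  move=> a; have := schwartz_affine (sc (a%:Z - 1) ^+ n) 0 (sc_neq0 (R := R) (a%:Z - 1)) sPsi.
  rewrite (_ : (fun x => _) = dil Psi (a%:Z - 1)); last by apply/funext => x; rewrite addr0.
  by move=> /smooth_kernel_schwartz[D D0 h]; exists D.
exists (\sum_a D a); first by apply: sumr_ge0 => a _; have [] := hD a.
by apply: smooth_kernel_sum => a; have [] := hD a.
Qed.

(** At a nonzero [y] the bands of large index vanish, as one sees by comparing [2^|j|] with
    [4 |y|^2] and [4 / |y|^2]; the sum over all integers is then a finite window. *)
Lemma band_windows_sum : (forall xi : V, xi != 0 -> \sum_(j \in [set: int]) fourier Psi ((2 : R) ^ (- j) *: xi) = 1) ->
  resolves Psi.
Proof.
move=> Psum y y0; have d0 := dotmx_gt0 y0; set d := dotmx y y in d0.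
pose N0 := ((Num.truncn (4 * d)).+1 + (Num.truncn (4 / d)).+1)%N.
have pN (N : nat) (t : R) : (Num.truncn t < N)%N -> t < sc N%:Z.
  move=> tN; apply: lt_le_trans (truncnS_gt t) _.
  by rewrite sc_nat -natrX ler_nat (leq_trans tN)// ltnW// ltn_expl.
have sq (N : nat) : sc N%:Z <= sc N%:Z ^+ 2 :> R.
  by rewrite sc_nat expr2 ler_peMl ?exprn_ge0// exprn_ege1// ler1n.
have far j : (N0 <= absz j)%N -> band Psi j y = 0.
  move=> jN; apply/eqP; apply: contraT => /(band_supp nPsi suppPsi); rewrite -/d => /andP[h1 h2].
  have [m hm] : exists m : nat, absz j = m by exists (absz j).
  have t1 : 4 * d < sc m%:Z by apply: pN; move: jN; rewrite hm /N0; lia.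
  have t2 : 4 / d < sc m%:Z by apply: pN; move: jN; rewrite hm /N0; lia.
  have sm := sq m; have [j0|j0] := leP 0 j.
    have jm : j = m%:Z by lia.
    by move: h1; rewrite jm; move: t1 sm; move: (sc m%:Z) => a; lra.
  have jm : j = - m%:Z by lia.
  move: h2; rewrite jm scN exprVn => h2.
  have a0 : 0 < sc m%:Z ^+ 2 :> R by rewrite exprn_gt0.
  rewrite -[4 * _]/(4 / _) ltr_pdivlMr// in h2; rewrite ltr_pdivrMr// in t2.
  by have := ler_wpM2l (ltW d0) sm; lra.
exists N0 => N hN; rewrite -(Psum y y0).
pose F (k : nat) := band Psi (- N%:Z + k%:Z) y; rewrite (@fsbig_ord _ _ _ N.*2.+1 F).
pose Q := [set j : int | - N%:Z <= j <= N%:Z].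
rewrite -(@fsbig_widen _ _ _ _ Q setT (fun j => fourier Psi ((2 : R) ^ (- j) *: y))) => //; last first.
  move=> j [_ /=] jQ; rewrite -/(sc (- j)) -bandE//; apply: far; move: jQ hN; rewrite /Q/=.
  by move=> /negP; rewrite negb_and -!ltNge; lia.
rewrite (@reindex_fsbig _ _ _ _ _ (fun k : nat => - N%:Z + k%:Z) `I_N.*2.+1 Q); last first.
  split.
  - by move=> k /=; rewrite /Q/=; lia.
  - by move=> k l _ _; lia.
  - by move=> j; rewrite /Q/= => h; exists (absz (j + N%:Z)) => //=; lia.
by apply: eq_fsbigr => k _; rewrite /F bandE.
Qed.

Hypothesis Psum : resolves Psi.

Section limit.
Variables (tau : V -> R[i]) (M A r : R).
Hypotheses (mtau : cmeas tau) (tauM : forall xi, normc (tau xi) <= M).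
Let m j xi : R[i] := band Psi j xi * tau xi.
Hypothesis fam : ss_family (fat Psi) r A m.

Lemma nice_band_mul j : nice (m j).
Proof.
have mb : cmeas (band Psi j) by exact/cscont_cmeas/cscont_band.
split; first exact: cmeasM.
  by exists (N1 Psi * M) => xi; rewrite normcM ler_pM//; exact: normc_band.
by rewrite /m; under eq_fun do rewrite mulrC; exact: (cintgMb (cintg_band nPsi FPsi j) mtau tauM).
Qed.

(** Dominated convergence in frequency, the partial sums of bands being bounded by [band_window];
    the origin, where all bands vanish, is removed by [cint_point]. *)
Lemma windows_cvg f x : nice f -> cintg mu (fourier f) ->
  ccvg (fun N : nat => window_op m (- N%:Z) N.*2.+1 f x) (multiplier_op tau f x).
Proof.
move=> nf Fi; have [_ _ fi] := nf; have [mF Fl] := Fi.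
have M0 : 0 <= M := le_trans (normc_ge0 _) (tauM 0).
have [B B0 hB] := band_window nPsi suppPsi.
pose G xi : R[i] := fourier f xi * tau xi * ec (dotmx x xi).
have me : cmeas (fun xi => ec (dotmx x xi)) by apply: cmeas_ec; mdot.
have Gi : cintg mu G.
  apply: cintg_char; first by mdot.
  by under eq_fun do rewrite mulrC; exact: (cintgMb Fi mtau tauM).
have Gb xi : normc (G xi) <= N1 f * M.
  by rewrite /G normcM normc_ec mulr1 normcM ler_pM//; exact: normc_fourier.
have -> : multiplier_op tau f x = cint mu G by rewrite /multiplier_op invfourierE.
rewrite -(cint_point n_gt0 0 Gi Gb).
pose GN (N : nat) xi : R[i] := (\sum_(j < N.*2.+1) m (- N%:Z + j%:Z) xi * fourier f xi) * ec (dotmx x xi).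
rewrite (_ : (fun N : nat => _) = fun N => cint mu (GN N)); last first.
  apply/funext => N; have [_ ->] := window_opE (- N%:Z) N.*2.+1 fam nf.
  by rewrite invfourierE.
have GE N xi : GN N xi = (\sum_(j < N.*2.+1) band Psi (- N%:Z + j%:Z) xi) * G xi.
  by rewrite /GN /G /m -mulr_suml -mulr_suml -!mulrA; congr (_ * _); rewrite mulrA mulrA; congr (_ * _); rewrite mulrC.
have mm j : cmeas (m j) by have [] := nice_band_mul j.
apply: (@cint_dct _ _ _ _ _ _ (fun xi => B * M * normc (fourier f xi))).
- by move=> N; apply: cmeasM => //; apply: cmeas_sum => j; exact: cmeasM.
- by have [mG _] := Gi; apply: cmeasM => //; apply: cmeas_rc; mfun.
- move=> xi; have [->|x0] := eqVneq xi 0.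
    rewrite subr0 normr0 ltxx /= mulr0; under eq_fun => N.
      rewrite GE big1 ?mul0r; first over.
      by move=> j _; rewrite (band0 nPsi suppPsi).
    exact: ccvg_cst.
  have [N0 hN0] := Psum x0.
  have -> : 0 < `|xi - 0| by rewrite subr0 normr_gt0.
  rewrite mulr1; have E N : (N0 <= N)%N -> GN N xi = G xi by move=> h; rewrite GE hN0// mul1r.
  by split; apply: cvg_near_cst; exists N0 => // N /= h; apply/eqP; rewrite E.
- move=> N xi; rewrite GE normcM -mulrA ler_pM//.
    by apply: le_trans (normc_sum _ _) _; exact: hB.
  by rewrite /G normcM normc_ec mulr1 normcM mulrC ler_wpM2r.
- by have mn := measurable_normc mF; mfun.
- by apply: nnZr_lty => //; [rewrite mulr_ge0|exact: measurable_normc].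
Qed.

End limit.
End conclusion.

(** * Choice of the exponent and the family attached to a symbol *)

Section multiplier_families.
Context {R : realType} {n : nat}.
Local Notation V := 'rV[R]_n.
Local Notation mu := (@lebesgue_rV R n).

Lemma nice_Lp_lty (p : R) (f : V -> R[i]) : 1 < p -> nice f -> (\int[mu]_x (normc (f x) `^ p)%:E < +oo)%E.
Proof.
move=> p1 [mf [B hB] [_ fi]]; have mn := measurable_normc mf.
apply: (le_lt_via (\int[mu]_x (B `^ (p - 1) * normc (f x))%:E)%E); last first.
  by apply: nnZr_lty => //; exact: powR_ge0.
apply: nn_le => x; rewrite lee_fin ?powR_ge0//.
have -> : normc (f x) `^ p = normc (f x) `^ (p - 1) * normc (f x).
  have [->|nz] := eqVneq (normc (f x)) 0; first by rewrite mulr0 powR0// gt_eqF// (lt_trans _ p1).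
  by rewrite -[X in _ * X]powRr1// -powRD ?nz ?implybT// subrK.
by apply: ler_wpM2r => //; apply: ge0_ler_powR; rewrite ?nnegrE ?(le_trans _ (hB x)) ?subr_ge0 ?(ltW p1).
Qed.

(** [1/r] is the midpoint between [|1 - 2/p|], which is below 1, and the smaller of 1 and [2s/n]. *)
Lemma interpolation_exponent (p s : R) : (0 < n)%N -> 1 < p -> 0 < s -> `|p^-1 - 2^-1| < s / n%:R ->
  exists r : R, [/\ 1 < r, n%:R / (2 * r) < s & `|1 - 2 / p| < r^-1].
Proof.
move=> n_gt0 p1 s0 ps; have n0 : 0 < n%:R :> R by rewrite ltr0n.
have p0 : 0 < p := lt_trans ltr01 p1.
set e := `|_ - _|; have e0 : 0 <= e := normr_ge0 _.
have ee : e = 2 * `|p^-1 - 2^-1|.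
  rewrite /e -[X in X * `|p^-1 - _|](@ger0_norm _ 2)// -normrM distrC; congr `|_|; field.
  exact: lt0r_neq0.
have e1 : e < 1.
  have i1 : p^-1 < 1 by rewrite invf_lt1.
  have i0 : 0 < p^-1 by rewrite invr_gt0.
  by rewrite /e ltr_norml; lra.
pose t := (e + Num.min 1 (2 * (s / n%:R))) / 2.
have h1 : Num.min 1 (2 * (s / n%:R)) <= 1 by rewrite ge_min lexx.
have h2 : Num.min 1 (2 * (s / n%:R)) <= 2 * (s / n%:R) by rewrite ge_min lexx orbT.
have h3 : e < Num.min 1 (2 * (s / n%:R)) by rewrite lt_min e1 /=; lra.
have t0 : 0 < t by rewrite /t; lra.
exists t^-1; rewrite invrK; split.
- by rewrite invf_gt1//; rewrite /t; lra.
- have -> : n%:R / (2 * t^-1) = t / 2 * n%:R by field; rewrite gt_eqF.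
  by rewrite -ltr_pdivlMr// /t; lra.
- by rewrite /t; lra.
Qed.

Variables (Psi : V -> R[i]) (s r C : R).
Hypotheses (s0 : 0 < s) (sPsi : schwartz Psi).
Hypothesis suppPsi : annular Psi.
Hypothesis Psum : resolves Psi.
Hypothesis hC : single_scale_bound Psi s r C.

(** Undoing the dilation by [2^j] identifies the [j]-th piece with the multiplier of
    [single_scale_bound]. The constant [C + 1] in place of [C] is positive, as [window_bound]
    requires after multiplication by [a^2]. *)
Lemma ss_family_multiplier (sigma tau : V -> R[i]) (M a : R) : 0 <= C ->
  cmeas tau -> (forall xi, normc (tau xi) <= M) -> {ae mu, forall xi, sigma xi = tau xi} ->
  (forall j : int, exists2 h, represents h (bessel s (dist_of_fun (fun xi : V =>
     fourier Psi xi * sigma ((2 : R) ^ j *: xi)))) & (lorentz1 (n%:R / s) h <= a%:E)%E) ->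
  ss_family (fat Psi) r ((C + 1) * a ^+ 2) (fun j xi => band Psi j xi * tau xi).
Proof.
move=> C0 mtau tauM st Ka.
have nPsi := nice_schwartz sPsi; have cPsi := cscont_schwartz sPsi.
have FPsi := cintg_fourier_schwartz sPsi; have [mF _] := FPsi.
split=> [j|j xi|j u w Bw nu mw wB]; first exact: (nice_band_mul sPsi mtau tauM).
  move=> h; apply: (fat_one nPsi suppPsi Psum); apply: contraNneq h => ->.
  by rewrite mul0r.
have [h hrep ha] := Ka j.
pose tj xi := tau (sc j *: xi).
have mtj : cmeas tj by case: mtau => t1 t2; split; apply: (measurableT_comp (f := fun x => _ (tau x))) => //; mfun.
have gi : cintg mu (fun xi => fourier Psi xi * tj xi).
  by under eq_fun do rewrite mulrC; exact: (cintgMb FPsi mtj (fun xi => tauM _)).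
have [|mh sr] := represents_scale_rep sPsi s0 suppPsi gi _ hrep.
  move=> T mT; apply: cint_ae; first by apply: cmeasM => //; case: gi.
  by apply: filterS (ae_scale j st) => xi E; rewrite /tj -E.
have H := hC gi mh sr ha j nu mw wB.
rewrite (_ : (fun xi => band Psi j xi * tau xi * fourier u xi) = fun xi =>
  fourier Psi (sc (- j) *: xi) * tj (sc (- j) *: xi) * fourier u xi); last first.
  by apply/funext => xi; rewrite bandE// /tj scalerA -scD subrr scale1r.
apply: (le_trans H); apply: lee_wpmul2r; last by rewrite lee_fin ler_wpM2r ?sqr_ge0// lerDl.
by apply: int_ge0 => x; rewrite mulr_ge0 ?sqr_ge0 ?powR_ge0.
Qed.

End multiplier_families.

(* The sum over [int] below has finite support for each [xi], by the support
   condition on [fourier Psi]. *)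
Theorem theorem1p1 (R : realType) (n : nat) (p s : R) (Psi : 'rV[R]_n -> R[i])
    (n_gt0 : (0 < n)%N) (p_gt1 : 1 < p) (s_gt0 : 0 < s) (s_ltn : s < n%:R)
    (ps : `|p^-1 - 2^-1| < s / n%:R) (Psi_schwartz : schwartz Psi)
    (Psi_supp : closure [set xi : 'rV[R]_n | fourier Psi xi != 0] `<=` [set xi | 2^-1 < enorm xi < 2])
    (Psi_sum : forall xi : 'rV[R]_n, xi != 0 ->
       \sum_(j \in [set: int]) fourier Psi ((2 : R) ^ (- j) *: xi) = 1) :
  exists C : R, forall sigma : 'rV[R]_n -> R[i], lebesgue_measurable sigma ->
    (exists M : R, forall xi, ComplexField.Normc.normc (sigma xi) <= M) ->
    let K := ereal_sup (range (fun j : int =>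
      dist_lorentz1 (n%:R / s) (bessel s (dist_of_fun (fun xi : 'rV[R]_n =>
        fourier Psi xi * sigma ((2 : R) ^ j *: xi)))))) in (K < +oo)%E ->
    forall f : 'rV[R]_n -> R[i], schwartz f ->
      (cLnorm p (multiplier_op sigma f) <= C%:E * K * cLnorm p f)%E.
Proof.
have suppPsi xi : fourier Psi xi != 0 -> 4^-1 < dotmx xi xi < 4.
  move=> h; have /andP[h1 h2] := Psi_supp xi (@subset_closure _ [set xi | fourier Psi xi != 0] xi h).
  have E : dotmx xi xi = enorm xi ^+ 2 by rewrite /enorm sqr_sqrtr// dotmx_ge0.
  by rewrite E; apply/andP; split; rewrite expr2; nra.
have nPsi := nice_schwartz Psi_schwartz; have cPsi := cscont_schwartz Psi_schwartz.
have FPsi := cintg_fourier_schwartz Psi_schwartz.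
have Psum := band_windows_sum n_gt0 Psi_schwartz suppPsi Psi_sum.
have p_gt0 : 0 < p := lt_trans ltr01 p_gt1.
have [r [r1 rs pr]] := interpolation_exponent n_gt0 p_gt1 s_gt0 ps.
have [C1 C10 hC1] := single_scale nPsi cPsi FPsi suppPsi n_gt0 s_gt0 s_ltn r1 rs Psum.
have [D1 D10 sphi] := smooth_kernel_fat Psi_schwartz.
have [D2 D20 wphi] := fat_window nPsi suppPsi.
have D0 : 0 <= D1 + D2 by rewrite addr_ge0.
have sphi' : smooth_kernel (fat Psi) (D1 + D2).
  move=> x v xv; have [h1 h2] := sphi x v xv.
  by split; [apply: (le_trans h1)|apply: (le_trans h2)]; rewrite ler_wpM2r// lerDl.
have wphi' xi j0 M : \sum_(i < M) normc (fourier (fat Psi) (sc (- (j0 + i%:Z)) *: xi)) ^+ 2 <= D1 + D2.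
  by apply: (le_trans (wphi xi j0 M)); rewrite lerDr.
have [C2 C20 hC2] := window_bound n_gt0 D0 (nice_fat nPsi) (cscont_fat cPsi) sphi' wphi' r1 p_gt1 pr.
pose C0 := C2 * (C1 + 1) `^ (p / 2).
have C00 : 0 <= C0 by rewrite mulr_ge0 ?powR_ge0.
exists (C0 `^ p^-1) => sigma [g mg sg] [M hM] K Koo f sf.
have nf := nice_schwartz sf; have Ff := cintg_fourier_schwartz sf; have [mFf _] := Ff.
(* Cutting off a Borel version of [sigma] keeps it bounded everywhere. *)
pose tau xi := g xi * (normc (g xi) <= M)%R%:R%:C%C.
have mtau : cmeas tau.
  apply: cmeasM => //; apply: cmeas_rc; rewrite (_ : (fun xi => _) = fun xi => (\1_[set xi | normc (g xi) <= M] xi : R)).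
    apply: measurable_indic; rewrite -[X in measurable X]setTI.
    by apply: measurable_fun_le => //; apply: measurable_normc.
  by apply/funext => xi; rewrite indicE mem_setE.
have tauM xi : normc (tau xi) <= `|M|.
  rewrite /tau normcM normc_rc normr_nat mulr_natr mulrb; case: ifP => h.
    exact: (le_trans h (ler_norm M)).
  exact: normr_ge0.
have st : {ae lebesgue_rV n, forall xi, sigma xi = tau xi}.
  by apply: filterS sg => xi E; rewrite /tau -E hM; exact: esym (mulr1 _).
have TE x : multiplier_op sigma f x = multiplier_op tau f x.
  rewrite /multiplier_op !invfourierE; apply: cint_ae; last by apply: filterS st => xi ->.
  apply: cmeasM; first exact: cmeasM.
  by apply: cmeas_ec; mdot.
set J := (\int[lebesgue_rV n]_x (normc (f x) `^ p)%:E)%E.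
have J0 : (0 <= J)%E by apply: int_ge0 => x; rewrite powR_ge0.
have Joo : (J < +oo)%E := nice_Lp_lty p_gt1 nf.
(* A bound [a > K] provides, for every [j], an actual representing function of norm at most [a],
   since the infimum in [dist_lorentz1] need not be attained; it also covers [K = 0]. *)
have main (a : R) : 0 < a -> (K < a%:E)%E ->
    (\int[lebesgue_rV n]_x (normc (multiplier_op tau f x) `^ p)%:E <= (C0 * a `^ p)%:E * J)%E.
  move=> a0 Ka.
  have fam := ss_family_multiplier s_gt0 Psi_schwartz suppPsi Psum hC1 C10 mtau tauM st (a := a).
  have {}fam : ss_family (fat Psi) r ((C1 + 1) * a ^+ 2) (fun j xi => band Psi j xi * tau xi).
    apply: fam => j.
    have /ereal_inf_lt[_ [h hrep <-] ha] := le_lt_trans (ereal_sup_ubound (imageP _ (I : setT j))) Ka.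
    by exists h => //; exact: ltW.
  have A0 : 0 < (C1 + 1) * a ^+ 2 by rewrite mulr_gt0 ?exprn_gt0// ltr_wpDl.
  have -> : C0 * a `^ p = C2 * ((C1 + 1) * a ^+ 2) `^ (p / 2).
    rewrite powRM ?addr_ge0 ?sqr_ge0// mulrA -powR_mulrn ?(ltW a0)// -powRrM.
    by congr (_ * _ `^ _); field.
  apply: (@fatou_le _ _ _ (lebesgue_rV n) (fun (N : nat) x =>
    normc (window_op (fun j xi => band Psi j xi * tau xi) (- N%:Z) N.*2.+1 f x) `^ p)).
  - move=> N; have [ci ->] := window_opE (- N%:Z) N.*2.+1 fam nf.
    by apply: measurable_powRl; apply: measurable_normc; exact/cscont_cmeas/cscont_invfourier.
  - by move=> N x; exact: powR_ge0.
  - move=> x; apply: cvg_powRl => //; apply: ccvg_normc.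
    exact: (windows_cvg n_gt0 Psi_schwartz suppPsi Psum mtau tauM fam).
  - by move=> N; exact: (hC2 _ _ A0 fam _ _ _ nf).
clearbody C0; have K0 : (0 <= K)%E.
  apply: (le_trans _ (ereal_sup_ubound (imageP _ (I : setT (0 : int))))).
  apply: le_ereal_inf_tmp => _ [h _ <-]; apply: integral_ge0 => t _.
  rewrite mule_ge0 ?lee_fin ?powR_ge0//.
  exact: rearrangement_ge0.
have Kfin : K \is a fin_num by rewrite ge0_fin_numE.
have Jfin : J \is a fin_num by rewrite ge0_fin_numE.
have i0 : 0 <= fine J by rewrite fine_ge0.
have pi0 : 0 <= p^-1 by rewrite invr_ge0 ltW.
rewrite !cLnormE -/J -(fineK Jfin) poweR_EFin -(fineK Kfin).
(* The weighted constant is quadratic in [a] and enters with the power [p / 2], so the [p]-th root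
   is linear in [a = fine K + e], and [e] can tend to 0. *)
have step (e : R) : 0 < e -> (cLnorm p (multiplier_op sigma f) <=
    (C0 `^ p^-1 * (fine K + e) * fine J `^ p^-1)%:E)%E.
  move=> e0; have a0 : 0 < fine K + e by rewrite ltr_wpDl// fine_ge0.
  have Ka : (K < (fine K + e)%:E)%E by rewrite -{1}(fineK Kfin) lte_fin ltrDl.
  have := main _ a0 Ka; rewrite -(fineK Jfin) -EFinM => H.
  rewrite cLnormE; under eq_integral do rewrite TE.
  have Z : (0 <= \int[lebesgue_rV n]_x (normc (multiplier_op tau f x) `^ p)%:E)%E.
    by apply: int_ge0 => x; rewrite powR_ge0.
  apply: (le_trans (gt0_ler_poweR pi0 _ _ H)); rewrite ?in_itv/= ?andbT ?leey ?Z//.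
    by rewrite lee_fin !mulr_ge0 ?powR_ge0.
  rewrite lee_fin !powRM ?mulr_ge0 ?powR_ge0// -[(_ `^ p) `^ _]powRrM mulfV ?gt_eqF//.
  by rewrite powRr1// ltW.
rewrite -cLnormE -!EFinM; apply/lee_addgt0Pr => e e0.
pose b := C0 `^ p^-1 * fine J `^ p^-1 + 1.
have b0 : 0 < b by rewrite ltr_wpDl// mulr_ge0 ?powR_ge0.
apply: (le_trans (step (e / b) _)); first by rewrite divr_gt0.
rewrite -EFinD lee_fin mulrDr mulrDl lerD2l mulrAC mulrA ler_pdivrMr//.
by rewrite [leRHS]mulrC ler_wpM2r ?(ltW e0)// /b lerDl.
Qed.
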